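(* Let $d$ be a positive square-free integer such that $K=\mathbb{Q}(\sqrt d)$ is a real quadratic number field, with totally positive fundamental unit $\varepsilon=\frac{a+b\sqrt d}{2}\in\mathcal{O}_{K,+}^\times$, $a,b\in\mathbb{N}$, such that $\mathbb{Z}+\mathbb{Z}\varepsilon=\mathcal{O}_K$. Let $u\ge2$ be an integer, let $\mathfrak{f}=(u)=u\mathcal{O}_K$, and let $g=g(\mathfrak{f})$. Define $q_n=e^{2\pi i\tau_n}$ for $n\in\mathbb{Z}$ and $\zeta_u=e^{2\pi i/u}$. Then, with $n$ running through the integers, $$X(\mathfrak{f})=\lim_{n\to\infty}\left|\frac{(\zeta_u;q_n)_\infty\,(\zeta_u;q_{-n})_\infty}{(\zeta_u;q_{n+2g})_\infty\,(\zeta_u;q_{-n+2g})_\infty}\right|=\lim_{n\to\infty}\left|\frac{(\zeta_u;q_{n-g})_\infty\,(\zeta_u;q_{-n-g})_\infty}{(\zeta_u;q_{n+g})_\infty\,(\zeta_u;q_{-n+g})_\infty}\right|.$$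
   Context: Notation. $\mathcal{O}_K$ is the ring of integers of $K$, and $\mathcal{O}_{K,+}^\times$ is the group of totally positive units; the totally positive fundamental unit $\varepsilon$ is its generator with $a,b\in\mathbb{N}$ (so $\varepsilon>1$). $\varepsilon'=\varepsilon^{-1}$ denotes the Galois conjugate of $\varepsilon$. The polynomials $T_n$ ($n\in\mathbb{Z}$) are the normalized Chebyshev polynomials of the first kind, defined by $T_n(X+X^{-1})=X^n+X^{-n}$; thus $T_n(a)=\varepsilon^n+\varepsilon^{-n}$. For $n\in\mathbb{Z}$, $\tau_n=\frac{T_{n+1}(a)+i\,b\sqrt d}{T_n(a)}$. For $\zeta,q\in\mathbb{C}$ with $|q|<1$, $(\zeta;q)_\infty=\prod_{k\ge0}(1-\zeta q^k)$. $g(\mathfrak{f})$ is the smallest positive integer such that $\varepsilon^{g(\mathfrak{f})}$ generates the group $\mathcal{O}_{K,+}^\times\cap(1+\mathfrak{f})$. Double sine function: for $\omega>0$ and $0<z<1+\omega$, $$\mathcal{S}(\omega,z)=\exp\left(\zeta_2'(0,1+\omega-z,\omega)-\zeta_2'(0,z,\omega)\right),$$ where $\zeta_2(s,z,\omega)=\sum_{n_1,n_2=0}^\infty(n_1+n_2\omega+z)^{-s}$ (analytically continued in $s$), and $'$ means the derivative with respect to $s$. Shintani's invariant (for the trivial ray class of conductor $\mathfrak{f}=(u)$): put $\mu=\frac1u$. For each $k\in\mathbb{Z}$ there is a unique pair $(x_k,y_k)\in\mathbb{Q}^2$ with $0<x_k\le 1$, $0\le y_k<1$ and $x_k\varepsilon^{1-k}+y_k\varepsilon^{-k}\in\mu+\mathcal{O}_K$.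 Then $$X(\mathfrak{f})=X_1(\mathfrak{f})X_2(\mathfrak{f}),\quad X_1(\mathfrak{f})=\prod_{k=1}^{g(\mathfrak{f})}\mathcal{S}(\varepsilon,x_k\varepsilon+y_k),\quad X_2(\mathfrak{f})=\prod_{k=1}^{g(\mathfrak{f})}\mathcal{S}(\varepsilon',x_k\varepsilon'+y_k).$$ *)

(* Defs.v *)
From Stdlib Require Import Reals ZArith QArith Qreals Lra ClassicalEpsilon.
From Coquelicot Require Import Coquelicot.
Open Scope R_scope.

(** * The real quadratic field [Q(sqrt d)], as a subfield of [R] *)

Definition squarefree (d : nat) : Prop :=
  forall m : nat, Nat.divide (m * m) d -> m = 1%nat.

(** [galois_pair d x x'] : [x] lies in [Q(sqrt d)] and [x'] is its Galois
    conjugate. *)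
Definition galois_pair (d : nat) (x x' : R) : Prop :=
  exists r s : Q,
    x = Q2R r + Q2R s * sqrt (INR d) /\ x' = Q2R r - Q2R s * sqrt (INR d).

Definition in_quadratic_field (d : nat) (x : R) : Prop :=
  exists x' : R, galois_pair d x x'.

(** Root of the monic integer polynomial [X^(n+1) + c_n X^n + ... + c_0]. *)
Definition algebraic_integer (x : R) : Prop :=
  exists (n : nat) (c : nat -> Z),
    x ^ S n + sum_f_R0 (fun k => IZR (c k) * x ^ k) n = 0.

Definition ring_of_integers (d : nat) (x : R) : Prop :=
  in_quadratic_field d x /\ algebraic_integer x.

Definition totally_positive (d : nat) (x : R) : Prop :=
  exists x' : R, galois_pair d x x' /\ 0 < x /\ 0 < x'.

Definition totally_positive_unit (d : nat) (x : R) : Prop :=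
  ring_of_integers d x /\
  (exists y : R, ring_of_integers d y /\ x * y = 1) /\
  totally_positive d x.

Definition generated_by (G : R -> Prop) (e : R) : Prop :=
  forall x : R, G x <-> exists n : Z, x = powerRZ e n.

Definition ideal_gen (d u : nat) (x : R) : Prop :=
  exists y : R, ring_of_integers d y /\ x = INR u * y.

(** Totally positive units congruent to [1] modulo the ideal [(u)]. *)
Definition ray_unit (d u : nat) (x : R) : Prop :=
  totally_positive_unit d x /\ ideal_gen d u (x - 1).

Definition is_ray_index (d : nat) (eps : R) (u g : nat) : Prop :=
  ((0 < g)%nat /\ generated_by (ray_unit d u) (eps ^ g)) /\
  forall m : nat,
    (0 < m)%nat -> generated_by (ray_unit d u) (eps ^ m) -> (g <= m)%nat.

Definition ray_index (d : nat) (eps : R) (u : nat) : nat :=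
  epsilon (inhabits 0%nat) (is_ray_index d eps u).

(** * Normalized Chebyshev polynomials *)

Fixpoint cheb_nat (n : nat) (x : R) : R :=
  match n with
  | O => 2
  | S m => match m with
           | O => x
           | S p => x * cheb_nat m x - cheb_nat p x
           end
  end.

(** Value at [x] of [T_n], [n : Z]; [T_(-n) = T_n]. *)
Definition cheb (n : Z) (x : R) : R := cheb_nat (Z.abs_nat n) x.

Lemma cheb_nat_spec (n : nat) (x : R) :
  x <> 0 -> cheb_nat n (x + / x) = x ^ n + (/ x) ^ n.
Proof.
intros hx.
cut (cheb_nat n (x + / x) = x ^ n + (/ x) ^ n /\
     cheb_nat (S n) (x + / x) = x ^ S n + (/ x) ^ S n); [tauto |].
induction n as [| n [IH1 IH2]].
- split; simpl; lra.
- split; [exact IH2 |].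
  change (cheb_nat (S (S n)) (x + / x))
    with ((x + / x) * cheb_nat (S n) (x + / x) - cheb_nat n (x + / x)).
  rewrite IH1, IH2; simpl; field_simplify; try assumption.
  assert (h : x * / x = 1) by (field; assumption).
  generalize (x ^ n) ((/ x) ^ n); intros p q; field; assumption.
Qed.

(** The relation defining [T_n]. *)
Lemma cheb_spec (n : Z) (x : R) :
  x <> 0 -> cheb n (x + / x) = powerRZ x n + powerRZ x (- n).
Proof.
intros hx; unfold cheb; rewrite cheb_nat_spec by assumption.
destruct n as [| p | p]; simpl; rewrite ?pow_inv; lra.
Qed.

(** * Complex analysis *)

Definition Cexp (z : C) : C :=
  (exp (Re z) * cos (Im z), exp (Re z) * sin (Im z)).

(** [f 0 * ... * f (n - 1)] *)
Fixpoint Cprod (f : nat -> C) (n : nat) : C :=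
  match n with
  | O => RtoC 1
  | S m => (Cprod f m * f m)%C
  end.

(** [(zeta; q)_oo]; [lim] is a total operator, meaningful for [|q| < 1]. *)
Definition qpochhammer (zeta q : C) : C :=
  @lim C_CompleteNormedModule
    (filtermap (fun n => Cprod (fun k => (1 - zeta * q ^ k)%C) n) eventually).

Definition analytic_at (f : C -> C) (s0 : C) : Prop :=
  exists (c : nat -> C) (r : R),
    0 < r /\
    forall s : C, Cmod (s - s0) < r ->
      @is_pseries C_AbsRing C_NormedModule c (s - s0)%C (f s).

(** * Barnes double zeta function and double sine function *)

(** [F] is the analytic continuation to [C \ {1, 2}] of
    [sum_(m, n >= 0) (m + n w + z)^(-s)], which converges absolutely for
    [Re s > 2]; its only singularities are poles at [1] and [2]. *)
Definition is_barnes_zeta2 (z w : R) (F : C -> C) : Prop :=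
  (forall s : C, s <> RtoC 1 -> s <> RtoC 2 -> analytic_at F s) /\
  (forall s : C, 2 < Re s ->
     exists inner : nat -> C,
       (forall m : nat,
          @is_series C_AbsRing C_NormedModule
            (fun n => Cexp (- s * RtoC (ln (INR m + INR n * w + z)))%C)
            (inner m)) /\
       @is_series C_AbsRing C_NormedModule inner (F s)).

(** [barnes_zeta2 z w s] is [zeta_2(s, z, w)], for [z, w > 0]. *)
Definition barnes_zeta2 (z w : R) : C -> C :=
  epsilon (inhabits (fun _ : C => RtoC 0)) (is_barnes_zeta2 z w).

Definition double_sine (w z : R) : C :=
  Cexp (C_derive (barnes_zeta2 (1 + w - z) w) 0
        - C_derive (barnes_zeta2 z w) 0)%C.

(** * Shintani's invariant of the trivial ray class of conductor [(u)] *)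

Definition rational (x : R) : Prop := exists r : Q, x = Q2R r.

Definition is_shintani_pair
    (d : nat) (eps : R) (u : nat) (k : Z) (p : R * R) : Prop :=
  rational (fst p) /\ rational (snd p) /\
  0 < fst p <= 1 /\ 0 <= snd p < 1 /\
  ring_of_integers d
    (fst p * powerRZ eps (1 - k) + snd p * powerRZ eps (- k) - / INR u).

Definition shintani_pair (d : nat) (eps : R) (u : nat) (k : Z) : R * R :=
  epsilon (inhabits (0, 0)) (is_shintani_pair d eps u k).

(** [prod_(k = 1 .. g) S(w, x_k w + y_k)], used for [w = eps] and [w = eps']. *)
Definition shintani_factor (d : nat) (eps : R) (u : nat) (w : R) : C :=
  Cprod
    (fun i => let p := shintani_pair d eps u (Z.of_nat (S i)) in
              double_sine w (fst p * w + snd p))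
    (ray_index d eps u).

(** The conjugate of the totally positive unit [eps] is [/ eps]. *)
Definition shintani_X (d : nat) (eps : R) (u : nat) : C :=
  (shintani_factor d eps u eps * shintani_factor d eps u (/ eps))%C.

(** * The points [tau_n] and [q_n] *)

Definition tau (d a b : nat) (n : Z) : C :=
  ((RtoC (cheb (n + 1) (INR a)) + Ci * RtoC (INR b * sqrt (INR d)))
   / RtoC (cheb n (INR a)))%C.

Definition nome (d a b : nat) (n : Z) : C :=
  Cexp (RtoC (2 * PI) * Ci * tau d a b n)%C.

Definition root_of_unity (u : nat) : C :=
  Cexp (RtoC (2 * PI) * Ci / RtoC (INR u))%C.

(* Main.v *)
(** Write [e(w) = exp (2 pi i w)] and
    [R(t, z) = log |prod_(i >= 0) (1 - e(z + i t))| - log |prod_(i >= 1) (1 - e((z - i) / t))|].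
    Since [tau_(n+2) = a - 1 / tau_n] and the Shintani pairs satisfy
    [y_(k+1) = 1 - x_k], [x_(k+1) = a x_k + y_k] modulo [1], the sum over [k] of
    [R(tau, x_k tau + y_k)], taken at [tau = tau_(n + 2 (g - k))], telescopes
    to the logarithm of [|P_n / P_(n+2g)|], where [P_n = (zeta_u; q_n)_oo];
    here [eps^g = 1] modulo [u] closes the telescope. As [n] goes to infinity,
    [tau_n] and [tau_(-n)] tend to [eps] and [/ eps], so it remains to see that
    [R(t, x t + y)] tends to [log S(w, x w + y)] when [t] tends to the real
    number [w > 0].

    Expanding [log |1 - e(w)|] over its zeros turns a finite linear combination
    of values of [R] that kills quadratic polynomials into an absolutely
    convergent sum over a quadrant of the lattice spanned by [1] and [t]. The
    combination is chosen so that the functional equations of [R] evaluate all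
    its terms but one. What results is a formula for [R(t, x t + y)] as a
    double series which is dominated uniformly as [t] tends to [w], up to terms
    of size [Im t + |Im (1 / t)|]. The same double series is the derivative at
    [s = 0] of a combination of Barnes zeta functions, whose other terms are
    elementary because they reduce to half-integer zeta functions.

    The continuation of [zeta_2] comes from [z^(2-s)] being the double sum of its
    mixed second differences: expanding these in powers of the shifts expresses
    [(s - 1) (s - 2) zeta_2(s)] through its values at [s + 1], [s + 2], ..., and a
    sum that converges in a larger half plane. *)
Require Import Defs.
From Stdlib Require Import Reals ZArith.
From Coquelicot Require Import Coquelicot.
From Stdlib Require Import Lra Lia Psatz List ClassicalEpsilon.
Open Scope R_scope.


(** * Dominated convergence for series *)

(** As [n] grows, [q_n] approaches the unit circle, where the infinite product stops converging;
    only the quotient measured by [Rq] keeps a limit. No integral representation of the double sine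
    function is used: every logarithm is the real logarithm of a modulus, so no branch has to be
    followed, and limits are interchanged with sums. A sum over a plane lattice wants terms of cubic
    decay, and the second-order Taylor polynomial of [log |w + d|] stands in the way; hence the
    combinations that kill quadratic polynomials. Their auxiliary points lie symmetrically about the
    centre [(1 + t) / 2]: there the functional equations determine [Rq], and the opposite quadrant
    is the negative of the first.

    The other obstacle is that [ray_index], [shintani_pair], [barnes_zeta2] and [lim] are choices or
    total operators. Each must be shown to have a value, which makes the whole continuation of the
    zeta function part of the proof, and that value must be identified; for the derivative at [0] an
    identity theorem carries the comparison past the poles [1] and [2]. *)

Lemma ex_series_dominated (a b : nat -> R) :
  (forall n, Rabs (a n) <= b n) -> ex_series b -> ex_series a.
Proof.
  intros h hb. apply (ex_series_le a b); [exact h | exact hb].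
Qed.

Lemma Series_abs_le (a b : nat -> R) :
  (forall n, Rabs (a n) <= b n) -> ex_series b ->
  Rabs (Series a) <= Series b.
Proof.
  intros h hb.
  assert (ha : ex_series (fun n => Rabs (a n))).
  { apply (ex_series_dominated _ b); [| exact hb].
    intros n; rewrite Rabs_Rabsolu; apply h. }
  eapply Rle_trans; [apply Series_Rabs, ha |].
  apply Series_le; [| exact hb].
  intros n; split; [apply Rabs_pos | apply h].
Qed.

Lemma Series_tail_lim (g : nat -> R) :
  ex_series g -> is_lim_seq (fun n => Series (fun k => g (n + k)%nat)) 0.
Proof.
  intros hg.
  apply is_lim_seq_incr_1.
  apply is_lim_seq_ext with (fun n => Series g - sum_n g n).
  - intros n. rewrite (Series_incr_n g (S n)); [| lia | exact hg].
    simpl pred. rewrite sum_n_Reals. ring.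
  - replace 0 with (Series g - Series g) by ring.
    apply is_lim_seq_minus'; [apply is_lim_seq_const |].
    exact (Series_correct g hg).
Qed.

Lemma sum_f_R0_lim (f : nat -> nat -> R) (F : nat -> R) (n : nat) :
  (forall k, is_lim_seq (fun N => f N k) (F k)) ->
  is_lim_seq (fun N => sum_f_R0 (f N) n) (sum_f_R0 F n).
Proof.
  intros h; induction n as [| n IH]; simpl; [apply h |].
  apply (is_lim_seq_plus' _ _ _ _ IH (h (S n))).
Qed.

Lemma is_lim_seq_abs_le (a : nat -> R) (l B : R) :
  is_lim_seq a l -> (forall n, Rabs (a n) <= B) -> Rabs l <= B.
Proof.
  intros h hB.
  apply (is_lim_seq_le (fun n => Rabs (a n)) (fun _ => B) (Rabs l) B);
    [exact hB | apply (is_lim_seq_abs a l h) | apply is_lim_seq_const].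
Qed.

Lemma tannery (f : nat -> nat -> R) (F g : nat -> R) :
  ex_series g ->
  (forall N k, Rabs (f N k) <= g k) ->
  (forall k, is_lim_seq (fun N => f N k) (F k)) ->
  is_lim_seq (fun N => Series (f N)) (Series F).
Proof.
  intros hg hb hl.
  assert (hF : forall k, Rabs (F k) <= g k).
  { intros k; apply (is_lim_seq_abs_le (fun N => f N k)); auto. }
  assert (eF : ex_series F) by (apply (ex_series_dominated _ g); auto).
  assert (ef : forall N, ex_series (f N))
    by (intros N; apply (ex_series_dominated _ g); auto).
  apply is_lim_seq_spec; intros [e he]; simpl.
  destruct (proj2 (is_lim_seq_spec _ _) (Series_tail_lim g hg) (mkposreal (e / 4) ltac:(lra)))
    as [K hK]; simpl in hK.
  specialize (hK (S K) ltac:(lia)). rewrite Rminus_0_r in hK.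
  pose proof (sum_f_R0_lim f F K hl) as hs.
  apply is_lim_seq_spec in hs.
  destruct (hs (mkposreal (e / 4) ltac:(lra))) as [M hM]; simpl in hM.
  exists M; intros N hN; specialize (hM N hN).
  rewrite (Series_incr_n (f N) (S K)), (Series_incr_n F (S K)) by (auto; lia).
  change (pred (S K)) with K.
  assert (hg' : ex_series (fun k => g (S K + k)%nat))
    by (apply ex_series_incr_n; exact hg).
  assert (t1 : Rabs (Series (fun k => f N (S K + k)%nat)) <= Series (fun k => g (S K + k)%nat))
    by (apply Series_abs_le; auto).
  assert (t2 : Rabs (Series (fun k => F (S K + k)%nat)) <= Series (fun k => g (S K + k)%nat))
    by (apply Series_abs_le; auto).
  revert t1 t2 hK hM. simpl plus.
  generalize (Series (fun k => f N (S (K + k)))) (Series (fun k => F (S (K + k))))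
    (Series (fun k => g (S (K + k)))) (sum_f_R0 (f N) K) (sum_f_R0 F K).
  intros p q r s t. unfold Rabs; repeat destruct Rcase_abs; lra.
Qed.

(** Summable dominating weights on [nat * nat] are taken of the product form
    [u i * v j]. *)
Definition summable_pos (u : nat -> R) : Prop :=
  (forall n, 0 < u n) /\ ex_series u.

Lemma double_row_ex (a : nat -> nat -> R) (u v : nat -> R) :
  summable_pos u -> summable_pos v ->
  (forall i j, Rabs (a i j) <= u i * v j) ->
  (forall i, ex_series (a i)) /\
  (forall i, Rabs (Series (a i)) <= u i * Series v) /\
  ex_series (fun i => Series (a i)).
Proof.
  intros [pu eu] [pv ev] h.
  assert (e1 : forall i, ex_series (fun j => u i * v j))
    by (intros i; apply (ex_series_scal (u i) v); exact ev).
  assert (e2 : forall i, ex_series (a i))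
    by (intros i; apply (ex_series_dominated _ (fun j => u i * v j)); auto).
  assert (e3 : forall i, Rabs (Series (a i)) <= u i * Series v).
  { intros i; rewrite <- Series_scal_l; apply Series_abs_le; auto. }
  repeat split; auto.
  apply (ex_series_dominated _ (fun i => u i * Series v)); auto.
  apply (ex_series_scal_r (Series v) u); exact eu.
Qed.

Lemma Series_sum_exchange (a : nat -> nat -> R) (N : nat) :
  (forall i, ex_series (a i)) ->
  ex_series (fun j => sum_f_R0 (fun i => a i j) N) /\
  Series (fun j => sum_f_R0 (fun i => a i j) N)
  = sum_f_R0 (fun i => Series (a i)) N.
Proof.
  intros h; induction N as [| N [e IH]]; simpl.
  - split; [apply h | reflexivity].
  - split.
    + apply (ex_series_plus (fun j => sum_f_R0 (fun i => a i j) N) (a (S N))); auto.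
    + rewrite Series_plus; auto. now rewrite IH.
Qed.

Lemma sum_f_R0_abs_le (a b : nat -> R) (N : nat) :
  (forall i, Rabs (a i) <= b i) -> Rabs (sum_f_R0 a N) <= sum_f_R0 b N.
Proof.
  intros h; induction N as [| N IH]; simpl; auto.
  eapply Rle_trans; [apply Rabs_triang |]; apply Rplus_le_compat; auto.
Qed.

Lemma sum_f_R0_le_Series (u : nat -> R) (N : nat) :
  summable_pos u -> sum_f_R0 u N <= Series u.
Proof.
  intros [pu eu].
  rewrite (Series_incr_n u (S N)) by (auto; lia); change (pred (S N)) with N.
  assert (0 <= Series (fun k => u (S N + k)%nat)); [| lra].
  replace 0 with (Series (fun _ : nat => 0 * 0)).
  - apply Series_le; [intros n; split; [lra | rewrite Rmult_0_l; apply Rlt_le, pu]|].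
    apply ex_series_incr_n; exact eu.
  - rewrite Series_scal_l; ring.
Qed.

(** Both iterated sums are limits of one sequence, the sums over the first [N] rows: a finite
    exchange gives one limit, [tannery] the other. *)
Lemma double_Series_exchange (a : nat -> nat -> R) (u v : nat -> R) :
  summable_pos u -> summable_pos v ->
  (forall i j, Rabs (a i j) <= u i * v j) ->
  Series (fun i => Series (fun j => a i j)) = Series (fun j => Series (fun i => a i j)).
Proof.
  intros hu hv h.
  destruct (double_row_ex a u v hu hv h) as (e1 & _ & e3).
  destruct (double_row_ex (fun j i => a i j) v u hv hu) as (f1 & _ & f3).
  { intros i j; rewrite Rmult_comm; apply h. }
  assert (H : is_lim_seq (fun N => Series (fun j => sum_f_R0 (fun i => a i j) N))
                (Series (fun j => Series (fun i => a i j)))).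
  { apply (tannery _ _ (fun j => v j * Series u)).
    - apply (ex_series_scal_r (Series u) v), hv.
    - intros N j.
      eapply Rle_trans; [apply (sum_f_R0_abs_le _ (fun i => u i * v j)); auto |].
      rewrite <- scal_sum. apply Rmult_le_compat_l; [apply Rlt_le, hv |].
      apply sum_f_R0_le_Series; exact hu.
    - intros j. apply is_lim_seq_ext with (sum_n (fun i => a i j)).
      + intros n; apply sum_n_Reals.
      + apply Series_correct, f1. }
  assert (H' : is_lim_seq (fun N => Series (fun j => sum_f_R0 (fun i => a i j) N))
                (Series (fun i => Series (a i)))).
  { apply is_lim_seq_ext with (sum_n (fun i => Series (a i))).
    - intros N; rewrite sum_n_Reals; symmetry; apply Series_sum_exchange; exact e1.
    - apply Series_correct; exact e3. }
  apply is_lim_seq_unique in H; apply is_lim_seq_unique in H'.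
  apply Rbar_finite_eq; rewrite <- H; symmetry; exact H'.
Qed.

(** The finitely many pairs with [i + j < K] are absorbed by enlarging the constant, since the
    weights are positive. Lattice estimates hold only far from the origin, so this is how they
    become global bounds. *)
Lemma dominate_all (M : nat -> nat -> R) (C : R) (K : nat) (u v : nat -> R) :
  (forall n, 0 < u n) -> (forall n, 0 < v n) ->
  (forall i j, (K <= i + j)%nat -> M i j <= C * (u i * v j)) ->
  exists C', 0 < C' /\ forall i j, M i j <= C' * (u i * v j).
Proof.
  intros pu pv h.
  set (q := fun i j => Rabs (M i j) / (u i * v j)).
  assert (qp : forall i j, 0 <= q i j).
  { intros i j; unfold q; apply Rdiv_le_0_compat; [apply Rabs_pos |].
    apply Rmult_lt_0_compat; auto. }
  assert (sp : forall (w : nat -> R) n, (forall i, 0 <= w i) -> 0 <= sum_f_R0 w n).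
  { intros w n hw; induction n; simpl; auto. specialize (hw (S n)); lra. }
  assert (sl : forall (w : nat -> R) n k, (forall i, 0 <= w i) -> (k <= n)%nat -> w k <= sum_f_R0 w n).
  { intros w n k hw; induction n; intros hk; simpl.
    - replace k with 0%nat by lia; lra.
    - destruct (Nat.eq_dec k (S n)) as [-> |].
      + pose proof (sp w n hw); lra.
      + specialize (IHn ltac:(lia)). specialize (hw (S n)); lra. }
  set (D := sum_f_R0 (fun i => sum_f_R0 (q i) K) K).
  assert (hD : forall i j, (i <= K)%nat -> (j <= K)%nat -> q i j <= D).
  { intros i j hi hj. eapply Rle_trans; [apply (sl (q i) K j); auto |].
    apply (sl (fun i => sum_f_R0 (q i) K) K i); auto. }
  assert (D0 : 0 <= D) by (apply sp; intros; apply sp; auto).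
  exists (Rabs C + D + 1); split; [pose proof (Rabs_pos C); lra |].
  intros i j.
  assert (up : 0 < u i * v j) by (apply Rmult_lt_0_compat; auto).
  destruct (le_lt_dec K (i + j)) as [hk | hk].
  - eapply Rle_trans; [apply h, hk |].
    apply Rmult_le_compat_r; [lra |]. pose proof (Rle_abs C); lra.
  - specialize (hD i j ltac:(lia) ltac:(lia)).
    apply Rle_trans with (q i j * (u i * v j)).
    + unfold q. unfold Rdiv. rewrite Rmult_assoc, Rinv_l, Rmult_1_r by lra. apply Rle_abs.
    + apply Rmult_le_compat_r; [lra |]. pose proof (Rabs_pos C); lra.
Qed.

Lemma lim_bounded (a : nat -> R) (l : R) :
  is_lim_seq a l -> exists B, forall n, Rabs (a n) <= B.
Proof.
  intros h. destruct (filterlim_bounded a) as [M hM].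
  - exists l; exact h.
  - exists M; exact hM.
Qed.

(** Near the origin there is no uniform estimate, but each of the finitely many sequences there
    converges and is therefore bounded; [dominate_all] merges these bounds with the given one. *)
Lemma double_tannery (f : nat -> nat -> nat -> R) (F : nat -> nat -> R)
    (C : R) (K : nat) (u v : nat -> R) :
  summable_pos u -> summable_pos v ->
  (forall N i j, (K <= i + j)%nat -> Rabs (f N i j) <= C * (u i * v j)) ->
  (forall i j, is_lim_seq (fun N => f N i j) (F i j)) ->
  is_lim_seq (fun N => Series (fun i => Series (fun j => f N i j)))
    (Series (fun i => Series (fun j => F i j))).
Proof.
  intros hu hv hb hl.
  assert (hB : exists B : nat -> nat -> R, forall i j N, Rabs (f N i j) <= B i j).
  { exists (fun i j => proj1_sig (ClassicalEpsilon.constructive_indefinite_description _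
         (lim_bounded _ _ (hl i j)))).
    intros i j N. destruct ClassicalEpsilon.constructive_indefinite_description as [B hB].
    apply hB. }
  destruct hB as [B hB].
  destruct (dominate_all (fun i j => if le_lt_dec K (i + j) then C * (u i * v j) else B i j)
     C K u v) as (C' & pC & hC').
  { apply hu. } { apply hv. }
  { intros i j hk; destruct le_lt_dec; [lra | lia]. }
  assert (hb' : forall N i j, Rabs (f N i j) <= (C' * u i) * v j).
  { intros N i j; rewrite Rmult_assoc; eapply Rle_trans; [| apply hC'].
    destruct le_lt_dec; auto. }
  assert (hu' : summable_pos (fun i => C' * u i)).
  { split; [intros n; apply Rmult_lt_0_compat; auto; apply hu |].
    apply (ex_series_scal C' u), hu. }
  apply (tannery _ _ (fun i => C' * u i * Series v)).
  - apply (ex_series_scal_r (Series v)), hu'.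
  - intros N i.
    exact (proj1 (proj2 (double_row_ex (f N) _ v hu' hv (hb' N))) i).
  - intros i. apply (tannery _ _ (fun j => C' * u i * v j)); auto.
    apply (ex_series_scal (C' * u i) v), hv.
Qed.

(** * Power weights and finite sums *)

Definition power_weight (q : R) (n : nat) : R := Rpower (INR n + 1) (- q).

Lemma power_weight_pos (q : R) (n : nat) : 0 < power_weight q n.
Proof. apply exp_pos. Qed.

(** Integral test in discrete form: by the mean value theorem the terms are dominated by the
    telescoping differences of [(n + 1)^(1 - q)], which tends to [0]. *)
Lemma power_weight_summable (q : R) : 1 < q -> summable_pos (power_weight q).
Proof.
  intros hq; split; [apply power_weight_pos |].
  apply ex_series_incr_1.
  assert (hpos : forall n, 0 < INR n + 1) by (intros n; pose proof (pos_INR n); lra).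
  set (G := fun n => Rpower (INR n + 1) (1 - q)).
  assert (hd : forall n, (q - 1) * power_weight q (S n) <= G n - G (S n)).
  { intros n.
    destruct (MVT_gen (fun x => Rpower x (1 - q)) (INR n + 1) (INR (S n) + 1)
      (fun x => (1 - q) * Rpower x (- q))) as (c & hc & e).
    - intros x hx. unfold Rpower. rewrite Rmin_left in hx by (rewrite S_INR; lra).
      assert (0 < x) by (specialize (hpos n); lra).
      auto_derive; [lra |].
      replace ((1 - q) * ln x) with (- q * ln x + ln x) by ring.
      rewrite exp_plus, exp_ln by lra. field; lra.
    - intros x hx. rewrite Rmin_left in hx by (rewrite S_INR; lra).
      assert (0 < x) by (specialize (hpos n); lra).
      apply continuity_pt_filterlim. apply (ex_derive_continuous (fun x => Rpower x (1 - q))).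
      unfold Rpower; auto_derive; lra.
    - rewrite Rmin_left, Rmax_right in hc by (rewrite S_INR; lra).
      replace (G n - G (S n)) with ((q - 1) * Rpower c (- q)).
      2:{ unfold G. rewrite S_INR in e |- *.
          replace (INR n + 1 + 1 - (INR n + 1)) with 1 in e by ring. lra. }
      apply Rmult_le_compat_l; [lra |].
      unfold power_weight, Rpower.
      assert (hl : ln c <= ln (INR (S n) + 1)).
      { specialize (hpos n). apply Rcomplements.ln_le; lra. }
      destruct (Rle_lt_or_eq_dec (- q * ln (INR (S n) + 1)) (- q * ln c)).
      + nra.
      + left; apply exp_increasing; lra.
      + right; f_equal; lra. }
  apply (ex_series_dominated _ (fun n => / (q - 1) * (G n - G (S n)))).
  - intros n. rewrite Rabs_pos_eq by apply Rlt_le, power_weight_pos.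
    apply Rmult_le_reg_l with (q - 1); [lra |].
    rewrite <- Rmult_assoc, Rinv_r, Rmult_1_l by lra. apply hd.
  - apply (ex_series_scal (/ (q - 1)) (fun n => G n - G (S n))).
    exists (G 0%nat - 0).
    change (is_lim_seq (sum_n (fun n => G n - G (S n))) (G 0%nat - 0)).
    apply (is_lim_seq_ext (fun n => G 0%nat - G (S n))).
    + intros n. rewrite sum_n_Reals. induction n; simpl; [reflexivity |].
      rewrite <- IHn; simpl; ring.
    + apply is_lim_seq_minus'; [apply is_lim_seq_const |].
      apply -> (is_lim_seq_incr_1 G).
      unfold G, Rpower.
      apply (is_lim_seq_ext (fun n => exp ((1 - q) * ln (INR n + 1)))); [reflexivity |].
      apply (filterlim_comp _ _ _ (fun n => (1 - q) * ln (INR n + 1)) exp _ (Rbar_locally m_infty));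
        [| apply is_lim_exp_m].
      replace m_infty with (Rbar_mult (1 - q) p_infty).
      2:{ simpl; destruct Rle_dec; [exfalso; lra | reflexivity]. }
      apply is_lim_seq_scal_l.
      apply (filterlim_comp _ _ _ (fun n => INR n + 1) ln _ (Rbar_locally p_infty));
        [| apply is_lim_ln_p].
      apply (is_lim_seq_plus _ _ p_infty 1); [apply is_lim_seq_INR | apply is_lim_seq_const | reflexivity].
Qed.

Lemma tannery_tail (f : nat -> nat -> R) (F g : nat -> R) (K : nat) :
  ex_series g ->
  (forall N k, (K <= k)%nat -> Rabs (f N k) <= g k) ->
  (forall k, is_lim_seq (fun N => f N k) (F k)) ->
  is_lim_seq (fun N => Series (f N)) (Series F).
Proof.
  intros hg hb hl.
  assert (hB : exists B : nat -> R, forall k N, Rabs (f N k) <= B k).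
  { exists (fun k => proj1_sig (ClassicalEpsilon.constructive_indefinite_description _
         (lim_bounded _ _ (hl k)))).
    intros k N. destruct ClassicalEpsilon.constructive_indefinite_description as [B hB].
    apply hB. }
  destruct hB as [B hB].
  apply (tannery f F (fun k => if le_lt_dec K k then g k else B k)); auto.
  - apply (ex_series_incr_n _ K).
    apply (ex_series_ext (fun k => g (K + k)%nat)).
    + intros n. destruct le_lt_dec; [reflexivity | lia].
    + apply -> (ex_series_incr_n (V := R_NormedModule) g K). exact hg.
  - intros N k; destruct le_lt_dec; auto.
Qed.

(** From [(i + 1) (j + 1) <= (i + j + 1)^2]. A decay in [i + j] of exponent [2 q] thus becomes a
    product weight of exponent [q] in each index, summable as soon as [2 q > 2]; cubic decay gives
    [3 / 2] twice. *)
Lemma power_weight_mul (q : R) (i j : nat) :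
  0 <= q -> Rpower (INR i + INR j + 1) (- (2 * q)) <= power_weight q i * power_weight q j.
Proof.
  intros hq. pose proof (pos_INR i); pose proof (pos_INR j).
  unfold power_weight, Rpower. rewrite <- exp_plus.
  assert (h : ln (INR i + 1) + ln (INR j + 1) <= 2 * ln (INR i + INR j + 1)).
  { rewrite <- ln_mult by lra.
    replace (2 * ln (INR i + INR j + 1)) with (ln (INR i + INR j + 1) + ln (INR i + INR j + 1)) by ring.
    rewrite <- ln_mult by lra. apply Rcomplements.ln_le; nra. }
  destruct (Rle_lt_or_eq_dec (- (2 * q) * ln (INR i + INR j + 1))
     (- q * ln (INR i + 1) + - q * ln (INR j + 1))) as [h1 | h1]; [nra | |].
  - left; apply exp_increasing, h1.
  - right; rewrite h1; reflexivity.
Qed.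

Lemma inv_cube_weight (i j : nat) :
  / (INR i + INR j + 1) ^ 3 <= power_weight (3 / 2) i * power_weight (3 / 2) j.
Proof.
  eapply Rle_trans; [right | apply power_weight_mul; lra].
  pose proof (pos_INR i); pose proof (pos_INR j).
  replace (2 * (3 / 2)) with (INR 3) by (simpl; field).
  rewrite Rpower_Ropp, Rpower_pow by lra. reflexivity.
Qed.

Lemma inv_square_weight (j : nat) : / (INR j + 1) ^ 2 = power_weight 2 j.
Proof.
  pose proof (pos_INR j). unfold power_weight.
  transitivity (/ Rpower (INR j + 1) (INR 2)).
  - rewrite Rpower_pow by lra; reflexivity.
  - rewrite <- Rpower_Ropp; f_equal; simpl; ring.
Qed.

(** It has [n] terms and may be empty, unlike [sum_f_R0] and [sum_n], which include the index [n];
    this suits splittings such as [n + m] and [2 n]. *)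
Fixpoint sumR (f : nat -> R) (n : nat) : R :=
  match n with O => 0 | S m => sumR f m + f m end.

Lemma sumR_ext (f g : nat -> R) (n : nat) :
  (forall i, (i < n)%nat -> f i = g i) -> sumR f n = sumR g n.
Proof.
  induction n as [| n IH]; intros h; simpl; [reflexivity |].
  rewrite IH, h; auto.
Qed.

Lemma sumR_even_odd (f : nat -> R) (n : nat) :
  sumR f (2 * n) = sumR (fun i => f (2 * i)%nat) n + sumR (fun i => f (2 * i + 1)%nat) n.
Proof.
  induction n as [| n IH]; [simpl; ring |].
  replace (2 * S n)%nat with (S (S (2 * n))) by lia.
  cbn [sumR]. rewrite IH.
  replace (2 * n + 1)%nat with (S (2 * n)) by lia. ring.
Qed.

Lemma sumR_reflect (f : nat -> R) (n m : nat) :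
  sumR f (n + m) = sumR f n + sumR (fun i => f (n + m - 1 - i)%nat) m.
Proof.
  revert n; induction m as [| m IH]; intros n.
  - rewrite Nat.add_0_r; simpl; ring.
  - replace (n + S m)%nat with (S n + m)%nat by lia. rewrite IH. cbn [sumR].
    replace (S n + m - 1 - m)%nat with n by lia. ring.
Qed.

Lemma Series_finite (f : nat -> R) (n : nat) :
  (forall i, (n <= i)%nat -> f i = 0) -> Series f = sumR f n.
Proof.
  intros h. apply is_series_unique.
  change (is_lim_seq (sum_n f) (sumR f n)).
  apply (is_lim_seq_incr_n _ n).
  apply (is_lim_seq_ext (fun _ => sumR f n)); [| apply is_lim_seq_const].
  assert (e : forall k, sum_n f k = sumR f (S k)).
  { intros k; induction k as [| k IH]; [rewrite sum_O; simpl; ring |].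
    rewrite sum_Sn, IH. reflexivity. }
  intros k. rewrite e. induction k as [| k IH]; [simpl; rewrite h; [ring | lia] |].
  cbn [sumR Nat.add] in *. rewrite IH. rewrite (h (S (k + n))) by lia. ring.
Qed.

(** * Series of complex numbers *)

(** Componentwise, so that the theory of real series applies; [csum_is_series] identifies it with
    convergence in the normed module [C]. *)
Definition csum (a : nat -> C) (l : C) : Prop :=
  is_series (fun n => fst (a n)) (fst l) /\ is_series (fun n => snd (a n)) (snd l).

Lemma sum_n_pair (a : nat -> C) (n : nat) :
  @sum_n C_AbelianMonoid a n = (sum_n (fun k => fst (a k)) n, sum_n (fun k => snd (a k)) n).
Proof.
  induction n as [| n IH].
  - rewrite !sum_O; destruct (a 0%nat); reflexivity.
  - rewrite !sum_Sn, IH; reflexivity.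
Qed.

Lemma csum_is_series (a : nat -> C) (l : C) :
  csum a l <-> @is_series C_AbsRing C_NormedModule a l.
Proof.
  unfold csum, is_series. split.
  - intros [h1 h2]. 
    apply (filterlim_locally (F := eventually) (U := C_UniformSpace)). intros e.
    generalize (proj1 (filterlim_locally _ _) h1 e) (proj1 (filterlim_locally _ _) h2 e).
    intros u v; generalize (filter_and _ _ u v); apply filter_imp.
    intros n [b1 b2]. rewrite sum_n_pair. split; [exact b1 | exact b2].
  - intros h. pose proof (proj1 (filterlim_locally (F := eventually) (U := C_UniformSpace) _ _) h) as h'.
    split; apply filterlim_locally; intros e; generalize (h' e); apply filter_imp; intros n b;
      rewrite sum_n_pair in b; destruct b as [b1 b2]; [exact b1 | exact b2].
Qed.

Lemma csum_ext (a b : nat -> C) (l : C) : (forall n, a n = b n) -> csum a l -> csum b l.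
Proof.
  intros h [h1 h2]; split; [eapply is_series_ext; [| exact h1] | eapply is_series_ext; [| exact h2]];
    intros n; cbn beta; rewrite h; reflexivity.
Qed.

Lemma csum_unique (a : nat -> C) (l m : C) : csum a l -> csum a m -> l = m.
Proof.
  intros [h1 h2] [k1 k2]. apply is_series_unique in h1, h2, k1, k2.
  destruct l, m; simpl in *; congruence.
Qed.

Lemma csum_plus (a b : nat -> C) (l m : C) :
  csum a l -> csum b m -> csum (fun n => (a n + b n)%C) (l + m)%C.
Proof.
  intros [h1 h2] [k1 k2]; split; simpl.
  - exact (is_series_plus _ _ _ _ h1 k1).
  - exact (is_series_plus _ _ _ _ h2 k2).
Qed.

Lemma csum_scal (c : C) (a : nat -> C) (l : C) :
  csum a l -> csum (fun n => (c * a n)%C) (c * l)%C.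
Proof.
  intros [h1 h2]; destruct c as [x y]; split; simpl.
  - apply (is_series_minus _ _ _ _ (is_series_scal_l x _ _ h1) (is_series_scal_l y _ _ h2)).
  - apply (is_series_plus _ _ _ _ (is_series_scal_l x _ _ h2) (is_series_scal_l y _ _ h1)).
Qed.

Lemma csum_minus (a b : nat -> C) (l m : C) :
  csum a l -> csum b m -> csum (fun n => (a n - b n)%C) (l - m)%C.
Proof.
  intros h k. apply (csum_ext (fun n => (a n + (-1) * b n)%C)); [intros n; ring |].
  replace (l - m)%C with (l + (-1) * m)%C by ring.
  apply csum_plus, csum_scal; assumption.
Qed.

Lemma Rabs_fst_le (z : C) : Rabs (fst z) <= Cmod z.
Proof. eapply Rle_trans; [apply Rmax_l | apply Rmax_Cmod]. Qed.

Lemma Rabs_snd_le (z : C) : Rabs (snd z) <= Cmod z.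
Proof. eapply Rle_trans; [apply Rmax_r | apply Rmax_Cmod]. Qed.

Lemma Cmod_le_sum (z : C) : Cmod z <= Rabs (fst z) + Rabs (snd z).
Proof.
  pose proof (Rabs_pos (fst z)); pose proof (Rabs_pos (snd z)).
  unfold Cmod. apply Rsqr_incr_0_var; [| lra].
  rewrite Rsqr_sqrt by nra. unfold Rsqr.
  rewrite <- (pow2_abs (fst z)), <- (pow2_abs (snd z)). nra.
Qed.

Lemma csum_exists (a : nat -> C) (b : nat -> R) :
  ex_series b -> (forall n, Cmod (a n) <= b n) ->
  csum a (Series (fun n => fst (a n)), Series (fun n => snd (a n))).
Proof.
  intros eb h; split; simpl; apply Series_correct; apply (ex_series_dominated _ b); auto;
    intros n; (eapply Rle_trans; [| apply h]); [apply Rabs_fst_le | apply Rabs_snd_le].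
Qed.

(** Sharp only up to the factor [2], which is harmless for our use. *)
Lemma csum_norm_le (a : nat -> C) (b : nat -> R) (l : C) :
  ex_series b -> (forall n, Cmod (a n) <= b n) -> csum a l -> Cmod l <= 2 * Series b.
Proof.
  intros eb h [h1 h2].
  eapply Rle_trans; [apply Cmod_le_sum |].
  rewrite <- (is_series_unique _ _ h1), <- (is_series_unique _ _ h2).
  assert (Rabs (Series (fun n => fst (a n))) <= Series b).
  { apply Series_abs_le; auto. intros n; eapply Rle_trans; [apply Rabs_fst_le | apply h]. }
  assert (Rabs (Series (fun n => snd (a n))) <= Series b).
  { apply Series_abs_le; auto. intros n; eapply Rle_trans; [apply Rabs_snd_le | apply h]. }
  lra.
Qed.

Lemma csum_decr_1 (a : nat -> C) (l : C) :
  csum (fun n => a (S n)) (l - a 0%nat)%C -> csum a l.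
Proof.
  intros [h1 h2]; split; [apply (is_series_decr_1 (fun n => fst (a n))) | apply (is_series_decr_1 (fun n => snd (a n)))]; assumption.
Qed.

Lemma csum_incr_1 (a : nat -> C) (l : C) :
  csum a l -> csum (fun n => a (S n)) (l - a 0%nat)%C.
Proof.
  intros [h1 h2]; split; simpl.
  - apply (is_series_incr_1 (fun n => fst (a n))). 
    unfold plus; simpl. replace (fst l + - fst (a 0%nat) + fst (a 0%nat)) with (fst l) by ring. exact h1.
  - apply (is_series_incr_1 (fun n => snd (a n))). 
    unfold plus; simpl. replace (snd l + - snd (a 0%nat) + snd (a 0%nat)) with (snd l) by ring. exact h2.
Qed.

Lemma csum_const_0 : csum (fun _ => RtoC 0) 0.
Proof.
  assert (is_series (fun _ : nat => 0) 0).
  { change (is_lim_seq (sum_n (fun _ : nat => 0)) 0).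
    apply (is_lim_seq_ext (fun _ => 0)); [| apply is_lim_seq_const].
    intros n; rewrite sum_n_const; ring. }
  split; exact H.
Qed.

(** * The complex exponential *)

Lemma Cexp_add (z w : C) : Cexp (z + w) = (Cexp z * Cexp w)%C.
Proof.
  destruct z as [x y], w as [u v]; unfold Cexp, Cmult; simpl.
  rewrite exp_plus, cos_plus, sin_plus. f_equal; ring.
Qed.

Lemma Cexp_0 : Cexp 0 = 1.
Proof.
  unfold Cexp; simpl; rewrite exp_0, cos_0, sin_0. apply injective_projections; simpl; ring.
Qed.

Lemma Cmod_Cexp (z : C) : Cmod (Cexp z) = exp (Re z).
Proof.
  unfold Cmod, Cexp; simpl.
  replace (_ + _) with ((exp (Re z)) ^ 2).
  - rewrite sqrt_pow2; [reflexivity | apply Rlt_le, exp_pos].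
  - pose proof (sin2_cos2 (Im z)) as h; unfold Rsqr in h. simpl. 
    transitivity (exp (Re z) * exp (Re z) * (sin (Im z) * sin (Im z) + cos (Im z) * cos (Im z))); [rewrite h | ]; ring.
Qed.

Lemma Cexp_neq_0 (z : C) : Cexp z <> 0.
Proof.
  intros h. pose proof (Cmod_Cexp z) as e; rewrite h, Cmod_0 in e.
  pose proof (exp_pos (Re z)); lra.
Qed.

Lemma Cexp_R (x : R) : Cexp (RtoC x) = RtoC (exp x).
Proof.
  unfold Cexp, RtoC; simpl. rewrite cos_0, sin_0. f_equal; ring.
Qed.

Lemma const_of_derive_0 (f : R -> R) (r : R) :
  (forall t, Rabs t < r -> is_derive f t 0) -> forall t, Rabs t < r -> f t = f 0.
Proof.
  intros h t ht.
  destruct (MVT_gen f 0 t (fun _ => 0)) as (c & _ & e).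
  - intros x hx. apply h.
    revert ht hx; unfold Rmin, Rmax; destruct Rle_dec; unfold Rabs; repeat destruct Rcase_abs; lra.
  - intros x hx. apply continuity_pt_filterlim, (ex_derive_continuous f). exists 0; apply h.
    revert ht hx; unfold Rmin, Rmax; destruct Rle_dec; unfold Rabs; repeat destruct Rcase_abs; lra.
  - lra.
Qed.

(** With [y = y1 + i y2] the equations say [y' = a p y], so [y exp(- p A)] has derivative zero. [U]
    and [V] are its real and imaginary parts. *)
Lemma linear_ode_Cexp (y1 y2 A a : R -> R) (p : C) (r : R) :
  (forall t, Rabs t < r -> is_derive A t (a t)) -> A 0 = 0 ->
  (forall t, Rabs t < r -> is_derive y1 t (a t * (fst p * y1 t - snd p * y2 t))) ->
  (forall t, Rabs t < r -> is_derive y2 t (a t * (fst p * y2 t + snd p * y1 t))) ->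
  y1 0 = 1 -> y2 0 = 0 ->
  forall t, Rabs t < r -> (y1 t, y2 t) = Cexp (p * RtoC (A t)).
Proof.
  intros hA hA0 h1 h2 i1 i2 t ht.
  set (U := fun t => exp (- fst p * A t) * (y1 t * cos (snd p * A t) + y2 t * sin (snd p * A t))).
  set (V := fun t => exp (- fst p * A t) * (y2 t * cos (snd p * A t) - y1 t * sin (snd p * A t))).
  assert (eU : U t = U 0).
  { apply (const_of_derive_0 U r); [| exact ht]. intros s hs. unfold U.
    specialize (hA s hs); specialize (h1 s hs); specialize (h2 s hs).
    auto_derive; [repeat split; eexists; eassumption |].
    rewrite (is_derive_unique A _ _ hA : Derive (fun x : R => A x) s = _),
      (is_derive_unique y1 _ _ h1 : Derive (fun x : R => y1 x) s = _),
      (is_derive_unique y2 _ _ h2 : Derive (fun x : R => y2 x) s = _). ring. }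
  assert (eV : V t = V 0).
  { apply (const_of_derive_0 V r); [| exact ht]. intros s hs. unfold V.
    specialize (hA s hs); specialize (h1 s hs); specialize (h2 s hs).
    auto_derive; [repeat split; eexists; eassumption |].
    rewrite (is_derive_unique A _ _ hA : Derive (fun x : R => A x) s = _),
      (is_derive_unique y1 _ _ h1 : Derive (fun x : R => y1 x) s = _),
      (is_derive_unique y2 _ _ h2 : Derive (fun x : R => y2 x) s = _). ring. }
  unfold U in eU; unfold V in eV.
  rewrite hA0, !Rmult_0_r, i1, i2, exp_0, cos_0, sin_0 in eU, eV.
  set (E := exp (- fst p * A t)) in *.
  assert (hE : exp (fst p * A t) * E = 1).
  { unfold E. rewrite <- exp_plus. replace (_ + _) with 0 by ring. apply exp_0. }
  assert (hE0 : E <> 0) by (apply Rgt_not_eq, exp_pos).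
  assert (q1 : y1 t * cos (snd p * A t) + y2 t * sin (snd p * A t) = exp (fst p * A t)).
  { apply (Rmult_eq_reg_l E); lra. }
  assert (q2 : y2 t * cos (snd p * A t) - y1 t * sin (snd p * A t) = 0).
  { apply (Rmult_eq_reg_l E); lra. }
  pose proof (sin2_cos2 (snd p * A t)) as sc; unfold Rsqr in sc.
  unfold Cexp; simpl. rewrite !Rmult_0_r, Rminus_0_r, Rplus_0_l.
  rewrite <- q1.
  set (cc := cos (snd p * A t)) in *. set (ss := sin (snd p * A t)) in *.
  f_equal.
  - transitivity (y1 t * (ss * ss + cc * cc) + ss * (y2 t * cc - y1 t * ss) + 0); [rewrite sc, q2; ring |]. 
    transitivity ((y1 t * cc + y2 t * ss) * cc - ss * (y2 t * cc - y1 t * ss) + ss * (y2 t * cc - y1 t * ss)); [ring | rewrite q2; ring].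
  - transitivity (y2 t * (ss * ss + cc * cc)); [rewrite sc; ring |].
    transitivity ((y1 t * cc + y2 t * ss) * ss + cc * (y2 t * cc - y1 t * ss)); [ring | rewrite q2; ring].
Qed.

Lemma CV_radius_ge (a : nat -> R) (r M : R) :
  (forall n, Rabs (a n * r ^ n) <= M) -> Rbar_le r (CV_radius a).
Proof. intros h. apply (proj1 (CV_radius_bounded a)). exists M; exact h. Qed.

(** Power series solution of [(1 + b t) y' = p y], [y 0 = 1]. *)
Lemma series_ode_Cexp (b : R) (p : C) (c : nat -> C) (A : R -> R) (r : R) :
  (forall j, (RtoC (INR (S j)) * c (S j) = (p - RtoC (b * INR j)) * c j)%C) ->
  c 0%nat = 1 ->
  (forall x, 0 <= x < r -> exists M, forall n, Cmod (c n) * x ^ n <= M) ->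
  (forall t, Rabs t < r -> 1 + b * t <> 0 /\ is_derive A t (/ (1 + b * t))) ->
  A 0 = 0 ->
  forall t, Rabs t < r ->
    csum (fun n => (c n * RtoC (t ^ n))%C) (Cexp (p * RtoC (A t))).
Proof.
  intros hc c0 hM hA hA0 t ht.
  set (a1 := fun n => fst (c n)). set (a2 := fun n => snd (c n)).
  assert (rad : forall s, Rabs s < r -> Rbar_lt (Rabs s) (CV_radius a1) /\ Rbar_lt (Rabs s) (CV_radius a2)).
  { intros s hs. pose proof (Rabs_pos s) as s0.
    destruct (hM ((Rabs s + r) / 2)) as [M hM']; [lra |].
    assert (pp : forall n, 0 <= ((Rabs s + r) / 2) ^ n) by (intros; apply pow_le; lra).
    split.
    - apply (Rbar_lt_le_trans _ (Finite ((Rabs s + r) / 2))); [simpl; lra |].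
      apply (CV_radius_ge _ _ M). intros n. rewrite Rabs_mult, (Rabs_pos_eq (_ ^ n)) by auto.
      eapply Rle_trans; [| apply (hM' n)]. apply Rmult_le_compat_r; [auto | apply Rabs_fst_le].
    - apply (Rbar_lt_le_trans _ (Finite ((Rabs s + r) / 2))); [simpl; lra |].
      apply (CV_radius_ge _ _ M). intros n. rewrite Rabs_mult, (Rabs_pos_eq (_ ^ n)) by auto.
      eapply Rle_trans; [| apply (hM' n)]. apply Rmult_le_compat_r; [auto | apply Rabs_snd_le]. }
  assert (rec : forall n, INR (S n) * a1 (S n) + b * (INR n * a1 n) = fst p * a1 n - snd p * a2 n /\
                          INR (S n) * a2 (S n) + b * (INR n * a2 n) = fst p * a2 n + snd p * a1 n).
  { intros n. pose proof (hc n) as e. unfold a1, a2.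
    pose proof (f_equal fst e) as e1; pose proof (f_equal snd e) as e2.
    cbn -[INR] in e1, e2. split; lra. }
  (* One component with free real coefficients [p1], [p2]: the real and the imaginary part are both
     instances. Multiplied by [1 + b s], the claim is the recursion, coefficient by coefficient. *)
  assert (ode : forall (x y : nat -> R) (p1 p2 s : R), Rabs s < r ->
     Rbar_lt (Rabs s) (CV_radius x) -> Rbar_lt (Rabs s) (CV_radius y) ->
     (forall n, INR (S n) * x (S n) + b * (INR n * x n) = p1 * x n + p2 * y n) ->
     is_derive (PSeries x) s (/ (1 + b * s) * (p1 * PSeries x s + p2 * PSeries y s))).
  { intros x y p1 p2 s hs rx ry hr.
    destruct (hA s hs) as [nz _].
    replace (/ (1 + b * s) * (p1 * PSeries x s + p2 * PSeries y s)) with (PSeries (PS_derive x) s).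
    { apply is_derive_PSeries; exact rx. }
    apply (Rmult_eq_reg_l (1 + b * s)); [| exact nz].
    rewrite <- Rmult_assoc, Rinv_r, Rmult_1_l by exact nz.
    rewrite <- (PSeries_scal p1), <- (PSeries_scal p2), <- PSeries_plus.
    2: apply CV_radius_inside; destruct (Req_dec p1 0) as [-> | h0]; [| rewrite CV_radius_scal; assumption].
    3: apply CV_radius_inside; destruct (Req_dec p2 0) as [-> | h0]; [| rewrite CV_radius_scal; assumption].
    2-3: rewrite (CV_radius_ext _ (fun _ => 0)), CV_radius_const_0; [exact I | intros n; unfold PS_scal, scal; simpl; unfold mult; simpl; ring].
    rewrite Rmult_plus_distr_r, Rmult_1_l, (Rmult_assoc b), <- PSeries_incr_1, <- (PSeries_scal b), <- PSeries_plus.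
    2: apply CV_radius_inside; rewrite CV_radius_derive; exact rx.
    2: apply CV_radius_inside; destruct (Req_dec b 0) as [-> | h0]; [| rewrite CV_radius_scal, CV_radius_incr_1, CV_radius_derive; assumption].
    2: rewrite (CV_radius_ext _ (fun _ => 0)), CV_radius_const_0; [exact I | intros n; unfold PS_scal, scal; simpl; unfold mult; simpl; ring].
    apply PSeries_ext. intros n. unfold PS_plus, PS_scal, PS_derive, PS_incr_1, scal, plus; simpl; unfold mult; simpl.
    rewrite <- hr. destruct n; [simpl; unfold zero; simpl; ring | simpl; ring]. }
  assert (y0 : forall x, PSeries x 0 = x 0%nat).
  { intros x. apply is_series_unique. apply is_series_decr_1.
    apply (is_series_ext (fun _ => 0)).
    - intros n; simpl; ring.
    - unfold plus, opp; simpl. replace (x 0%nat + - (x 0%nat * 1)) with 0 by ring. apply (proj1 csum_const_0). }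
  assert (E : (PSeries a1 t, PSeries a2 t) = Cexp (p * RtoC (A t))).
  { apply (linear_ode_Cexp _ _ A (fun t => / (1 + b * t)) p r).
    - intros s hs; apply hA; exact hs.
    - exact hA0.
    - intros s hs. destruct (rad s hs) as [r1 r2].
      replace (fst p * PSeries a1 s - snd p * PSeries a2 s) with (fst p * PSeries a1 s + (- snd p) * PSeries a2 s) by ring.
      apply ode; auto. intros n; rewrite (proj1 (rec n)); ring.
    - intros s hs. destruct (rad s hs) as [r1 r2]. apply ode; auto. intros n; exact (proj2 (rec n)).
    - rewrite y0; unfold a1; rewrite c0; reflexivity.
    - rewrite y0; unfold a2; rewrite c0; reflexivity.
    - exact ht. }
  rewrite <- E. destruct (rad t ht) as [r1 r2]. split; cbn [fst snd].
  - apply (is_series_ext (fun n => a1 n * t ^ n)); [intros n; unfold a1; simpl; ring |].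
    apply Series_correct. apply ex_pseries_R, CV_radius_inside, r1.
  - apply (is_series_ext (fun n => a2 n * t ^ n)); [intros n; unfold a2; simpl; ring |].
    apply Series_correct. apply ex_pseries_R, CV_radius_inside, r2.
Qed.

Lemma exp_series (x : R) : is_series (fun n => x ^ n / INR (fact n)) (exp x).
Proof.
  apply (is_series_ext (fun n => / INR (fact n) * x ^ n)).
  { intros n; apply Rmult_comm. }
  apply is_series_Reals. intros e he. unfold exp. destruct (exist_exp x) as [l hl]. apply hl; exact he.
Qed.

Lemma series_term_bounded (a : nat -> R) : ex_series a -> exists M, forall n, a n <= M.
Proof.
  intros h. destruct (lim_bounded a 0) as [M hM]; [apply ex_series_lim_0, h |].
  exists M; intros n; eapply Rle_trans; [apply Rle_abs | apply hM].
Qed.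

(** The case [b = 0], [A t = t] of [series_ode_Cexp], read at [t = 1]; the radius [2] only serves to
    have [1] inside. The case [b = 1] is the binomial series. *)
Lemma Cexp_series (z : C) : csum (fun n => (z ^ n / RtoC (INR (fact n)))%C) (Cexp z).
Proof.
  assert (nz : forall n, RtoC (INR (fact n)) <> 0).
  { intros n h; apply RtoC_inj in h; apply (INR_fact_neq_0 n h). }
  pose proof (series_ode_Cexp 0 z (fun n => (z ^ n / RtoC (INR (fact n)))%C) (fun t => t) 2) as H.
  specialize (fun a b c d e => H a b c d e 1).
  replace (Cexp z) with (Cexp (z * RtoC 1)) by (f_equal; ring).
  eapply csum_ext; [| apply H].
  - intros n; cbn beta. rewrite pow1; ring.
  - intros j. change (fact (S j)) with (S j * fact j)%nat. rewrite mult_INR, RtoC_mult, Rmult_0_l.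
    change (z ^ S j)%C with (z * z ^ j)%C. field. split; [apply nz |].
    intros h; apply RtoC_inj in h; apply (not_0_INR (S j)); auto.
  - change (INR (fact 0)) with 1. apply injective_projections; simpl; field; lra.
  - intros x hx. destruct (series_term_bounded (fun n => (Cmod z * x) ^ n / INR (fact n))) as [M hM].
    + eexists; apply exp_series.
    + exists M; intros n. rewrite Cmod_div, Cmod_pow, Cmod_R, Rabs_pos_eq by (try apply nz; apply pos_INR).
      eapply Rle_trans; [| apply (hM n)]. right. cbn beta. rewrite Rpow_mult_distr. field. apply INR_fact_neq_0.
  - intros t _; split; [lra |]. auto_derive; [trivial |]. rewrite Rmult_0_l, Rplus_0_r, Rinv_1; reflexivity.
  - reflexivity.
  - rewrite Rabs_pos_eq; lra.
Qed.

(** [gbinom p j] is the coefficient of [v^j] in [(1 + v)^p]. *)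
Fixpoint gbinom (p : C) (j : nat) : C :=
  match j with
  | O => 1
  | S i => (gbinom p i * (p - RtoC (INR i)) / RtoC (INR (S i)))%C
  end.

(** The coefficients of [(1 - v)^(-A)], which majorize those of [(1 + v)^p] for all [|p| <= A]. *)
Fixpoint gbinom_bound (A : R) (j : nat) : R :=
  match j with
  | O => 1
  | S i => gbinom_bound A i * (A + INR i) / INR (S i)
  end.

Lemma gbinom_bound_pos (A : R) (j : nat) : 0 < A -> 0 < gbinom_bound A j.
Proof.
  intros hA; induction j as [| j IH]; [simpl; lra |].
  change (0 < gbinom_bound A j * (A + INR j) / INR (S j)).
  pose proof (pos_INR j). apply Rdiv_lt_0_compat; [| apply lt_0_INR; lia].
  apply Rmult_lt_0_compat; lra.
Qed.

Lemma gbinom_bound_summable (A x : R) :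
  0 < A -> 0 < x < 1 -> ex_series (fun j => gbinom_bound A j * x ^ j).
Proof.
  intros hA hx.
  assert (pos : forall j, 0 < gbinom_bound A j * x ^ j).
  { intros j; apply Rmult_lt_0_compat; [apply gbinom_bound_pos, hA | apply pow_lt; lra]. }
  apply (ex_series_ext (fun j => Rabs (gbinom_bound A j * x ^ j))).
  { intros j; apply Rabs_pos_eq, Rlt_le, pos. }
  apply ex_series_DAlembert with x; [lra | intros n; apply Rgt_not_eq, pos |].
  apply (is_lim_seq_ext (fun n => x * (1 + (A - 1) * / INR (S n)))).
  - intros n. pose proof (gbinom_bound_pos A n hA).
    assert (0 < x ^ n) by (apply pow_lt; lra).
    assert (0 < INR (S n)) by (apply lt_0_INR; lia).
    pose proof (pos_INR n).
    rewrite Rabs_pos_eq.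
    + change (gbinom_bound A (S n)) with (gbinom_bound A n * (A + INR n) / INR (S n)).
      rewrite S_INR in *. simpl pow. field. repeat split; lra.
    + apply Rlt_le, Rdiv_lt_0_compat; apply pos.
  - replace x with (x * (1 + (A - 1) * 0)) at 1 by ring.
    apply (is_lim_seq_scal_l _ x (1 + (A - 1) * 0)).
    apply is_lim_seq_plus'; [apply is_lim_seq_const |].
    apply (is_lim_seq_scal_l _ (A - 1) 0).
    apply (is_lim_seq_incr_1 (fun n => / INR n)).
    replace (Finite 0) with (Rbar_inv p_infty) by reflexivity.
    apply is_lim_seq_inv; [apply is_lim_seq_INR | discriminate].
Qed.

Lemma gbinom_le (A : R) (p : C) (j : nat) : Cmod p <= A -> Cmod (gbinom p j) <= gbinom_bound A j.
Proof.
  intros hp; induction j as [| j IH]; [simpl; rewrite Cmod_1; lra |].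
  change (Cmod (gbinom p j * (p - RtoC (INR j)) / RtoC (INR (S j))) <= gbinom_bound A j * (A + INR j) / INR (S j)).
  assert (0 < INR (S j)) by (apply lt_0_INR; lia).
  rewrite Cmod_div by (intros h; apply RtoC_inj in h; lra).
  rewrite Cmod_mult, Cmod_R, (Rabs_pos_eq (INR (S j))) by lra.
  apply Rmult_le_compat_r; [apply Rlt_le, Rinv_0_lt_compat; lra |].
  apply Rmult_le_compat; auto; try apply Cmod_ge_0.
  eapply Rle_trans; [apply Cmod_triangle |]. rewrite Cmod_opp, Cmod_R, (Rabs_pos_eq (INR j)) by apply pos_INR. lra.
Qed.

Lemma binomial_series (p : C) (v : R) :
  Rabs v < 1 -> csum (fun j => (gbinom p j * RtoC (v ^ j))%C) (Cexp (p * RtoC (ln (1 + v)))).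
Proof.
  intros hv.
  apply (series_ode_Cexp 1 p (gbinom p) (fun t => ln (1 + t)) 1).
  - intros j. change (gbinom p (S j)) with (gbinom p j * (p - RtoC (INR j)) / RtoC (INR (S j)))%C.
    rewrite Rmult_1_l. field. intros h; apply RtoC_inj in h; apply (not_0_INR (S j)); auto.
  - reflexivity.
  - intros x hx.
    destruct (series_term_bounded (fun n => gbinom_bound (Cmod p + 1) n * ((x + 1) / 2) ^ n)) as [M hM].
    { apply gbinom_bound_summable; [pose proof (Cmod_ge_0 p); lra | lra]. }
    exists M; intros n. eapply Rle_trans; [| apply hM].
    apply Rmult_le_compat; [apply Cmod_ge_0 | apply pow_le; lra | apply gbinom_le; lra | apply pow_incr; lra].
  - intros t ht. apply Rabs_def2 in ht. split; [lra |]. auto_derive; [lra | field; lra].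
  - rewrite Rplus_0_r; apply ln_1.
  - exact hv.
Qed.

Lemma Cexp_quadratic_bound (z : C) :
  Cmod (Cexp z - 1 - z) <= 2 * (Cmod z ^ 2 * exp (Cmod z)).
Proof.
  pose proof (Cexp_series z) as h.
  apply csum_incr_1, csum_incr_1 in h.
  assert (e : (Cexp z - z ^ 0 / RtoC (INR (fact 0)) - z ^ 1 / RtoC (INR (fact 1)))%C = (Cexp z - 1 - z)%C).
  { change (INR (fact 0)) with 1. change (INR (fact 1)) with 1. simpl Cpow. field. }
  rewrite e in h.
  replace (Cmod z ^ 2 * exp (Cmod z)) with (Series (fun n => Cmod z ^ 2 * (Cmod z ^ n / INR (fact n)))).
  2:{ rewrite Series_scal_l; f_equal; apply is_series_unique, exp_series. }
  eapply csum_norm_le; [| | exact h].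
  - apply (ex_series_scal (Cmod z ^ 2) (fun n => Cmod z ^ n / INR (fact n))). eexists; apply exp_series.
  - intros n. cbn beta. rewrite Cmod_div, Cmod_pow, Cmod_R.
    2:{ intros k; apply RtoC_inj in k; exact (INR_fact_neq_0 _ k). }
    rewrite Rabs_pos_eq by apply pos_INR.
    replace (Cmod z ^ S (S n)) with (Cmod z ^ 2 * Cmod z ^ n) by (simpl; ring).
    unfold Rdiv. rewrite Rmult_assoc. apply Rmult_le_compat_l; [apply pow_le, Cmod_ge_0 |].
    apply Rmult_le_compat_l; [apply pow_le, Cmod_ge_0 |].
    apply Rinv_le_contravar; [apply INR_fact_lt_0 | apply le_INR].
    transitivity (fact (S n)); simpl; lia.
Qed.

(** * Logarithms of moduli *)

Definition lnm (z : C) : R := ln (Cmod z).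

Lemma lnm_mult (z w : C) : z <> 0 -> w <> 0 -> lnm (z * w) = lnm z + lnm w.
Proof.
  intros hz hw; unfold lnm; rewrite Cmod_mult, ln_mult; auto; apply Cmod_gt_0; assumption.
Qed.

Lemma lnm_opp (z : C) : lnm (- z) = lnm z.
Proof. unfold lnm; now rewrite Cmod_opp. Qed.

Lemma lnm_sqrt (x y : R) : 0 < x ^ 2 + y ^ 2 -> lnm (x, y) = / 2 * ln (x ^ 2 + y ^ 2).
Proof.
  intros h. unfold lnm, Cmod; simpl fst; simpl snd.
  rewrite <- (sqrt_sqrt (x ^ 2 + y ^ 2)) at 2 by lra.
  rewrite ln_mult by (apply sqrt_lt_R0; lra). lra.
Qed.

Lemma Cmod_1p_ge (v : C) (s : R) : Cmod v <= 1 / 2 -> 0 <= s <= 1 -> 1 / 2 <= Cmod (1 + RtoC s * v).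
Proof.
  intros hv hs.
  pose proof (Cmod_triangle (1 + RtoC s * v) (- (RtoC s * v))) as h.
  replace (1 + RtoC s * v + - (RtoC s * v))%C with (RtoC 1) in h by ring.
  rewrite Cmod_1, Cmod_opp, Cmod_mult, Cmod_R, Rabs_pos_eq in h by lra.
  pose proof (Cmod_ge_0 v). nra.
Qed.

(** The derivative of [log |1 + s v|] in [s] is [Re (v / (1 + s v))]. So [r] plays the role of a
    Taylor polynomial whose derivative is off by [Re (dr / (1 + s v))], and [|1 + s v| >= 1 / 2]
    produces the factor [2]. The expansions of first and second order are both instances. *)
Lemma ln_mod_1p (v : C) (r : R -> R) (dr : R -> C) (B : R) :
  Cmod v <= 1 / 2 ->
  (forall s, 0 <= s <= 1 -> is_derive r s (Re (v / (1 + RtoC s * v) - dr s / (1 + RtoC s * v)))) ->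
  (forall s, 0 <= s <= 1 -> Cmod (dr s) <= B) -> r 0 = 0 ->
  Rabs (lnm (1 + v) - r 1) <= 2 * B.
Proof.
  intros hv hr hB r0.
  destruct v as [x y].
  assert (pos : forall s, 0 <= s <= 1 -> 0 < (1 + s * x) ^ 2 + (s * y) ^ 2).
  { intros s hs. pose proof (Cmod_1p_ge _ s hv hs) as h.
    assert (e : Cmod (1 + RtoC s * (x, y)) ^ 2 = (1 + s * x) ^ 2 + (s * y) ^ 2).
    { rewrite Cmod2_alt. simpl. ring. }
    rewrite <- e. apply pow_lt; lra. }
  set (h := fun s => / 2 * ln ((1 + s * x) ^ 2 + (s * y) ^ 2) - r s).
  assert (hd : forall s, 0 <= s <= 1 -> is_derive h s (Re (dr s / (1 + RtoC s * (x, y))))).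
  { intros s hs. unfold h. specialize (pos s hs). specialize (hr s hs).
    set (T := Re (dr s / (1 + RtoC s * (x, y)))).
    replace T with (Re ((x, y) / (1 + RtoC s * (x, y))) - Re ((x, y) / (1 + RtoC s * (x, y)) - dr s / (1 + RtoC s * (x, y)))).
    2:{ unfold T. simpl. ring. }
    apply (is_derive_minus (fun s => / 2 * ln ((1 + s * x) ^ 2 + (s * y) ^ 2)) r); [| exact hr].
    auto_derive; [simpl in *; lra |]. simpl. field. simpl in pos. nra. }
  destruct (MVT_gen h 0 1 (fun s => Re (dr s / (1 + RtoC s * (x, y))))) as (c & hc & e).
  - intros s hs. rewrite Rmin_left, Rmax_right in hs by lra. apply hd; lra.
  - intros s hs. rewrite Rmin_left, Rmax_right in hs by lra.
    apply continuity_pt_filterlim, (ex_derive_continuous h). eexists; apply hd; lra.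
  - rewrite Rmin_left, Rmax_right in hc by lra.
    assert (h0 : h 0 = 0).
    { unfold h. rewrite r0, !Rmult_0_l, Rplus_0_r. replace (1 ^ 2 + 0 ^ 2) with 1 by ring. rewrite ln_1; ring. }
    assert (h1 : h 1 = lnm (1 + (x, y)) - r 1).
    { unfold h. specialize (pos 1 ltac:(lra)). rewrite !Rmult_1_l in *.
      rewrite <- lnm_sqrt by exact pos. f_equal. f_equal. apply injective_projections; simpl; ring. }
    rewrite <- h1. replace (h 1) with (h 1 - h 0) by lra. rewrite e, Rminus_0_r, Rmult_1_r.
    eapply Rle_trans; [apply Rabs_fst_le |].
    pose proof (Cmod_1p_ge _ c hv hc) as hq.
    assert (nz : (1 + RtoC c * (x, y))%C <> 0) by (apply Cmod_gt_0; lra).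
    rewrite Cmod_div by exact nz.
    specialize (hB c hc). pose proof (Cmod_ge_0 (dr c)).
    apply Rmult_le_reg_r with (Cmod (1 + RtoC c * (x, y))); [lra |].
    unfold Rdiv. rewrite Rmult_assoc, Rinv_l by lra. nra.
Qed.

Lemma ln_mod_1p_linear (v : C) :
  Cmod v <= 1 / 2 -> Rabs (lnm (1 + v) - Re v) <= 2 * Cmod v ^ 2.
Proof.
  intros hv.
  replace (Re v) with ((fun s => s * Re v) 1) by (simpl; ring).
  apply (ln_mod_1p v (fun s => s * Re v) (fun s => - RtoC s * v * v)%C); auto.
  - intros s hs. assert (nz : (1 + RtoC s * v)%C <> 0).
    { apply Cmod_gt_0. pose proof (Cmod_1p_ge v s hv hs); lra. }
    replace (v / (1 + RtoC s * v) - - RtoC s * v * v / (1 + RtoC s * v))%C with v.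
    + auto_derive; [trivial | ring].
    + field; exact nz.
  - intros s hs. rewrite !Cmod_mult, Cmod_opp, Cmod_R, Rabs_pos_eq by lra.
    pose proof (Cmod_ge_0 v). simpl. nra.
  - ring.
Qed.

Lemma ln_mod_1p_quadratic (v : C) :
  Cmod v <= 1 / 2 -> Rabs (lnm (1 + v) - (Re v - Re (v * v) / 2)) <= 2 * Cmod v ^ 3.
Proof.
  intros hv.
  replace (Re v - Re (v * v) / 2) with ((fun s => s * Re v - s ^ 2 * (Re (v * v) / 2)) 1) by (simpl; ring).
  apply (ln_mod_1p v (fun s => s * Re v - s ^ 2 * (Re (v * v) / 2))
     (fun s => RtoC (s ^ 2) * v * v * v)%C); auto.
  - intros s hs. assert (nz : (1 + RtoC s * v)%C <> 0).
    { apply Cmod_gt_0. pose proof (Cmod_1p_ge v s hv hs); lra. }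
    replace (v / (1 + RtoC s * v) - RtoC (s ^ 2) * v * v * v / (1 + RtoC s * v))%C with (v - RtoC s * (v * v))%C.
    + auto_derive; [trivial |]. unfold Re; destruct v as [x y]; simpl; field.
    + rewrite RtoC_pow. simpl Cpow. field; exact nz.
  - intros s hs. rewrite !Cmod_mult, Cmod_R, Rabs_pos_eq by nra.
    pose proof (Cmod_ge_0 v). 
    assert (0 <= Cmod v * Cmod v * Cmod v) by (repeat apply Rmult_le_pos; auto).
    simpl. assert (s * (s * 1) <= 1) by nra. nra.
  - ring.
Qed.

Lemma ln_mod_1p_abs (v : C) : Cmod v <= 1 / 2 -> Rabs (lnm (1 + v)) <= 2 * Cmod v.
Proof.
  intros hv. pose proof (ln_mod_1p_linear v hv) as h.
  pose proof (Rabs_fst_le v). change (fst v) with (Re v) in *.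
  pose proof (Cmod_ge_0 v). revert h H. unfold Rabs; repeat destruct Rcase_abs; nra.
Qed.

(** * Finite linear functionals on functions of a complex variable *)

(** The functional [f |-> sum_i c_i f(d_i)], for [l] the list of the
    [(c_i, d_i)]. *)
Fixpoint Lam (l : list (R * C)) (f : C -> R) : R :=
  match l with
  | nil => 0
  | p :: t => fst p * f (snd p) + Lam t f
  end.

Fixpoint labs (l : list (R * C)) : R :=
  match l with nil => 0 | p :: t => Rabs (fst p) + labs t end.

(** Any bound for the moduli of the points would do; the sum is simpler than the maximum, and
    starting at [1] keeps it positive. *)
Fixpoint lrad (l : list (R * C)) : R :=
  match l with nil => 1 | p :: t => Cmod (snd p) + lrad t end.

Lemma labs_pos l : 0 <= labs l.
Proof. induction l as [| p t IH]; simpl; [lra |]. pose proof (Rabs_pos (fst p)); lra. Qed.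

Lemma lrad_pos l : 1 <= lrad l.
Proof. induction l as [| p t IH]; simpl; [lra |]. pose proof (Cmod_ge_0 (snd p)); lra. Qed.

Lemma lrad_le l p : In p l -> Cmod (snd p) <= lrad l.
Proof.
  induction l as [| q t IH]; simpl; [tauto |]. pose proof (lrad_pos t).
  pose proof (Cmod_ge_0 (snd q)).
  intros [-> | h]; [lra |]. specialize (IH h); lra.
Qed.

Lemma Lam_ext l f g : (forall p, In p l -> f (snd p) = g (snd p)) -> Lam l f = Lam l g.
Proof.
  induction l as [| q t IH]; intros h; simpl; [reflexivity |].
  rewrite h by (left; reflexivity). rewrite IH; [reflexivity |]. intros; apply h; right; assumption.
Qed.

Lemma Lam_plus l f g : Lam l (fun d => f d + g d) = Lam l f + Lam l g.
Proof. induction l as [| q t IH]; simpl; [ring |]. rewrite IH; ring. Qed.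

Lemma Lam_scal l c f : Lam l (fun d => c * f d) = c * Lam l f.
Proof. induction l as [| q t IH]; simpl; [ring |]. rewrite IH; ring. Qed.

Lemma Lam_abs_le l f e : (forall p, In p l -> Rabs (f (snd p)) <= e) -> Rabs (Lam l f) <= labs l * e.
Proof.
  induction l as [| q t IH]; intros h; simpl; [rewrite Rabs_R0; lra |].
  eapply Rle_trans; [apply Rabs_triang |]. rewrite Rmult_plus_distr_r.
  apply Rplus_le_compat.
  - rewrite Rabs_mult. apply Rmult_le_compat_l; [apply Rabs_pos | apply h; left; reflexivity].
  - apply IH; intros; apply h; right; assumption.
Qed.

Lemma Lam_lim l (f : nat -> C -> R) (F : C -> R) :
  (forall p, In p l -> is_lim_seq (fun N => f N (snd p)) (F (snd p))) ->
  is_lim_seq (fun N => Lam l (f N)) (Lam l F).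
Proof.
  induction l as [| q t IH]; intros h; simpl; [apply is_lim_seq_const |].
  apply is_lim_seq_plus'.
  - apply (is_lim_seq_scal_l _ (fst q) (F (snd q))). apply h; left; reflexivity.
  - apply IH; intros; apply h; right; assumption.
Qed.

Lemma Lam_Series l (f : nat -> C -> R) :
  (forall p, In p l -> ex_series (fun n => f n (snd p))) ->
  ex_series (fun n => Lam l (f n)) /\
  Series (fun n => Lam l (f n)) = Lam l (fun d => Series (fun n => f n d)).
Proof.
  induction l as [| q t IH]; intros h; simpl.
  - split; [exists 0; apply (proj1 csum_const_0) | apply is_series_unique, (proj1 csum_const_0)].
  - destruct IH as [e1 e2]; [intros; apply h; right; assumption |].
    assert (e0 : ex_series (fun n => fst q * f n (snd q))).
    { apply (ex_series_scal (fst q) (fun n => f n (snd q))). apply h; left; reflexivity. }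
    split; [apply (ex_series_plus _ _ e0 e1) |].
    rewrite Series_plus, e2, Series_scal_l; auto.
Qed.

(** As [a] runs through [C], the second condition says that the sum of [c_i d_i] vanishes in [C].
    Taylor polynomials of [lnm] are real parts, so this form applies to them directly. *)
Definition kills_linear (l : list (R * C)) : Prop :=
  Lam l (fun _ => 1) = 0 /\ forall a : C, Lam l (fun d => Re (a * d)) = 0.

Definition kills_quadratic (l : list (R * C)) : Prop :=
  kills_linear l /\ forall a : C, Lam l (fun d => Re (a * (d * d))) = 0.

Lemma kills_const l c : kills_linear l -> Lam l (fun _ => c) = 0.
Proof.
  intros [h _]. rewrite (Lam_ext l (fun _ => c) (fun _ => c * 1)) by (intros; ring).
  rewrite Lam_scal, h; ring.
Qed.

Lemma Lam_linear_error l f a b e :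
  kills_linear l -> (forall p, In p l -> Rabs (f (snd p) - (a + Re (b * snd p))) <= e) ->
  Rabs (Lam l f) <= labs l * e.
Proof.
  intros k h.
  replace (Lam l f) with (Lam l (fun d => f d - (a + Re (b * d)))).
  - apply Lam_abs_le; exact h.
  - rewrite (Lam_ext l _ (fun d => f d + (-1) * (a + Re (b * d)))) by (intros; ring).
    rewrite Lam_plus, Lam_scal, Lam_plus, (proj2 k), (kills_const l a k). ring.
Qed.

Lemma Lam_quadratic_error l f a b c e :
  kills_quadratic l ->
  (forall p, In p l -> Rabs (f (snd p) - (a + Re (b * snd p) + Re (c * (snd p * snd p)))) <= e) ->
  Rabs (Lam l f) <= labs l * e.
Proof.
  intros [k k2] h.
  replace (Lam l f) with (Lam l (fun d => f d - (a + Re (b * d) + Re (c * (d * d))))).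
  - apply Lam_abs_le; exact h.
  - rewrite (Lam_ext l _ (fun d => f d + (-1) * (a + Re (b * d) + Re (c * (d * d))))) by (intros; ring).
    rewrite Lam_plus, Lam_scal, !Lam_plus, (proj2 k), k2, (kills_const l a k). ring.
Qed.

Lemma lnm_shift (w d : C) : w <> 0 -> Cmod d <= Cmod w / 2 ->
  lnm (w + d) = lnm w + lnm (1 + d / w) /\ Cmod (d / w) <= 1 / 2.
Proof.
  intros hw hd. assert (0 < Cmod w) by (apply Cmod_gt_0; exact hw).
  assert (hq : Cmod (d / w) <= 1 / 2).
  { rewrite Cmod_div by exact hw. apply Rmult_le_reg_r with (Cmod w); [lra |].
    unfold Rdiv; rewrite Rmult_assoc, Rinv_l by lra. lra. }
  split; [| exact hq].
  replace (w + d)%C with (w * (1 + d / w))%C by (field; exact hw).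
  apply lnm_mult; [exact hw |].
  pose proof (Cmod_1p_ge (d / w) 1 hq ltac:(lra)) as k. rewrite Cmult_1_l in k.
  apply Cmod_gt_0; lra.
Qed.

(** The Taylor polynomial of order two of [log |w + d|] in [d / w] is killed and a cubic remainder
    is left. This is the source of absolute convergence over a plane lattice. *)
Lemma Lam_lnm_cubic l (w : C) :
  kills_quadratic l -> 2 * lrad l <= Cmod w ->
  Rabs (Lam l (fun d => lnm (w + d))) <= labs l * (2 * (lrad l / Cmod w) ^ 3).
Proof.
  intros k hw. pose proof (lrad_pos l).
  assert (nz : w <> 0) by (apply Cmod_gt_0; lra).
  apply (Lam_quadratic_error l _ (lnm w) (/ w) (- (RtoC (/ 2)) / (w * w))); [exact k |].
  intros p hp. pose proof (lrad_le l p hp) as hd.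
  destruct (lnm_shift w (snd p) nz ltac:(lra)) as [e hq]. rewrite e.
  replace (lnm w + lnm (1 + snd p / w) - _) with
    (lnm (1 + snd p / w) - (Re (snd p / w) - Re (snd p / w * (snd p / w)) / 2)).
  - eapply Rle_trans; [apply ln_mod_1p_quadratic, hq |].
    apply Rmult_le_compat_l; [lra |]. apply pow_incr. split; [apply Cmod_ge_0 |].
    rewrite Cmod_div by exact nz. apply Rmult_le_compat_r; [| exact hd].
    apply Rlt_le, Rinv_0_lt_compat; lra.
  - replace (/ w * snd p)%C with (snd p / w)%C by (field; exact nz).
    replace (- RtoC (/ 2) / (w * w) * (snd p * snd p))%C with (RtoC (- / 2) * (snd p / w * (snd p / w)))%C.
    + rewrite (re_scal_l (- / 2)). field.
    + rewrite RtoC_opp. field; exact nz.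
Qed.

(** * The function [e(w) = exp (2 pi i w)] *)

Definition ce (w : C) : C := Cexp (RtoC (2 * PI) * Ci * w).

Lemma ce_add z w : ce (z + w) = (ce z * ce w)%C.
Proof. unfold ce; rewrite <- Cexp_add; f_equal; ring. Qed.

Lemma Cmod_ce w : Cmod (ce w) = exp (- (2 * PI * Im w)).
Proof. unfold ce; rewrite Cmod_Cexp; f_equal; destruct w; simpl; ring. Qed.

Lemma ce_eq w : ce w = (exp (- (2 * PI * Im w)) * cos (2 * PI * Re w), exp (- (2 * PI * Im w)) * sin (2 * PI * Re w)).
Proof.
  unfold ce, Cexp. destruct w as [x y]; simpl.
  f_equal; (f_equal; [f_equal; ring | f_equal; ring]).
Qed.

Lemma ce_nat (n : nat) : ce (RtoC (INR n)) = 1.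
Proof.
  rewrite ce_eq; simpl. rewrite Rmult_0_r, Ropp_0, exp_0.
  replace (2 * PI * INR n) with (0 + 2 * INR n * PI) by ring.
  rewrite cos_period, sin_period, cos_0, sin_0. apply injective_projections; simpl; ring.
Qed.

Lemma ce_Z (n : Z) : ce (RtoC (IZR n)) = 1.
Proof.
  destruct (Z_le_gt_dec 0 n) as [h | h].
  - rewrite <- (Z2Nat.id n h), <- INR_IZR_INZ. apply ce_nat.
  - pose proof (ce_add (RtoC (IZR n)) (RtoC (IZR (- n)))) as e.
    rewrite <- RtoC_plus, <- plus_IZR in e. replace (n + - n)%Z with 0%Z in e by ring.
    rewrite <- (Z2Nat.id (- n)) in e at 1 by lia. rewrite <- INR_IZR_INZ, ce_nat, Cmult_1_r in e.
    rewrite <- e. exact (ce_nat 0).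
Qed.

Lemma ce_add_Z w (n : Z) : ce (w + RtoC (IZR n)) = ce w.
Proof. rewrite ce_add, ce_Z; ring. Qed.

Lemma ce_half : ce (RtoC (/ 2)) = (- (1))%C.
Proof.
  rewrite ce_eq; simpl. rewrite Rmult_0_r, Ropp_0, exp_0.
  replace (2 * PI * / 2) with PI by field. rewrite cos_PI, sin_PI. apply injective_projections; simpl; ring.
Qed.

Lemma ce_neq_0 w : ce w <> 0.
Proof. apply Cexp_neq_0. Qed.

Definition nonint (w : C) : Prop := forall n : Z, w <> RtoC (IZR n).

Lemma ce_neq_1 w : nonint w -> (1 - ce w)%C <> 0.
Proof.
  intros h e.
  assert (e1 : ce w = 1) by (transitivity (1 - (1 - ce w))%C; [ring | rewrite e; ring]).
  pose proof (Cmod_ce w) as m. rewrite e1, Cmod_1 in m.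
  assert (im : Im w = 0).
  { rewrite <- exp_0 in m. apply exp_inv in m. pose proof PI_RGT_0. nra. }
  rewrite ce_eq, im, Rmult_0_r, Ropp_0, exp_0 in e1.
  pose proof (f_equal fst e1) as c1; simpl in c1.
  assert (s0 : sin (PI * Re w) = 0).
  { replace (2 * PI * Re w) with (2 * (PI * Re w)) in c1 by ring. rewrite cos_2a_sin in c1. nra. }
  apply sin_eq_0_0 in s0. destruct s0 as [k hk].
  apply (h k). destruct w as [x y]; simpl in *. unfold RtoC. f_equal; [| exact im].
  pose proof PI_RGT_0. apply (Rmult_eq_reg_l PI); lra.
Qed.

Lemma ce_double w : (1 - ce w)%C = ((1 - ce (w / 2)) * (1 - ce ((w + 1) / 2)))%C.
Proof.
  assert (e1 : ce w = (ce (w / 2) * ce (w / 2))%C) by (rewrite <- ce_add; f_equal; field).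
  replace ((w + 1) / 2)%C with (w / 2 + RtoC (/ 2))%C.
  2:{ rewrite RtoC_inv by lra. field. }
  rewrite ce_add, ce_half, e1. ring.
Qed.

Lemma nonint_div w (n : nat) (j : Z) : nonint w -> (0 < n)%nat ->
  nonint ((w + RtoC (IZR j)) / RtoC (INR n)).
Proof.
  intros h hn k e. apply (h (k * Z.of_nat n - j)%Z).
  assert (nz : RtoC (INR n) <> 0) by (intros q; apply RtoC_inj in q; apply (not_0_INR n); auto; lia).
  rewrite minus_IZR, mult_IZR, <- INR_IZR_INZ, RtoC_minus, RtoC_mult, <- e. field. exact nz.
Qed.

(** [1 - X^N] is the product of the [1 - X] twisted by the [N]-th roots of unity. For [N = 2^K]
    iterating [1 - x^2 = (1 - x) (1 + x)] suffices, and powers of two are enough for a limit. *)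
Lemma fold_ce (K : nat) : forall w, nonint w ->
  lnm (1 - ce w) = sumR (fun j => lnm (1 - ce ((w + RtoC (INR j)) / RtoC (INR (2 ^ K))))) (2 ^ K).
Proof.
  induction K as [| K IH]; intros w hw.
  - cbn [sumR Nat.pow]. change (INR 0) with 0. change (INR 1) with 1. rewrite Rplus_0_l.
    do 3 f_equal. field.
  - assert (n1 : nonint (w / 2)).
    { pose proof (nonint_div w 2 0 hw ltac:(lia)) as q. rewrite Cplus_0_r in q. exact q. }
    assert (n2 : nonint ((w + 1) / 2)) by exact (nonint_div w 2 1 hw ltac:(lia)).
    rewrite ce_double, lnm_mult by (apply ce_neq_1; assumption).
    rewrite (IH _ n1), (IH _ n2).
    change (2 ^ S K)%nat with (2 * 2 ^ K)%nat. rewrite sumR_even_odd.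
    assert (nz : RtoC (INR (2 ^ K)) <> 0).
    { intros q; apply RtoC_inj in q; apply (not_0_INR (2 ^ K)); auto. apply Nat.pow_nonzero; lia. }
    f_equal; apply sumR_ext; intros i _; do 3 f_equal; rewrite ?plus_INR, !mult_INR; simpl (INR 2); simpl (INR 1);
      rewrite ?RtoC_plus, !RtoC_mult, ?RtoC_plus; field; exact nz.
Qed.

(** The upper half of the indices, [N - 1 - i] with [N = 2^(K + 1)], is moved to [- (i + 1)] by
    periodicity. The arguments then stay near [[- 1 / 2, 1 / 2]], and each factor behaves for large
    [N] like a multiple of the corresponding linear factor of the sine product. *)
Lemma fold_ce_sym (K : nat) w : nonint w ->
  lnm (1 - ce w) =
  sumR (fun j => lnm (1 - ce ((w + RtoC (INR j)) / RtoC (INR (2 ^ S K)))) +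
                 lnm (1 - ce ((w - RtoC (INR j + 1)) / RtoC (INR (2 ^ S K))))) (2 ^ K).
Proof.
  intros hw. rewrite (fold_ce (S K) w hw).
  assert (nz : RtoC (INR (2 ^ S K)) <> 0).
  { intros q; apply RtoC_inj in q; apply (not_0_INR (2 ^ S K)); auto. apply Nat.pow_nonzero; lia. }
  match goal with |- sumR ?f _ = _ => replace (sumR f (2 ^ S K)) with (sumR f (2 ^ K + 2 ^ K)) by (f_equal; simpl; lia) end.
  rewrite sumR_reflect.
  assert (sp : forall f g n, sumR f n + sumR g n = sumR (fun i => f i + g i) n).
  { intros f g n; induction n as [| n IH]; simpl; [ring |]. rewrite <- IH; ring. }
  rewrite sp. apply sumR_ext. intros i hi. f_equal. f_equal. f_equal.
  rewrite <- (ce_add_Z ((w - RtoC (INR i + 1)) / RtoC (INR (2 ^ S K))) 1).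
  f_equal.
  replace (INR (2 ^ K + 2 ^ K - 1 - i)) with (INR (2 ^ S K) - 1 - INR i).
  - rewrite !RtoC_minus, RtoC_plus. field; exact nz.
  - rewrite !minus_INR by lia. simpl (INR 1). do 3 f_equal. simpl; lia.
Qed.

Lemma ce_linear_bound (h : C) (D : R) : Cmod h <= D ->
  Cmod (ce h - 1 - RtoC (2 * PI) * Ci * h) <= 2 * ((2 * PI) ^ 2 * exp (2 * PI * D)) * Cmod h ^ 2.
Proof.
  intros hh. unfold ce. eapply Rle_trans; [apply Cexp_quadratic_bound |].
  pose proof PI_RGT_0.
  assert (e : Cmod (RtoC (2 * PI) * Ci * h) = 2 * PI * Cmod h).
  { rewrite !Cmod_mult, Cmod_Ci, Cmod_R, Rabs_pos_eq by lra; ring. }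
  rewrite e. rewrite Rpow_mult_distr.
  assert (exp (2 * PI * Cmod h) <= exp (2 * PI * D)).
  { destruct hh as [hh | ->]; [left; apply exp_increasing; nra | right; reflexivity]. }
  assert (0 <= (2 * PI) ^ 2 * Cmod h ^ 2) by (apply Rmult_le_pos; apply pow2_ge_0).
  nra.
Qed.

(** The bound [11 / 20] exceeds [1 / 2] because the arguments met in [Lam_ce_bound] are [m / N], at
    most [1 / 2], plus a perturbation of at most [1 / 40]. With [PI <= 4] the angle stays below
    [22 / 10], where [t - t^3 / 6] is still large enough. *)
Lemma sin_lower (x : R) : Rabs x <= 11 / 20 -> Rabs x / 2 <= Rabs (sin (PI * x)).
Proof.
  intros hx.
  assert (gen : forall x, 0 <= x <= 11 / 20 -> x / 2 <= sin (PI * x)).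
  { clear x hx. intros x hx. pose proof PI_4. pose proof PI2_3_2. unfold PI2 in *.
    assert (0 <= PI * x <= 22 / 10) by nra.
    destruct (sin_bound (PI * x) 0) as [h _]; [lra | |].
    - nra.
    - replace (sin_approx (PI * x) (2 * 0 + 1)) with (PI * x - (PI * x) ^ 3 / 6) in h.
      + assert (3 * x <= PI * x) by nra.
        set (t := PI * x) in *.
        assert (t * t <= 484 / 100) by nra.
        assert (t ^ 3 <= t * (484 / 100)) by (replace (t ^ 3) with (t * (t * t)) by ring; nra).
        lra.
      + unfold sin_approx, sin_term; simpl. field. }
  destruct (Rle_dec 0 x) as [p | p].
  - rewrite Rabs_pos_eq in * by lra. eapply Rle_trans; [apply gen; lra | apply Rle_abs].
  - rewrite Rabs_left in * by lra. rewrite <- Rabs_Ropp, <- sin_neg.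
    replace (- (PI * x)) with (PI * - x) by ring. eapply Rle_trans; [apply gen; lra | apply Rle_abs].
Qed.

(** With [E = exp(- PI y)] one has [|1 - e(x + i y)|^2 = (1 - E^2)^2 + 4 E^2 sin(PI x)^2]; the first
    square is dropped. *)
Lemma one_minus_ce_lower (v : C) (B : R) : Rabs (Re v) <= 11 / 20 -> Rabs (Im v) <= B ->
  exp (- (PI * B)) * Rabs (Re v) <= Cmod (1 - ce v).
Proof.
  intros hx hy. pose proof PI_RGT_0.
  destruct v as [x y]; simpl Re in *; simpl Im in *.
  set (E := exp (- (PI * y))).
  assert (Ep : 0 < E) by apply exp_pos.
  assert (e2 : exp (- (2 * PI * y)) = E * E) by (unfold E; rewrite <- exp_plus; f_equal; ring).
  assert (low : exp (- (PI * B)) <= E).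
  { unfold E. pose proof (Rle_abs y). destruct (Rle_lt_or_eq_dec y B) as [q | q]; [lra | |].
    - left; apply exp_increasing; nra.
    - rewrite q; lra. }
  apply Rle_trans with (E * (2 * Rabs (sin (PI * x)))).
  - pose proof (sin_lower x hx). pose proof (Rabs_pos x).
    pose proof (exp_pos (- (PI * B))). apply Rmult_le_compat; lra.
  - assert (sq : (E * (2 * Rabs (sin (PI * x)))) ^ 2 <= Cmod (1 - ce (x, y)) ^ 2).
    { rewrite Cmod2_alt, ce_eq. simpl Re; simpl Im. rewrite e2.
      replace (2 * PI * x) with (2 * (PI * x)) by ring.
      replace ((E * (2 * Rabs (sin (PI * x)))) ^ 2) with (4 * (E * E) * Rabs (sin (PI * x)) ^ 2) by ring.
      rewrite pow2_abs, cos_2a_sin, sin_2a.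
      pose proof (sin2_cos2 (PI * x)) as sc; unfold Rsqr in sc.
      set (s := sin (PI * x)) in *; set (c := cos (PI * x)) in *.
      replace ((1 + - (E * E * (1 - 2 * s * s))) ^ 2 + (0 + - (E * E * (2 * s * c))) ^ 2)
        with ((1 - E * E) ^ 2 + 4 * (E * E) * s ^ 2 + 4 * (E * E) * (E * E) * s ^ 2 * (s * s + c * c - 1)) by ring.
      rewrite sc. pose proof (pow2_ge_0 (1 - E * E)). lra. }
    apply Rsqr_incr_0_var; [unfold Rsqr; nra | apply Cmod_ge_0].
Qed.

(** Domination of the folded factors, uniform in [N]. At [v = (w + m) / N] the modulus of [1 - e(v)]
    is at least of order [|m| / N], and a displacement [d / N] multiplies [1 - e(v)] by [1 + X] with
    [X] of order [1 / |m|]. The part of [X] linear in [d] is killed; the rest and [X^2] are of order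
    [1 / m^2]. *)
Lemma Lam_ce_bound (l : list (R * C)) (w : C) : kills_linear l ->
  exists (J : nat) (K : R), (0 < J)%nat /\ 0 <= K /\ forall m N : R, INR J <= Rabs m -> 2 * Rabs m <= N ->
    Rabs (Lam l (fun d => lnm (1 - ce ((w + RtoC m + d) / RtoC N)))) <= K / m ^ 2.
Proof.
  intros kl. pose proof PI_RGT_0 as hpi.
  set (B := Cmod w). set (D := lrad l).
  assert (B0 : 0 <= B) by apply Cmod_ge_0.
  assert (D1 : 1 <= D) by apply lrad_pos.
  set (c0 := exp (- (PI * B))). set (E1 := exp (2 * PI * B)).
  set (C3 := 2 * ((2 * PI) ^ 2 * exp (2 * PI * D))).
  set (C1 := 2 * PI + C3 * D).
  assert (c0p : 0 < c0) by apply exp_pos. assert (E1p : 0 < E1) by apply exp_pos.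
  assert (C3p : 0 < C3).
  { unfold C3. pose proof (exp_pos (2 * PI * D)). assert (0 < (2 * PI) ^ 2) by (apply pow_lt; lra).
    apply Rmult_lt_0_compat; [lra |]. apply Rmult_lt_0_compat; lra. }
  assert (C1p : 0 < C1) by (unfold C1; assert (0 < C3 * D) by (apply Rmult_lt_0_compat; lra); lra).
  set (C2 := 2 * E1 * C1 * D / c0). set (C4 := 2 * E1 * C3 * D ^ 2 / c0).
  assert (C2p : 0 < C2).
  { unfold C2; apply Rdiv_lt_0_compat; auto. repeat apply Rmult_lt_0_compat; lra. }
  assert (C4p : 0 < C4).
  { unfold C4; apply Rdiv_lt_0_compat; auto. apply Rmult_lt_0_compat; [apply Rmult_lt_0_compat; [lra | exact C3p] | apply pow_lt; lra]. }
  (* [20 B] makes [|w| / N] at most [1 / 40], and [2 C2] makes [|X|] at most [1 / 2]. *)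
  destruct (nfloor_ex (1 + 20 * B + 2 * C2)) as [J hJ]; [nra |].
  exists (S J), (labs l * (2 * C2 ^ 2 + C4)).
  split; [lia |].
  split. { apply Rmult_le_pos; [apply labs_pos |]. pose proof (pow2_ge_0 C2). lra. }
  intros m N hm hN. rewrite S_INR in hm.
  assert (hm1 : 1 + 20 * B + 2 * C2 < Rabs m) by lra.
  assert (Np : 2 < N) by nra.
  assert (mnz : m <> 0). { intros ->. rewrite Rabs_R0 in hm1. lra. }
  assert (Nz : RtoC N <> 0) by (intros q; apply RtoC_inj in q; lra).
  set (v := ((w + RtoC m) / RtoC N)%C).
  assert (rv : Re v = (Re w + m) / N /\ Im v = Im w / N).
  { unfold v. destruct w as [x y]. simpl. split; field; lra. }
  destruct rv as [rv iv].
  assert (wr : Rabs (Re w) <= B) by apply Rabs_fst_le.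
  assert (wi : Rabs (Im w) <= B) by apply Rabs_snd_le.
  assert (iN : 0 < / N) by (apply Rinv_0_lt_compat; lra).
  assert (iN1 : / N < 1) by (rewrite <- Rinv_1; apply Rinv_lt_contravar; lra).
  assert (NN : N * / N = 1) by (apply Rinv_r; lra).
  assert (hmN : Rabs m * / N <= 1 / 2) by nra.
  assert (hBN : B * / N <= 1 / 40) by nra.
  assert (xr : Rabs (Re v) <= 11 / 20).
  { rewrite rv. unfold Rdiv. rewrite Rabs_mult, (Rabs_pos_eq (/ N)) by lra.
    pose proof (Rabs_triang (Re w) m). nra. }
  assert (xl : Rabs m / (2 * N) <= Rabs (Re v)).
  { rewrite rv. unfold Rdiv. rewrite Rabs_mult, (Rabs_pos_eq (/ N)), Rinv_mult by lra.
    pose proof (Rabs_triang (Re w + m) (- Re w)) as t. rewrite Rabs_Ropp in t.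
    replace (Re w + m + - Re w) with m in t by ring. nra. }
  assert (ir : Rabs (Im v) <= B).
  { rewrite iv. unfold Rdiv. rewrite Rabs_mult, (Rabs_pos_eq (/ N)) by lra.
    pose proof (Rabs_pos (Im w)). nra. }
  assert (low : c0 * (Rabs m / (2 * N)) <= Cmod (1 - ce v)).
  { eapply Rle_trans; [| apply (one_minus_ce_lower v B xr ir)].
    apply Rmult_le_compat_l; [apply Rlt_le, c0p | exact xl]. }
  assert (lp : 0 < c0 * (Rabs m / (2 * N))).
  { apply Rmult_lt_0_compat; auto. apply Rdiv_lt_0_compat; lra. }
  assert (dz : (1 - ce v)%C <> 0) by (apply Cmod_gt_0; lra).
  assert (up : Cmod (ce v) <= E1).
  { rewrite Cmod_ce. unfold E1. pose proof (Rle_abs (- Im v)) as t. rewrite Rabs_Ropp in t.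
    assert (t' : - (2 * PI * Im v) <= 2 * PI * B) by nra.
    destruct t' as [t' | ->]; [left; apply exp_increasing, t' | right; reflexivity]. }
  assert (invlow : / Cmod (1 - ce v) <= 2 * N / (c0 * Rabs m)).
  { replace (2 * N / (c0 * Rabs m)) with (/ (c0 * (Rabs m / (2 * N)))) by (field; repeat split; lra).
    apply Rinv_le_contravar; assumption. }
  assert (ilp : 0 < / Cmod (1 - ce v)) by (apply Rinv_0_lt_compat; lra).
  assert (msq : m ^ 2 = Rabs m * Rabs m) by (rewrite <- pow2_abs; ring).
  (* The derivative of [log (1 - e(v + d / N))] in [d] at [0]. *)
  set (b := (- (RtoC (2 * PI) * Ci) * ce v / ((1 - ce v) * RtoC N))%C).
  replace (labs l * (2 * C2 ^ 2 + C4) / m ^ 2) with (labs l * ((2 * C2 ^ 2 + C4) / m ^ 2)) by (field; exact mnz).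
  apply (Lam_linear_error l _ (lnm (1 - ce v)) b); [exact kl |].
  intros p hp. set (d := snd p). assert (hd : Cmod d <= D) by (apply lrad_le; exact hp).
  set (h := (d / RtoC N)%C).
  assert (hh : Cmod h <= D * / N).
  { unfold h. rewrite Cmod_div, Cmod_R, Rabs_pos_eq by (auto; lra).
    apply Rmult_le_compat_r; lra. }
  assert (h0 : 0 <= Cmod h) by apply Cmod_ge_0.
  assert (hD : Cmod h <= D) by nra.
  pose proof (ce_linear_bound h D hD) as q. fold C3 in q.
  set (Y := (ce h - 1 - RtoC (2 * PI) * Ci * h)%C) in *.
  set (X := (- (ce v / (1 - ce v)) * (ce h - 1))%C).
  assert (fac : (1 - ce ((w + RtoC m + d) / RtoC N))%C = ((1 - ce v) * (1 + X))%C).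
  { replace ((w + RtoC m + d) / RtoC N)%C with (v + h)%C by (unfold v, h; field; exact Nz).
    rewrite ce_add. unfold X. field. exact dz. }
  assert (c1 : Cmod (ce h - 1) <= C1 * Cmod h).
  { replace (ce h - 1)%C with (Y + RtoC (2 * PI) * Ci * h)%C by (unfold Y; ring).
    eapply Rle_trans; [apply Cmod_triangle |].
    rewrite !Cmod_mult, Cmod_Ci, Cmod_R, Rabs_pos_eq by lra.
    assert (Cmod h ^ 2 <= D * Cmod h) by nra. unfold C1. nra. }
  assert (qv : Cmod (ce v / (1 - ce v)) <= E1 * (2 * N / (c0 * Rabs m))).
  { rewrite Cmod_div by exact dz. apply Rmult_le_compat; [apply Cmod_ge_0 | lra | exact up | exact invlow]. }
  assert (hX : Cmod X <= C2 / Rabs m).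
  { unfold X. rewrite Cmod_mult, Cmod_opp.
    apply Rle_trans with ((E1 * (2 * N / (c0 * Rabs m))) * (C1 * (D * / N))).
    - apply Rmult_le_compat; try apply Cmod_ge_0; [exact qv |].
      eapply Rle_trans; [exact c1 |]. apply Rmult_le_compat_l; lra.
    - right. unfold C2. field. repeat split; lra. }
  assert (hX2 : Cmod X <= 1 / 2).
  { eapply Rle_trans; [exact hX |]. apply Rmult_le_reg_r with (Rabs m); [lra |].
    unfold Rdiv. rewrite Rmult_assoc, Rinv_l by lra. lra. }
  assert (xz : (1 + X)%C <> 0).
  { pose proof (Cmod_1p_ge X 1 hX2 ltac:(lra)) as k. rewrite Cmult_1_l in k. apply Cmod_gt_0; lra. }
  rewrite fac, lnm_mult by assumption.
  pose proof (ln_mod_1p_linear X hX2) as e1.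
  assert (e2 : Cmod (X - b * d) <= C4 / m ^ 2).
  { replace (X - b * d)%C with (- (ce v / (1 - ce v)) * Y)%C.
    2:{ unfold X, b, Y, h. field. split; assumption. }
    rewrite Cmod_mult, Cmod_opp.
    apply Rle_trans with ((E1 * (2 * N / (c0 * Rabs m))) * (C3 * (D * / N) ^ 2)).
    - apply Rmult_le_compat; try apply Cmod_ge_0; [exact qv |].
      eapply Rle_trans; [exact q |]. apply Rmult_le_compat_l; [lra |]. apply pow_incr; lra.
    - replace (E1 * (2 * N / (c0 * Rabs m)) * (C3 * (D * / N) ^ 2)) with (C4 / Rabs m * / N).
      2:{ unfold C4. field. repeat split; lra. }
      rewrite msq. unfold Rdiv. rewrite Rinv_mult, <- Rmult_assoc.
      apply Rmult_le_compat_l; [apply Rlt_le, Rdiv_lt_0_compat; lra |].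
      apply Rinv_le_contravar; lra. }
  assert (e3 : Rabs (Re X - Re (b * d)) <= C4 / m ^ 2).
  { eapply Rle_trans; [| exact e2]. replace (Re X - Re (b * d)) with (fst (X - b * d)%C) by (simpl; ring).
    apply Rabs_fst_le. }
  assert (e4 : 2 * Cmod X ^ 2 <= 2 * C2 ^ 2 / m ^ 2).
  { unfold Rdiv. rewrite Rmult_assoc. apply Rmult_le_compat_l; [lra |].
    replace (C2 ^ 2 * / m ^ 2) with ((C2 / Rabs m) ^ 2).
    - apply pow_incr. split; [apply Cmod_ge_0 | exact hX].
    - rewrite msq. field. lra. }
  replace (lnm (1 - ce v) + lnm (1 + X) - (lnm (1 - ce v) + Re (b * d)))
    with ((lnm (1 + X) - Re X) + (Re X - Re (b * d))) by ring.
  eapply Rle_trans; [apply Rabs_triang |].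
  replace ((2 * C2 ^ 2 + C4) / m ^ 2) with (2 * C2 ^ 2 / m ^ 2 + C4 / m ^ 2) by (field; exact mnz).
  lra.
Qed.

Lemma lnm_ce_lim (v : C) : v <> 0 ->
  is_lim_seq (fun K => lnm (1 - ce (v / RtoC (INR (2 ^ S K)))) - lnm v + ln (INR (2 ^ S K))) (ln (2 * PI)).
Proof.
  intros hv. pose proof PI_RGT_0.
  assert (vp : 0 < Cmod v) by (apply Cmod_gt_0; exact hv).
  set (N := fun K => INR (2 ^ S K)).
  assert (Np : forall K, 1 <= N K).
  { intros K; unfold N. change 1 with (INR 1). apply le_INR. pose proof (Nat.pow_nonzero 2 (S K)); lia. }
  assert (Nl : is_lim_seq (fun K => / N K) 0).
  { apply (is_lim_seq_ext (fun K => (1 / 2) ^ S K)).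
    - intros K; unfold N. rewrite pow_INR. simpl (INR 2). unfold Rdiv. rewrite Rmult_1_l, pow_inv. reflexivity.
    - apply (is_lim_seq_incr_1 (fun K => (1 / 2) ^ K)). apply is_lim_seq_geom. rewrite Rabs_pos_eq; lra. }
  assert (Nz : forall K, RtoC (N K) <> 0) by (intros K q; apply RtoC_inj in q; specialize (Np K); lra).
  set (C0 := 2 * ((2 * PI) ^ 2 * exp (2 * PI * Cmod v)) * Cmod v).
  assert (lim : is_lim_seq (fun K => Cmod (1 - ce (v / RtoC (N K))) * (N K / Cmod v)) (2 * PI)).
  { apply (is_lim_seq_le_le (fun K => 2 * PI - C0 * / N K) _ (fun K => 2 * PI + C0 * / N K)).
    - intros K. specialize (Np K). 
      assert (iN : 0 < / N K) by (apply Rinv_0_lt_compat; lra).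
      assert (iN1 : / N K <= 1) by (rewrite <- Rinv_1; apply Rinv_le_contravar; lra).
      assert (e : Cmod (v / RtoC (N K)) = Cmod v * / N K).
      { rewrite Cmod_div, Cmod_R, Rabs_pos_eq by (auto; lra). reflexivity. }
      pose proof (ce_linear_bound (v / RtoC (N K)) (Cmod v)) as q.
      rewrite e in q. specialize (q ltac:(nra)).
      set (h := (v / RtoC (N K))%C) in *.
      set (Y := (ce h - 1 - RtoC (2 * PI) * Ci * h)%C) in *.
      assert (t : Cmod (RtoC (2 * PI) * Ci * h) = 2 * PI * (Cmod v * / N K)).
      { rewrite !Cmod_mult, Cmod_Ci, Cmod_R, e, Rabs_pos_eq by lra. ring. }
      pose proof (Cmod_triangle (- Y) (- (RtoC (2 * PI) * Ci * h))) as t1.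
      replace (- Y + - (RtoC (2 * PI) * Ci * h))%C with (1 - ce h)%C in t1 by (unfold Y; ring).
      pose proof (Cmod_triangle (1 - ce h) Y) as t2.
      replace (1 - ce h + Y)%C with (- (RtoC (2 * PI) * Ci * h))%C in t2 by (unfold Y; ring).
      rewrite !Cmod_opp, t in t1. rewrite Cmod_opp, t in t2.
      assert (s1 : 2 * PI * (Cmod v * / N K) * (N K / Cmod v) = 2 * PI) by (field; lra).
      assert (s2 : Cmod Y * (N K / Cmod v) <= C0 * / N K).
      { apply Rle_trans with (2 * ((2 * PI) ^ 2 * exp (2 * PI * Cmod v)) * (Cmod v * / N K) ^ 2 * (N K / Cmod v)).
        - apply Rmult_le_compat_r; [apply Rlt_le, Rdiv_lt_0_compat; lra | exact q].
        - right. unfold C0. field. lra. }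
      assert (s3 : 0 < N K / Cmod v) by (apply Rdiv_lt_0_compat; lra).
      split; nra.
    - replace (Finite (2 * PI)) with (Finite (2 * PI - C0 * 0)) by (f_equal; ring).
      apply is_lim_seq_minus'; [apply is_lim_seq_const |]. apply (is_lim_seq_scal_l _ C0 0); exact Nl.
    - replace (Finite (2 * PI)) with (Finite (2 * PI + C0 * 0)) by (f_equal; ring).
      apply is_lim_seq_plus'; [apply is_lim_seq_const |]. apply (is_lim_seq_scal_l _ C0 0); exact Nl. }
  assert (ln_lim : is_lim_seq (fun K => ln (Cmod (1 - ce (v / RtoC (N K))) * (N K / Cmod v))) (ln (2 * PI))).
  { apply (is_lim_seq_continuous ln); [| exact lim].
    apply continuity_pt_filterlim, (ex_derive_continuous ln). eexists; apply is_derive_ln. lra. }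
  assert (ev : eventually (fun K => 0 < Cmod (1 - ce (v / RtoC (N K))) * (N K / Cmod v))).
  { apply is_lim_seq_spec in lim. destruct (lim (mkposreal PI H)) as [M hM]. exists M; intros n hn.
    specialize (hM n hn). simpl in hM. apply Rabs_def2 in hM. lra. }
  eapply is_lim_seq_ext_loc; [| exact ln_lim].
  revert ev. apply filter_imp. intros K hK. fold (N K). specialize (Np K).
  assert (s3 : 0 < N K / Cmod v) by (apply Rdiv_lt_0_compat; lra).
  assert (0 < Cmod (1 - ce (v / RtoC (N K)))).
  { destruct (Cmod_ge_0 (1 - ce (v / RtoC (N K)))) as [g | g]; [exact g |]. rewrite <- g in hK. lra. }
  rewrite ln_mult by assumption. unfold lnm. rewrite ln_div by lra. ring.
Qed.

(** Each logarithm differs from [lnm (w + d)] by about [ln (2 PI) - ln N]; these constants, though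
    divergent, are independent of [d] and killed. *)
Lemma Lam_ce_lim (l : list (R * C)) (w : C) : kills_linear l ->
  (forall p, In p l -> (w + snd p)%C <> 0) ->
  is_lim_seq (fun K => Lam l (fun d => lnm (1 - ce ((w + d) / RtoC (INR (2 ^ S K))))))
    (Lam l (fun d => lnm (w + d))).
Proof.
  intros kl h.
  apply (is_lim_seq_ext (fun K => Lam l (fun d => lnm (1 - ce ((w + d) / RtoC (INR (2 ^ S K)))) - lnm (w + d)
            + ln (INR (2 ^ S K))) + Lam l (fun d => lnm (w + d)))).
  - intros K. rewrite <- Lam_plus.
    rewrite (Lam_ext l _ (fun d => lnm (1 - ce ((w + d) / RtoC (INR (2 ^ S K)))) + ln (INR (2 ^ S K)))) by (intros; ring).
    rewrite Lam_plus, (kills_const l _ kl). ring.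
  - replace (Finite (Lam l (fun d => lnm (w + d))))
      with (Finite (Lam l (fun _ => ln (2 * PI)) + Lam l (fun d => lnm (w + d))))
      by (rewrite (kills_const l _ kl); f_equal; ring).
    apply is_lim_seq_plus'; [| apply is_lim_seq_const].
    apply (Lam_lim l (fun K d => lnm (1 - ce ((w + d) / RtoC (INR (2 ^ S K)))) - lnm (w + d)
            + ln (INR (2 ^ S K))) (fun _ => ln (2 * PI))).
    intros p hp. apply lnm_ce_lim, h, hp.
Qed.

Lemma nonint_add (w : C) (n : Z) : nonint w -> nonint (w + RtoC (IZR n)).
Proof.
  intros h k e. apply (h (k - n)%Z). rewrite minus_IZR, RtoC_minus, <- e. ring.
Qed.

Lemma nonint_neq_0 (w : C) : nonint w -> w <> 0.
Proof. intros h; exact (h 0%Z). Qed.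

Lemma INR_pow2_gt (j K : nat) : (j < 2 ^ K)%nat -> 2 * (INR j + 1) <= INR (2 ^ S K).
Proof.
  intros h. change (2 ^ S K)%nat with (2 * 2 ^ K)%nat. rewrite mult_INR. simpl (INR 2).
  apply le_INR in h. rewrite S_INR in h. lra.
Qed.

(** Sine product in a form where only second differences occur. *)
Lemma row_sum (l : list (R * C)) (w : C) : kills_linear l ->
  (forall p, In p l -> nonint (w + snd p)) ->
  Series (fun j => Lam l (fun d => lnm (w + RtoC (INR j) + d)) + Lam l (fun d => lnm (w - RtoC (INR j + 1) + d)))
  = Lam l (fun d => lnm (1 - ce (w + d))).
Proof.
  intros kl hn.
  set (A := fun K m => Lam l (fun d => lnm (1 - ce ((w + RtoC m + d) / RtoC (INR (2 ^ S K)))))).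
  (* Set to [0] beyond the [2^K] factors, so that the finite products become full series, all with
     the same sum, and dominated convergence in [K] applies. *)
  set (f := fun K j => if le_lt_dec (2 ^ K) j then 0 else A K (INR j) + A K (- (INR j + 1))).
  assert (hf : forall K, Series (f K) = Lam l (fun d => lnm (1 - ce (w + d)))).
  { intros K. rewrite (Series_finite _ (2 ^ K)).
    2:{ intros i hi; unfold f; destruct le_lt_dec; [reflexivity | lia]. }
    assert (sw : forall (g : nat -> C -> R) n, sumR (fun j => Lam l (g j)) n = Lam l (fun d => sumR (fun j => g j d) n)).
    { intros g n; induction n as [| n IH]; simpl.
      - symmetry; apply (kills_const l 0 kl).
      - rewrite IH, <- Lam_plus. reflexivity. }
    rewrite (sumR_ext _ (fun j => Lam l (fun d => lnm (1 - ce ((w + d + RtoC (INR j)) / RtoC (INR (2 ^ S K)))) +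
       lnm (1 - ce ((w + d - RtoC (INR j + 1)) / RtoC (INR (2 ^ S K))))))).
    - rewrite sw. apply Lam_ext. intros p hp. symmetry. apply fold_ce_sym, hn, hp.
    - intros i hi. unfold f. destruct le_lt_dec; [lia |]. unfold A. rewrite <- Lam_plus.
      apply Lam_ext. intros p hp. f_equal; do 4 f_equal; rewrite ?RtoC_opp; ring. }
  destruct (Lam_ce_bound l w kl) as (J & K0 & J1 & K0p & hb).
  assert (lim : is_lim_seq (fun K => Series (f K))
     (Series (fun j => Lam l (fun d => lnm (w + RtoC (INR j) + d)) + Lam l (fun d => lnm (w - RtoC (INR j + 1) + d))))).
  { apply (tannery_tail f _ (fun j => 5 * K0 * power_weight 2 j) J).
    - apply (ex_series_scal (5 * K0) (power_weight 2)). apply power_weight_summable; lra.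
    - intros K j hj. rewrite <- inv_square_weight. apply le_INR in hj.
      apply lt_INR in J1 as J1'. simpl in J1'.
      assert (1 <= INR J) by (change 1 with (INR 1); apply le_INR; lia).
      assert (0 < / (INR j + 1) ^ 2) by (apply Rinv_0_lt_compat, pow_lt; lra).
      unfold f. destruct le_lt_dec as [q | q].
      + rewrite Rabs_R0. apply Rmult_le_pos; lra.
      + eapply Rle_trans; [apply Rabs_triang |].
        pose proof (INR_pow2_gt j K q).
        pose proof (hb (INR j) (INR (2 ^ S K))) as b1.
        pose proof (hb (- (INR j + 1)) (INR (2 ^ S K))) as b2.
        rewrite Rabs_Ropp in b2. rewrite Rabs_pos_eq in b1, b2 by lra.
        specialize (b1 ltac:(lra) ltac:(lra)). specialize (b2 ltac:(lra) ltac:(lra)).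
        fold (A K (INR j)) in b1. fold (A K (- (INR j + 1))) in b2.
        replace ((- (INR j + 1)) ^ 2) with ((INR j + 1) ^ 2) in b2 by ring.
        assert (b3 : K0 / INR j ^ 2 <= 4 * K0 * / (INR j + 1) ^ 2).
        { unfold Rdiv. replace (4 * K0 * / (INR j + 1) ^ 2) with (K0 * / ((INR j + 1) ^ 2 / 4)) by (field; lra).
          apply Rmult_le_compat_l; [exact K0p |].
          apply Rinv_le_contravar; [| nra]. apply Rdiv_lt_0_compat; [apply pow_lt; lra | lra]. }
        unfold Rdiv in *. lra.
    - intros j.
      apply (is_lim_seq_ext_loc (fun K => A K (INR j) + A K (- (INR j + 1)))).
      + exists (S j). intros K hK. unfold f. destruct le_lt_dec as [q | q]; [exfalso | reflexivity].
        pose proof (Nat.pow_gt_lin_r 2 K). lia.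
      + apply is_lim_seq_plus'.
        * apply (Lam_ce_lim l (w + RtoC (INR j))); [exact kl |]. intros p hp.
          replace (w + RtoC (INR j) + snd p)%C with (w + snd p + RtoC (IZR (Z.of_nat j)))%C
            by (rewrite <- INR_IZR_INZ; ring).
          apply nonint_neq_0, nonint_add, hn, hp.
        * replace (w - RtoC (INR j + 1))%C with (w + RtoC (- (INR j + 1)))%C by (rewrite RtoC_opp; ring).
          apply (Lam_ce_lim l (w + RtoC (- (INR j + 1)))); [exact kl |]. intros p hp.
          replace (w + RtoC (- (INR j + 1)) + snd p)%C with (w + snd p + RtoC (IZR (- (Z.of_nat (S j)))))%C.
          -- apply nonint_neq_0, nonint_add, hn, hp.
          -- rewrite opp_IZR, <- INR_IZR_INZ, S_INR. ring. }
  apply (is_lim_seq_ext _ (fun _ => Lam l (fun d => lnm (1 - ce (w + d))))) in lim; [| exact hf].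
  apply is_lim_seq_unique in lim. rewrite Lim_seq_const in lim. injection lim; auto.
Qed.

(** * Logarithms of infinite products as lattice sums *)

Lemma lattice_lower (t : C) : Im t <> 0 ->
  exists k, 0 < k /\ forall p q : R, k * (Rabs p + Rabs q) <= Cmod (RtoC p * t + RtoC q).
Proof.
  intros ht. assert (a0 : 0 < Rabs (Im t)) by (apply Rabs_pos_lt; exact ht).
  set (a := Rabs (Im t)) in *. pose proof (Cmod_ge_0 t).
  set (M := 1 + (1 + Cmod t) / a).
  assert (q0 : 0 <= (1 + Cmod t) / a) by (apply Rlt_le, Rdiv_lt_0_compat; lra).
  exists (/ M). split; [apply Rinv_0_lt_compat; unfold M; lra |].
  intros p q. set (W := Cmod (RtoC p * t + RtoC q)).
  assert (h1 : Rabs p * a <= W).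
  { unfold a. rewrite <- Rabs_mult.
    replace (p * Im t) with (snd (RtoC p * t + RtoC q)%C) by (destruct t; simpl; ring). apply Rabs_snd_le. }
  assert (h2 : Rabs q <= W + Rabs p * Cmod t).
  { rewrite <- (Cmod_R q), <- (Cmod_R p), <- Cmod_mult.
    rewrite <- (Cmod_opp (RtoC p * t)).
    replace (RtoC q) with ((RtoC p * t + RtoC q) + - (RtoC p * t))%C at 1 by ring. apply Cmod_triangle. }
  apply Rmult_le_reg_l with M; [unfold M; lra |].
  rewrite <- Rmult_assoc, Rinv_r, Rmult_1_l by (unfold M; lra).
  assert (h3 : Rabs p <= W / a).
  { apply Rmult_le_reg_r with a; [exact a0 |]. unfold Rdiv. rewrite Rmult_assoc, Rinv_l by lra. lra. }
  unfold M. replace ((1 + (1 + Cmod t) / a) * W) with (W + (1 + Cmod t) * (W / a)) by (field; lra).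
  nra.
Qed.

(** Stated for real [p], [q] with [i <= |p|] and [j <= |q|], so that one bound covers every quadrant
    of the lattice. *)
Lemma Lam_lattice_bound (l : list (R * C)) (t z : C) : kills_quadratic l -> Im t <> 0 ->
  exists (K : nat) (M : R), forall (i j : nat) (p q : R), INR i <= Rabs p -> INR j <= Rabs q -> (K <= i + j)%nat ->
    Rabs (Lam l (fun d => lnm (z + RtoC p * t + RtoC q + d)))
    <= M * (power_weight (3 / 2) i * power_weight (3 / 2) j).
Proof.
  intros kl ht. destruct (lattice_lower t ht) as (k & kp & hk).
  set (D := lrad l). assert (D1 : 1 <= D) by apply lrad_pos.
  pose proof (Cmod_ge_0 z).
  destruct (nfloor_ex ((2 * Cmod z + k + 4 * D) / k)) as [K hK].
  { apply Rlt_le, Rdiv_lt_0_compat; lra. }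
  exists (S K), (labs l * (2 * (2 * D / k) ^ 3)).
  intros i j p q hp hq hij.
  set (s := INR i + INR j + 1).
  assert (s0 : (2 * Cmod z + k + 4 * D) / k <= s - 1).
  { apply le_INR in hij. rewrite plus_INR, S_INR in hij. unfold s. lra. }
  assert (s1 : 2 * Cmod z + k + 4 * D <= k * (s - 1)).
  { apply Rmult_le_compat_l with (r := k) in s0; [| lra].
    replace (k * ((2 * Cmod z + k + 4 * D) / k)) with (2 * Cmod z + k + 4 * D) in s0 by (field; lra). exact s0. }
  set (w := (z + RtoC p * t + RtoC q)%C).
  assert (hw : k * (s - 1) - Cmod z <= Cmod w).
  { pose proof (Cmod_triangle w (- z)) as tr. rewrite Cmod_opp in tr.
    replace (w + - z)%C with (RtoC p * t + RtoC q)%C in tr by (unfold w; ring).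
    specialize (hk p q). assert (k * (s - 1) <= k * (Rabs p + Rabs q)); [| lra].
    apply Rmult_le_compat_l; unfold s; lra. }
  assert (hw2 : k / 2 * s <= Cmod w) by lra.
  pose proof (pos_INR i); pose proof (pos_INR j).
  assert (sp : 1 <= s) by (unfold s; lra).
  assert (wp : 0 < Cmod w) by nra.
  eapply Rle_trans; [apply Lam_lnm_cubic; [exact kl |]; fold w; fold D; nra |].
  fold w; fold D. rewrite (Rmult_assoc (labs l)). apply Rmult_le_compat_l; [apply labs_pos |].
  rewrite Rmult_assoc. apply Rmult_le_compat_l; [lra |].
  apply Rle_trans with ((2 * D / k) ^ 3 * / s ^ 3).
  - rewrite <- pow_inv, <- Rpow_mult_distr. apply pow_incr. split.
    + apply Rlt_le, Rdiv_lt_0_compat; lra.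
    + apply Rmult_le_reg_r with (Cmod w); [exact wp |].
      unfold Rdiv at 1. rewrite Rmult_assoc, Rinv_l, Rmult_1_r by lra.
      apply Rle_trans with (2 * D / k * / s * (k / 2 * s)).
      * right. field. lra.
      * apply Rmult_le_compat_l; [| exact hw2].
        apply Rlt_le, Rmult_lt_0_compat; [apply Rdiv_lt_0_compat; lra | apply Rinv_0_lt_compat; lra].
  - apply Rmult_le_compat_l; [apply pow_le, Rlt_le, Rdiv_lt_0_compat; lra |]. apply inv_cube_weight.
Qed.

(** [log |prod_(i >= 0) (1 - e(w + i t))|] *)
Definition logphi (t w : C) : R := Series (fun i => lnm (1 - ce (w + RtoC (INR i) * t))).

Lemma logphi_ex (t w : C) : 0 < Im t -> ex_series (fun i => lnm (1 - ce (w + RtoC (INR i) * t))).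
Proof.
  intros ht. pose proof PI_RGT_0.
  set (r := exp (- (2 * PI * Im t))).
  assert (r1 : 0 < r < 1).
  { split; [apply exp_pos |]. unfold r. rewrite <- exp_0. apply exp_increasing.
    assert (0 < 2 * PI * Im t) by (apply Rmult_lt_0_compat; lra). lra. }
  assert (e : forall i, Cmod (ce (w + RtoC (INR i) * t)) = Cmod (ce w) * r ^ i).
  { intros i. rewrite !Cmod_ce. unfold r.
    induction i as [| i IH].
    - simpl. rewrite Rmult_1_r. f_equal. destruct w, t; simpl; ring.
    - rewrite S_INR. simpl pow. rewrite (Rmult_comm (exp (- (2 * PI * Im t)))), <- Rmult_assoc, <- IH, <- exp_plus.
      f_equal. destruct w, t; simpl; ring. }
  assert (lim : is_lim_seq (fun i => Cmod (ce w) * r ^ i) 0).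
  { replace (Finite 0) with (Rbar_mult (Cmod (ce w)) 0) by (simpl; f_equal; ring).
    apply is_lim_seq_scal_l, is_lim_seq_geom. rewrite Rabs_pos_eq; lra. }
  apply is_lim_seq_spec in lim. destruct (lim (mkposreal (1 / 2) ltac:(lra))) as [N hN]; simpl in hN.
  apply (ex_series_incr_n _ N).
  apply (ex_series_dominated _ (fun i => 2 * Cmod (ce w) * r ^ N * r ^ i)).
  - intros i. specialize (hN (N + i)%nat ltac:(lia)). rewrite Rminus_0_r, <- e in hN.
    rewrite Rabs_pos_eq in hN by apply Cmod_ge_0.
    replace (1 - ce (w + RtoC (INR (N + i)) * t))%C with (1 + - ce (w + RtoC (INR (N + i)) * t))%C by ring.
    eapply Rle_trans; [apply ln_mod_1p_abs; rewrite Cmod_opp; lra |].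
    rewrite Cmod_opp, e, pow_add. right; ring.
  - apply (ex_series_scal (2 * Cmod (ce w) * r ^ N) (fun i => r ^ i)). apply ex_series_geom.
    rewrite Rabs_pos_eq; lra.
Qed.

Definition off_lattice (t w : C) : Prop :=
  forall p q : Z, (w + RtoC (IZR p) * t + RtoC (IZR q))%C <> 0.

Lemma Im_opp_inv (t : C) : 0 < Im t -> 0 < Im (- / t).
Proof.
  intros h. destruct t as [x y]; simpl in *.
  assert (0 < x * (x * 1) + y * (y * 1)) by nra.
  replace (- (- y / (x * (x * 1) + y * (y * 1)))) with (y / (x * (x * 1) + y * (y * 1))) by (field; lra).
  apply Rdiv_lt_0_compat; lra.
Qed.

(** Splitting the half planes [n >= 0] and [m < 0] into quadrants: the sums
    over the common quadrant cancel. *)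
Lemma quarter_sum (l : list (R * C)) (t z : C) :
  kills_quadratic l -> 0 < Im t ->
  (forall p, In p l -> off_lattice t (z + snd p)) ->
  Series (fun i => Series (fun j =>
     Lam l (fun d => lnm (z + RtoC (INR i) * t + RtoC (INR j) + d)
                     - lnm (z - RtoC (INR i + 1) * t - RtoC (INR j + 1) + d)))) =
  Lam l (fun d => logphi t (z + d) - logphi (- / t) ((z + d - 1) / t)).
Proof.
  intros kq ht hoff.
  assert (tz : t <> 0) by (intros e; rewrite e in ht; simpl in ht; lra).
  destruct (Lam_lattice_bound l t z kq ltac:(lra)) as (K & M & hb).
  set (u := power_weight (3 / 2)).
  assert (hu : summable_pos u) by (apply power_weight_summable; lra).
  assert (up : forall n, 0 < u n) by apply hu.
  set (A := fun p q : R => Lam l (fun d => lnm (z + RtoC p * t + RtoC q + d))).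
  assert (dom : forall P Q : nat -> R, (forall n, INR n <= Rabs (P n)) -> (forall n, INR n <= Rabs (Q n)) ->
     exists v : nat -> R, summable_pos v /\ forall i j, Rabs (A (P i) (Q j)) <= v i * u j).
  { intros P Q hP hQ.
    destruct (dominate_all (fun i j => Rabs (A (P i) (Q j))) M K u u up up) as (C' & cp & hC).
    - intros i j hij. apply hb; auto.
    - exists (fun n => C' * u n). split.
      + split; [intros n; apply Rmult_lt_0_compat; auto |]. apply (ex_series_scal C' u), hu.
      + intros i j. rewrite Rmult_assoc. apply hC. }
  (* [P] and [Q] enumerate the nonnegative and the negative integers, so a row or a column over all
     integers is the sum of its two halves. The common quadrant is [P] for multiples of [t], [Q] for
     multiples of [1]. *)
  pose (P := fun n : nat => INR n). pose (Q := fun n : nat => - (INR n + 1)).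
  assert (hP : forall n, INR n <= Rabs (P n)) by (intros n; apply Rle_abs).
  assert (hQ : forall n, INR n <= Rabs (Q n)).
  { intros n; unfold Q. pose proof (pos_INR n). rewrite Rabs_Ropp, Rabs_pos_eq; lra. }
  destruct (dom P P hP hP) as (v1 & hv1 & b1).
  destruct (dom P Q hP hQ) as (v2 & hv2 & b2).
  destruct (dom Q Q hQ hQ) as (v3 & hv3 & b3).
  destruct (double_row_ex _ v1 u hv1 hu b1) as (r1 & _ & s1).
  destruct (double_row_ex _ v2 u hv2 hu b2) as (r2 & _ & s2).
  destruct (double_row_ex _ v3 u hv3 hu b3) as (r3 & _ & s3).
  destruct (double_row_ex (fun j i => A (P i) (Q j)) u v2 hu hv2) as (c2 & _ & d2).
  { intros j i; rewrite Rmult_comm; apply b2. }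
  destruct (double_row_ex (fun j i => A (Q i) (Q j)) u v3 hu hv3) as (c3 & _ & d3).
  { intros j i; rewrite Rmult_comm; apply b3. }
  assert (rows : forall i, Series (fun j => A (P i) (P j)) + Series (fun j => A (P i) (Q j))
      = Lam l (fun d => lnm (1 - ce (z + d + RtoC (INR i) * t)))).
  { intros i. rewrite <- Series_plus by auto.
    rewrite <- (Lam_ext l (fun d => lnm (1 - ce (z + RtoC (INR i) * t + d)))) by (intros; do 3 f_equal; ring).
    rewrite <- (row_sum l (z + RtoC (INR i) * t) (proj1 kq)).
    - apply Series_ext. intros j. f_equal. unfold A, P, Q. apply Lam_ext; intros p hp.
      f_equal. rewrite RtoC_opp; ring.
    - intros p hp n e. apply (hoff p hp (Z.of_nat i) (- n)%Z).
      rewrite <- INR_IZR_INZ, opp_IZR, RtoC_opp.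
      transitivity (z + RtoC (INR i) * t + snd p - RtoC (IZR n))%C; [ring | rewrite e; ring]. }
  (* Columns run in the direction of [t]. Dividing by [t] turns them into rows of the lattice
     spanned by [1] and [1 / t], for the functional with the points [d / t]. *)
  assert (kt : kills_linear (map (fun p => (fst p, (snd p / t)%C)) l) /\
     forall f, Lam (map (fun p => (fst p, (snd p / t)%C)) l) f = Lam l (fun d => f (d / t)%C)).
  { assert (g : forall f, Lam (map (fun p => (fst p, (snd p / t)%C)) l) f = Lam l (fun d => f (d / t)%C)).
    { intros f. clear. induction l as [| q s IH]; simpl; [reflexivity |]. now rewrite IH. }
    split; [| exact g]. split.
    - rewrite g; apply kq.
    - intros a. rewrite g. rewrite (Lam_ext l _ (fun d => Re (a / t * d))).
      + apply kq.
      + intros p hp. f_equal. field. exact tz. }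
  destruct kt as [kt lt].
  assert (cols : forall j, Series (fun i => A (P i) (Q j)) + Series (fun i => A (Q i) (Q j))
      = Lam l (fun d => lnm (1 - ce ((z + d - 1) / t + RtoC (INR j) * (- / t))))).
  { intros j. rewrite <- Series_plus by auto.
    set (w := ((z - RtoC (INR j + 1)) / t)%C).
    assert (nw : forall p, In p l -> nonint (w + snd p / t)).
    { intros p hp n e. apply (hoff p hp (- n)%Z (- Z.of_nat (S j))%Z).
      rewrite !opp_IZR, !RtoC_opp, <- INR_IZR_INZ, S_INR.
      transitivity (((w + snd p / t) - RtoC (IZR n)) * t)%C; [unfold w; field; exact tz | rewrite e; ring]. }
    rewrite <- (Lam_ext l (fun d => lnm (1 - ce (w + d / t)))).
    2:{ intros p hp. do 3 f_equal. unfold w. rewrite RtoC_plus. field. exact tz. }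
    rewrite <- (lt (fun d => lnm (1 - ce (w + d)))).
    rewrite <- (row_sum _ w kt).
    - apply Series_ext. intros i. rewrite !lt. 
      (* The division changes each logarithm by the constant [lnm t], which is killed. *)
      assert (gen : forall m : R, (forall p, In p l -> (w + RtoC m + snd p / t)%C <> 0) ->
         A m (Q j) = Lam l (fun d => lnm (w + RtoC m + d / t))).
      { intros m hm. unfold A.
        rewrite (Lam_ext l _ (fun d => lnm t + lnm (w + RtoC m + d / t))).
        - rewrite Lam_plus, (kills_const l _ (proj1 kq)). ring.
        - intros p hp. rewrite <- lnm_mult by (try exact tz; apply hm, hp). f_equal.
          unfold w, Q. rewrite RtoC_opp. field. exact tz. }
      f_equal.
      + apply (gen (INR i)). intros p hp.
        replace (w + RtoC (INR i) + snd p / t)%C with (w + snd p / t + RtoC (IZR (Z.of_nat i)))%C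
          by (rewrite <- INR_IZR_INZ; ring).
        apply nonint_neq_0, nonint_add, nw, hp.
      + unfold Q at 1. rewrite gen.
        * apply Lam_ext; intros p hp. f_equal. rewrite RtoC_opp. ring.
        * intros p hp.
          replace (w + RtoC (- (INR i + 1)) + snd p / t)%C with (w + snd p / t + RtoC (IZR (- Z.of_nat (S i))))%C
            by (rewrite opp_IZR, <- INR_IZR_INZ, S_INR; ring).
          apply nonint_neq_0, nonint_add, nw, hp.
    - intros p hp. apply in_map_iff in hp. destruct hp as (p0 & <- & hp0). simpl. apply nw, hp0. }
  assert (LHS : Series (fun i => Series (fun j =>
     Lam l (fun d => lnm (z + RtoC (INR i) * t + RtoC (INR j) + d)
                     - lnm (z - RtoC (INR i + 1) * t - RtoC (INR j + 1) + d))))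
     = Series (fun i => Series (fun j => A (P i) (P j))) - Series (fun i => Series (fun j => A (Q i) (Q j)))).
  { rewrite <- Series_minus by auto. apply Series_ext; intros i.
    rewrite <- Series_minus by auto. apply Series_ext; intros j.
    unfold A, P, Q.
    rewrite (Lam_ext l _ (fun d => lnm (z + RtoC (INR i) * t + RtoC (INR j) + d) +
       (-1) * lnm (z - RtoC (INR i + 1) * t - RtoC (INR j + 1) + d))) by (intros; ring).
    rewrite Lam_plus, Lam_scal.
    rewrite (Lam_ext l (fun d => lnm (z + RtoC (- (INR i + 1)) * t + RtoC (- (INR j + 1)) + d))
        (fun d => lnm (z - RtoC (INR i + 1) * t - RtoC (INR j + 1) + d))).
    - ring.
    - intros p hp. f_equal. rewrite !RtoC_opp. ring. }
  etransitivity; [exact LHS |].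
  assert (f2 := double_Series_exchange _ v2 u hv2 hu b2).
  assert (f3 := double_Series_exchange _ v3 u hv3 hu b3).
  rewrite f3.
  pose proof (Im_opp_inv t ht) as ht'.
  destruct (Lam_Series l (fun i d => lnm (1 - ce (z + d + RtoC (INR i) * t)))) as [e1 e2].
  { intros p hp. apply (logphi_ex t (z + snd p)), ht. }
  destruct (Lam_Series l (fun j d => lnm (1 - ce ((z + d - 1) / t + RtoC (INR j) * (- / t))))) as [e3 e4].
  { intros p hp. apply (logphi_ex (- / t) ((z + snd p - 1) / t)), ht'. }
  rewrite (Lam_ext l (fun d => logphi t (z + d) - logphi (- / t) ((z + d - 1) / t))
     (fun d => logphi t (z + d) + (-1) * logphi (- / t) ((z + d - 1) / t))) by (intros; ring).
  rewrite Lam_plus, Lam_scal. unfold logphi. rewrite <- e2, <- e4.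
  rewrite <- (Series_ext _ _ rows), <- (Series_ext _ _ cols).
  rewrite Series_plus, (Series_plus _ _ d2 d3), f2 by auto. ring.
Qed.

(** * Functional equations of the infinite products *)

Lemma one_minus_ce_pos_im (w : C) : 0 < Im w -> (1 - ce w)%C <> 0.
Proof.
  intros h e. assert (e1 : ce w = 1) by (transitivity (1 - (1 - ce w))%C; [ring | rewrite e; ring]).
  pose proof (Cmod_ce w) as m. rewrite e1, Cmod_1, <- exp_0 in m. apply exp_inv in m.
  pose proof PI_RGT_0. assert (0 < 2 * PI * Im w) by (apply Rmult_lt_0_compat; lra). lra.
Qed.

Lemma ce_opp w : ce (- w) = (/ ce w)%C.
Proof.
  assert (e : (ce (- w) * ce w)%C = 1).
  { rewrite <- ce_add. replace (- w + w)%C with (RtoC (IZR 0)) by ring. apply ce_Z. }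
  transitivity (ce (- w) * ce w * / ce w)%C; [field; apply ce_neq_0 | rewrite e; ring].
Qed.

Lemma lnm_ce_reflect (w : C) : (1 - ce w)%C <> 0 -> lnm (1 - ce (- w)) = lnm (1 - ce w) + 2 * PI * Im w.
Proof.
  intros h. rewrite ce_opp.
  replace (1 - / ce w)%C with (- ((1 - ce w) * / ce w))%C by (field; apply ce_neq_0).
  rewrite lnm_opp, lnm_mult; [| exact h |].
  2:{ rewrite <- ce_opp. apply ce_neq_0. }
  f_equal. unfold lnm. rewrite Cmod_inv, ln_Rinv, Cmod_ce, ln_exp; [ring | | apply ce_neq_0].
  apply Cmod_gt_0, ce_neq_0.
Qed.

Lemma logphi_period (t w : C) (n : Z) : logphi t (w + RtoC (IZR n)) = logphi t w.
Proof.
  apply Series_ext. intros i. do 2 f_equal. 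
  replace (w + RtoC (IZR n) + RtoC (INR i) * t)%C with (w + RtoC (INR i) * t + RtoC (IZR n))%C by ring.
  now rewrite ce_add_Z.
Qed.

Lemma logphi_shift (t w : C) : 0 < Im t -> logphi t w = lnm (1 - ce w) + logphi t (w + t).
Proof.
  intros ht. unfold logphi. rewrite Series_incr_1 by (apply logphi_ex, ht).
  f_equal; [do 3 f_equal; simpl; ring |].
  apply Series_ext. intros i. rewrite S_INR, RtoC_plus. do 3 f_equal. ring.
Qed.

Lemma Series_even_odd (f : nat -> R) : ex_series f ->
  ex_series (fun n => f (2 * n)%nat) -> ex_series (fun n => f (2 * n + 1)%nat) ->
  Series f = Series (fun n => f (2 * n)%nat) + Series (fun n => f (2 * n + 1)%nat).
Proof.
  intros h h0 h1.
  assert (e : forall (g : nat -> R) k, sum_n g k = sumR g (S k)).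
  { intros g k; induction k as [| k IH]; [rewrite sum_O; simpl; ring |].
    rewrite sum_Sn, IH. reflexivity. }
  pose proof (Series_correct _ h) as H. pose proof (Series_correct _ h0) as H0. pose proof (Series_correct _ h1) as H1.
  pose proof (is_lim_seq_plus' _ _ _ _ H0 H1) as H2.
  assert (H3 : is_lim_seq (fun n => sum_n f (2 * n + 1)) (Series f)).
  { apply (is_lim_seq_subseq (sum_n f) (Series f) (fun n => (2 * n + 1)%nat)); [| exact H].
    apply eventually_subseq. intros n; lia. }
  apply (is_lim_seq_ext _ (fun n => sum_n f (2 * n + 1))) in H2.
  - apply is_lim_seq_unique in H2, H3. rewrite H3 in H2. injection H2; auto.
  - intros n. rewrite !e. replace (S (2 * n + 1))%nat with (2 * S n)%nat by lia. now rewrite sumR_even_odd.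
Qed.

(** [prod (1 + q^(n+1/2)) (1 - q^(n+1/2)) (1 + q^(n+1)) = 1] (Euler). *)
Lemma logphi_euler (t : C) : 0 < Im t ->
  logphi t (RtoC (/ 2) + t / 2) + logphi t (t / 2) + logphi t (RtoC (/ 2) + t) = 0.
Proof.
  intros ht.
  assert (ht2 : 0 < Im (2 * t)) by (destruct t; simpl in *; lra).
  assert (hh : forall w, ce (RtoC (/ 2) + w) = (- ce w)%C) by (intros w; rewrite ce_add, ce_half; ring).
  assert (im : forall i, 0 <= INR i * Im t) by (intros i; apply Rmult_le_pos; [apply pos_INR | lra]).
  (* [(1 + x) (1 - x) = 1 - x^2] turns pairs of factors into factors for the period [2 t]. Splitting
     the product over all [n >= 1] by parity, in [e3], expresses it through the same two products,
     and everything cancels. *)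
  assert (e1 : logphi t (RtoC (/ 2) + t / 2) + logphi t (t / 2) = logphi (2 * t) t).
  { unfold logphi. rewrite <- Series_plus by (apply logphi_ex, ht).
    apply Series_ext. intros i.
    replace (RtoC (/ 2) + t / 2 + RtoC (INR i) * t)%C with (RtoC (/ 2) + (t / 2 + RtoC (INR i) * t))%C by ring.
    rewrite hh. set (w := (t / 2 + RtoC (INR i) * t)%C).
    assert (iw : 0 < Im w).
    { specialize (im i). unfold w. destruct t; simpl in *; lra. }
    replace (t + RtoC (INR i) * (2 * t))%C with (w + w)%C by (unfold w; field).
    replace (1 - ce (w + w))%C with ((1 - - ce w) * (1 - ce w))%C by (rewrite ce_add; ring).
    rewrite lnm_mult; [reflexivity | | apply one_minus_ce_pos_im, iw].
    rewrite <- hh. apply one_minus_ce_pos_im. destruct w; simpl in *; lra. }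
  assert (e2 : logphi t (RtoC (/ 2) + t) = logphi (2 * t) (2 * t) - logphi t t).
  { unfold logphi. rewrite <- Series_minus by (apply logphi_ex; assumption).
    apply Series_ext. intros i.
    replace (RtoC (/ 2) + t + RtoC (INR i) * t)%C with (RtoC (/ 2) + (t + RtoC (INR i) * t))%C by ring.
    rewrite hh. set (w := (t + RtoC (INR i) * t)%C).
    assert (iw : 0 < Im w).
    { specialize (im i). unfold w. destruct t; simpl in *; lra. }
    replace (2 * t + RtoC (INR i) * (2 * t))%C with (w + w)%C by (unfold w; ring).
    replace (1 - ce (w + w))%C with ((1 - - ce w) * (1 - ce w))%C by (rewrite ce_add; ring).
    rewrite lnm_mult; [ring | | apply one_minus_ce_pos_im, iw].
    rewrite <- hh. apply one_minus_ce_pos_im. destruct w; simpl in *; lra. }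
  assert (e3 : logphi t t = logphi (2 * t) t + logphi (2 * t) (2 * t)).
  { assert (a0 : forall n, (t + RtoC (INR (2 * n)) * t)%C = (t + RtoC (INR n) * (2 * t))%C).
    { intros n. rewrite mult_INR, RtoC_mult. simpl (INR 2). rewrite RtoC_plus. ring. }
    assert (a1 : forall n, (t + RtoC (INR (2 * n + 1)) * t)%C = (2 * t + RtoC (INR n) * (2 * t))%C).
    { intros n. rewrite plus_INR, mult_INR, RtoC_plus, RtoC_mult. simpl (INR 2). simpl (INR 1). rewrite RtoC_plus. ring. }
    unfold logphi at 1. rewrite Series_even_odd.
    - f_equal; apply Series_ext; intros n; [rewrite a0 | rewrite a1]; reflexivity.
    - apply logphi_ex, ht.
    - eapply ex_series_ext; [| apply (logphi_ex (2 * t) t ht2)]. intros n; cbn beta. now rewrite a0.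
    - eapply ex_series_ext; [| apply (logphi_ex (2 * t) (2 * t) ht2)]. intros n; cbn beta. now rewrite a1. }
  lra.
Qed.

(** Logarithm of the modulus of the quotient of [q]-products which tends to
    the double sine function. *)
Definition Rq (t z : C) : R := logphi t z - logphi (- / t) ((z - 1) / t).

(** One of the two products is periodic under the shift, the other one loses a factor; for the shift
    by [t] their roles are exchanged. *)
Lemma Rq_shift_1 (t z : C) : 0 < Im t -> Rq t (z + 1) = Rq t z - lnm (1 - ce (z / t)).
Proof.
  intros ht. assert (tz : t <> 0) by (intros e; rewrite e in ht; simpl in ht; lra).
  unfold Rq. rewrite (logphi_period t z 1).
  replace ((z + 1 - 1) / t)%C with (z / t)%C by (f_equal; ring).
  rewrite (logphi_shift (- / t) (z / t)) by (apply Im_opp_inv, ht).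
  replace (z / t + - / t)%C with ((z - 1) / t)%C by (field; exact tz). ring.
Qed.

Lemma Rq_shift_t (t z : C) : 0 < Im t -> Rq t (z + t) = Rq t z - lnm (1 - ce z).
Proof.
  intros ht. assert (tz : t <> 0) by (intros e; rewrite e in ht; simpl in ht; lra).
  unfold Rq. rewrite (logphi_shift t z) by exact ht.
  replace ((z + t - 1) / t)%C with ((z - 1) / t + RtoC (IZR 1))%C by (field; exact tz).
  rewrite logphi_period. ring.
Qed.

(** The map [z -> (z - 1) / t] carries the three half-period points for [t] to those for [- 1 / t],
    up to a period, so Euler's identity applies to both products. It fixes the additive constant
    that the shift relations leave open. *)
Lemma Rq_euler (t : C) : 0 < Im t ->
  Rq t ((1 + t) / 2) + Rq t (t / 2) + Rq t (RtoC (/ 2) + t) = 0.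
Proof.
  intros ht. assert (tz : t <> 0) by (intros e; rewrite e in ht; simpl in ht; lra).
  assert (i2 : RtoC (/ 2) = (/ 2)%C) by (rewrite RtoC_inv by lra; reflexivity).
  pose proof (logphi_euler t ht) as h1.
  pose proof (logphi_euler (- / t) (Im_opp_inv t ht)) as h2.
  unfold Rq.
  replace ((1 + t) / 2)%C with (RtoC (/ 2) + t / 2)%C by (rewrite i2; field).
  replace ((RtoC (/ 2) + t / 2 - 1) / t)%C with (RtoC (/ 2) + - / t / 2)%C by (rewrite i2; field; exact tz).
  replace ((t / 2 - 1) / t)%C with (RtoC (/ 2) + - / t)%C by (rewrite i2; field; exact tz).
  replace ((RtoC (/ 2) + t - 1) / t)%C with (- / t / 2 + RtoC (IZR 1))%C by (rewrite i2; field; exact tz).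
  rewrite logphi_period. lra.
Qed.

Lemma off_lattice_coord (t : C) (x y : R) : Im t <> 0 ->
  (forall p q : Z, x <> IZR p \/ y <> IZR q) -> off_lattice t (RtoC x * t + RtoC y).
Proof.
  intros ht h p q e.
  assert (e1 : (RtoC (x + IZR p) * t + RtoC (y + IZR q))%C = 0).
  { rewrite <- e, !RtoC_plus. ring. }
  pose proof (f_equal snd e1) as s; pose proof (f_equal fst e1) as f. destruct t as [a b]; simpl in *.
  assert (s' : (x + IZR p) * b = 0) by lra.
  apply Rmult_integral in s'. destruct s' as [s' | s']; [| contradiction].
  rewrite s' in f. destruct (h (- p)%Z (- q)%Z) as [k | k]; apply k; rewrite opp_IZR; lra.
Qed.

(** * The absolutely convergent formula for [Rq] *)

Definition lnpt (t : C) (p q : R) : R := lnm (RtoC p * t + RtoC q).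

(** The two linear corrections make the sum over [i] and [j] absolutely
    convergent. *)
Definition qterm (t : C) (r s : R) (i j : nat) : R :=
  let a := INR i + / 2 in let b := INR j + / 2 in
  lnpt t (a + r) (b + s) - lnpt t (a - r) (b - s)
  - 2 * r * (lnpt t (a + / 2) b - lnpt t (a - / 2) b)
  - 2 * s * (lnpt t a (b + / 2) - lnpt t a (b - / 2)).

Definition pt (t : C) (c r s : R) : R * C := (c, (RtoC r * t + RtoC s)%C).

(** A functional which kills quadratic polynomials, hence makes the lattice sum
    for [Rq] absolutely convergent. Besides [r t + s] it only involves points
    whose contribution to [Rq] the shift relations and Euler's identity make
    explicit. *)
Definition pinning (t : C) (r s : R) : list (R * C) :=
  pt t 1 r s :: pt t (- / 2 + r ^ 2 + s ^ 2) 0 0 ::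
  pt t (- r - / 6) (/ 2) 0 :: pt t (r - / 6) (- / 2) 0 ::
  pt t (- s - / 6) 0 (/ 2) :: pt t (s - / 6) 0 (- / 2) ::
  pt t (- r ^ 2 / 2 + / 24) 1 0 :: pt t (- r ^ 2 / 2 + / 24) (- 1) 0 ::
  pt t (- s ^ 2 / 2 + / 24) 0 1 :: pt t (- s ^ 2 / 2 + / 24) 0 (- 1) ::
  pt t (- 2 * r * s) (/ 4) (/ 2) :: pt t (2 * r * s) (/ 4) (- / 2) ::
  pt t (2 * r * s) (- / 4) (/ 2) :: pt t (- 2 * r * s) (- / 4) (- / 2) :: nil.

Lemma pinning_kills (t : C) (r s : R) : kills_quadratic (pinning t r s).
Proof.
  repeat split.
  - simpl. field.
  - intros [a b]; destruct t as [x y]. simpl. field.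
  - intros [a b]; destruct t as [x y]. simpl. field.
Qed.

Lemma IZR_neq_frac (n m k : Z) : (1 < m)%Z -> (Z.modulo k m <> 0)%Z -> IZR k / IZR m <> IZR n.
Proof.
  intros hm hk e. apply hk.
  assert (e' : IZR k = IZR (n * m)).
  { rewrite mult_IZR, <- e. field. apply IZR_lt in hm. lra. }
  apply eq_IZR in e'. subst k. apply Z.mod_mul. lia.
Qed.

(** The mixed points are [(+-1/4, +-1/2)] because [(1/2, 1/2)] is excluded: added to the centre
    [(1 + t) / 2] it gives a lattice point, where the logarithm is singular. *)
Lemma pinning_off_lattice (t : C) (r s : R) : Im t <> 0 ->
  (forall p q : Z, / 2 + r <> IZR p \/ / 2 + s <> IZR q) ->
  forall p, In p (pinning t r s) -> off_lattice t ((1 + t) / 2 + snd p).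
Proof.
  intros ht h p hp.
  assert (gen : forall c r s, (forall p q : Z, / 2 + r <> IZR p \/ / 2 + s <> IZR q) ->
      off_lattice t ((1 + t) / 2 + snd (pt t c r s))).
  { clear - ht. intros c r s h. simpl.
    replace ((1 + t) / 2 + (RtoC r * t + RtoC s))%C with (RtoC (/ 2 + r) * t + RtoC (/ 2 + s))%C.
    - apply off_lattice_coord; assumption.
    - rewrite !RtoC_plus, !RtoC_inv by lra. field. }
  unfold pinning in hp. simpl In in hp.
  assert (half : forall n : Z, / 2 + 0 <> IZR n).
  { intros n e. apply (IZR_neq_frac n 2 1); [lia | discriminate | lra]. }
  assert (q1 : forall n : Z, / 2 + / 4 <> IZR n).
  { intros n e. apply (IZR_neq_frac n 4 3); [lia | discriminate | lra]. }
  assert (q2 : forall n : Z, / 2 + - / 4 <> IZR n).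
  { intros n e. apply (IZR_neq_frac n 4 1); [lia | discriminate | lra]. }
  repeat (destruct hp as [hp | hp]; [rewrite <- hp; apply gen; first [exact h | intros; left; apply half | intros; right; apply half | intros; left; apply q1 | intros; left; apply q2] |]).
  contradiction.
Qed.

Lemma lnm_one_minus_ce_half : lnm (1 - ce (RtoC (/ 2))) = ln 2.
Proof.
  rewrite ce_half. replace (1 - - (1))%C with (RtoC 2) by ring.
  unfold lnm. rewrite Cmod_R, Rabs_pos_eq by lra. reflexivity.
Qed.

(** The weights free of [r] and [s] add up, by the shift relations, to [- 1 / 3] times Euler's
    identity; the [1 / 24] among them balance the quadratic moment of the [- 1 / 6]. The other
    weights multiply differences that the shift relations evaluate: first differences give [ln 2],
    second differences [PI Im t] and [PI Im (/ t)], the mixed difference [0]. *)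
Lemma Lam_pinning_Rq (t : C) (r s : R) : 0 < Im t ->
  Lam (pinning t r s) (fun d => Rq t ((1 + t) / 2 + d)) =
  Rq t ((1 + t) / 2 + (RtoC r * t + RtoC s)) + (r + s) * ln 2
  - PI / 2 * (r ^ 2 * Im t + s ^ 2 * Im (/ t)) + PI / 24 * (Im t + Im (/ t)).
Proof.
  intros ht. assert (tz : t <> 0) by (intros e; rewrite e in ht; simpl in ht; lra).
  assert (ht0 : Im t <> 0) by lra.
  set (c := ((1 + t) / 2)%C).
  set (f := fun r s => Rq t (c + (RtoC r * t + RtoC s))).
  assert (s1 : forall r s, f r (s + 1) = f r s - lnm (1 - ce ((c + (RtoC r * t + RtoC s)) / t))).
  { intros. unfold f. rewrite <- Rq_shift_1 by exact ht. f_equal. rewrite RtoC_plus. ring. }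
  assert (st : forall r s, f (r + 1) s = f r s - lnm (1 - ce (c + (RtoC r * t + RtoC s)))).
  { intros. unfold f. rewrite <- Rq_shift_t by exact ht. f_equal. rewrite RtoC_plus. ring. }
  assert (i2 : RtoC (/ 2) = (/ 2)%C) by (rewrite RtoC_inv by lra; reflexivity).
  assert (i4 : RtoC (/ 4) = (/ (2 * 2))%C) by (rewrite <- RtoC_mult, <- RtoC_inv by lra; do 2 f_equal; lra).
  assert (hA : f (/ 2) 0 = f (- / 2) 0 - ln 2).
  { replace (f (/ 2) 0) with (f (- / 2 + 1) 0) by (f_equal; field). rewrite st, <- lnm_one_minus_ce_half.
    do 4 f_equal. unfold c. rewrite RtoC_opp, i2. field. }
  assert (hB : f 0 (/ 2) = f 0 (- / 2) - ln 2).
  { replace (f 0 (/ 2)) with (f 0 (- / 2 + 1)) by (f_equal; field). rewrite s1, <- lnm_one_minus_ce_half.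
    do 4 f_equal. unfold c. rewrite RtoC_opp, i2. field. exact tz. }
  assert (nc : nonint c).
  { intros n e. apply (f_equal Im) in e. unfold c in e. destruct t; simpl in *. lra. }
  assert (nct : nonint (c / t)).
  { intros n e. assert (e' : (c = RtoC (IZR n) * t)%C) by (rewrite <- e; field; exact tz).
    unfold c in e'. pose proof (f_equal snd e') as u1; pose proof (f_equal fst e') as u2.
    destruct t as [x y]; simpl in *. assert (y * (/ 2 - IZR n) = 0) by lra.
    apply Rmult_integral in H. destruct H; [contradiction |].
    apply (IZR_neq_frac n 2 1); [lia | discriminate | lra]. }
  (* The two shifts produce the factors at [c] and at [1 - c], related by reflection; what remains
     is [2 PI Im c]. *)
  assert (hC : f 1 0 + f (-1) 0 - 2 * f 0 0 = PI * Im t).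
  { pose proof (st 0 0) as u1. rewrite Rplus_0_l in u1.
    pose proof (st (-1) 0) as u2. replace (-1 + 1) with 0 in u2 by ring.
    replace (c + (RtoC 0 * t + RtoC 0))%C with c in u1 by ring.
    replace (c + (RtoC (-1) * t + RtoC 0))%C with (- c + RtoC (IZR 1))%C in u2 by (unfold c; field).
    rewrite ce_add_Z, lnm_ce_reflect in u2 by (apply ce_neq_1, nc).
    replace (Im c) with (Im t / 2) in u2 by (unfold c; destruct t; simpl; field). lra. }
  assert (hD : f 0 1 + f 0 (-1) - 2 * f 0 0 = PI * Im (/ t)).
  { pose proof (s1 0 0) as u1. rewrite Rplus_0_l in u1.
    pose proof (s1 0 (-1)) as u2. replace (-1 + 1) with 0 in u2 by ring.
    replace (c + (RtoC 0 * t + RtoC 0))%C with c in u1 by ring.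
    replace ((c + (RtoC 0 * t + RtoC (-1))) / t)%C with (- (c / t) + RtoC (IZR 1))%C in u2
      by (unfold c; field; exact tz).
    rewrite ce_add_Z, lnm_ce_reflect in u2 by (apply ce_neq_1, nct).
    replace (Im (c / t)) with (Im (/ t) / 2) in u2.
    - lra.
    - replace (c / t)%C with (RtoC (/ 2) + RtoC (/ 2) * / t)%C by (unfold c; rewrite i2; field; exact tz).
      destruct (/ t)%C as [x y]. simpl. field. }
  (* After division by [t] the two shifts produce [1 - e(1/4)] and [1 - e(- 1/4)], which have the
     same modulus. *)
  assert (hE : f (/ 4) (/ 2) - f (/ 4) (- / 2) - f (- / 4) (/ 2) + f (- / 4) (- / 2) = 0).
  { pose proof (s1 (/ 4) (- / 2)) as u1. pose proof (s1 (- / 4) (- / 2)) as u2.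
    replace (- / 2 + 1) with (/ 2) in u1, u2 by field. rewrite u1, u2.
    replace ((c + (RtoC (/ 4) * t + RtoC (- / 2))) / t)%C with (- RtoC (/ 4) + RtoC (IZR 1))%C
      by (unfold c; rewrite RtoC_opp, i2, i4; field; exact tz).
    replace ((c + (RtoC (- / 4) * t + RtoC (- / 2))) / t)%C with (RtoC (/ 4))
      by (unfold c; rewrite !RtoC_opp, i2, i4; field; exact tz).
    rewrite ce_add_Z, lnm_ce_reflect.
    - simpl. ring.
    - apply ce_neq_1. intros n e. apply RtoC_inj in e. apply (IZR_neq_frac n 4 1); [lia | discriminate | lra]. }
  assert (hF : f 0 0 + f 0 (- / 2) + f (/ 2) 0 = 0).
  { refine (eq_trans _ (Rq_euler t ht)). unfold f. unfold c.
    replace ((1 + t) / 2 + (RtoC 0 * t + RtoC 0))%C with ((1 + t) / 2)%C by ring.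
    replace ((1 + t) / 2 + (RtoC 0 * t + RtoC (- / 2)))%C with (t / 2)%C by (rewrite RtoC_opp, i2; field).
    replace ((1 + t) / 2 + (RtoC (/ 2) * t + RtoC 0))%C with (RtoC (/ 2) + t)%C by (rewrite i2; field).
    reflexivity. }
  change (Lam (pinning t r s) (fun d => Rq t (c + d))) with
   (1 * f r s + ((- / 2 + r ^ 2 + s ^ 2) * f 0 0 + ((- r - / 6) * f (/ 2) 0 + ((r - / 6) * f (- / 2) 0
   + ((- s - / 6) * f 0 (/ 2) + ((s - / 6) * f 0 (- / 2)
   + ((- r ^ 2 / 2 + / 24) * f 1 0 + ((- r ^ 2 / 2 + / 24) * f (- 1) 0
   + ((- s ^ 2 / 2 + / 24) * f 0 1 + ((- s ^ 2 / 2 + / 24) * f 0 (- 1)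
   + ((- 2 * r * s) * f (/ 4) (/ 2) + ((2 * r * s) * f (/ 4) (- / 2)
   + ((2 * r * s) * f (- / 4) (/ 2) + ((- 2 * r * s) * f (- / 4) (- / 2) + 0)))))))))))))).
  fold (f r s).
  replace (PI / 2 * (r ^ 2 * Im t + s ^ 2 * Im (/ t))) with (r ^ 2 / 2 * (PI * Im t) + s ^ 2 / 2 * (PI * Im (/ t))) by field.
  replace (PI / 24 * (Im t + Im (/ t))) with (/ 24 * (PI * Im t) + / 24 * (PI * Im (/ t))) by field.
  rewrite <- hC, <- hD.
  assert (hF' : f 0 0 = - f 0 (- / 2) - f (/ 2) 0) by lra.
  assert (hE' : f (/ 4) (/ 2) = f (/ 4) (- / 2) + f (- / 4) (/ 2) - f (- / 4) (- / 2)) by lra.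
  rewrite hE', hF', hB, hA. field.
Qed.

(** The opposite quadrant is the reflection of the first in the centre, so each lattice term [g] is
    odd in the displacement. Only the antisymmetric part of the weights of [pinning] survives: the
    points [(+-1, 0)], [(0, +-1)] and the mixed points drop out and [qterm] is left. *)
Lemma Rq_formula (t : C) (r s : R) : 0 < Im t ->
  (forall p q : Z, / 2 + r <> IZR p \/ / 2 + s <> IZR q) ->
  Rq t ((1 + t) / 2 + (RtoC r * t + RtoC s)) =
  Series (fun i => Series (fun j => qterm t r s i j)) - (r + s) * ln 2
  + PI / 2 * (r ^ 2 * Im t + s ^ 2 * Im (/ t)) - PI / 24 * (Im t + Im (/ t)).
Proof.
  intros ht h.
  pose proof (Lam_pinning_Rq t r s ht) as e1.
  rewrite <- (Lam_ext _ (fun d => logphi t ((1 + t) / 2 + d) - logphi (- / t) (((1 + t) / 2 + d - 1) / t))) in e1 by reflexivity.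
  rewrite <- (quarter_sum (pinning t r s) t ((1 + t) / 2) (pinning_kills t r s) ht) in e1.
  2:{ apply pinning_off_lattice; [lra | exact h]. }
  rewrite (Series_ext _ (fun i => Series (fun j => qterm t r s i j))) in e1; [lra |].
  intros i. apply Series_ext. intros j.
  set (a := INR i + / 2). set (b := INR j + / 2).
  set (g := fun x y => lnpt t (a + x) (b + y) - lnpt t (a - x) (b - y)).
  assert (i2 : RtoC (/ 2) = (/ 2)%C) by (rewrite RtoC_inv by lra; reflexivity).
  assert (hg : forall x y, lnm ((1 + t) / 2 + RtoC (INR i) * t + RtoC (INR j) + (RtoC x * t + RtoC y))
     - lnm ((1 + t) / 2 - RtoC (INR i + 1) * t - RtoC (INR j + 1) + (RtoC x * t + RtoC y)) = g x y).
  { intros x y. unfold g, lnpt, a, b. f_equal.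
    - f_equal. rewrite !RtoC_plus, i2. field.
    - rewrite <- lnm_opp. f_equal. rewrite !RtoC_minus, !RtoC_plus, i2. field. }
  assert (og : forall x y, g (- x) (- y) = - g x y).
  { intros x y. unfold g. replace (a - - x) with (a + x) by ring. replace (b - - y) with (b + y) by ring.
    replace (a + - x) with (a - x) by ring. replace (b + - y) with (b - y) by ring. ring. }
  unfold pinning. cbn [Lam fst snd pt]. rewrite !hg.
  pose proof (og 0 0) as o0. rewrite Ropp_0 in o0.
  pose proof (og (/ 2) 0) as o1. pose proof (og 0 (/ 2)) as o2.
  pose proof (og 1 0) as o3. pose proof (og 0 1) as o4. rewrite Ropp_0 in o1, o2, o3, o4.
  pose proof (og (/ 4) (/ 2)) as o5. pose proof (og (/ 4) (- / 2)) as o6. rewrite Ropp_involutive in o6.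
  replace (g 0 0) with 0 by lra.
  change (-1) with (- (1)) in *. rewrite o1, o2, o3, o4, o5, o6.
  unfold qterm. fold a b. unfold g. rewrite !Rplus_0_r, !Rminus_0_r. field.
Qed.

(** * Uniform domination and the limit at real points *)

(** [qterm] as a single functional around the shifted lattice point [(i + 1/2) t + (j + 1/2)], which
    makes the cubic bound available. *)
Definition qlist (t : C) (r s : R) : list (R * C) :=
  pt t 1 r s :: pt t (- 1) (- r) (- s) ::
  pt t (- (2 * r)) (/ 2) 0 :: pt t (2 * r) (- / 2) 0 ::
  pt t (- (2 * s)) 0 (/ 2) :: pt t (2 * s) 0 (- / 2) :: nil.

Lemma qterm_Lam (t : C) (r s : R) (i j : nat) :
  qterm t r s i j =
  Lam (qlist t r s) (fun d => lnm (RtoC (INR i + / 2) * t + RtoC (INR j + / 2) + d)).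
Proof.
  unfold qterm, lnpt, qlist. cbn [Lam fst snd pt].
  set (a := INR i + / 2). set (b := INR j + / 2).
  assert (h : forall x y, (RtoC a * t + RtoC b + (RtoC x * t + RtoC y))%C = (RtoC (a + x) * t + RtoC (b + y))%C).
  { intros; rewrite !RtoC_plus; ring. }
  rewrite !h, !Rplus_0_r. unfold Rminus. ring.
Qed.

Lemma qlist_kills (t : C) (r s : R) : kills_quadratic (qlist t r s).
Proof.
  repeat split.
  - simpl. field.
  - intros [a b]; destruct t as [x y]. simpl. field.
  - intros [a b]; destruct t as [x y]. simpl. field.
Qed.

(** In this quadrant the real parts of the lattice points are positive and add up without
    cancellation. The bound therefore needs only [Re t] bounded below, and it holds up to and
    including real [t], where the estimate over the whole lattice breaks down. *)
Lemma qterm_bound (r s k B : R) : 0 < k ->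
  exists (K : nat) (M : R), forall (t : C) (i j : nat), k <= Re t -> Cmod t <= B -> (K <= i + j)%nat ->
   Rabs (qterm t r s i j) <= M * (power_weight (3 / 2) i * power_weight (3 / 2) j).
Proof.
  intros kp.
  set (D := 1 + (2 * Rabs r + 2) * Rabs B + 2 * Rabs s + 4).
  assert (D1 : 1 <= D).
  { unfold D. pose proof (Rabs_pos r). pose proof (Rabs_pos s). pose proof (Rabs_pos B).
    assert (0 <= (2 * Rabs r + 2) * Rabs B) by (apply Rmult_le_pos; lra). lra. }
  set (k' := Rmin k 1 / 2).
  assert (k'p : 0 < k'). { unfold k', Rmin; destruct Rle_dec; lra. }
  assert (hk1 : k' <= k / 2 /\ k' <= 1 / 2). { unfold k', Rmin; destruct Rle_dec; lra. }
  set (A := 2 + 4 * Rabs r + 4 * Rabs s).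
  assert (A0 : 0 <= A). { unfold A. pose proof (Rabs_pos r). pose proof (Rabs_pos s). lra. }
  destruct (nfloor_ex (2 * D / k')) as [K hK]; [apply Rlt_le, Rdiv_lt_0_compat; lra |].
  exists (S K), (A * (2 * (D / k') ^ 3)).
  intros t i j hre hB hij. rewrite qterm_Lam.
  set (w := (RtoC (INR i + / 2) * t + RtoC (INR j + / 2))%C).
  pose proof (pos_INR i). pose proof (pos_INR j).
  assert (hw : k' * (INR i + INR j + 1) <= Cmod w).
  { apply Rle_trans with (Re w); [| eapply Rle_trans; [apply Rle_abs | apply Rabs_fst_le]].
    unfold w. destruct t as [x y]. simpl in hre |- *.
    assert ((INR i + / 2) * (2 * k') <= (INR i + / 2) * x) by (apply Rmult_le_compat_l; lra).
    assert ((INR j + / 2) * (2 * k') <= (INR j + / 2) * 1) by (apply Rmult_le_compat_l; lra).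
    assert (0 <= k' * (INR i + INR j + 1)) by (apply Rmult_le_pos; lra). lra. }
  assert (hs : 2 * D <= k' * (INR i + INR j + 1)).
  { apply le_INR in hij. rewrite plus_INR, S_INR in hij.
    apply Rle_trans with (k' * (2 * D / k')); [right; field; lra |]. apply Rmult_le_compat_l; lra. }
  assert (hl : lrad (qlist t r s) <= D).
  { unfold qlist, pt; cbn [lrad snd].
    assert (g : forall x y, Cmod (RtoC x * t + RtoC y) <= Rabs x * Rabs B + Rabs y).
    { intros x y. eapply Rle_trans; [apply Cmod_triangle |]. rewrite Cmod_mult, !Cmod_R.
      apply Rplus_le_compat_r, Rmult_le_compat_l; [apply Rabs_pos |].
      eapply Rle_trans; [exact hB | apply Rle_abs]. }
    pose proof (g r s). pose proof (g (- r) (- s)). pose proof (g (/ 2) 0). pose proof (g (- / 2) 0).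
    pose proof (g 0 (/ 2)). pose proof (g 0 (- / 2)).
    rewrite !Rabs_Ropp, ?Rabs_R0, ?(Rabs_pos_eq (/ 2)) in * by lra.
    unfold D. pose proof (Rabs_pos B). lra. }
  assert (ha : labs (qlist t r s) <= A).
  { unfold qlist, pt; cbn [labs fst]. rewrite !Rabs_Ropp, !Rabs_mult, (Rabs_pos_eq 1), (Rabs_pos_eq 2) by lra.
    unfold A. assert (Rabs (-1) = 1) by (rewrite Rabs_left; lra). lra. }
  assert (wp : 0 < Cmod w) by lra.
  pose proof (lrad_pos (qlist t r s)) as lp. pose proof (labs_pos (qlist t r s)) as lp'.
  eapply Rle_trans; [apply Lam_lnm_cubic; [apply qlist_kills | fold w; lra] |]. fold w.
  rewrite (Rmult_assoc A).
  apply Rmult_le_compat; [exact lp' | | exact ha |].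
  { apply Rmult_le_pos; [lra |]. apply pow_le. apply Rlt_le, Rdiv_lt_0_compat; lra. }
  rewrite Rmult_assoc. apply Rmult_le_compat_l; [lra |].
  apply Rle_trans with ((D / k') ^ 3 * / (INR i + INR j + 1) ^ 3).
  - rewrite <- pow_inv, <- Rpow_mult_distr. apply pow_incr. split.
    + apply Rlt_le, Rdiv_lt_0_compat; lra.
    + apply Rle_trans with (D / Cmod w).
      * apply Rmult_le_compat_r; [apply Rlt_le, Rinv_0_lt_compat; lra | exact hl].
      * unfold Rdiv. rewrite Rmult_assoc. apply Rmult_le_compat_l; [lra |].
        rewrite <- Rinv_mult. apply Rinv_le_contravar; [apply Rmult_lt_0_compat; lra | exact hw].
  - apply Rmult_le_compat_l; [apply pow_le, Rlt_le, Rdiv_lt_0_compat; lra |]. apply inv_cube_weight.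
Qed.

Lemma lnpt_lim (t : nat -> C) (w p q : R) :
  is_lim_seq (fun n => Re (t n)) w -> is_lim_seq (fun n => Im (t n)) 0 -> 0 < p * w + q ->
  is_lim_seq (fun n => lnpt (t n) p q) (lnpt (RtoC w) p q).
Proof.
  intros hr hi hp.
  set (x := fun n => p * Re (t n) + q). set (y := fun n => p * Im (t n)).
  assert (hx : is_lim_seq x (p * w + q)).
  { apply is_lim_seq_plus'; [apply (is_lim_seq_scal_l _ p w), hr | apply is_lim_seq_const]. }
  assert (hy : is_lim_seq y 0).
  { replace (Finite 0) with (Rbar_mult p 0) by (simpl; f_equal; ring). apply is_lim_seq_scal_l, hi. }
  assert (hxy : is_lim_seq (fun n => x n ^ 2 + y n ^ 2) ((p * w + q) ^ 2)).
  { replace ((p * w + q) ^ 2) with ((p * w + q) * (p * w + q) + 0 * 0) by ring.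
    apply (is_lim_seq_ext (fun n => x n * x n + y n * y n)); [intros; ring |].
    apply is_lim_seq_plus'; apply is_lim_seq_mult'; assumption. }
  assert (sq : 0 < (p * w + q) ^ 2) by (apply pow_lt; exact hp).
  assert (e0 : lnpt (RtoC w) p q = / 2 * ln ((p * w + q) ^ 2)).
  { unfold lnpt. replace (RtoC p * RtoC w + RtoC q)%C with (p * w + q, 0).
    - rewrite lnm_sqrt by lra. do 2 f_equal. ring.
    - apply injective_projections; simpl; ring. }
  rewrite e0.
  assert (ev : eventually (fun n => 0 < x n ^ 2 + y n ^ 2)).
  { apply is_lim_seq_spec in hxy. destruct (hxy (mkposreal _ sq)) as [N hN]. exists N. intros n hn.
    specialize (hN n hn). simpl in hN. apply Rabs_def2 in hN. simpl. lra. }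
  apply (is_lim_seq_ext_loc (fun n => / 2 * ln (x n ^ 2 + y n ^ 2))).
  - revert ev. apply filter_imp. intros n hn. rewrite <- lnm_sqrt by exact hn.
    unfold lnpt. f_equal. unfold x, y. destruct (t n); apply injective_projections; simpl; ring.
  - apply (is_lim_seq_scal_l _ (/ 2) (ln ((p * w + q) ^ 2))).
    apply (is_lim_seq_continuous ln); [| exact hxy].
    apply continuity_pt_filterlim, (ex_derive_continuous ln). eexists; apply is_derive_ln, sq.
Qed.

(** The logarithm of the double sine function [S(w, x w + y)] in the
    coordinates [r = x - 1/2], [s = y - 1/2]. *)
Definition log_double_sine (w r s : R) : R :=
  Series (fun i => Series (fun j => qterm (RtoC w) r s i j)) - (r + s) * ln 2.

Lemma Rq_lim (t : nat -> C) (w x y : R) :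
  0 < w -> (forall n, 0 < Im (t n)) ->
  is_lim_seq (fun n => Re (t n)) w -> is_lim_seq (fun n => Im (t n)) 0 ->
  0 < x <= 1 -> 0 <= y < 1 -> (forall p q : Z, x <> IZR p \/ y <> IZR q) ->
  is_lim_seq (fun n => Rq (t n) (RtoC x * t n + RtoC y)) (log_double_sine w (x - / 2) (y - / 2)).
Proof.
  intros wp ht hr hi hx hy hxy.
  set (r := x - / 2). set (s := y - / 2).
  assert (i2 : RtoC (/ 2) = (/ 2)%C) by (rewrite RtoC_inv by lra; reflexivity).
  assert (e : forall n, Rq (t n) (RtoC x * t n + RtoC y) =
     Series (fun i => Series (fun j => qterm (t n) r s i j)) + ((- (r + s) * ln 2
       + PI / 2 * (r ^ 2 * Im (t n) + s ^ 2 * Im (/ t n))) + - (PI / 24) * (Im (t n) + Im (/ t n)))).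
  { intros n. rewrite <- (Rplus_0_l (Series _)).
    replace (RtoC x * t n + RtoC y)%C with ((1 + t n) / 2 + (RtoC r * t n + RtoC s))%C.
    - rewrite Rq_formula; [ring | apply ht |].
      intros p q. destruct (hxy p q) as [k | k]; [left | right]; intros q'; apply k; rewrite <- q'; unfold r, s; ring.
    - unfold r, s. rewrite !RtoC_minus, i2. field. }
  apply (is_lim_seq_ext _ _ _ (fun n => eq_sym (e n))).
  assert (hinv : is_lim_seq (fun n => Im (/ t n)) 0).
  { apply (is_lim_seq_ext (fun n => - Im (t n) / (Re (t n) * Re (t n) + Im (t n) * Im (t n)))).
    - intros n. destruct (t n) as [u v]; simpl. rewrite !Rmult_1_r. reflexivity.
    - replace 0 with (- 0 / (w * w + 0 * 0)) by (field; nra).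
      apply is_lim_seq_div'; [| | nra].
      + apply (is_lim_seq_opp (fun n => Im (t n)) 0), hi.
      + apply is_lim_seq_plus'; apply is_lim_seq_mult'; assumption. }
  unfold log_double_sine.
  replace (Finite (Series (fun i => Series (fun j => qterm (RtoC w) r s i j)) - (r + s) * ln 2))
    with (Finite (Series (fun i => Series (fun j => qterm (RtoC w) r s i j)) + ((- (r + s) * ln 2
       + PI / 2 * (r ^ 2 * 0 + s ^ 2 * 0)) + - (PI / 24) * (0 + 0)))) by (f_equal; ring).
  apply is_lim_seq_plus'.
  2:{ repeat apply is_lim_seq_plus'.
      - apply is_lim_seq_const.
      - apply (is_lim_seq_scal_l _ (PI / 2) (r ^ 2 * 0 + s ^ 2 * 0)). apply is_lim_seq_plus'.
        + apply (is_lim_seq_scal_l _ (r ^ 2) 0), hi.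
        + apply (is_lim_seq_scal_l _ (s ^ 2) 0), hinv.
      - apply (is_lim_seq_scal_l _ (- (PI / 24)) (0 + 0)). apply is_lim_seq_plus'; assumption. }
  assert (ev : eventually (fun n => w / 2 <= Re (t n) /\ Cmod (t n) <= 2 * w + 1)).
  { apply is_lim_seq_spec in hr, hi.
    destruct (hr (mkposreal (w / 2) ltac:(lra))) as [N1 h1]. destruct (hi (mkposreal 1 ltac:(lra))) as [N2 h2].
    exists (N1 + N2)%nat. intros n hn. specialize (h1 n ltac:(lia)). specialize (h2 n ltac:(lia)). simpl in h1, h2.
    rewrite Rminus_0_r in h2. pose proof (Cmod_le_sum (t n)) as cs. change (fst (t n)) with (Re (t n)) in cs.
    change (snd (t n)) with (Im (t n)) in cs. apply Rabs_def2 in h1.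
    rewrite (Rabs_pos_eq (Re (t n))) in cs by lra. split; lra. }
  destruct ev as [N0 hN0].
  apply (is_lim_seq_incr_n _ N0).
  destruct (qterm_bound r s (w / 2) (2 * w + 1) ltac:(lra)) as (K & M & hb).
  assert (hu : summable_pos (power_weight (3 / 2))) by (apply power_weight_summable; lra).
  apply (double_tannery (fun n i j => qterm (t (n + N0)%nat) r s i j) (fun i j => qterm (RtoC w) r s i j) M K _ _ hu hu).
  - intros n i j hij. destruct (hN0 (n + N0)%nat ltac:(lia)). apply hb; assumption.
  - intros i j. apply (is_lim_seq_incr_n (fun n => qterm (t n) r s i j) N0).
    pose proof (pos_INR i). pose proof (pos_INR j).
    assert (0 <= INR i * w) by (apply Rmult_le_pos; lra).
    (* The half-open ranges matter here: [(i + x) w + (j + y)] is positive because [x > 0], and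
       [(i + 1 - x) w + (j + 1 - y)] because [y < 1]. *)
    assert (0 < x * w) by (apply Rmult_lt_0_compat; lra).
    assert (0 <= (1 - x) * w) by (apply Rmult_le_pos; lra).
    assert (g : forall p q, 0 < p * w + q ->
       is_lim_seq (fun n => lnpt (t n) p q) (lnpt (RtoC w) p q)) by (intros; apply lnpt_lim; assumption).
    assert (mn : forall (f g : nat -> R) (a b : R), is_lim_seq f a -> is_lim_seq g b ->
       is_lim_seq (fun n => f n - g n) (a - b)) by (intros; apply is_lim_seq_minus'; assumption).
    assert (sc : forall (c : R) (f : nat -> R) (a : R), is_lim_seq f a -> is_lim_seq (fun n => c * f n) (c * a))
      by (intros c f a h; apply (is_lim_seq_scal_l f c a h)).
    unfold qterm.
    apply (mn (fun n => _ - _) (fun n => _) _ _); [apply (mn (fun n => _ - _) (fun n => _) _ _);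
      [apply (mn (fun n => _) (fun n => _) _ _) | apply sc, (mn (fun n => _) (fun n => _) _ _)]
      | apply sc, (mn (fun n => _) (fun n => _) _ _)]; apply g; unfold r, s; lra.
Qed.

(** * Analytic functions of a complex variable *)

Lemma sumR_nonneg (a : nat -> R) (n : nat) : (forall k, 0 <= a k) -> 0 <= sumR a n.
Proof. intros h; induction n as [| n IH]; simpl; [lra |]. specialize (h n); lra. Qed.

Lemma sumR_le (a b : nat -> R) (n : nat) : (forall k, a k <= b k) -> sumR a n <= sumR b n.
Proof. intros h; induction n as [| n IH]; simpl; [lra |]. specialize (h n); lra. Qed.

Lemma sumR_sum_n (a : nat -> R) (n : nat) : sumR a (S n) = sum_n a n.
Proof.
  induction n as [| n IH]; [rewrite sum_O; simpl; ring |].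
  rewrite sum_Sn, <- IH. reflexivity.
Qed.

Lemma sumR_scal (c : R) (a : nat -> R) (n : nat) : sumR (fun k => c * a k) n = c * sumR a n.
Proof. induction n as [| n IH]; simpl; [ring |]. rewrite IH; ring. Qed.

Lemma sumR_plus (a b : nat -> R) (n : nat) : sumR (fun k => a k + b k) n = sumR a n + sumR b n.
Proof. induction n as [| n IH]; simpl; [ring |]. rewrite IH; ring. Qed.

Lemma sumR_le_is_series (a : nat -> R) (l : R) (n : nat) :
  (forall k, 0 <= a k) -> is_series a l -> sumR a n <= l.
Proof.
  intros h hl.
  apply (is_lim_seq_incr_compare (sumR a) l).
  - apply is_lim_seq_incr_1. apply (is_lim_seq_ext (sum_n a)); [intros; symmetry; apply sumR_sum_n | exact hl].
  - intros k. simpl. specialize (h k). lra.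
Qed.

Lemma bounded_ex_series (a : nat -> R) (M : R) :
  (forall k, 0 <= a k) -> (forall n, sumR a n <= M) -> ex_series a /\ Series a <= M.
Proof.
  intros h hM.
  assert (e : ex_finite_lim_seq (sumR a)).
  { apply (ex_finite_lim_seq_incr _ M); [| exact hM]. intros n; simpl. specialize (h n); lra. }
  destruct e as [l hl].
  assert (hs : is_series a l).
  { change (is_lim_seq (sum_n a) l). apply is_lim_seq_incr_1 in hl.
    apply (is_lim_seq_ext (fun n => sumR a (S n))); [intros; apply sumR_sum_n | exact hl]. }
  split; [exists l; exact hs |]. rewrite (is_series_unique _ _ hs).
  apply (is_lim_seq_le (sumR a) (fun _ => M) l M); [exact hM | exact hl | apply is_lim_seq_const].
Qed.

Lemma sumR_Series (a : nat -> nat -> R) (n : nat) : (forall k, ex_series (fun i => a i k)) ->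
  ex_series (fun i => sumR (a i) n) /\ sumR (fun k => Series (fun i => a i k)) n = Series (fun i => sumR (a i) n).
Proof.
  intros h. induction n as [| n [e IH]]; simpl.
  - split; [exists 0; apply (proj1 csum_const_0) | symmetry; apply is_series_unique, (proj1 csum_const_0)].
  - split; [apply (ex_series_plus _ _ e (h n)) |]. rewrite Series_plus, IH; auto.
Qed.

(** [f] has on the disc of radius [r] at [s0] the expansion with coefficients
    [c], of norm [sum_k |c_k| r^k] at most [M]. *)
Definition expands (f : C -> C) (s0 : C) (r M : R) (c : nat -> C) : Prop :=
  (forall n, sumR (fun k => Cmod (c k) * r ^ k) n <= M) /\
  (forall s, Cmod (s - s0) < r -> csum (fun k => (c k * (s - s0) ^ k)%C) (f s)).

Section Expands.
Variables (s0 : C) (r : R).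
Hypothesis rp : 0 < r.

Let rk (k : nat) : 0 <= r ^ k.
Proof. apply pow_le; lra. Qed.

Let cr (c : nat -> C) (k : nat) : 0 <= Cmod (c k) * r ^ k.
Proof. apply Rmult_le_pos; [apply Cmod_ge_0 | apply rk]. Qed.

Lemma expands_nonneg f M c : expands f s0 r M c -> 0 <= M.
Proof. intros [h _]; exact (h 0%nat). Qed.

Lemma expands_summable f M c : expands f s0 r M c ->
  ex_series (fun k => Cmod (c k) * r ^ k) /\ Series (fun k => Cmod (c k) * r ^ k) <= M.
Proof. intros [h _]; apply bounded_ex_series; auto. Qed.

Lemma expands_coef_le f M c k : expands f s0 r M c -> Cmod (c k) * r ^ k <= M.
Proof.
  intros [h _]. specialize (h (S k)). simpl in h.
  pose proof (sumR_nonneg (fun k => Cmod (c k) * r ^ k) k (cr c)). lra.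
Qed.

Lemma expands_ext f g M c : (forall s, Cmod (s - s0) < r -> f s = g s) ->
  expands f s0 r M c -> expands g s0 r M c.
Proof. intros e [h1 h2]; split; [exact h1 |]. intros s hs; rewrite <- e by exact hs; auto. Qed.

Lemma expands_le f M M' c : M <= M' -> expands f s0 r M c -> expands f s0 r M' c.
Proof. intros e [h1 h2]; split; [| exact h2]. intros n; eapply Rle_trans; eauto. Qed.

Lemma expands_plus f g M N c e : expands f s0 r M c -> expands g s0 r N e ->
  expands (fun s => f s + g s)%C s0 r (M + N) (fun k => c k + e k)%C.
Proof.
  intros [h1 h2] [k1 k2]; split.
  - intros n. eapply Rle_trans; [| apply Rplus_le_compat; [apply (h1 n) | apply (k1 n)]].
    rewrite <- sumR_plus. apply sumR_le. intros k. rewrite <- Rmult_plus_distr_r.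
    apply Rmult_le_compat_r; [apply rk | apply Cmod_triangle].
  - intros s hs. eapply csum_ext; [| apply (csum_plus _ _ _ _ (h2 s hs) (k2 s hs))].
    intros k; cbn beta; ring.
Qed.

Lemma expands_scal a f M c : expands f s0 r M c ->
  expands (fun s => a * f s)%C s0 r (Cmod a * M) (fun k => a * c k)%C.
Proof.
  intros [h1 h2]; split.
  - intros n. rewrite (sumR_ext _ (fun k => Cmod a * (Cmod (c k) * r ^ k))) by (intros; rewrite Cmod_mult; ring).
    rewrite sumR_scal. apply Rmult_le_compat_l; [apply Cmod_ge_0 | apply h1].
  - intros s hs. eapply csum_ext; [| apply (csum_scal a _ _ (h2 s hs))].
    intros k; cbn beta; ring.
Qed.

Lemma expands_exp (l : R) :
  expands (fun s => Cexp (- s * RtoC l)) s0 r (exp (- Re s0 * l + r * Rabs l))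
    (fun k => Cexp (- s0 * RtoC l) * (RtoC (- l) ^ k / RtoC (INR (fact k))))%C.
Proof.
  assert (nz : forall n, RtoC (INR (fact n)) <> 0).
  { intros n h; apply RtoC_inj in h; apply (INR_fact_neq_0 n h). }
  split.
  - intros n. rewrite exp_plus.
    assert (e : Cmod (Cexp (- s0 * RtoC l)) = exp (- Re s0 * l)).
    { rewrite Cmod_Cexp. f_equal. destruct s0; simpl; ring. }
    rewrite (sumR_ext _ (fun k => exp (- Re s0 * l) * ((r * Rabs l) ^ k / INR (fact k)))).
    + rewrite sumR_scal. apply Rmult_le_compat_l; [apply Rlt_le, exp_pos |].
      apply sumR_le_is_series; [| apply exp_series].
      intros k. apply Rdiv_le_0_compat; [| apply INR_fact_lt_0].
      apply pow_le, Rmult_le_pos; [lra | apply Rabs_pos].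
    + intros k _. rewrite Cmod_mult, e, Cmod_div, Cmod_pow, !Cmod_R by apply nz.
      rewrite Rabs_Ropp, (Rabs_pos_eq (INR _)) by apply pos_INR. rewrite Rpow_mult_distr. unfold Rdiv; ring.
  - intros s hs.
    replace (Cexp (- s * RtoC l)) with (Cexp (- s0 * RtoC l) * Cexp (RtoC (- l) * (s - s0)))%C.
    2:{ rewrite <- Cexp_add, RtoC_opp. f_equal. ring. }
    eapply csum_ext; [| apply csum_scal, Cexp_series].
    intros k; cbn beta. rewrite Cpow_mult_l. field. apply nz.
Qed.

Lemma expands_const (a : C) :
  expands (fun _ => a) s0 r (Cmod a) (fun k => match k with O => a | _ => 0 end).
Proof.
  split.
  - intros n. destruct n; [apply Cmod_ge_0 |].
    induction n as [| n IH]; [simpl; lra |]. cbn [sumR] in *. rewrite Cmod_0. lra.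
  - intros s hs. apply csum_decr_1. simpl.
    replace (a - a * 1)%C with (RtoC 0) by ring.
    eapply csum_ext; [| apply csum_const_0]. intros n; cbn beta; ring.
Qed.

Lemma expands_mul_lin (a : C) f M c : expands f s0 r M c ->
  expands (fun s => (s - a) * f s)%C s0 r ((r + Cmod (s0 - a)) * M)
    (fun k => match k with O => (s0 - a) * c 0%nat | S j => c j + (s0 - a) * c k end)%C.
Proof.
  intros [h1 h2]; split.
  - intros n.
    assert (g : forall n, sumR (fun k => Cmod (match k with O => (s0 - a) * c 0%nat | S j => c j + (s0 - a) * c k end)%C * r ^ k) n
       <= r * sumR (fun k => Cmod (c k) * r ^ k) (pred n) + Cmod (s0 - a) * sumR (fun k => Cmod (c k) * r ^ k) n).
    { clear n. intros n. induction n as [| n IH]; [simpl; lra |].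
      cbn [sumR]. destruct n as [| n].
      - simpl. rewrite Cmod_mult. lra.
      - cbn [pred sumR] in *.
        pose proof (Cmod_triangle (c n) ((s0 - a) * c (S n))) as t. rewrite Cmod_mult in t.
        apply (Rmult_le_compat_r (r ^ S n)) in t; [| apply rk].
        replace (r ^ S n) with (r * r ^ n) in * by reflexivity. lra. }
    eapply Rle_trans; [apply g |]. rewrite Rmult_plus_distr_r.
    apply Rplus_le_compat; apply Rmult_le_compat_l; auto; [lra | apply Cmod_ge_0].
  - intros s hs. specialize (h2 s hs).
    replace ((s - a) * f s)%C with ((s - s0) * f s + (s0 - a) * f s)%C by ring.
    apply (csum_ext (fun k => (match k with O => 0 | S j => (s - s0) * (c j * (s - s0) ^ j) end + (s0 - a) * (c k * (s - s0) ^ k))%C)).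
    + intros [| k]; simpl; ring.
    + apply csum_plus; [| apply csum_scal, h2].
      apply csum_decr_1. replace ((s - s0) * f s - 0)%C with ((s - s0) * f s)%C by ring.
      apply csum_scal, h2.
Qed.

Fixpoint div_coef (b : C) (c : nat -> C) (k : nat) : C :=
  match k with
  | O => c 0%nat / b
  | S j => (c (S j) - div_coef b c j) / b
  end.

(** Long division by [(s - s0) + b]. In the weighted norm of coefficients, [G = f / (s - a)]
    satisfies [|b| |G| <= |f| + r |G|], whence the constant. *)
Lemma expands_div_lin (a : C) f M c : r < Cmod (s0 - a) -> expands f s0 r M c ->
  expands (fun s => f s / (s - a))%C s0 r (M / (Cmod (s0 - a) - r)) (div_coef (s0 - a) c).
Proof.
  intros ha [h1 h2]. set (b := (s0 - a)%C) in *.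
  assert (bz : b <> 0) by (apply Cmod_gt_0; lra).
  assert (g : forall n, Cmod b * sumR (fun k => Cmod (div_coef b c k) * r ^ k) n <=
     sumR (fun k => Cmod (c k) * r ^ k) n + r * sumR (fun k => Cmod (div_coef b c k) * r ^ k) n).
  { intros n.
    apply Rle_trans with (sumR (fun k => Cmod (c k) * r ^ k) n + r * sumR (fun k => Cmod (div_coef b c k) * r ^ k) (pred n)).
    - induction n as [| n IH]; [simpl; lra |]. cbn [sumR]. destruct n as [| n].
      + simpl. rewrite Cmod_div by exact bz. right. field. lra.
      + cbn [pred sumR] in *.
        assert (t : Cmod b * Cmod (div_coef b c (S n)) <= Cmod (c (S n)) + Cmod (div_coef b c n)).
        { simpl. rewrite <- Cmod_mult. replace (b * ((c (S n) - div_coef b c n) / b))%C with (c (S n) + - div_coef b c n)%C by (field; exact bz).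
          rewrite <- (Cmod_opp (div_coef b c n)). apply Cmod_triangle. }
        apply (Rmult_le_compat_r (r ^ S n)) in t; [| apply rk].
        replace (r ^ S n) with (r * r ^ n) in * by reflexivity. lra.
    - apply Rplus_le_compat_l, Rmult_le_compat_l; [lra |].
      destruct n as [| n]; [simpl; lra |]. cbn [pred sumR]. pose proof (cr (div_coef b c) n). lra. }
  assert (B : forall n, sumR (fun k => Cmod (div_coef b c k) * r ^ k) n <= M / (Cmod b - r)).
  { intros n. apply Rmult_le_reg_l with (Cmod b - r); [lra |].
    replace ((Cmod b - r) * (M / (Cmod b - r))) with M by (field; lra).
    specialize (g n). specialize (h1 n). lra. }
  split; [exact B |]. intros s hs.
  destruct (bounded_ex_series _ _ (cr (div_coef b c)) B) as [e _].
  assert (nz : (s - a)%C <> 0).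
  { replace (s - a)%C with ((s - s0) + b)%C by (unfold b; ring). apply Cmod_gt_0.
    pose proof (Cmod_triangle (s - s0 + b) (- (s - s0))) as t. rewrite Cmod_opp in t.
    replace (s - s0 + b + - (s - s0))%C with b in t by ring. lra. }
  set (G := (Series (fun n => fst (div_coef b c n * (s - s0) ^ n)%C), Series (fun n => snd (div_coef b c n * (s - s0) ^ n)%C)) : C).
  assert (hG : csum (fun n => (div_coef b c n * (s - s0) ^ n)%C) G).
  { apply (csum_exists _ _ e). intros n. rewrite Cmod_mult, Cmod_pow.
    apply Rmult_le_compat_l; [apply Cmod_ge_0 |]. apply pow_incr. split; [apply Cmod_ge_0 | lra]. }
  replace (f s / (s - a))%C with G; [exact hG |].
  assert (hf : csum (fun k => (c k * (s - s0) ^ k)%C) ((s - s0) * G + b * G)%C).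
  { apply (csum_ext (fun k => (match k with O => 0 | S j => (s - s0) * (div_coef b c j * (s - s0) ^ j) end + b * (div_coef b c k * (s - s0) ^ k))%C)).
    + intros [| k]; simpl; field; exact bz.
    + apply csum_plus; [| apply csum_scal, hG].
      apply csum_decr_1. replace ((s - s0) * G - 0)%C with ((s - s0) * G)%C by ring.
      apply csum_scal, hG. }
  rewrite <- (csum_unique _ _ _ hf (h2 s hs)). unfold b. field. exact nz.
Qed.

(** Weierstrass's theorem in the weighted [l^1] norm of coefficients, where it is an exchange of
    summations and asks for no Cauchy formula. The factor [2] is that of [csum_norm_le]. *)
Lemma expands_series (f : nat -> C -> C) (F : C -> C) (M : nat -> R) (c : nat -> nat -> C) :
  (forall i, expands (f i) s0 r (M i) (c i)) -> ex_series M ->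
  (forall s, Cmod (s - s0) < r -> csum (fun i => f i s) (F s)) ->
  expands F s0 r (2 * Series M)
    (fun k => (Series (fun i => fst (c i k)), Series (fun i => snd (c i k)))).
Proof.
  intros hf eM hF.
  assert (M0 : forall i, 0 <= M i) by (intros i; apply (expands_nonneg _ _ _ (hf i))).
  assert (cM : forall i k, Cmod (c i k) * r ^ k <= M i) by (intros i k; apply (expands_coef_le _ _ _ k (hf i))).
  assert (ek : forall k, ex_series (fun i => Cmod (c i k) * r ^ k)).
  { intros k. apply (ex_series_dominated _ M); [| exact eM]. intros i. rewrite Rabs_pos_eq by apply cr. apply cM. }
  assert (rz : forall k, r ^ k <> 0) by (intros k; apply pow_nonzero; lra).
  assert (ek' : forall k, ex_series (fun i => Cmod (c i k))).
  { intros k. apply (ex_series_ext (fun i => Cmod (c i k) * r ^ k * / r ^ k)); [intros i; rewrite Rmult_assoc, Rinv_r, Rmult_1_r by apply rz; reflexivity |].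
    apply (ex_series_scal_r (/ r ^ k) (fun i => Cmod (c i k) * r ^ k)), ek. }
  set (Ck := fun k => (Series (fun i => fst (c i k)), Series (fun i => snd (c i k)))).
  assert (hC : forall k, csum (fun i => c i k) (Ck k)).
  { intros k. apply (csum_exists _ _ (ek' k)). intros; lra. }
  split.
  - intros n.
    apply Rle_trans with (sumR (fun k => 2 * Series (fun i => Cmod (c i k) * r ^ k)) n).
    + apply sumR_le. intros k. rewrite Series_scal_r, <- Rmult_assoc. apply Rmult_le_compat_r; [apply rk |].
      apply (csum_norm_le _ _ _ (ek' k)) with (2 := hC k). intros; lra.
    + rewrite sumR_scal. apply Rmult_le_compat_l; [lra |].
      destruct (sumR_Series (fun i k => Cmod (c i k) * r ^ k) n ek) as [e1 e2]. rewrite e2.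
      apply Series_le; [| exact eM]. intros i. split; [apply sumR_nonneg, cr |]. apply (hf i).
  - intros s hs. set (h := (s - s0)%C) in *.
    set (q := (Cmod h / r + 1) / 2).
    assert (q1 : Cmod h / r < q < 1 /\ 0 <= Cmod h / r).
    { assert (0 <= Cmod h / r) by (apply Rdiv_le_0_compat; [apply Cmod_ge_0 | exact rp]).
      assert (Cmod h / r < 1) by (apply Rmult_lt_reg_r with r; [exact rp |]; unfold Rdiv; rewrite Rmult_assoc, Rinv_l; lra).
      unfold q; lra. }
    (* The geometric term makes the weight strictly positive even where [M i] vanishes; [q] lies
       strictly between [|h| / r] and [1]. *)
    set (u := fun i => M i + (1 / 2) ^ i). set (v := fun k => q ^ k).
    assert (hu : summable_pos u).
    { split.
      - intros i. unfold u. pose proof (M0 i). assert (0 < (1 / 2) ^ i) by (apply pow_lt; lra). lra.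
      - apply (ex_series_plus M (fun i => (1 / 2) ^ i)); [exact eM |]. apply ex_series_geom. rewrite Rabs_pos_eq; lra. }
    assert (hv : summable_pos v).
    { split; [intros k; apply pow_lt; lra |]. apply ex_series_geom. rewrite Rabs_pos_eq; lra. }
    assert (b : forall i k, Cmod (c i k * h ^ k) <= u i * v k).
    { intros i k. rewrite Cmod_mult, Cmod_pow.
      replace (Cmod h ^ k) with (r ^ k * (Cmod h / r) ^ k) by (rewrite <- Rpow_mult_distr; f_equal; field; lra).
      rewrite <- Rmult_assoc. apply Rmult_le_compat; [apply cr | apply pow_le; lra | |].
      - unfold u. specialize (cM i k). assert (0 < (1 / 2) ^ i) by (apply pow_lt; lra). lra.
      - apply pow_incr. lra. }
    assert (part : forall pr : C -> R, (forall z, Rabs (pr z) <= Cmod z) ->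
       (forall i, Series (fun k => pr (c i k * h ^ k)%C) = pr (f i s)) ->
       (forall k, Series (fun i => pr (c i k * h ^ k)%C) = pr (Ck k * h ^ k)%C) ->
       is_series (fun i => pr (f i s)) (pr (F s)) -> is_series (fun k => pr (Ck k * h ^ k)%C) (pr (F s))).
    { intros pr hp e1 e2 e3.
      assert (b' : forall i k, Rabs (pr (c i k * h ^ k)%C) <= u i * v k) by (intros; eapply Rle_trans; eauto).
      destruct (double_row_ex (fun k i => pr (c i k * h ^ k)%C) v u hv hu) as (_ & _ & x).
      { intros k i; rewrite Rmult_comm; apply b'. }
      pose proof (double_Series_exchange _ u v hu hv b') as E.
      pose proof (Series_ext _ _ e1) as E1. cbn beta in E1, E. rewrite E in E1.
      rewrite (is_series_unique _ _ e3) in E1. rewrite <- E1.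
      rewrite (Series_ext _ _ e2). apply Series_correct.
      apply (ex_series_ext (fun k => Series (fun i => pr (c i k * h ^ k)%C))); [exact e2 | exact x]. }
    split; [apply (part fst Rabs_fst_le) | apply (part snd Rabs_snd_le)].
    + intros i. apply is_series_unique, (hf i); exact hs.
    + intros k. apply is_series_unique.
      pose proof (csum_scal (h ^ k)%C _ _ (hC k)) as [y _].
      rewrite (Cmult_comm (Ck k)). eapply is_series_ext; [| exact y]. intros i; cbn beta. now rewrite Cmult_comm.
    + apply hF, hs.
    + intros i. apply is_series_unique, (hf i); exact hs.
    + intros k. apply is_series_unique.
      pose proof (csum_scal (h ^ k)%C _ _ (hC k)) as [_ y].
      rewrite (Cmult_comm (Ck k)). eapply is_series_ext; [| exact y]. intros i; cbn beta. now rewrite Cmult_comm.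
    + apply hF, hs.
Qed.

End Expands.

Fixpoint Csum (a : nat -> C) (n : nat) : C :=
  match n with O => 0 | S m => (Csum a m + a m)%C end.

Lemma csum_drop (a : nat -> C) (l : C) (m : nat) :
  csum a l -> csum (fun k => a (m + k)%nat) (l - Csum a m)%C.
Proof.
  intros h. induction m as [| m IH].
  - simpl. replace (l - 0)%C with l by ring. exact h.
  - apply csum_incr_1 in IH. rewrite Nat.add_0_r in IH. simpl.
    replace (l - (Csum a m + a m))%C with (l - Csum a m - a m)%C by ring.
    eapply csum_ext; [| exact IH]. intros n; cbn beta. f_equal; lia.
Qed.

(** Besides giving remainders, it bounds values ([m = 0]), yields the derivative ([m = 2]) and
    isolates a leading coefficient. *)
Lemma expands_tail f s0 r M c (m : nat) (h : C) : 0 < r -> expands f s0 r M c -> Cmod h < r ->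
  Cmod (f (s0 + h)%C - Csum (fun k => (c k * h ^ k)%C) m) <= 2 * (M * (Cmod h / r) ^ m).
Proof.
  intros rp hf hh.
  assert (e : (s0 + h - s0)%C = h) by ring.
  pose proof (proj2 hf (s0 + h)%C) as hs. rewrite e in hs. specialize (hs hh).
  pose proof (csum_drop _ _ m hs) as ht.
  assert (q0 : 0 <= Cmod h / r) by (apply Rdiv_le_0_compat; [apply Cmod_ge_0 | exact rp]).
  assert (q1 : Cmod h / r <= 1).
  { apply Rmult_le_reg_r with r; [exact rp |]. unfold Rdiv; rewrite Rmult_assoc, Rinv_l; lra. }
  destruct (expands_summable s0 r rp f M c hf) as [e1 e2].
  assert (e1' : ex_series (fun k => Cmod (c (m + k)%nat) * r ^ (m + k))).
  { apply -> (ex_series_incr_n (fun k => Cmod (c k) * r ^ k) m). exact e1. }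
  assert (e2' : Series (fun k => Cmod (c (m + k)%nat) * r ^ (m + k)) <= M).
  { eapply Rle_trans; [| exact e2]. destruct m as [| m]; [right; reflexivity |].
    rewrite (Series_incr_n (fun k => Cmod (c k) * r ^ k) (S m)) by (auto; lia).
    rewrite <- sum_n_Reals. simpl pred. rewrite <- sumR_sum_n.
    assert (0 <= sumR (fun k => Cmod (c k) * r ^ k) (S m)); [| lra].
    apply sumR_nonneg. intros; apply Rmult_le_pos; [apply Cmod_ge_0 | apply pow_le; lra]. }
  apply Rle_trans with (2 * Series (fun k => Cmod (c (m + k)%nat) * r ^ (m + k) * (Cmod h / r) ^ m)).
  - eapply csum_norm_le; [| | exact ht].
    + apply (ex_series_scal_r ((Cmod h / r) ^ m) (fun k => Cmod (c (m + k)%nat) * r ^ (m + k))), e1'.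
    + intros k. cbn beta. rewrite Cmod_mult, Cmod_pow, Rmult_assoc. apply Rmult_le_compat_l; [apply Cmod_ge_0 |].
      replace (Cmod h ^ (m + k)) with (r ^ (m + k) * ((Cmod h / r) ^ m * (Cmod h / r) ^ k)).
      * apply Rmult_le_compat_l; [apply pow_le; lra |].
        rewrite <- (Rmult_1_r ((Cmod h / r) ^ m)) at 2. apply Rmult_le_compat_l; [apply pow_le, q0 |].
        rewrite <- (pow1 k). apply pow_incr; lra.
      * rewrite <- pow_add, <- Rpow_mult_distr. f_equal. field; lra.
  - rewrite Series_scal_r. apply Rmult_le_compat_l; [lra |].
    apply Rmult_le_compat_r; [apply pow_le, q0 | exact e2'].
Qed.

(** * Complex derivatives *)

(** First-order approximation in the modulus norm, in which the rules of calculus are direct;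
    [cder_C_derive] links it to [C_derive]. *)
Definition cder (f : C -> C) (z l : C) : Prop :=
  forall e, 0 < e -> exists d, 0 < d /\
    forall h, Cmod h < d -> Cmod (f (z + h) - f z - l * h)%C <= e * Cmod h.

Lemma expands_value f s0 r M c : 0 < r -> expands f s0 r M c -> f s0 = c 0%nat.
Proof.
  intros rp [_ h]. specialize (h s0). replace (s0 - s0)%C with (RtoC 0) in h by ring.
  rewrite Cmod_0 in h. specialize (h rp).
  apply (csum_unique _ _ _ h). apply csum_decr_1. simpl.
  replace (c 0%nat - c 0%nat * 1)%C with (RtoC 0) by ring.
  eapply csum_ext; [| apply csum_const_0]. intros n; cbn beta. ring.
Qed.

Lemma expands_cder f s0 r M c : 0 < r -> expands f s0 r M c -> cder f s0 (c 1%nat).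
Proof.
  intros rp hf e he. pose proof (expands_nonneg _ _ _ _ _ hf) as M0.
  exists (Rmin r (e * r ^ 2 / (2 * M + 1))).
  assert (r2 : 0 < r ^ 2) by (apply pow_lt; lra).
  assert (p : 0 < e * r ^ 2 / (2 * M + 1)) by (apply Rdiv_lt_0_compat; [apply Rmult_lt_0_compat; lra | lra]).
  split; [apply Rmin_glb_lt; assumption |].
  intros h hh. assert (h1 : Cmod h < r) by (eapply Rlt_le_trans; [exact hh | apply Rmin_l]).
  assert (h2 : Cmod h < e * r ^ 2 / (2 * M + 1)) by (eapply Rlt_le_trans; [exact hh | apply Rmin_r]).
  pose proof (expands_tail f s0 r M c 2 h rp hf h1) as t. simpl in t.
  rewrite (expands_value f s0 r M c rp hf).
  replace (f (s0 + h) - c 0%nat - c 1%nat * h)%C with (f (s0 + h) - (0 + c 0%nat * 1 + c 1%nat * (h * 1)))%C by ring.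
  eapply Rle_trans; [exact t |].
  pose proof (Cmod_ge_0 h) as h0.
  assert (h3 : (2 * M + 1) * Cmod h <= e * r ^ 2).
  { apply Rle_trans with ((2 * M + 1) * (e * r ^ 2 / (2 * M + 1))); [apply Rmult_le_compat_l; lra | right; field; lra]. }
  replace (2 * (M * (Cmod h / r * (Cmod h / r * 1)))) with (2 * M * Cmod h * Cmod h * / r ^ 2) by (field; lra).
  apply Rmult_le_reg_r with (r ^ 2); [exact r2 |]. rewrite Rmult_assoc, Rinv_l, Rmult_1_r by lra. nra.
Qed.

Lemma cder_unique f z l m : cder f z l -> cder f z m -> l = m.
Proof.
  intros hl hm. destruct (Ceq_dec l m) as [-> | ne]; [reflexivity | exfalso].
  assert (p : 0 < Cmod (l - m)). { apply Cmod_gt_0. intros e. apply ne. replace l with (l - m + m)%C by ring. rewrite e; ring. }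
  destruct (hl (Cmod (l - m) / 4) ltac:(lra)) as (d1 & p1 & b1).
  destruct (hm (Cmod (l - m) / 4) ltac:(lra)) as (d2 & p2 & b2).
  set (x := Rmin d1 d2 / 2). assert (xp : 0 < x) by (unfold x; pose proof (Rmin_glb_lt d1 d2 0 p1 p2); lra).
  assert (cx : Cmod (RtoC x) = x) by (rewrite Cmod_R; apply Rabs_pos_eq; lra).
  specialize (b1 (RtoC x)). specialize (b2 (RtoC x)). rewrite cx in b1, b2.
  pose proof (Rmin_l d1 d2). pose proof (Rmin_r d1 d2).
  specialize (b1 ltac:(unfold x in *; lra)). specialize (b2 ltac:(unfold x in *; lra)).
  set (A := (f (z + RtoC x) - f z - l * RtoC x)%C) in *. set (B := (f (z + RtoC x) - f z - m * RtoC x)%C) in *.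
  assert (e : Cmod (l - m) * x <= Cmod A + Cmod B).
  { rewrite <- cx, <- Cmod_mult. rewrite <- (Cmod_opp A).
    replace ((l - m) * RtoC x)%C with (- A + B)%C by (unfold A, B; ring). apply Cmod_triangle. }
  nra.
Qed.

Lemma cder_plus f g z l m : cder f z l -> cder g z m -> cder (fun s => f s + g s)%C z (l + m)%C.
Proof.
  intros hl hm e he.
  destruct (hl (e / 2) ltac:(lra)) as (d1 & p1 & b1). destruct (hm (e / 2) ltac:(lra)) as (d2 & p2 & b2).
  exists (Rmin d1 d2). split; [apply Rmin_glb_lt; assumption |].
  intros h hh. pose proof (Rmin_l d1 d2). pose proof (Rmin_r d1 d2).
  specialize (b1 h ltac:(lra)). specialize (b2 h ltac:(lra)).
  replace (f (z + h) + g (z + h) - (f z + g z) - (l + m) * h)%C with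
    ((f (z + h) - f z - l * h) + (g (z + h) - g z - m * h))%C by ring.
  eapply Rle_trans; [apply Cmod_triangle |]. lra.
Qed.

Lemma cder_scal (a : C) f z l : cder f z l -> cder (fun s => a * f s)%C z (a * l)%C.
Proof.
  intros hl e he. pose proof (Cmod_ge_0 a).
  destruct (hl (e / (Cmod a + 1)) ltac:(apply Rdiv_lt_0_compat; lra)) as (d & p & b).
  exists d; split; [exact p |]. intros h hh. specialize (b h hh).
  replace (a * f (z + h) - a * f z - a * l * h)%C with (a * (f (z + h) - f z - l * h))%C by ring.
  rewrite Cmod_mult. pose proof (Cmod_ge_0 h).
  apply Rle_trans with (Cmod a * (e / (Cmod a + 1) * Cmod h)); [apply Rmult_le_compat_l; assumption |].
  replace (Cmod a * (e / (Cmod a + 1) * Cmod h)) with (e * Cmod h * (Cmod a / (Cmod a + 1))) by (field; lra).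
  rewrite <- (Rmult_1_r (e * Cmod h)) at 2. apply Rmult_le_compat_l; [apply Rmult_le_pos; lra |].
  apply Rmult_le_reg_r with (Cmod a + 1); [lra |]. unfold Rdiv. rewrite Rmult_assoc, Rinv_l; lra.
Qed.

Lemma cder_minus f g z l m : cder f z l -> cder g z m -> cder (fun s => f s - g s)%C z (l - m)%C.
Proof.
  intros hl hm. pose proof (cder_plus _ _ _ _ _ hl (cder_scal (-1) g z m hm)) as h.
  intros e he. destruct (h e he) as (d & p & b). exists d; split; [exact p |]. intros k hk.
  specialize (b k hk). replace (f (z + k) - g (z + k) - (f z - g z) - (l - m) * k)%C with
   (f (z + k) + -1 * g (z + k) - (f z + -1 * g z) - (l + -1 * m) * k)%C by ring. exact b.
Qed.

Lemma cder_ext_loc f g z l r : 0 < r -> (forall s, Cmod (s - z) < r -> f s = g s) -> cder f z l -> cder g z l.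
Proof.
  intros rp hfg hf e he. destruct (hf e he) as (d & p & b).
  exists (Rmin d r). split; [apply Rmin_glb_lt; assumption |].
  intros h hh. pose proof (Rmin_l d r). pose proof (Rmin_r d r).
  rewrite <- !hfg.
  - apply b; lra.
  - replace (z - z)%C with (RtoC 0) by ring. rewrite Cmod_0; exact rp.
  - replace (z + h - z)%C with h by ring. lra.
Qed.

Lemma cder_mult f g z l m : cder f z l -> cder g z m ->
  cder (fun s => f s * g s)%C z (l * g z + f z * m)%C.
Proof.
  intros hl hm e he.
  set (A := Cmod l + Cmod m + Cmod (f z) + Cmod (g z) + 1).
  pose proof (Cmod_ge_0 l). pose proof (Cmod_ge_0 m). pose proof (Cmod_ge_0 (f z)). pose proof (Cmod_ge_0 (g z)).
  assert (A1 : 1 <= A) by (unfold A; lra).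
  set (e' := Rmin 1 (e / (4 * A))).
  assert (ep : 0 < e') by (apply Rmin_glb_lt; [lra | apply Rdiv_lt_0_compat; lra]).
  assert (e1 : e' <= 1) by apply Rmin_l.
  assert (e2 : e' * (4 * A) <= e).
  { apply Rle_trans with (e / (4 * A) * (4 * A)); [apply Rmult_le_compat_r; [lra | apply Rmin_r] | right; field; lra]. }
  destruct (hl e' ep) as (d1 & p1 & b1). destruct (hm e' ep) as (d2 & p2 & b2).
  set (d3 := e / (4 * (A + 1) * (A + 1))).
  assert (p3 : 0 < d3) by (apply Rdiv_lt_0_compat; nra).
  exists (Rmin (Rmin d1 d2) d3). split; [repeat apply Rmin_glb_lt; assumption |].
  intros h hh. pose proof (Rmin_l (Rmin d1 d2) d3). pose proof (Rmin_r (Rmin d1 d2) d3).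
  pose proof (Rmin_l d1 d2). pose proof (Rmin_r d1 d2).
  specialize (b1 h ltac:(lra)). specialize (b2 h ltac:(lra)).
  set (X := (f (z + h) - f z - l * h)%C) in *. set (Y := (g (z + h) - g z - m * h)%C) in *.
  replace (f (z + h) * g (z + h) - f z * g z - (l * g z + f z * m) * h)%C
   with (X * g z + (f z * Y + (X + l * h) * (Y + m * h)))%C by (unfold X, Y; ring).
  pose proof (Cmod_ge_0 h) as h0.
  assert (t1 : Cmod (X * g z) <= e / 4 * Cmod h).
  { rewrite Cmod_mult. apply Rle_trans with (e' * Cmod h * A); [apply Rmult_le_compat; try apply Cmod_ge_0; [exact b1 | unfold A; lra] |]. nra. }
  assert (t2 : Cmod (f z * Y) <= e / 4 * Cmod h).
  { rewrite Cmod_mult. apply Rle_trans with (A * (e' * Cmod h)); [apply Rmult_le_compat; try apply Cmod_ge_0; [unfold A; lra | exact b2] |]. nra. }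
  assert (t3 : Cmod ((X + l * h) * (Y + m * h)) <= e / 4 * Cmod h).
  { rewrite Cmod_mult.
    assert (u1 : Cmod (X + l * h) <= (A + 1) * Cmod h).
    { eapply Rle_trans; [apply Cmod_triangle |]. rewrite Cmod_mult. unfold A. nra. }
    assert (u2 : Cmod (Y + m * h) <= (A + 1) * Cmod h).
    { eapply Rle_trans; [apply Cmod_triangle |]. rewrite Cmod_mult. unfold A. nra. }
    apply Rle_trans with ((A + 1) * Cmod h * ((A + 1) * Cmod h)); [apply Rmult_le_compat; auto; apply Cmod_ge_0 |].
    assert (u3 : (A + 1) * (A + 1) * Cmod h <= e / 4).
    { apply Rle_trans with ((A + 1) * (A + 1) * d3); [apply Rmult_le_compat_l; [nra | lra] |].
      right. unfold d3. field. lra. }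
    nra. }
  eapply Rle_trans; [apply Cmod_triangle |].
  eapply Rle_trans; [apply Rplus_le_compat_l, Cmod_triangle |].
  assert (0 <= e * Cmod h) by (apply Rmult_le_pos; lra). lra.
Qed.

Lemma cder_C_derive f z l : cder f z l -> C_derive f z = l.
Proof.
  intros h. unfold C_derive. apply is_C_lim_unique.
  apply (filterlim_locally (U := C_UniformSpace)). intros [e he].
  destruct (h (e / 2) ltac:(lra)) as (d & p & b).
  assert (key : forall y : C, Cmod (y - z) < d -> y <> z -> Cmod ((f y - f z) / (y - z) - l) < e).
  { intros y hy ne. specialize (b (y - z)%C hy).
    replace (z + (y - z))%C with y in b by ring.
    assert (nz : (y - z)%C <> 0). { intros q. apply ne. replace y with (y - z + z)%C by ring. rewrite q; ring. }
    assert (np : 0 < Cmod (y - z)) by (apply Cmod_gt_0; exact nz).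
    replace ((f y - f z) / (y - z) - l)%C with ((f y - f z - l * (y - z)) / (y - z))%C by (field; exact nz).
    rewrite Cmod_div by exact nz.
    apply Rle_lt_trans with (e / 2); [| lra].
    apply Rmult_le_reg_r with (Cmod (y - z)); [exact np |]. unfold Rdiv at 1. rewrite Rmult_assoc, Rinv_l; lra. }
  assert (dp : 0 < d / 2) by lra.
  (* Balls of the uniform structure of [C] are squares: within [d / 2] in each coordinate the
     modulus is below [sqrt 2] times [d / 2], hence below [d]. *)
  exists (mkposreal (d / 2) dp). intros y hy ne.
  apply C_NormedModule_mixin_compat1.
  pose proof (C_NormedModule_mixin_compat2 z y (mkposreal (d / 2) dp) hy) as hd. simpl in hd.
  assert (s2 : sqrt 2 <= 3 / 2).
  { rewrite <- (sqrt_pow2 (3 / 2)) by lra. apply sqrt_le_1_alt. lra. }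
  apply key; [| exact ne]. apply (Rlt_trans _ _ _ hd). nra.
Qed.

Lemma is_pseries_csum (c : nat -> C) (h l : C) :
  @is_pseries C_AbsRing C_NormedModule c h l <-> csum (fun k => (c k * h ^ k)%C) l.
Proof.
  rewrite csum_is_series. unfold is_pseries.
  assert (e : forall k, scal (pow_n (K := C_AbsRing) h k) (c k) = (c k * h ^ k)%C).
  { intros k. rewrite Cmult_comm. change (scal (pow_n (K := C_AbsRing) h k) (c k)) with (pow_n (K := C_AbsRing) h k * c k)%C.
    reflexivity. }
  split; apply is_series_ext; intros k; [apply e | symmetry; apply e].
Qed.

Lemma expands_analytic f s0 r M c : 0 < r -> expands f s0 r M c -> analytic_at f s0.
Proof.
  intros rp [_ h]. exists c, r. split; [exact rp |]. intros s hs. apply is_pseries_csum, h, hs.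
Qed.

(** [analytic_at] gives mere convergence. The terms at distance [r / 2] tend to [0] and are bounded,
    so at distance [r / 4] a geometric series of sum [2] bounds the norm. *)
Lemma analytic_expands f s0 : analytic_at f s0 -> exists r M c, 0 < r /\ expands f s0 r M c.
Proof.
  intros (c & r & rp & h).
  pose proof (h (s0 + RtoC (r / 2))%C) as hh.
  replace (s0 + RtoC (r / 2) - s0)%C with (RtoC (r / 2)) in hh by ring.
  rewrite Cmod_R, Rabs_pos_eq in hh by lra. specialize (hh ltac:(lra)).
  apply is_pseries_csum in hh. destruct hh as [h1 h2].
  destruct (lim_bounded _ _ (ex_series_lim_0 _ (ex_intro _ _ h1))) as [B1 b1].
  destruct (lim_bounded _ _ (ex_series_lim_0 _ (ex_intro _ _ h2))) as [B2 b2].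
  assert (b : forall k, Cmod (c k) * (r / 2) ^ k <= B1 + B2).
  { intros k. specialize (b1 k). specialize (b2 k). cbn beta in b1, b2.
    rewrite <- (Rabs_pos_eq (r / 2)) by lra. rewrite <- Cmod_R, <- Cmod_pow, <- Cmod_mult.
    eapply Rle_trans; [apply Cmod_le_sum |]. lra. }
  exists (r / 4), ((B1 + B2) * 2), c. split; [lra |]. split.
  - intros n. apply Rle_trans with (sumR (fun k => (B1 + B2) * (1 / 2) ^ k) n).
    + apply sumR_le. intros k. replace (r / 4) with (r / 2 * (1 / 2)) by field.
      rewrite Rpow_mult_distr, <- Rmult_assoc. apply Rmult_le_compat_r; [apply pow_le; lra | apply b].
    + rewrite sumR_scal. apply Rmult_le_compat_l.
      * specialize (b 0%nat). pose proof (Cmod_ge_0 (c 0%nat)). simpl in b. lra.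
      * apply sumR_le_is_series; [intros; apply pow_le; lra |].
        assert (hg : is_series (fun k => (1 / 2) ^ k) (/ (1 - 1 / 2))) by (apply is_series_geom; rewrite Rabs_pos_eq; lra).
        replace (/ (1 - 1 / 2)) with 2 in hg by field. exact hg.
  - intros s hs. apply is_pseries_csum, h. lra.
Qed.

Lemma analytic_ext_loc f g s0 r : 0 < r -> (forall s, Cmod (s - s0) < r -> f s = g s) ->
  analytic_at f s0 -> analytic_at g s0.
Proof.
  intros rp e (c & r' & rp' & h). exists c, (Rmin r r'). split; [apply Rmin_glb_lt; assumption |].
  intros s hs. pose proof (Rmin_l r r'). pose proof (Rmin_r r r').
  rewrite <- e by lra. apply h; lra.
Qed.

Lemma expands_shrink f s0 r r' M c : 0 < r' <= r -> expands f s0 r M c -> expands f s0 r' M c.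
Proof.
  intros hr [h1 h2]. split.
  - intros n. eapply Rle_trans; [| apply (h1 n)]. apply sumR_le. intros k.
    apply Rmult_le_compat_l; [apply Cmod_ge_0 |]. apply pow_incr; lra.
  - intros s hs. apply h2; lra.
Qed.

Lemma analytic_plus f g s0 : analytic_at f s0 -> analytic_at g s0 -> analytic_at (fun s => f s + g s)%C s0.
Proof.
  intros hf hg. apply analytic_expands in hf, hg.
  destruct hf as (r & M & c & rp & hf). destruct hg as (r' & M' & c' & rp' & hg).
  pose proof (Rmin_glb_lt r r' 0 rp rp') as mp. pose proof (Rmin_l r r'). pose proof (Rmin_r r r').
  apply (expands_analytic _ _ (Rmin r r') (M + M') (fun k => c k + c' k)%C mp).
  apply expands_plus; [exact mp | |]; eapply expands_shrink; try eassumption; lra.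
Qed.

Lemma analytic_scal a f s0 : analytic_at f s0 -> analytic_at (fun s => a * f s)%C s0.
Proof.
  intros hf. apply analytic_expands in hf. destruct hf as (r & M & c & rp & hf).
  exact (expands_analytic _ _ _ _ _ rp (expands_scal s0 r a f M c hf)).
Qed.

Lemma analytic_minus f g s0 : analytic_at f s0 -> analytic_at g s0 -> analytic_at (fun s => f s - g s)%C s0.
Proof.
  intros hf hg. apply (analytic_ext_loc (fun s => f s + (-1) * g s)%C _ _ 1); [lra | intros; ring |].
  apply analytic_plus; [exact hf | apply analytic_scal, hg].
Qed.

Lemma analytic_cder f s0 : analytic_at f s0 -> exists l, cder f s0 l.
Proof.
  intros hf. apply analytic_expands in hf. destruct hf as (r & M & c & rp & hf).
  exists (c 1%nat). eapply expands_cder; eassumption.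
Qed.

(** * Identity theorem along a segment *)

(** If [c m] is the first nonzero coefficient, a zero at [s0 + h] forces [|c m| <= K |h|], which
    fails for small [h]. So all coefficients vanish. *)
Lemma isolated_zeros f s0 : analytic_at f s0 ->
  (forall e, 0 < e -> exists s, 0 < Cmod (s - s0) < e /\ f s = 0) ->
  exists r, 0 < r /\ forall s, Cmod (s - s0) < r -> f s = 0.
Proof.
  intros hf hz. apply analytic_expands in hf. destruct hf as (r & M & c & rp & hf).
  exists r. split; [exact rp |].
  pose proof (expands_nonneg _ _ _ _ _ hf) as M0.
  assert (cz : forall m, forall k, (k < m)%nat -> c k = 0).
  { intros m. induction m as [| m IH]; [intros; lia |].
    assert (cm : c m = 0).
    { destruct (Ceq_dec (c m) 0) as [e | ne]; [exact e | exfalso].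
      assert (p : 0 < Cmod (c m)) by (apply Cmod_gt_0; exact ne).
      set (K := 2 * M / r ^ S m).
      assert (rp' : 0 < r ^ S m) by (apply pow_lt; exact rp).
      assert (K0 : 0 <= K) by (apply Rdiv_le_0_compat; lra).
      destruct (hz (Rmin r (Cmod (c m) / (K + 1)))) as (s & hs & fs).
      { apply Rmin_glb_lt; [exact rp | apply Rdiv_lt_0_compat; lra]. }
      pose proof (Rmin_l r (Cmod (c m) / (K + 1))). pose proof (Rmin_r r (Cmod (c m) / (K + 1))).
      set (h := (s - s0)%C) in *.
      pose proof (expands_tail f s0 r M c (S m) h rp hf ltac:(lra)) as t.
      replace (s0 + h)%C with s in t by (unfold h; ring). rewrite fs in t. cbn [Csum] in t.
      assert (z : Csum (fun k => (c k * h ^ k)%C) m = 0).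
      { clear - IH. assert (g : forall n, (n <= m)%nat -> Csum (fun k => (c k * h ^ k)%C) n = 0).
        { intros n; induction n as [| n IHn]; intros hn; simpl; [reflexivity |].
          rewrite IHn, (IH n) by lia. ring. }
        apply g; lia. }
      rewrite z in t. replace (0 - (0 + c m * h ^ m))%C with (- (c m * h ^ m))%C in t by ring.
      rewrite Cmod_opp, Cmod_mult, Cmod_pow in t.
      assert (hp : 0 < Cmod h ^ m) by (apply pow_lt; lra).
      assert (t2 : 2 * (M * (Cmod h / r) ^ S m) = K * Cmod h * Cmod h ^ m).
      { unfold K, Rdiv. rewrite Rpow_mult_distr, pow_inv. simpl. field. assert (r ^ m <> 0) by (apply pow_nonzero; lra). split; [assumption | lra]. }
      rewrite t2 in t. apply Rmult_le_reg_r in t; [| exact hp].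
      assert (Cmod h * (K + 1) < Cmod (c m)).
      { apply Rlt_le_trans with (Cmod (c m) / (K + 1) * (K + 1)); [apply Rmult_lt_compat_r; lra | right; field; lra]. }
      lra. }
    intros k hk. destruct (Nat.eq_dec k m) as [-> | ]; [exact cm | apply IH; lia]. }
  intros s hs. apply (csum_unique _ _ _ (proj2 hf s hs)).
  eapply csum_ext; [| apply csum_const_0]. intros k; cbn beta. rewrite (cz (S k) k) by lia. ring.
Qed.

(** Connectedness of the segment: let [T] be the supremum of the parameters up to which [f] vanishes
    locally. The point of parameter [T] is a limit of zeros, so [f] vanishes on a disc around it,
    and unless [T = 1] that disc pushes the supremum further. *)
Lemma identity_segment f (p q : C) :
  (forall t, 0 <= t <= 1 -> analytic_at f (p + RtoC t * (q - p))) -> p <> q ->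
  (exists r, 0 < r /\ forall s, Cmod (s - p) < r -> f s = 0) ->
  exists r, 0 < r /\ forall s, Cmod (s - q) < r -> f s = 0.
Proof.
  intros ha npq hp.
  set (g := fun t => (p + RtoC t * (q - p))%C).
  set (Z := fun t => exists r, 0 < r /\ forall s, Cmod (s - g t) < r -> f s = 0).
  assert (dp : 0 < Cmod (q - p)).
  { apply Cmod_gt_0. intros e. apply npq. symmetry. replace q with (q - p + p)%C by ring. rewrite e; ring. }
  assert (gd : forall t u, Cmod (g t - g u) = Rabs (t - u) * Cmod (q - p)).
  { intros t u. unfold g. replace (p + RtoC t * (q - p) - (p + RtoC u * (q - p)))%C with (RtoC (t - u) * (q - p))%C by (rewrite RtoC_minus; ring).
    rewrite Cmod_mult, Cmod_R. reflexivity. }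
  set (E := fun t => 0 <= t <= 1 /\ forall u, 0 <= u <= t -> Z u).
  assert (Z0 : Z 0).
  { destruct hp as (r & rp & h). exists r. split; [exact rp |]. intros s hs. apply h.
    unfold g in hs. replace (p + RtoC 0 * (q - p))%C with p in hs by ring. exact hs. }
  assert (E0 : E 0) by (split; [lra |]; intros u hu; replace u with 0 by lra; exact Z0).
  destruct (completeness E) as (T & hT1 & hT2).
  { exists 1. intros t ht; apply ht. }
  { exists 0; exact E0. }
  assert (T0 : 0 <= T) by (apply hT1, E0).
  assert (T1 : T <= 1) by (apply hT2; intros t ht; apply ht).
  assert (below : forall u, 0 <= u < T -> Z u).
  { intros u hu. destruct (Classical_Prop.classic (exists t, E t /\ u < t)) as [(t & ht & hut) | no].
    - apply ht; lra.
    - exfalso. assert (T <= u); [| lra]. apply hT2. intros t ht.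
      destruct (Rle_dec t u); [assumption |]. exfalso; apply no; exists t; split; [exact ht | lra]. }
  assert (ZT : Z T).
  { destruct (Req_dec T 0) as [-> | hT]; [exact Z0 |].
    apply isolated_zeros; [apply ha; lra |].
    intros e he. set (u := Rmax (T / 2) (T - e / (2 * Cmod (q - p)))).
    assert (ep : 0 < e / (2 * Cmod (q - p))) by (apply Rdiv_lt_0_compat; lra).
    assert (hu : 0 <= u < T).
    { split; [eapply Rle_trans; [| apply Rmax_l]; lra | apply Rmax_lub_lt; lra]. }
    exists (g u). split.
    - change (p + RtoC T * (q - p))%C with (g T). rewrite gd, Rabs_left by lra.
      split; [apply Rmult_lt_0_compat; lra |].
      apply Rle_lt_trans with (e / (2 * Cmod (q - p)) * Cmod (q - p)).
      + apply Rmult_le_compat_r; [lra |]. pose proof (Rmax_r (T / 2) (T - e / (2 * Cmod (q - p)))). unfold u; lra.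
      + replace (e / (2 * Cmod (q - p)) * Cmod (q - p)) with (e / 2) by (field; lra). lra.
    - destruct (below u hu) as (r & rp & h). apply h.
      replace (g u - g u)%C with (RtoC 0) by ring. rewrite Cmod_0; exact rp. }
  assert (TT : T = 1).
  { destruct (Req_dec T 1) as [e | ne]; [exact e | exfalso].
    destruct ZT as (r & rp & h).
    set (d := Rmin (1 - T) (r / (2 * Cmod (q - p)))).
    assert (dpos : 0 < d). { apply Rmin_glb_lt; [lra | apply Rdiv_lt_0_compat; lra]. }
    assert (ET : E (T + d)).
    { split; [pose proof (Rmin_l (1 - T) (r / (2 * Cmod (q - p)))); unfold d in *; lra |].
      intros u hu. destruct (Rlt_dec u T) as [lt | ge]; [apply below; lra |].
      exists (r / 2). split; [lra |]. intros s hs. apply h.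
      replace (s - g T)%C with ((s - g u) + (g u - g T))%C by ring.
      eapply Rle_lt_trans; [apply Cmod_triangle |]. rewrite gd, Rabs_pos_eq by lra.
      assert ((u - T) * Cmod (q - p) <= r / (2 * Cmod (q - p)) * Cmod (q - p)).
      { apply Rmult_le_compat_r; [lra |]. pose proof (Rmin_r (1 - T) (r / (2 * Cmod (q - p)))). unfold d in *; lra. }
      replace (r / (2 * Cmod (q - p)) * Cmod (q - p)) with (r / 2) in H by (field; lra). lra. }
    specialize (hT1 _ ET). lra. }
  rewrite TT in ZT. destruct ZT as (r & rp & h). exists r; split; [exact rp |].
  intros s hs. apply h. unfold g. replace (p + RtoC 1 * (q - p))%C with q by ring. exact hs.
Qed.

(** * Expansion of lattice sums *)

(** The complex power [x^(-s)]; the minus sign of the Dirichlet convention is part of the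
    definition. *)
Definition npow (x : R) (s : C) : C := Cexp (- s * RtoC (ln x)).

Lemma expands_gbinom (s0 : C) (r : R) (g : C -> C) (M : R) (c : nat -> C) (j : nat) :
  0 < r -> expands g s0 r M c ->
  exists c', expands (fun s => gbinom (- s) j * g s)%C s0 r (gbinom_bound (r + Cmod s0) j * M) c'.
Proof.
  intros rp hg. induction j as [| j [c' IH]].
  - exists c. simpl. rewrite Rmult_1_l. eapply expands_ext; [| exact hg]. intros; cbn beta; ring.
  - assert (nz : RtoC (INR (S j)) <> 0) by (intros q; apply RtoC_inj in q; apply (not_0_INR (S j)); auto).
    pose proof (expands_scal s0 r (- / RtoC (INR (S j)))%C _ _ _
      (expands_mul_lin s0 r rp (- RtoC (INR j))%C _ _ _ IH)) as h.
    eexists. eapply expands_ext; [| eapply expands_le; [| exact h]].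
    + intros s hs. cbn beta. change (gbinom (- s) (S j)) with (gbinom (- s) j * (- s - RtoC (INR j)) / RtoC (INR (S j)))%C.
      field. exact nz.
    + assert (0 < INR (S j)) by (apply lt_0_INR; lia).
      rewrite Cmod_opp, Cmod_inv, Cmod_R, Rabs_pos_eq by (auto; lra).
      change (gbinom_bound (r + Cmod s0) (S j)) with (gbinom_bound (r + Cmod s0) j * (r + Cmod s0 + INR j) / INR (S j)).
      pose proof (expands_nonneg _ _ _ _ _ IH) as M0.
      assert (t : Cmod (s0 - - RtoC (INR j)) <= Cmod s0 + INR j).
      { replace (s0 - - RtoC (INR j))%C with (s0 + RtoC (INR j))%C by ring.
        eapply Rle_trans; [apply Cmod_triangle |]. rewrite Cmod_R, Rabs_pos_eq by apply pos_INR. lra. }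
      apply Rmult_le_reg_l with (INR (S j)); [assumption |].
      rewrite <- Rmult_assoc, Rinv_r, Rmult_1_l by lra.
      replace (INR (S j) * (gbinom_bound (r + Cmod s0) j * (r + Cmod s0 + INR j) / INR (S j) * M))
        with ((r + Cmod s0 + INR j) * (gbinom_bound (r + Cmod s0) j * M)) by (field; lra).
      apply Rmult_le_compat_r; [exact M0 | lra].
Qed.

Lemma npow_shift (x : R) (s : C) (j : nat) : 0 < x ->
  npow x (s + RtoC (INR j)) = (RtoC (/ x ^ j) * npow x s)%C.
Proof.
  intros hx. unfold npow.
  replace (- (s + RtoC (INR j)) * RtoC (ln x))%C with (RtoC (- INR j * ln x) + - s * RtoC (ln x))%C
    by (rewrite RtoC_mult, RtoC_opp; ring).
  rewrite Cexp_add, Cexp_R. do 2 f_equal.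
  replace (- INR j * ln x) with (- (INR j * ln x)) by ring.
  rewrite exp_Ropp. f_equal. change (Rpower x (INR j) = x ^ j). apply Rpower_pow, hx.
Qed.

(** The [j]-th term of the binomial expansion of [(x + h)^(-s)] in powers of [h / x]. *)
Definition pbinom (h : R) (x : R) (j : nat) (s : C) : C :=
  (gbinom (- s) j * (RtoC (h ^ j) * npow x (s + RtoC (INR j))))%C.

Lemma expands_npow (s0 : C) (r x : R) : 0 < r -> 1 <= x ->
  exists c, expands (npow x) s0 r (Rpower x (r - Re s0)) c.
Proof.
  intros rp hx. eexists. eapply expands_le; [| apply (expands_exp s0 r rp (ln x))].
  assert (0 <= ln x) by (rewrite <- ln_1; apply Rcomplements.ln_le; lra).
  rewrite (Rabs_pos_eq (ln x)) by assumption. unfold Rpower. right; f_equal; ring.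
Qed.

Lemma expands_pbinom (s0 : C) (r h x : R) (j : nat) : 0 < r -> 1 <= x ->
  exists c, expands (pbinom h x j) s0 r (gbinom_bound (r + Cmod s0) j * ((Rabs h / x) ^ j * Rpower x (r - Re s0))) c.
Proof.
  intros rp hx. destruct (expands_npow s0 r x rp hx) as [c hc].
  pose proof (expands_scal s0 r (RtoC (h ^ j * / x ^ j)) _ _ _ hc) as h1.
  destruct (expands_gbinom s0 r _ _ _ j rp h1) as [c' h2].
  exists c'. eapply expands_ext; [| eapply expands_le; [| exact h2]].
  - intros s hs. unfold pbinom. rewrite npow_shift by lra. rewrite RtoC_mult. ring.
  - right. do 2 f_equal. rewrite Cmod_R, Rabs_mult, <- RPow_abs. unfold Rdiv. rewrite Rpow_mult_distr, pow_inv.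
    f_equal. apply Rabs_pos_eq. apply Rlt_le, Rinv_0_lt_compat, pow_lt; lra.
Qed.

(** Taylor remainder of [(x + h)^(-s)] in the variable [h]. *)
Lemma expands_remainder1 (m : nat) (h : R) (s0 : C) (r : R) : 0 < r ->
  exists K, 0 <= K /\ forall x, 1 <= x -> 2 * Rabs h <= x ->
    exists c, expands (fun s => npow (x + h) s - Csum (fun j => pbinom h x j s) m)%C s0 r
       (K * Rpower x (r - Re s0 - INR m)) c.
Proof.
  intros rp. set (A := r + Cmod s0).
  assert (Ap : 0 < A) by (unfold A; pose proof (Cmod_ge_0 s0); lra).
  assert (e0 : ex_series (fun j => gbinom_bound A j * (1 / 2) ^ j)) by (apply gbinom_bound_summable; lra).
  assert (e1 : ex_series (fun k => gbinom_bound A (m + k) * (1 / 2) ^ (m + k))).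
  { apply -> (ex_series_incr_n (fun j => gbinom_bound A j * (1 / 2) ^ j) m). exact e0. }
  set (Sm := Series (fun k => gbinom_bound A (m + k) * (1 / 2) ^ (m + k))).
  assert (S0 : 0 <= Sm).
  { unfold Sm. replace 0 with (Series (fun _ : nat => 0 * 0)).
    - apply Series_le; [| exact e1]. intros n. split; [lra |].
      rewrite Rmult_0_l. apply Rmult_le_pos; [apply Rlt_le, gbinom_bound_pos, Ap | apply pow_le; lra].
    - rewrite Series_scal_l; ring. }
  exists (2 * ((2 * Rabs h) ^ m * Sm)). split.
  { apply Rmult_le_pos; [lra |]. apply Rmult_le_pos; [| exact S0]. apply pow_le.
    pose proof (Rabs_pos h); lra. }
  intros x hx hh.
  assert (ce : forall j, exists c, expands (pbinom h x j) s0 r (gbinom_bound A j * ((Rabs h / x) ^ j * Rpower x (r - Re s0))) c)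
    by (intros j; apply expands_pbinom; assumption).
  set (cf := fun j => proj1_sig (ClassicalEpsilon.constructive_indefinite_description _ (ce j))).
  assert (hc : forall j, expands (pbinom h x j) s0 r (gbinom_bound A j * ((Rabs h / x) ^ j * Rpower x (r - Re s0))) (cf j)).
  { intros j. unfold cf. destruct ClassicalEpsilon.constructive_indefinite_description; assumption. }
  assert (q : 0 <= Rabs h / x <= 1 / 2).
  { split; [apply Rdiv_le_0_compat; [apply Rabs_pos | lra] |].
    apply Rmult_le_reg_r with x; [lra |]. unfold Rdiv; rewrite Rmult_assoc, Rinv_l; lra. }
  assert (rpp : 0 < Rpower x (r - Re s0)) by apply exp_pos.
  set (M := fun k => (2 * Rabs h) ^ m * Rpower x (r - Re s0 - INR m) * (gbinom_bound A (m + k) * (1 / 2) ^ (m + k))).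
  assert (eM : ex_series M).
  { apply (ex_series_scal ((2 * Rabs h) ^ m * Rpower x (r - Re s0 - INR m))
      (fun k => gbinom_bound A (m + k) * (1 / 2) ^ (m + k))). exact e1. }
  assert (hM : forall k, expands (pbinom h x (m + k)) s0 r (M k) (cf (m + k)%nat)).
  { intros k. eapply expands_le; [| apply hc]. unfold M.
    assert (rx : Rpower x (r - Re s0 - INR m) = Rpower x (r - Re s0) * / x ^ m).
    { unfold Rminus at 1. rewrite Rpower_plus, Rpower_Ropp, Rpower_pow by lra. reflexivity. }
    rewrite rx.
    replace ((2 * Rabs h) ^ m * (Rpower x (r - Re s0) * / x ^ m) * (gbinom_bound A (m + k) * (1 / 2) ^ (m + k)))
      with (gbinom_bound A (m + k) * ((Rabs h / x) ^ m * (1 / 2) ^ k * Rpower x (r - Re s0))).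
    - apply Rmult_le_compat_l; [apply Rlt_le, gbinom_bound_pos, Ap |].
      apply Rmult_le_compat_r; [lra |]. rewrite pow_add. apply Rmult_le_compat_l; [apply pow_le; lra |].
      apply pow_incr; exact q.
    - unfold Rdiv. rewrite !Rpow_mult_distr, !pow_add, !pow1, !pow_inv.
      assert (2 ^ m <> 0) by (apply pow_nonzero; lra). assert (2 ^ k <> 0) by (apply pow_nonzero; lra).
      assert (x ^ m <> 0) by (apply pow_nonzero; lra). field. repeat split; assumption. }
  eexists. eapply expands_le; [| apply (expands_series s0 r rp (fun k => pbinom h x (m + k)) _ M _ hM eM)].
  - right. unfold M. rewrite Series_scal_l. fold Sm. ring.
  - intros s hs. apply (csum_drop (fun j => pbinom h x j s)).
    assert (hv : Rabs (h / x) < 1).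
    { unfold Rdiv. rewrite Rabs_mult, (Rabs_pos_eq (/ x)) by (apply Rlt_le, Rinv_0_lt_compat; lra). unfold Rdiv in q. lra. }
    pose proof (binomial_series (- s) (h / x) hv) as b.
    apply (csum_scal (npow x s)) in b.
    assert (hp : 0 < 1 + h / x) by (apply Rabs_def2 in hv; lra).
    replace (npow (x + h) s) with (npow x s * Cexp (- s * RtoC (ln (1 + h / x))))%C.
    + eapply csum_ext; [| exact b]. intros j. cbn beta. unfold pbinom. rewrite npow_shift by lra.
      unfold Rdiv. rewrite Rpow_mult_distr, RtoC_mult, pow_inv. ring.
    + unfold npow. rewrite <- Cexp_add. f_equal. 
      replace (x + h) with (x * (1 + h / x)) by (field; lra). rewrite ln_mult, RtoC_plus by lra. ring.
Qed.

Fixpoint Lx (l : list (R * R)) (x : R) (s : C) : C :=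
  match l with nil => 0 | p :: t => (RtoC (fst p) * npow (x + snd p) s + Lx t x s)%C end.

Fixpoint moment (l : list (R * R)) (j : nat) : R :=
  match l with nil => 0 | p :: t => fst p * snd p ^ j + moment t j end.

(** What remains of a combination of powers [(x + h)^(-s)] after [m] terms of its expansion at large
    [x]. It has size [x^(- Re s - m)], so its lattice sum converges for [Re s + m > 2]: each
    subtracted term gains a strip of width one. *)
Definition remL (m : nat) (l : list (R * R)) (x : R) (s : C) : C :=
  (Lx l x s - Csum (fun j => gbinom (- s) j * (RtoC (moment l j) * npow x (s + RtoC (INR j)))) m)%C.

Lemma Csum_ext (a b : nat -> C) (n : nat) : (forall i, (i < n)%nat -> a i = b i) -> Csum a n = Csum b n.
Proof.
  induction n as [| n IH]; intros h; simpl; [reflexivity |]. rewrite IH, h; auto.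
Qed.

Lemma Csum_lin (u v : C) (a b : nat -> C) (n : nat) :
  Csum (fun i => u * a i + v * b i)%C n = (u * Csum a n + v * Csum b n)%C.
Proof. induction n as [| n IH]; simpl; [ring |]. rewrite IH; ring. Qed.

Lemma Csum_0 (n : nat) : Csum (fun _ => 0) n = 0.
Proof. induction n as [| n IH]; simpl; [reflexivity |]. rewrite IH; ring. Qed.

Lemma remL_cons (m : nat) p l x s :
  remL m (p :: l) x s = (RtoC (fst p) * (npow (x + snd p) s - Csum (fun j => pbinom (snd p) x j s) m) + remL m l x s)%C.
Proof.
  unfold remL. cbn [Lx moment].
  rewrite (Csum_ext _ (fun j => RtoC (fst p) * pbinom (snd p) x j s +
     1 * (gbinom (- s) j * (RtoC (moment l j) * npow x (s + RtoC (INR j)))))%C).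
  - rewrite Csum_lin. ring.
  - intros j _. unfold pbinom. rewrite RtoC_plus, RtoC_mult. ring.
Qed.

Lemma remL_moments (m : nat) l x s : (forall j, (j < m)%nat -> moment l j = 0) -> remL m l x s = Lx l x s.
Proof.
  intros h. unfold remL. rewrite (Csum_ext _ (fun _ => 0)).
  - rewrite Csum_0. ring.
  - intros j hj. rewrite h by exact hj. ring.
Qed.

Lemma expands_0 (s0 : C) (r : R) : exists c, expands (fun _ => 0) s0 r 0 c.
Proof.
  eexists. eapply expands_le; [| apply (expands_const s0 r 0)]. rewrite Cmod_0; lra.
Qed.

Lemma expands_remL (m : nat) (l : list (R * R)) (s0 : C) (r : R) : 0 < r ->
  exists K X0, 0 <= K /\ 1 <= X0 /\ forall x, X0 <= x ->
    exists c, expands (remL m l x) s0 r (K * Rpower x (r - Re s0 - INR m)) c.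
Proof.
  intros rp. induction l as [| p l (K & X0 & K0 & X1 & IH)].
  - exists 0, 1. split; [lra |]. split; [lra |]. intros x hx.
    destruct (expands_0 s0 r) as [c hc]. exists c. rewrite Rmult_0_l.
    eapply expands_ext; [| exact hc]. intros s hs. unfold remL. cbn [Lx moment].
    rewrite (Csum_ext _ (fun _ => 0)); [rewrite Csum_0; ring | intros; ring].
  - destruct (expands_remainder1 m (snd p) s0 r rp) as (K' & K0' & h).
    exists (Rabs (fst p) * K' + K), (X0 + 2 * Rabs (snd p)).
    pose proof (Rabs_pos (snd p)). pose proof (Rabs_pos (fst p)).
    split; [nra |]. split; [lra |]. intros x hx.
    destruct (h x ltac:(lra) ltac:(lra)) as [c1 h1]. destruct (IH x ltac:(lra)) as [c2 h2].
    eexists. eapply expands_ext; [| eapply expands_le; [| apply (expands_plus s0 r rp _ _ _ _ _ _ (expands_scal s0 r (RtoC (fst p)) _ _ _ h1) h2)]].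
    + intros s hs. cbn beta. rewrite remL_cons. reflexivity.
    + rewrite Cmod_R. right; ring.
Qed.

(** For small [x] the binomial series is out of reach, but only finitely many lattice points are
    concerned and any norm will do for them. *)
Lemma expands_remL_any (m : nat) (l : list (R * R)) (s0 : C) (r x : R) : 0 < r ->
  exists M c, expands (remL m l x) s0 r M c.
Proof.
  intros rp.
  assert (np : forall y, exists M c, expands (npow y) s0 r M c) by (intros y; do 2 eexists; apply (expands_exp s0 r rp (ln y))).
  assert (hm : forall m h, exists M c, expands (fun s => Csum (fun j => pbinom h x j s) m) s0 r M c).
  { clear m. intros m h. induction m as [| m (M & c & IH)].
    - destruct (expands_0 s0 r) as [c hc]. exists 0, c; exact hc.
    - destruct (np x) as (M1 & c1 & h1).
      assert (h2 : exists M c, expands (fun s => npow x (s + RtoC (INR m)))%C s0 r M c).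
      { do 2 eexists. eapply expands_ext; [| apply (expands_scal s0 r (Cexp (- RtoC (INR m) * RtoC (ln x))) _ _ _ h1)].
        intros s hs. cbn beta. unfold npow. rewrite <- Cexp_add. f_equal. ring. }
      destruct h2 as (M2 & c2 & h2).
      destruct (expands_gbinom s0 r _ _ _ m rp (expands_scal s0 r (RtoC (h ^ m)) _ _ _ h2)) as [c3 h3].
      do 2 eexists. apply (expands_plus s0 r rp _ _ _ _ _ _ IH h3). }
  induction l as [| p l (M & c & IH)].
  - destruct (expands_0 s0 r) as [c hc]. exists 0, c.
    eapply expands_ext; [| exact hc]. intros s hs. unfold remL. cbn [Lx moment].
    rewrite (Csum_ext _ (fun _ => 0)); [rewrite Csum_0; ring | intros; ring].
  - destruct (np (x + snd p)) as (M1 & c1 & h1). destruct (hm m (snd p)) as (M2 & c2 & h2).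
    do 2 eexists. eapply expands_ext; [|
      apply (expands_plus s0 r rp _ _ _ _ _ _ (expands_scal s0 r (RtoC (fst p)) _ _ _
        (expands_plus s0 r rp _ _ _ _ _ _ h1 (expands_scal s0 r (-1) _ _ _ h2))) IH)].
    intros s hs. cbn beta. rewrite remL_cons. ring.
Qed.

(** * Iterated double series of complex numbers *)

(** Iterated rather than unordered, to match the form in which [is_barnes_zeta2] prescribes the
    double series. *)
Definition isum (a : nat -> nat -> C) (l : C) : Prop :=
  exists inner, (forall i, csum (a i) (inner i)) /\ csum inner l.

Definition dsum (a : nat -> nat -> C) : C :=
  (Series (fun i => Series (fun j => fst (a i j))), Series (fun i => Series (fun j => snd (a i j)))).

Lemma isum_dsum a l : isum a l -> l = dsum a.
Proof.
  intros (inner & h & k). unfold dsum.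
  rewrite (Series_ext _ (fun i => fst (inner i))) by (intros i; apply is_series_unique, (h i)).
  rewrite (Series_ext (fun i => Series (fun j => snd (a i j))) (fun i => snd (inner i))) by (intros i; apply is_series_unique, (h i)).
  destruct k as [k1 k2]. apply is_series_unique in k1, k2. rewrite k1, k2. destruct l; reflexivity.
Qed.

Lemma isum_ext a b l : (forall i j, a i j = b i j) -> isum a l -> isum b l.
Proof.
  intros e (inner & h & k). exists inner; split; [| exact k]. intros i. eapply csum_ext; [| apply h]. auto.
Qed.

Lemma isum_lin (u v : C) a b l m : isum a l -> isum b m -> isum (fun i j => u * a i j + v * b i j)%C (u * l + v * m)%C.
Proof.
  intros (f & h & k) (g & h' & k'). exists (fun i => u * f i + v * g i)%C. split.
  - intros i. apply csum_plus; apply csum_scal; auto.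
  - apply csum_plus; apply csum_scal; auto.
Qed.

(** If the coefficient norms of the terms are summable over the lattice, two applications of
    [expands_series] show that the double sum is analytic and may be differentiated term by term.
    The bound is asked for outside a finite set only. *)
Lemma lattice_expands (f : nat -> nat -> C -> C) (s0 : C) (r q K : R) (N : nat) :
  0 < r -> 1 < q ->
  (forall i j, (N <= i + j)%nat -> exists c, expands (f i j) s0 r (K * (power_weight q i * power_weight q j)) c) ->
  (forall i j, exists M c, expands (f i j) s0 r M c) ->
  (forall s, Cmod (s - s0) < r -> isum (fun i j => f i j s) (dsum (fun i j => f i j s))) /\
  analytic_at (fun s => dsum (fun i j => f i j s)) s0 /\
  forall dl, (forall i j, cder (f i j) s0 (dl i j)) ->
    isum dl (dsum dl) /\ cder (fun s => dsum (fun i j => f i j s)) s0 (dsum dl).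
Proof.
  intros rp q1 h1 h2.
  set (u := power_weight q). assert (hu : summable_pos u) by (apply power_weight_summable, q1).
  assert (ch : forall i j, exists Mc : R * (nat -> C), expands (f i j) s0 r (fst Mc) (snd Mc) /\
      ((N <= i + j)%nat -> fst Mc <= K * (u i * u j))).
  { intros i j. destruct (le_lt_dec N (i + j)) as [hl | hl].
    - destruct (h1 i j hl) as [c hc]. exists (K * (u i * u j), c). split; [exact hc | intros; simpl; lra].
    - destruct (h2 i j) as (M & c & hc). exists (M, c). split; [exact hc | intros; lia]. }
  set (Mc := fun i j => proj1_sig (ClassicalEpsilon.constructive_indefinite_description _ (ch i j))).
  assert (hMc : forall i j, expands (f i j) s0 r (fst (Mc i j)) (snd (Mc i j)) /\ ((N <= i + j)%nat -> fst (Mc i j) <= K * (u i * u j))).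
  { intros i j. unfold Mc. destruct ClassicalEpsilon.constructive_indefinite_description; assumption. }
  destruct (dominate_all (fun i j => fst (Mc i j)) K N u u) as (K' & Kp & hK).
  { apply hu. } { apply hu. } { intros i j; apply hMc. }
  set (cc := fun i j => snd (Mc i j)).
  assert (hc : forall i j, expands (f i j) s0 r (K' * u i * u j) (cc i j)).
  { intros i j. eapply expands_le; [| apply hMc]. rewrite Rmult_assoc. apply hK. }
  assert (ej : forall i, ex_series (fun j => K' * u i * u j)) by (intros i; apply (ex_series_scal (K' * u i) u), hu).
  set (I := fun i s => (Series (fun j => fst (f i j s)), Series (fun j => snd (f i j s))) : C).
  assert (vb : forall i j s, Cmod (s - s0) < r -> Cmod (f i j s) <= 2 * (K' * u i * u j)).
  { intros i j s hs. pose proof (expands_tail _ _ _ _ _ 0 (s - s0) rp (hc i j) hs) as t.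
    replace (s0 + (s - s0))%C with s in t by ring. simpl in t. rewrite Rmult_1_r in t.
    replace (f i j s - 0)%C with (f i j s) in t by ring. exact t. }
  assert (hI : forall i s, Cmod (s - s0) < r -> csum (fun j => f i j s) (I i s)).
  { intros i s hs. apply (csum_exists (fun j => f i j s) (fun j => 2 * (K' * u i * u j))).
    - apply (ex_series_scal 2 (fun j => K' * u i * u j)), ej.
    - intros j; apply vb, hs. }
  set (ci := fun i k => (Series (fun j => fst (cc i j k)), Series (fun j => snd (cc i j k))) : C).
  assert (eI : forall i, expands (I i) s0 r (2 * (K' * Series u) * u i) (ci i)).
  { intros i. eapply expands_le; [| apply (expands_series s0 r rp (f i) (I i) _ (cc i) (hc i) (ej i))].
    - rewrite Series_scal_l. right; ring.
    - intros s hs. apply hI, hs. }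
  assert (eu : ex_series (fun i => 2 * (K' * Series u) * u i)) by (apply (ex_series_scal (2 * (K' * Series u)) u), hu).
  set (F := fun s => dsum (fun i j => f i j s)).
  assert (hF : forall s, Cmod (s - s0) < r -> csum (fun i => I i s) (F s)).
  { intros s hs. apply (csum_exists (fun i => I i s) (fun i => 2 * (2 * (K' * Series u) * u i))).
    - apply (ex_series_scal 2 (fun i => 2 * (K' * Series u) * u i)), eu.
    - intros i. pose proof (expands_tail _ _ _ _ _ 0 (s - s0) rp (eI i) hs) as t.
      replace (s0 + (s - s0))%C with s in t by ring. simpl in t. rewrite Rmult_1_r in t.
      replace (I i s - 0)%C with (I i s) in t by ring. exact t. }
  pose proof (expands_series s0 r rp I F _ ci eI eu hF) as eF.
  split; [| split].
  - intros s hs. exists (fun i => I i s). split; [intros i; apply hI, hs | apply hF, hs].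
  - eapply expands_analytic; [exact rp | exact eF].
  - intros dl hd.
    assert (ed : forall i j, dl i j = cc i j 1%nat).
    { intros i j. eapply cder_unique; [apply hd |]. eapply expands_cder; [exact rp | apply hc]. }
    assert (rb : forall z M, Cmod z * r ^ 1 <= M -> Cmod z <= / r * M).
    { intros z M hz. simpl in hz. apply Rmult_le_reg_l with r; [exact rp |]. rewrite <- Rmult_assoc, Rinv_r, Rmult_1_l by lra. lra. }
    assert (c1 : forall i, csum (fun j => cc i j 1%nat) (ci i 1%nat)).
    { intros i. apply (csum_exists (fun j => cc i j 1%nat) (fun j => / r * (K' * u i * u j))).
      - apply (ex_series_scal (/ r) (fun j => K' * u i * u j)), ej.
      - intros j. apply rb. apply (expands_coef_le s0 r rp _ _ _ 1 (hc i j)). }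
    assert (c2 : csum (fun i => ci i 1%nat) (Series (fun i => fst (ci i 1%nat)), Series (fun i => snd (ci i 1%nat)))).
    { apply (csum_exists (fun i => ci i 1%nat) (fun i => / r * (2 * (K' * Series u) * u i))).
      - apply (ex_series_scal (/ r) (fun i => 2 * (K' * Series u) * u i)), eu.
      - intros i. apply rb. apply (expands_coef_le s0 r rp _ _ _ 1 (eI i)). }
    assert (is1 : isum dl (Series (fun i => fst (ci i 1%nat)), Series (fun i => snd (ci i 1%nat)))).
    { apply (isum_ext (fun i j => cc i j 1%nat)); [intros; symmetry; apply ed |].
      exists (fun i => ci i 1%nat). split; assumption. }
    pose proof (isum_dsum _ _ is1) as e. rewrite e in is1. split; [exact is1 |].
    rewrite <- e. apply (expands_cder F s0 r _ _ rp eF).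
Qed.

(** * Continuation of the Barnes double zeta function *)

(** As in [is_barnes_zeta2], the first index goes with [1] and the second with [w]; in [logphi] and
    [qterm] it is the first index that goes with the period. *)
Definition latt (z w : R) (i j : nat) : R := INR i + INR j * w + z.

Lemma latt_lower (z w : R) : 0 < z -> 0 < w ->
  exists k, 0 < k /\ forall i j, k * (INR i + INR j + 1) <= latt z w i j.
Proof.
  intros hz hw. exists (Rmin 1 (Rmin w z)).
  pose proof (Rmin_l 1 (Rmin w z)). pose proof (Rmin_r 1 (Rmin w z)).
  pose proof (Rmin_l w z). pose proof (Rmin_r w z).
  split; [repeat apply Rmin_glb_lt; lra |].
  intros i j. pose proof (pos_INR i). pose proof (pos_INR j). unfold latt. nra.
Qed.

Lemma lattice_remL (m : nat) (l : list (R * R)) (z w : R) (s0 : C) :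
  0 < z -> 0 < w -> 2 < Re s0 + INR m ->
  isum (fun i j => remL m l (latt z w i j) s0) (dsum (fun i j => remL m l (latt z w i j) s0)) /\
  analytic_at (fun s => dsum (fun i j => remL m l (latt z w i j) s)) s0 /\
  forall dl, (forall i j, cder (remL m l (latt z w i j)) s0 (dl i j)) ->
    isum dl (dsum dl) /\ cder (fun s => dsum (fun i j => remL m l (latt z w i j) s)) s0 (dsum dl).
Proof.
  intros hz hw hs.
  (* Half of the margin in [Re s0 + m > 2] is spent on the radius; the terms then have exponent
     [- 2 q], and the other half keeps [q > 1]. *)
  set (r := (Re s0 + INR m - 2) / 2). assert (rp : 0 < r) by (unfold r; lra).
  set (q := (Re s0 + INR m - r) / 2). assert (q1 : 1 < q) by (unfold q, r; lra).
  destruct (latt_lower z w hz hw) as (k & kp & hk).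
  destruct (expands_remL m l s0 r rp) as (K & X0 & K0 & X1 & hx).
  destruct (nfloor_ex (X0 / k)) as [N hN]; [apply Rlt_le, Rdiv_lt_0_compat; lra |].
  destruct (lattice_expands (fun i j => remL m l (latt z w i j)) s0 r q (K * Rpower k (- (2 * q))) (S N) rp q1)
    as (h1 & h2 & h3).
  - intros i j hij. pose proof (pos_INR i). pose proof (pos_INR j).
    assert (sp : X0 / k <= INR i + INR j).
    { apply le_INR in hij. rewrite S_INR, plus_INR in hij. lra. }
    assert (xl : X0 <= latt z w i j).
    { eapply Rle_trans; [| apply hk]. apply Rmult_le_compat_l with (r := k) in sp; [| lra].
      replace (k * (X0 / k)) with X0 in sp by (field; lra). lra. }
    destruct (hx _ xl) as [c hc]. exists c. eapply expands_le; [| exact hc].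
    rewrite Rmult_assoc. apply Rmult_le_compat_l; [exact K0 |].
    replace (r - Re s0 - INR m) with (- (2 * q)) by (unfold q; lra).
    apply Rle_trans with (Rpower k (- (2 * q)) * Rpower (INR i + INR j + 1) (- (2 * q))).
    + rewrite Rpower_mult_distr by lra. rewrite !Rpower_Ropp.
      apply Rinv_le_contravar; [apply exp_pos |]. apply Rle_Rpower_l; [lra |]. split; [| apply hk].
      apply Rmult_lt_0_compat; lra.
    + apply Rmult_le_compat_l; [apply Rlt_le, exp_pos |]. apply power_weight_mul; lra.
  - intros i j. apply expands_remL_any, rp.
  - split; [| split; [exact h2 | exact h3]]. apply h1.
    replace (s0 - s0)%C with (RtoC 0) by ring. rewrite Cmod_0. exact rp.
Qed.

Lemma csum_telescope (g : nat -> C) : is_lim_seq (fun n => Cmod (g n)) 0 ->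
  csum (fun n => (g (S n) - g n)%C) (- g 0%nat)%C.
Proof.
  intros h.
  assert (part : forall pr : C -> R, (forall z, Rabs (pr z) <= Cmod z) ->
    (forall a b, pr (a - b)%C = pr a - pr b) -> is_series (fun n => pr (g (S n) - g n)%C) (- pr (g 0%nat))).
  { intros pr hp hl.
    change (is_lim_seq (sum_n (fun n => pr (g (S n) - g n)%C)) (- pr (g 0%nat))).
    apply (is_lim_seq_ext (fun n => pr (g (S n)) - pr (g 0%nat))).
    - intros n. induction n as [| n IH]; [rewrite sum_O, hl; reflexivity |].
      rewrite sum_Sn, <- IH, hl. unfold plus; simpl. ring.
    - replace (- pr (g 0%nat)) with (0 - pr (g 0%nat)) by ring.
      apply is_lim_seq_minus'; [| apply is_lim_seq_const].
      apply (is_lim_seq_incr_1 (fun n => pr (g n))).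
      apply is_lim_seq_abs_0. apply (is_lim_seq_le_le (fun _ => 0) _ (fun n => Cmod (g n))).
      + intros n; split; [apply Rabs_pos | apply hp].
      + apply is_lim_seq_const.
      + exact h. }
  split; [apply (part fst Rabs_fst_le) | apply (part snd Rabs_snd_le)]; intros; reflexivity.
Qed.

Lemma npow_lim (s : C) (x : nat -> R) (k b : R) : 0 < Re s -> 0 < k -> 0 < b -> (forall n, x n = k * INR n + b) ->
  is_lim_seq (fun n => Cmod (npow (x n) s)) 0.
Proof.
  intros hs hk hb hx.
  apply (is_lim_seq_ext (fun n => exp (- Re s * ln (x n)))).
  { intros n. unfold npow. rewrite Cmod_Cexp. f_equal. destruct s; simpl; ring. }
  apply (filterlim_comp _ _ _ (fun n => - Re s * ln (x n)) exp _ (Rbar_locally m_infty)); [| apply is_lim_exp_m].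
  replace m_infty with (Rbar_mult (- Re s) p_infty).
  2:{ simpl; destruct Rle_dec; [exfalso; lra | reflexivity]. }
  apply is_lim_seq_scal_l.
  apply (filterlim_comp _ _ _ x ln _ (Rbar_locally p_infty)); [| apply is_lim_ln_p].
  apply (is_lim_seq_ext (fun n => k * INR n + b)); [intros; symmetry; apply hx |].
  apply (is_lim_seq_plus _ _ p_infty b); [| apply is_lim_seq_const | reflexivity].
  replace p_infty with (Rbar_mult k p_infty).
  2:{ simpl; destruct Rle_dec; [destruct Rle_lt_or_eq_dec; [reflexivity | lra] | exfalso; lra]. }
  apply is_lim_seq_scal_l, is_lim_seq_INR.
Qed.

(** The mixed second difference in the two lattice directions. *)
Definition mixed_diff (w : R) : list (R * R) := (1, 1 + w) :: (-1, 1) :: (-1, w) :: (1, 0) :: nil.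

(** The sum telescopes in [j], then in [i]. Since [Re p > 0] the contributions at infinity vanish
    and only the corner [i = j = 0] survives. *)
Lemma mixed_diff_sum (z w : R) (p : C) : 0 < z -> 0 < w -> 0 < Re p ->
  isum (fun i j => Lx (mixed_diff w) (latt z w i j) p) (npow z p).
Proof.
  intros hz hw hp.
  set (G := fun i j => (npow (latt z w (S i) j) p - npow (latt z w i j) p)%C).
  exists (fun i => (- G i 0%nat)%C). split.
  - intros i. apply (csum_ext (fun j => (G i (S j) - G i j)%C)).
    + intros j. unfold G, mixed_diff. cbn [Lx fst snd].
      replace (latt z w (S i) (S j)) with (latt z w i j + (1 + w)) by (unfold latt; rewrite !S_INR; ring).
      replace (latt z w i (S j)) with (latt z w i j + w) by (unfold latt; rewrite !S_INR; ring).
      replace (latt z w (S i) j) with (latt z w i j + 1) by (unfold latt; rewrite !S_INR; ring).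
      rewrite Rplus_0_r. ring.
    + apply csum_telescope.
      assert (b : forall i, is_lim_seq (fun j => Cmod (npow (latt z w i j) p)) 0).
      { clear i. intros i. apply (npow_lim p _ w (INR i + z)); auto; [pose proof (pos_INR i); lra |].
        intros n; unfold latt; ring. }
      apply (is_lim_seq_le_le (fun _ => 0) _ (fun j => Cmod (npow (latt z w (S i) j) p) + Cmod (npow (latt z w i j) p))).
      * intros j; split; [apply Cmod_ge_0 |]. unfold G. rewrite <- (Cmod_opp (npow (latt z w i j) p)). apply Cmod_triangle.
      * apply is_lim_seq_const.
      * replace (Finite 0) with (Finite (0 + 0)) by (f_equal; ring). apply is_lim_seq_plus'; apply b.
  - apply (csum_ext (fun i => (-1) * (npow (latt z w (S i) 0) p - npow (latt z w i 0) p))%C).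
    + intros i. unfold G. ring.
    + replace (npow z p) with ((-1) * - npow (latt z w 0 0) p)%C.
      * apply csum_scal, (csum_telescope (fun i => npow (latt z w i 0) p)).
        apply (npow_lim p _ 1 z); auto; [lra |]. intros n; unfold latt; simpl (INR 0); ring.
      * replace (latt z w 0 0) with z by (unfold latt; simpl; ring). ring.
Qed.

Definition bzeta (z w : R) (s : C) : C := dsum (fun i j => npow (latt z w i j) s).

(** With one point and no term subtracted, the remainder is the summand of the zeta function itself;
    the half plane of convergence is thus the case [m = 0] of [lattice_remL]. *)
Lemma remL_single (x : R) (s : C) : remL 0 ((1, 0) :: nil) x s = npow x s.
Proof. unfold remL. simpl. rewrite Rplus_0_r. ring. Qed.

Lemma dsum_ext a b : (forall i j, a i j = b i j) -> dsum a = dsum b.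
Proof.
  intros h. unfold dsum. f_equal; apply Series_ext; intros i; apply Series_ext; intros j; now rewrite h.
Qed.

Lemma bzeta_isum (z w : R) (s : C) : 0 < z -> 0 < w -> 2 < Re s ->
  isum (fun i j => npow (latt z w i j) s) (bzeta z w s).
Proof.
  intros hz hw hs. destruct (lattice_remL 0 ((1, 0) :: nil) z w s hz hw) as [h _]; [simpl; lra |].
  unfold bzeta. rewrite <- (dsum_ext _ _ (fun i j => remL_single (latt z w i j) s)).
  eapply isum_ext; [| exact h]. intros; apply remL_single.
Qed.

Lemma bzeta_analytic (z w : R) (s : C) : 0 < z -> 0 < w -> 2 < Re s -> analytic_at (bzeta z w) s.
Proof.
  intros hz hw hs. destruct (lattice_remL 0 ((1, 0) :: nil) z w s hz hw) as (_ & h & _); [simpl; lra |].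
  eapply (analytic_ext_loc _ _ _ 1); [lra | | exact h]. intros s' _. apply dsum_ext. intros; apply remL_single.
Qed.

Lemma analytic_mul_lin (a : C) f s0 : analytic_at f s0 -> analytic_at (fun s => (s - a) * f s)%C s0.
Proof.
  intros hf. apply analytic_expands in hf. destruct hf as (r & M & c & rp & hf).
  exact (expands_analytic _ _ _ _ _ rp (expands_mul_lin s0 r rp a f M c hf)).
Qed.

Lemma analytic_div_lin (a : C) f s0 : s0 <> a -> analytic_at f s0 -> analytic_at (fun s => f s / (s - a))%C s0.
Proof.
  intros ne hf. apply analytic_expands in hf. destruct hf as (r & M & c & rp & hf).
  assert (p : 0 < Cmod (s0 - a)).
  { apply Cmod_gt_0. intros e. apply ne. replace s0 with (s0 - a + a)%C by ring. rewrite e; ring. }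
  set (r' := Rmin r (Cmod (s0 - a) / 2)). assert (rp' : 0 < r') by (apply Rmin_glb_lt; lra).
  pose proof (Rmin_l r (Cmod (s0 - a) / 2)). pose proof (Rmin_r r (Cmod (s0 - a) / 2)).
  assert (hf' : expands f s0 r' M c) by (eapply expands_shrink; [| exact hf]; unfold r' in *; lra).
  refine (expands_analytic _ _ _ _ _ rp' (expands_div_lin s0 r' rp' a f M c _ hf')). unfold r' in *; lra.
Qed.

Lemma analytic_shift (a : C) f s0 : analytic_at f (s0 + a)%C -> analytic_at (fun s => f (s + a)%C) s0.
Proof.
  intros (c & r & rp & h). exists c, r. split; [exact rp |]. intros s hs.
  specialize (h (s + a)%C). replace (s + a - (s0 + a))%C with (s - s0)%C in h by ring. auto.
Qed.

Lemma analytic_npow x s0 : analytic_at (npow x) s0.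
Proof. exact (expands_analytic _ _ _ _ _ Rlt_0_1 (expands_exp s0 1 Rlt_0_1 (ln x))). Qed.

Lemma analytic_Csum (f : nat -> C -> C) s0 n : (forall i, (i < n)%nat -> analytic_at (f i) s0) ->
  analytic_at (fun s => Csum (fun i => f i s) n) s0.
Proof.
  intros h. induction n as [| n IH].
  - apply (analytic_ext_loc (fun s => 0 * npow 1 s)%C _ _ 1); [lra | intros; simpl; ring |].
    apply analytic_scal, analytic_npow.
  - simpl. apply analytic_plus; [apply IH; intros; apply h; lia | apply h; lia].
Qed.

Lemma analytic_gbinom (a : C) (f : C -> C) s0 j : analytic_at f s0 ->
  analytic_at (fun s => gbinom (a - s) j * f s)%C s0.
Proof.
  intros hf. induction j as [| j IH].
  - apply (analytic_ext_loc f _ _ 1); [lra | intros; simpl; ring | exact hf].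
  - assert (nz : RtoC (INR (S j)) <> 0) by (intros q; apply RtoC_inj in q; apply (not_0_INR (S j)); auto).
    apply (analytic_ext_loc (fun s => (- / RtoC (INR (S j))) * ((s - (a - RtoC (INR j))) * (gbinom (a - s) j * f s)))%C _ _ 1); [lra | |].
    + intros s _. change (gbinom (a - s) (S j)) with (gbinom (a - s) j * (a - s - RtoC (INR j)) / RtoC (INR (S j)))%C.
      field. exact nz.
    + apply analytic_scal, analytic_mul_lin, IH.
Qed.

(** [(s - 1) (s - 2) zeta_2(s)] extends to [Re s > 2 - k]. *)
Definition extends_to (z w : R) (k : nat) (H : C -> C) : Prop :=
  (forall s, 2 - INR k < Re s -> analytic_at H s) /\
  (forall s, 2 < Re s -> H s = ((s - 1) * ((s - 2) * bzeta z w s))%C).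

Lemma isum_Csum (c : nat -> C) (a : nat -> nat -> nat -> C) (l : nat -> C) (n : nat) :
  (forall k, (k < n)%nat -> isum (a k) (l k)) ->
  isum (fun i j => Csum (fun k => c k * a k i j)%C n) (Csum (fun k => c k * l k)%C n).
Proof.
  intros h. induction n as [| n IH].
  - exists (fun _ => 0). split; [intros i |]; apply csum_const_0.
  - simpl. eapply isum_ext; [| replace (Csum (fun k => c k * l k)%C n + c n * l n)%C
      with (1 * Csum (fun k => c k * l k)%C n + c n * l n)%C by ring; apply isum_lin; [apply IH; intros; apply h; lia | apply h; lia]].
    intros; cbn beta; ring.
Qed.

Lemma Csum_shift (a : nat -> C) (n : nat) : Csum a (S n) = (a 0%nat + Csum (fun i => a (S i)) n)%C.
Proof. induction n as [| n IH]; [simpl; ring |]. cbn [Csum] in *. rewrite IH. ring. Qed.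

Lemma gbinom_SS (p : C) (i : nat) :
  gbinom p (S (S i)) = (gbinom p i * ((p - RtoC (INR i)) * (p - RtoC (INR (S i)))) / (RtoC (INR (S i)) * RtoC (INR (S (S i)))))%C.
Proof.
  change (gbinom p (S (S i))) with (gbinom p i * (p - RtoC (INR i)) / RtoC (INR (S i)) * (p - RtoC (INR (S i))) / RtoC (INR (S (S i))))%C.
  field. split; intros q; apply RtoC_inj in q; eapply not_0_INR; try exact q; auto.
Qed.

(** Take [p = s - 2] in [mixed_diff_sum] and expand to order [k + 3]. The moments [0] and [1]
    vanish, and the term of order [m + 2] is a multiple of [zeta_2(s + m)] whose binomial
    coefficient contains [(s + m - 1) (s + m - 2)], exactly the factor that makes it a multiple of
    [H(s + m)]. The second moment is [2 w], so the term [m = 0] is [w H(s)]; solving for it leaves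
    values of [H] further to the right and a remainder that converges in the larger half plane. *)
Lemma extension_step (z w : R) (k : nat) (H : C -> C) : 0 < z -> 0 < w ->
  extends_to z w k H -> exists H', extends_to z w (S k) H'.
Proof.
  intros hz hw [h1 h2].
  set (l := mixed_diff w).
  set (R0 := fun s => dsum (fun i j => remL (S (S (S k))) l (latt z w i j) s)).
  set (b := fun i => (RtoC (moment l (S (S i))) / (RtoC (INR (S i)) * RtoC (INR (S (S i)))))%C).
  assert (nz : forall i, RtoC (INR (S i)) <> 0) by (intros i q; apply RtoC_inj in q; apply (not_0_INR (S i)); auto).
  assert (wz : RtoC w <> 0) by (intros q; apply RtoC_inj in q; lra).
  set (T := fun i s => (b i * (gbinom (2 - s) i * H (s + RtoC (INR i))))%C).
  exists (fun s => / RtoC w * (npow z (s + - (2)) - R0 (s + - (2))%C - Csum (fun i => T (S i) s) k))%C.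
  split.
  - intros s hs. rewrite S_INR in hs.
    apply analytic_scal, analytic_minus; [apply analytic_minus |].
    + apply (analytic_shift (- (2)) (npow z)), analytic_npow.
    + apply (analytic_shift (- (2)) R0).
      destruct (lattice_remL (S (S (S k))) l z w (s + - (2))%C hz hw) as (_ & h & _); [| exact h].
      rewrite !S_INR. destruct s; simpl in *; lra.
    + apply analytic_Csum. intros i hi. unfold T. apply analytic_scal, analytic_gbinom.
      apply (analytic_shift (RtoC (INR (S i))) H). apply h1.
      rewrite S_INR. pose proof (pos_INR i). destruct s; simpl in *; lra.
  - intros s hs.
    set (p := (s + - (2))%C). assert (hp : 0 < Re p) by (unfold p; destruct s; simpl in *; lra).
    destruct (lattice_remL (S (S (S k))) l z w p hz hw) as (i1 & _ & _).
    { rewrite !S_INR. pose proof (pos_INR k). lra. }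
    fold (R0 p) in i1.
    pose proof (mixed_diff_sum z w p hz hw hp) as i2. fold l in i2.
    set (cf := fun i => (gbinom (- p) (S (S i)) * RtoC (moment l (S (S i))))%C).
    assert (i3 : isum (fun i j => Csum (fun m => cf m * npow (latt z w i j) (s + RtoC (INR m)))%C (S k))
       (Csum (fun m => cf m * bzeta z w (s + RtoC (INR m)))%C (S k))).
    { apply (isum_Csum cf (fun m i j => npow (latt z w i j) (s + RtoC (INR m)))). intros m _.
      apply bzeta_isum; auto. pose proof (pos_INR m). destruct s; simpl in *; lra. }
    pose proof (isum_lin 1 (-1) _ _ _ _ i2 i3) as i4.
    assert (e : R0 p = (npow z p - Csum (fun m => cf m * bzeta z w (s + RtoC (INR m)))%C (S k))%C).
    { rewrite (isum_dsum _ _ i1). rewrite (dsum_ext _ (fun i j => (1 * Lx l (latt z w i j) p + -1 * Csum (fun m => cf m * npow (latt z w i j) (s + RtoC (INR m))) (S k))%C)).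
      - rewrite <- (isum_dsum _ _ i4). ring.
      - intros i j. unfold remL. rewrite Csum_shift, Csum_shift.
        replace (moment l 0) with 0 by (unfold l, mixed_diff; simpl; ring).
        replace (moment l 1) with 0 by (unfold l, mixed_diff; simpl; ring).
        rewrite (Csum_ext _ (fun m => cf m * npow (latt z w i j) (s + RtoC (INR m)))%C).
        + ring.
        + intros m hm. unfold cf. replace (p + RtoC (INR (S (S m))))%C with (s + RtoC (INR m))%C.
          * ring.
          * unfold p. rewrite !S_INR, !RtoC_plus. ring. }
    assert (eT : forall m, (cf m * bzeta z w (s + RtoC (INR m)))%C = T m s).
    { intros m. unfold T, cf, b. rewrite h2.
      2:{ pose proof (pos_INR m). destruct s; simpl in *; lra. }
      rewrite gbinom_SS. replace (2 - s)%C with (- p)%C by (unfold p; ring).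
      replace (- p - RtoC (INR m))%C with (- (s + RtoC (INR m) - 2))%C by (unfold p; ring).
      replace (- p - RtoC (INR (S m)))%C with (- (s + RtoC (INR m) - 1))%C by (unfold p; rewrite S_INR, RtoC_plus; ring).
      field. split; apply nz. }
    rewrite e, (Csum_ext _ (fun m => T m s)) by (intros; apply eT).
    rewrite Csum_shift.
    assert (t0 : T 0%nat s = (RtoC w * H s)%C).
    { unfold T, b. simpl (gbinom _ 0). simpl (INR 0). replace (s + RtoC 0)%C with s by ring.
      replace (moment l 2) with (2 * w) by (unfold l, mixed_diff; simpl; ring).
      simpl (INR 1). replace (INR 2) with 2 by (simpl; ring). rewrite RtoC_mult. field. }
    rewrite t0. rewrite <- h2 by exact hs. field. exact wz.
Qed.

Lemma extension_exists (z w : R) : 0 < z -> 0 < w -> forall k, exists H, extends_to z w k H.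
Proof.
  intros hz hw k. induction k as [| k [H hH]].
  - exists (fun s => (s - 1) * ((s - 2) * bzeta z w s))%C. split; [| reflexivity].
    intros s hs. simpl in hs. apply (analytic_mul_lin 1 (fun s => (s - 2) * bzeta z w s)%C), analytic_mul_lin, bzeta_analytic; lra.
  - exact (extension_step z w k H hz hw hH).
Qed.

Lemma extension_agree (z w : R) (k k' : nat) (H H' : C -> C) : extends_to z w k H -> extends_to z w k' H' ->
  forall s, 2 - INR k < Re s -> 2 - INR k' < Re s -> H s = H' s.
Proof.
  intros [h1 h2] [h1' h2'] s hs hs'.
  (* Far enough to the right that [Re p >= 4], so the unit disc at [p] lies in the half plane where
     both functions are given by the series. *)
  pose (q := s). pose (p := (s + RtoC (Rabs (Re s) + 4))%C).
  pose proof (Rabs_pos (Re s)). pose proof (Rle_abs (- Re s)) as ab. rewrite Rabs_Ropp in ab.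
  assert (z0 : (H s - H' s)%C = 0).
  { destruct (identity_segment (fun s => H s - H' s)%C p q) as (r & rp & hr).
    - intros t ht.
      assert (e : 0 <= (1 - t) * (Rabs (Re s) + 4)) by (apply Rmult_le_pos; lra).
      assert (re : Re s <= Re (p + RtoC t * (q - p))).
      { unfold p, q. destruct s as [x y]. simpl in *. lra. }
      apply analytic_minus; [apply h1 | apply h1']; lra.
    - unfold p, q. intros e'. apply (f_equal fst) in e'. destruct s; simpl in *; lra.
    - exists 1. split; [lra |]. intros s' hs2.
      assert (2 < Re s').
      { pose proof (Rabs_fst_le (s' - p)) as b. unfold p in b. destruct s as [x y], s' as [x' y']. simpl in *.
        assert (b' : Rabs (x' + - (x + (Rabs x + 4))) < 1) by (eapply Rle_lt_trans; [exact b | unfold p in hs2; exact hs2]).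
        apply Rabs_def2 in b'. lra. }
      rewrite h2, h2' by assumption. ring.
    - apply hr. unfold q. replace (s - s)%C with (RtoC 0) by ring. rewrite Cmod_0; exact rp. }
  replace (H s) with (H s - H' s + H' s)%C by ring. rewrite z0. ring.
Qed.

Lemma barnes_zeta2_exists (z w : R) : 0 < z -> 0 < w -> exists F, is_barnes_zeta2 z w F.
Proof.
  intros hz hw.
  set (Hk := fun k => proj1_sig (ClassicalEpsilon.constructive_indefinite_description _ (extension_exists z w hz hw k))).
  assert (hk : forall k, extends_to z w k (Hk k)).
  { intros k. unfold Hk. destruct ClassicalEpsilon.constructive_indefinite_description; assumption. }
  assert (kf : forall x, exists k, 2 - INR k < x).
  { intros x. destruct (nfloor_ex (Rabs (2 - x))) as [n hn]; [apply Rabs_pos |].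
    exists (S n). rewrite S_INR. pose proof (Rle_abs (2 - x)). lra. }
  set (ks := fun s : C => proj1_sig (ClassicalEpsilon.constructive_indefinite_description _ (kf (Re s)))).
  assert (hks : forall s, 2 - INR (ks s) < Re s).
  { intros s. unfold ks. destruct ClassicalEpsilon.constructive_indefinite_description; assumption. }
  exists (fun s => Hk (ks s) s / (s - 1) / (s - 2))%C. split.
  - intros s n1 n2.
    (* The level [ks s'] may jump with [s']. On the disc contained in the half plane of the fixed
       level [ks s], all levels give the same value. *)
    apply (analytic_ext_loc (fun s' => Hk (ks s) s' / (s' - 1) / (s' - 2))%C _ _ (Re s - (2 - INR (ks s)))).
    + specialize (hks s). lra.
    + intros s' hs'. do 2 f_equal. apply (extension_agree z w (ks s) (ks s')); auto.
      pose proof (Rabs_fst_le (s' - s)) as b.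
      assert (b' : Rabs (fst (s' - s)%C) < Re s - (2 - INR (ks s))) by lra.
      apply Rabs_def2 in b'. destruct s, s'; simpl in *; lra.
    + apply analytic_div_lin; [exact n2 |]. apply (analytic_div_lin 1 (Hk (ks s))); [exact n1 |]. apply hk, hks.
  - intros s hs. destruct (bzeta_isum z w s hz hw hs) as (inner & i1 & i2).
    exists inner. split.
    + intros m. apply csum_is_series. exact (i1 m).
    + apply csum_is_series. replace (Hk (ks s) s / (s - 1) / (s - 2))%C with (bzeta z w s); [exact i2 |].
      rewrite (proj2 (hk (ks s)) s hs). field.
      split; intros e; apply (f_equal Re) in e; destruct s; simpl in *; lra.
Qed.

(** * The double sine function *)

Lemma barnes_zeta2_spec (z w : R) : 0 < z -> 0 < w -> is_barnes_zeta2 z w (barnes_zeta2 z w).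
Proof.
  intros hz hw. unfold barnes_zeta2. apply ClassicalEpsilon.epsilon_spec, barnes_zeta2_exists; assumption.
Qed.

Lemma barnes_zeta2_bzeta (z w : R) (s : C) : 0 < z -> 0 < w -> 2 < Re s -> barnes_zeta2 z w s = bzeta z w s.
Proof.
  intros hz hw hs. destruct (proj2 (barnes_zeta2_spec z w hz hw) s hs) as (inner & h1 & h2).
  apply isum_dsum. exists inner. split; [intros i |]; apply csum_is_series; [exact (h1 i) | exact h2].
Qed.

Lemma barnes_zeta2_analytic (z w : R) (s : C) : 0 < z -> 0 < w -> s <> 1 -> s <> 2 -> analytic_at (barnes_zeta2 z w) s.
Proof. intros hz hw h1 h2. apply (proj1 (barnes_zeta2_spec z w hz hw)); assumption. Qed.

Lemma barnes_zeta2_cder (z w : R) : 0 < z -> 0 < w -> cder (barnes_zeta2 z w) 0 (C_derive (barnes_zeta2 z w) 0).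
Proof.
  intros hz hw. destruct (analytic_cder (barnes_zeta2 z w) 0) as [l hl].
  - apply barnes_zeta2_analytic; auto; intros e; apply RtoC_inj in e; lra.
  - rewrite (cder_C_derive _ _ _ hl). exact hl.
Qed.

(** The path [3 -> 3 + i -> i -> 0] avoids the poles [1] and [2]. *)
Lemma vanish_near_0 (G : C -> C) :
  (forall s, -1 < Re s -> s <> 1 -> s <> 2 -> analytic_at G s) ->
  (forall s, 2 < Re s -> G s = 0) ->
  exists r, 0 < r /\ forall s, Cmod (s - 0) < r -> G s = 0.
Proof.
  intros ha hz.
  assert (n1 : forall s : C, Im s <> 0 \/ (Re s <> 1 /\ Re s <> 2) -> s <> 1 /\ s <> 2).
  { intros [x y] h; simpl in h. split; intros e; pose proof (f_equal fst e) as e1; pose proof (f_equal snd e) as e2; simpl in *; tauto. }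
  assert (h1 : exists r, 0 < r /\ forall s, Cmod (s - (3, 1)) < r -> G s = 0).
  { apply (identity_segment G (3, 0) (3, 1)).
    - intros t ht. destruct (n1 ((3, 0) + RtoC t * ((3, 1) - (3, 0)))%C); [right; simpl; lra |].
      apply ha; auto. simpl; lra.
    - intros e. injection e; lra.
    - exists 1. split; [lra |]. intros s hs. apply hz.
      pose proof (Rabs_fst_le (s - (3, 0))) as b. destruct s as [x y]. simpl in *.
      assert (b' : Rabs (x + - (3)) < 1) by lra. apply Rabs_def2 in b'. lra. }
  assert (h2 : exists r, 0 < r /\ forall s, Cmod (s - (0, 1)) < r -> G s = 0).
  { apply (identity_segment G (3, 1) (0, 1)); [| intros e; injection e; lra | exact h1].
    intros t ht. destruct (n1 ((3, 1) + RtoC t * ((0, 1) - (3, 1)))%C); [left; simpl; lra |].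
    apply ha; auto. simpl; lra. }
  apply (identity_segment G (0, 1) 0); [| intros e; injection e; lra | exact h2].
  intros t ht. destruct (n1 ((0, 1) + RtoC t * (0 - (0, 1)))%C); [right; simpl; lra |].
  apply ha; auto. simpl; lra.
Qed.

Lemma npow_cder_0 (x : R) : cder (npow x) 0 (RtoC (- ln x)).
Proof.
  pose proof (expands_cder _ _ _ _ _ Rlt_0_1 (expands_exp 0 1 Rlt_0_1 (ln x))) as h.
  simpl in h. replace (RtoC (- ln x)) with (Cexp (- 0 * RtoC (ln x)) * (RtoC (- ln x) * 1 / 1))%C; [exact h |].
  replace (- 0 * RtoC (ln x))%C with (RtoC 0) by ring. rewrite Cexp_0. field.
Qed.

Lemma npow_0 (x : R) : npow x 0 = 1.
Proof. unfold npow. replace (- 0 * RtoC (ln x))%C with (RtoC 0) by ring. apply Cexp_0. Qed.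

Lemma npow_mult (x y : R) (s : C) : 0 < x -> 0 < y -> npow (x * y) s = (npow x s * npow y s)%C.
Proof. intros hx hy. unfold npow. rewrite <- Cexp_add, ln_mult, RtoC_plus by assumption. f_equal. ring. Qed.

Lemma Cmod_npow (x : R) (s : C) : Cmod (npow x s) = Rpower x (- Re s).
Proof. unfold npow, Rpower. rewrite Cmod_Cexp. f_equal. destruct s; simpl; ring. Qed.

(** The exponential is expanded at [s0] and [expands_series] is applied to the multiples
    [(s - s0)^k f], which replaces a Cauchy product of two power series. *)
Lemma analytic_mul_npow (x : R) (f : C -> C) (s0 : C) : analytic_at f s0 -> analytic_at (fun s => npow x s * f s)%C s0.
Proof.
  intros hf. apply analytic_expands in hf. destruct hf as (r & M & c & rp & hf).
  pose proof (expands_nonneg _ _ _ _ _ hf) as M0.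
  set (l := - ln x).
  assert (pw : forall k, exists c, expands (fun s => (s - s0) ^ k * f s)%C s0 r (r ^ k * M) c).
  { intros k. induction k as [| k [c' IH]].
    - exists c. simpl. rewrite Rmult_1_l. eapply expands_ext; [| exact hf]. intros; cbn beta; ring.
    - eexists. eapply expands_ext; [| eapply expands_le; [| apply (expands_mul_lin s0 r rp s0 _ _ _ IH)]].
      + intros s hs. cbn beta. simpl. ring.
      + replace (s0 - s0)%C with (RtoC 0) by ring. rewrite Cmod_0. simpl. right; ring. }
  set (cf := fun k => proj1_sig (ClassicalEpsilon.constructive_indefinite_description _ (pw k))).
  assert (hc : forall k, expands (fun s => (s - s0) ^ k * f s)%C s0 r (r ^ k * M) (cf k)).
  { intros k. unfold cf. destruct ClassicalEpsilon.constructive_indefinite_description; assumption. }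
  assert (nz : forall n, RtoC (INR (fact n)) <> 0).
  { intros n h; apply RtoC_inj in h; apply (INR_fact_neq_0 n h). }
  pose proof (fun k => expands_scal s0 r (RtoC l ^ k / RtoC (INR (fact k)))%C _ _ _ (hc k)) as hk.
  assert (eM : ex_series (fun k => Cmod (RtoC l ^ k / RtoC (INR (fact k)))%C * (r ^ k * M))).
  { apply (ex_series_ext (fun k => (Rabs l * r) ^ k / INR (fact k) * M)).
    - intros k. rewrite Cmod_div, Cmod_pow, !Cmod_R, (Rabs_pos_eq (INR _)) by (try apply nz; apply pos_INR).
      rewrite Rpow_mult_distr. unfold Rdiv. rewrite !Rmult_assoc. f_equal. rewrite <- !Rmult_assoc. f_equal. apply Rmult_comm.
    - apply (ex_series_scal_r M (fun k => (Rabs l * r) ^ k / INR (fact k))). eexists; apply exp_series. }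
  assert (hs : forall s, Cmod (s - s0) < r ->
    csum (fun k => RtoC l ^ k / RtoC (INR (fact k)) * ((s - s0) ^ k * f s))%C (Cexp (RtoC l * (s - s0)) * f s)%C).
  { intros s _. pose proof (csum_scal (f s) _ _ (Cexp_series (RtoC l * (s - s0)))) as h.
    rewrite Cmult_comm. eapply csum_ext; [| exact h]. intros k; cbn beta. rewrite Cpow_mult_l. field. apply nz. }
  pose proof (expands_scal s0 r (npow x s0) _ _ _
    (expands_series s0 r rp _ (fun s => Cexp (RtoC l * (s - s0)) * f s)%C _ _ hk eM hs)) as h.
  apply (expands_analytic _ _ _ _ _ rp) in h.
  eapply (analytic_ext_loc _ _ _ 1); [lra | | exact h].
  intros s _. cbn beta. rewrite Cmult_assoc. f_equal. unfold npow, l. rewrite <- Cexp_add. f_equal. rewrite RtoC_opp. ring.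
Qed.

Lemma npow_scaled_summable (k : R) (s : C) : 0 < k -> 1 < Re s ->
  exists l, csum (fun i => npow (k * (INR i + 1)) s) l.
Proof.
  intros hk hs. eexists. apply (csum_exists _ (fun i => Rpower k (- Re s) * power_weight (Re s) i)).
  - apply (ex_series_scal (Rpower k (- Re s)) (power_weight (Re s))). apply power_weight_summable, hs.
  - intros i. rewrite Cmod_npow. unfold power_weight. pose proof (pos_INR i).
    rewrite Rpower_mult_distr by lra. lra.
Qed.

(** * Half-integer zeta functions at [0] *)

Definition second_diff (h : R) : list (R * R) := (1, - h) :: (-2, 0) :: (1, h) :: nil.

(** Half-integer zeta function: [P(s) = k^(-s) (2^s - 1) zeta(s)]. *)
Lemma half_integer_cder (k : R) (P : C -> C) : 0 < k ->
  (forall s, -1 < Re s -> s <> 1 -> s <> 2 -> analytic_at P s) ->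
  (forall s, 2 < Re s -> csum (fun n => npow (k * (INR n + / 2)) s) (P s)) ->
  cder P 0 (RtoC (- / 2 * ln 2)).
Proof.
  intros hk hP hsum.
  set (l := second_diff (k / 2)).
  (* A simple series written as a double one supported on [j = 0], so that [lattice_expands] covers
     it. *)
  set (g := fun i j s => match j with O => remL 2 l (k * (INR i + 1)) s | _ => RtoC 0 end).
  set (E2 := fun s => dsum (fun i j => g i j s)).
  assert (hE : forall s0, -1 < Re s0 -> csum (fun i => remL 2 l (k * (INR i + 1)) s0) (E2 s0) /\ analytic_at E2 s0).
  { intros s0 hs. set (r := (Re s0 + 1) / 2). assert (rp : 0 < r) by (unfold r; lra).
    set (q := Re s0 + 2 - r). assert (q1 : 1 < q) by (unfold q, r; lra).
    destruct (expands_remL 2 l s0 r rp) as (K & X0 & K0 & X1 & hx).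
    destruct (nfloor_ex (X0 / k)) as [N hN]; [apply Rlt_le, Rdiv_lt_0_compat; lra |].
    destruct (lattice_expands g s0 r q (K * Rpower k (- q)) (S N) rp q1) as (h1 & h2 & _).
    - intros i [| j] hij.
      + pose proof (pos_INR i).
        assert (xl : X0 <= k * (INR i + 1)).
        { apply le_INR in hij. rewrite S_INR, Nat.add_0_r in hij.
          apply Rle_trans with (k * (X0 / k)); [right; field; lra |]. apply Rmult_le_compat_l; lra. }
        destruct (hx _ xl) as [c hc]. exists c. eapply expands_le; [| exact hc].
        rewrite Rmult_assoc. apply Rmult_le_compat_l; [exact K0 |].
        replace (r - Re s0 - INR 2) with (- q) by (unfold q; simpl; ring).
        replace (power_weight q 0) with 1.
        2:{ unfold power_weight, Rpower. simpl. rewrite Rplus_0_l, ln_1, Rmult_0_r, exp_0. reflexivity. }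
        unfold power_weight. rewrite Rmult_1_r, Rpower_mult_distr by lra. lra.
      + destruct (expands_0 s0 r) as [c hc]. exists c. eapply expands_le; [| exact hc].
        assert (0 < power_weight q i) by apply power_weight_pos. assert (0 < power_weight q (S j)) by apply power_weight_pos.
        assert (0 < Rpower k (- q)) by apply exp_pos.
        apply Rmult_le_pos; [apply Rmult_le_pos; lra | apply Rmult_le_pos; lra].
    - intros i [| j]; [apply expands_remL_any, rp |]. destruct (expands_0 s0 r) as [c hc]. exists 0, c. exact hc.
    - split; [| exact h2].
      destruct (h1 s0) as (inner & i1 & i2).
      { replace (s0 - s0)%C with (RtoC 0) by ring. rewrite Cmod_0. exact rp. }
      eapply csum_ext; [| exact i2]. intros i. cbn beta.
      apply (csum_unique _ _ _ (i1 i)). apply csum_decr_1. simpl.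
      replace (remL 2 l (k * (INR i + 1)) s0 - remL 2 l (k * (INR i + 1)) s0)%C with (RtoC 0) by ring.
      apply csum_const_0. }
  (* For [Re s > 2] this is the alternating sum of [(k (n + 1) / 2)^(-s)]. Written as half its first
     term plus half the second differences, it converges for [Re s > -1]. *)
  set (eta := fun s => (RtoC (/ 2) * (npow (k / 2) s + E2 s))%C).
  assert (rl : forall x s, remL 2 l x s = (npow (x - k / 2) s - 2 * npow x s + npow (x + k / 2) s)%C).
  { intros x s. rewrite remL_moments.
    - unfold l, second_diff. cbn [Lx fst snd]. rewrite Rplus_0_r. unfold Rminus. ring.
    - intros [| [| j]] hj; [simpl; ring | simpl; ring | lia]. }
  (* With [T = 2^(-s)] and [Z] the sum over all multiples of [k / 2], the even multiples give
     [Ev = T Z], the odd ones [P = (1 - T) Z], and [eta = P - Ev = (1 - 2 T) Z]. *)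
  assert (main : forall s, 2 < Re s -> ((1 - 2 * npow 2 s) * P s)%C = ((1 - npow 2 s) * eta s)%C).
  { intros s hs. specialize (hsum s hs).
    destruct (npow_scaled_summable k s hk ltac:(lra)) as [Ev hEv].
    destruct (npow_scaled_summable (k / 2) s ltac:(lra) ltac:(lra)) as [Z hZ].
    assert (e1 : E2 s = (P s - 2 * Ev + (P s - npow (k / 2) s))%C).
    { destruct (hE s ltac:(lra)) as [hE2 _]. apply (csum_unique _ _ _ hE2).
      pose proof (csum_incr_1 _ _ hsum) as h. cbn beta in h.
      replace (k * (INR 0 + / 2)) with (k / 2) in h by (simpl; field).
      eapply csum_ext; [| exact (csum_plus _ _ _ _ (csum_minus _ _ _ _ hsum (csum_scal 2 _ _ hEv)) h)].
      intros i. cbn beta. rewrite rl. rewrite S_INR. f_equal; [f_equal |]; f_equal; field. }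
    assert (e2 : Ev = (npow 2 s * Z)%C).
    { apply (csum_unique _ _ _ hEv). eapply csum_ext; [| apply (csum_scal (npow 2 s) _ _ hZ)].
      intros i. cbn beta. pose proof (pos_INR i). rewrite <- npow_mult by (try lra; apply Rmult_lt_0_compat; lra). f_equal. field. }
    assert (e3 : Z = (P s + Ev)%C).
    { assert (ev : forall i, (k / 2 * (INR (2 * i) + 1)) = k * (INR i + / 2)).
      { intros i. rewrite mult_INR. simpl. field. }
      assert (od : forall i, (k / 2 * (INR (2 * i + 1) + 1)) = k * (INR i + 1)).
      { intros i. rewrite plus_INR, mult_INR. simpl. field. }
      assert (part : forall pr : C -> R, (forall a b, pr (a + b)%C = pr a + pr b) ->
        is_series (fun i => pr (npow (k / 2 * (INR i + 1)) s)) (pr Z) ->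
        is_series (fun i => pr (npow (k * (INR i + / 2)) s)) (pr (P s)) ->
        is_series (fun i => pr (npow (k * (INR i + 1)) s)) (pr Ev) -> pr Z = pr (P s + Ev)%C).
      { intros pr hpr hz ho he. rewrite hpr.
        rewrite <- (is_series_unique _ _ hz), <- (is_series_unique _ _ ho), <- (is_series_unique _ _ he).
        rewrite (Series_even_odd (fun i => pr (npow (k / 2 * (INR i + 1)) s))).
        - f_equal; apply Series_ext; intros i; [rewrite ev | rewrite od]; reflexivity.
        - eexists; exact hz.
        - eexists. eapply is_series_ext; [| exact ho]. intros i; cbn beta; now rewrite ev.
        - eexists. eapply is_series_ext; [| exact he]. intros i; cbn beta; now rewrite od. }
      apply injective_projections.
      - apply (part fst); [reflexivity | apply hZ | apply hsum | apply hEv].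
      - apply (part snd); [reflexivity | apply hZ | apply hsum | apply hEv]. }
    rewrite e3 in e2. set (T := npow 2 s) in *.
    assert (e4 : ((1 - T) * Ev)%C = (T * P s)%C).
    { replace ((1 - T) * Ev)%C with (Ev - T * Ev)%C by ring. rewrite e2 at 1. ring. }
    unfold eta. rewrite e1. 
    replace ((1 - T) * (RtoC (/ 2) * (npow (k / 2) s + (P s - 2 * Ev + (P s - npow (k / 2) s)))))%C
      with ((RtoC (/ 2) * 2) * ((1 - T) * P s - (1 - T) * Ev))%C by ring.
    rewrite e4, RtoC_inv by lra. field. }
  assert (aeta : forall s, -1 < Re s -> analytic_at eta s).
  { intros s hs. apply analytic_scal, analytic_plus; [apply analytic_npow | apply hE, hs]. }
  destruct (vanish_near_0 (fun s => (1 - 2 * npow 2 s) * P s - (1 - npow 2 s) * eta s)%C) as (r & rp & hr).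
  - intros s h1 h2 h3. apply (analytic_ext_loc (fun s => (P s + (-2) * (npow 2 s * P s)) - (eta s - npow 2 s * eta s))%C _ _ 1); [lra | intros; ring |].
    apply analytic_minus; [apply analytic_plus | apply analytic_minus].
    + auto.
    + apply analytic_scal, analytic_mul_npow; auto.
    + auto.
    + apply analytic_mul_npow; auto.
  - intros s hs. rewrite main by exact hs. ring.
  - assert (e0 : eta 0 = RtoC (/ 2)).
    { unfold eta. destruct (hE 0 ltac:(simpl; lra)) as [h _].
      assert (z : E2 0 = 0).
      { apply (csum_unique _ _ _ h). eapply csum_ext; [| apply csum_const_0].
        intros i; cbn beta. rewrite rl, !npow_0. ring. }
      rewrite z, npow_0. ring. }
    assert (n0 : Cmod (0 - 0) < r) by (replace (0 - 0)%C with (RtoC 0) by ring; rewrite Cmod_0; exact rp).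
    (* At [0] one has [T = 1], so the relation reads [- P(0) = 0]. Its derivative then gives
       [- P'(0) = eta(0) ln 2] with [eta(0) = 1 / 2]. *)
    assert (P0 : P 0 = 0).
    { pose proof (hr 0 n0) as z. cbn beta in z. rewrite npow_0 in z.
      transitivity (- ((1 - 2 * 1) * P 0 - (1 - 1) * eta 0))%C; [ring | rewrite z; ring]. }
    destruct (analytic_cder P 0) as [p hp].
    { apply hP; [simpl; lra | |]; intros e; apply RtoC_inj in e; lra. }
    destruct (analytic_cder eta 0) as [m hm]; [apply aeta; simpl; lra |].
    pose proof (npow_cder_0 2) as h2.
    assert (c1 : cder (fun s => 1 - 2 * npow 2 s)%C 0 (0 - 2 * RtoC (- ln 2))%C).
    { apply cder_minus; [| apply cder_scal, h2]. intros e he. exists 1. split; [lra |]. intros h _.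
      replace (1 - 1 - 0 * h)%C with (RtoC 0) by ring. rewrite Cmod_0. apply Rmult_le_pos; [lra | apply Cmod_ge_0]. }
    assert (c2 : cder (fun s => 1 - npow 2 s)%C 0 (0 - RtoC (- ln 2))%C).
    { apply cder_minus; [| exact h2]. intros e he. exists 1. split; [lra |]. intros h _.
      replace (1 - 1 - 0 * h)%C with (RtoC 0) by ring. rewrite Cmod_0. apply Rmult_le_pos; [lra | apply Cmod_ge_0]. }
    pose proof (cder_minus _ _ _ _ _ (cder_mult _ _ _ _ _ c1 hp) (cder_mult _ _ _ _ _ c2 hm)) as c3.
    assert (c4 : cder (fun s => (1 - 2 * npow 2 s) * P s - (1 - npow 2 s) * eta s)%C 0 0).
    { apply (cder_ext_loc (fun _ => 0) _ _ _ r rp).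
      - intros s hs. symmetry. apply hr, hs.
      - intros e he. exists 1. split; [lra |]. intros h _. replace (0 - 0 - 0 * h)%C with (RtoC 0) by ring.
        rewrite Cmod_0. apply Rmult_le_pos; [lra | apply Cmod_ge_0]. }
    pose proof (cder_unique _ _ _ _ c3 c4) as u. rewrite P0, e0, npow_0 in u.
    replace (RtoC (- / 2 * ln 2)) with p; [exact hp |].
    rewrite RtoC_mult, RtoC_opp. rewrite RtoC_opp in u.
    transitivity (- RtoC (/ 2) * RtoC (ln 2) - ((0 - 2 * - RtoC (ln 2)) * 0 + (1 - 2 * 1) * p - ((0 - - RtoC (ln 2)) * RtoC (/ 2) + (1 - 1) * m)))%C.
    + ring.
    + rewrite u. ring.
Qed.

(** Shifting by [w] removes exactly the lattice line [j = 0], whose points are [i + 1/2]. For the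
    shift by [1] it is the line [i = 0] with points [w (j + 1/2)]; the scale [k = w] leaves no trace
    in the derivative because the function vanishes at [0]. *)
Lemma half_t_cder (w : R) : 0 < w ->
  cder (fun s => barnes_zeta2 (/ 2) w s - barnes_zeta2 (/ 2 + w) w s)%C 0 (RtoC (- / 2 * ln 2)).
Proof.
  intros hw. apply (half_integer_cder 1); [lra | |].
  - intros s _ h1 h2. apply analytic_minus; apply barnes_zeta2_analytic; auto; lra.
  - intros s hs. rewrite !barnes_zeta2_bzeta by lra.
    destruct (bzeta_isum (/ 2) w s ltac:(lra) hw hs) as (f & f1 & f2).
    destruct (bzeta_isum (/ 2 + w) w s ltac:(lra) hw hs) as (g & g1 & g2).
    eapply csum_ext; [| apply (csum_minus _ _ _ _ f2 g2)]. intros i. cbn beta.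
    assert (e : (f i - npow (latt (/ 2) w i 0) s)%C = g i).
    { apply (csum_unique _ _ _ (csum_incr_1 _ _ (f1 i))). eapply csum_ext; [| apply (g1 i)].
      intros j; cbn beta. f_equal. unfold latt. rewrite S_INR. ring. }
    rewrite <- e. replace (1 * (INR i + / 2)) with (latt (/ 2) w i 0) by (unfold latt; simpl; ring). ring.
Qed.

Lemma half_1_cder (w : R) : 0 < w ->
  cder (fun s => barnes_zeta2 (w / 2) w s - barnes_zeta2 (1 + w / 2) w s)%C 0 (RtoC (- / 2 * ln 2)).
Proof.
  intros hw. apply (half_integer_cder w); [lra | |].
  - intros s _ h1 h2. apply analytic_minus; apply barnes_zeta2_analytic; auto; lra.
  - intros s hs. rewrite !barnes_zeta2_bzeta by lra.
    destruct (bzeta_isum (w / 2) w s ltac:(lra) hw hs) as (f & f1 & f2).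
    destruct (bzeta_isum (1 + w / 2) w s ltac:(lra) hw hs) as (g & g1 & g2).
    assert (e : bzeta (1 + w / 2) w s = (bzeta (w / 2) w s - f 0%nat)%C).
    { apply (csum_unique _ _ _ g2). eapply csum_ext; [| apply (csum_incr_1 _ _ f2)].
      intros i. cbn beta. apply (csum_unique _ _ _ (f1 (S i))). eapply csum_ext; [| apply (g1 i)].
      intros j; cbn beta. f_equal. unfold latt. rewrite S_INR. ring. }
    rewrite e. replace (bzeta (w / 2) w s - (bzeta (w / 2) w s - f 0%nat))%C with (f 0%nat) by ring.
    eapply csum_ext; [| apply (f1 0%nat)]. intros j; cbn beta. f_equal. unfold latt. simpl. field.
Qed.

(** * The logarithm of the double sine function as a lattice sum *)

Lemma lnpt_R (w p q : R) : 0 < p * w + q -> lnpt (RtoC w) p q = ln (p * w + q).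
Proof.
  intros h. unfold lnpt, lnm. rewrite <- RtoC_mult, <- RtoC_plus, Cmod_R, Rabs_pos_eq by lra. reflexivity.
Qed.

Lemma double_sine_value (w x y : R) : 0 < w -> 0 < x <= 1 -> 0 <= y < 1 ->
  double_sine w (x * w + y) = RtoC (exp (log_double_sine w (x - / 2) (y - / 2))).
Proof.
  intros hw hx hy. unfold double_sine. rewrite <- Cexp_R. f_equal.
  set (r := x - / 2). set (s := y - / 2). set (c := (1 + w) / 2). set (d := r * w + s).
  assert (xw : 0 < x * w) by (apply Rmult_lt_0_compat; lra).
  assert (xw' : 0 <= (1 - x) * w) by (apply Rmult_le_pos; lra).
  replace (1 + w - (x * w + y)) with (c + - d) by (unfold c, d, r, s; field).
  replace (x * w + y) with (c + d) by (unfold c, d, r, s; field).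
  assert (cd1 : 0 < c + d) by (unfold c, d, r, s; lra).
  assert (cd2 : 0 < c + - d) by (unfold c, d, r, s; lra).
  (* The points and weights of [qterm] with opposite signs, since the derivative of [x^(-s)] at [0]
     is [- ln x]. The moments [0], [1], [2] vanish (the first because [d = r w + s]), so the sum [Q]
     converges for [Re s > -1] and can be differentiated at [0]. *)
  set (l := ((1, - d) :: (-1, d) :: (- (2 * r), - (w / 2)) :: (2 * r, w / 2) :: (- (2 * s), - / 2) :: (2 * s, / 2) :: nil) : list (R * R)).
  set (Q := fun s => dsum (fun i j => remL 3 l (latt c w i j) s)).
  assert (cp : 0 < c) by (unfold c; lra).
  assert (mom : forall j, (j < 3)%nat -> moment l j = 0).
  { intros [| [| [| j]]] hj; [| | | lia]; unfold l; simpl; unfold d; field. }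
  assert (c1 : c + - (w / 2) = / 2) by (unfold c; field).
  assert (c2 : c + w / 2 = / 2 + w) by (unfold c; field).
  assert (c3 : c + - / 2 = w / 2) by (unfold c; field).
  assert (c4 : c + / 2 = 1 + w / 2) by (unfold c; field).
  set (B := fun z => barnes_zeta2 z w).
  set (L := fun u => ((B (c + - d)%R u - B (c + d)%R u) - RtoC (2 * r) * (B (/ 2)%R u - B (/ 2 + w)%R u)
     - RtoC (2 * s) * (B (w / 2)%R u - B (1 + w / 2)%R u))%C).
  assert (hQ : forall u, 2 < Re u -> Q u = L u).
  { intros u hu. unfold Q. symmetry. apply isum_dsum.
    assert (hb : forall h, 0 < c + h -> isum (fun i j => npow (latt c w i j + h) u) (B (c + h)%R u)).
    { intros h hh. unfold B. rewrite barnes_zeta2_bzeta by assumption.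
      eapply isum_ext; [| apply bzeta_isum; assumption]. intros i j; cbn beta. f_equal. unfold latt; ring. }
    pose proof (hb (- d) cd2) as b1. pose proof (hb d cd1) as b2.
    pose proof (hb (- (w / 2)) ltac:(lra)) as b3. pose proof (hb (w / 2) ltac:(lra)) as b4.
    pose proof (hb (- / 2) ltac:(lra)) as b5. pose proof (hb (/ 2) ltac:(lra)) as b6.
    rewrite c1 in b3. rewrite c2 in b4. rewrite c3 in b5. rewrite c4 in b6.
    pose proof (isum_lin 1 1 _ _ _ _ (isum_lin 1 (-1) _ _ _ _ b1 b2)
      (isum_lin (RtoC (- (2 * r))) 1 _ _ _ _ (isum_lin 1 (-1) _ _ _ _ b3 b4)
        (isum_lin (RtoC (- (2 * s))) 0 _ _ _ _ (isum_lin 1 (-1) _ _ _ _ b5 b6) b1))) as b.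
    eapply isum_ext; [| match type of b with isum _ ?v => replace (L u) with v; [exact b |] end].
    - intros i j. cbn beta. rewrite remL_moments by exact mom. unfold l. cbn [Lx fst snd].
      rewrite !RtoC_opp. ring.
    - unfold L. rewrite !RtoC_opp. ring. }
  assert (aL : forall u : C, u <> RtoC 1 -> u <> RtoC 2 -> analytic_at L u).
  { intros u u1 u2. unfold L, B.
    apply analytic_minus; [apply analytic_minus; [apply analytic_minus | apply analytic_scal, analytic_minus] | apply analytic_scal, analytic_minus];
     apply barnes_zeta2_analytic; auto; lra. }
  assert (hq : forall i j, 0 <= INR i * w /\ 0 <= INR i /\ 0 <= INR j).
  { intros i j. pose proof (pos_INR i). pose proof (pos_INR j). split; [apply Rmult_le_pos; lra | split; assumption]. }
  (* The indices of [qterm] are swapped because [latt] attaches [w] to its second index; [eD]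
     restores the order by exchanging the sums. *)
  assert (dq : forall i j, cder (remL 3 l (latt c w i j)) 0 (RtoC (qterm (RtoC w) r s j i))).
  { intros i j. destruct (hq j i) as (p1 & p2 & p3).
    eapply (cder_ext_loc (fun u => 1 * npow (latt c w i j + - d)%R u + ((-1) * npow (latt c w i j + d)%R u +
       (RtoC (- (2 * r)) * npow (latt c w i j + - (w / 2))%R u + (RtoC (2 * r) * npow (latt c w i j + w / 2)%R u +
       (RtoC (- (2 * s)) * npow (latt c w i j + - / 2)%R u + RtoC (2 * s) * npow (latt c w i j + / 2)%R u)))))%C _ _ _ 1); [lra | |].
    - intros u _. rewrite remL_moments by exact mom. unfold l. cbn [Lx fst snd]. ring.
    - replace (RtoC (qterm (RtoC w) r s j i)) with
       (1 * RtoC (- ln (latt c w i j + - d)) + ((-1) * RtoC (- ln (latt c w i j + d)) +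
       (RtoC (- (2 * r)) * RtoC (- ln (latt c w i j + - (w / 2))) + (RtoC (2 * r) * RtoC (- ln (latt c w i j + w / 2)) +
       (RtoC (- (2 * s)) * RtoC (- ln (latt c w i j + - / 2)) + RtoC (2 * s) * RtoC (- ln (latt c w i j + / 2)))))))%C.
      + repeat apply cder_plus; apply cder_scal, npow_cder_0.
      + unfold qterm. rewrite !lnpt_R by (unfold r, s; lra).
        replace ((INR j + / 2 + r) * w + (INR i + / 2 + s)) with (latt c w i j + d) by (unfold latt, c, d; field).
        replace ((INR j + / 2 - r) * w + (INR i + / 2 - s)) with (latt c w i j + - d) by (unfold latt, c, d; field).
        replace ((INR j + / 2 + / 2) * w + (INR i + / 2)) with (latt c w i j + w / 2) by (unfold latt, c, d; field).
        replace ((INR j + / 2 - / 2) * w + (INR i + / 2)) with (latt c w i j + - (w / 2)) by (unfold latt, c, d; field).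
        replace ((INR j + / 2) * w + (INR i + / 2 + / 2)) with (latt c w i j + / 2) by (unfold latt, c, d; field).
        replace ((INR j + / 2) * w + (INR i + / 2 - / 2)) with (latt c w i j + - / 2) by (unfold latt, c, d; field).
        rewrite <- !RtoC_mult, <- !RtoC_plus. f_equal. ring. }
  destruct (vanish_near_0 (fun u => L u - Q u)%C) as (rr & rp & hr).
  { intros u h0 h1 h2. apply analytic_minus; [apply aL; assumption |].
    apply (lattice_remL 3 l c w u cp hw). simpl. lra. }
  { intros u hu. rewrite hQ by exact hu. ring. }
  destruct (lattice_remL 3 l c w 0 cp hw) as (_ & _ & h3); [simpl; lra |].
  destruct (h3 _ dq) as [_ h4]. fold Q in h4.
  set (D := dsum (fun i j => RtoC (qterm (RtoC w) r s j i))) in *.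
  assert (cL : cder L 0 ((C_derive (B (c + - d)%R) 0 - C_derive (B (c + d)%R) 0) - RtoC (2 * r) * RtoC (- / 2 * ln 2)
     - RtoC (2 * s) * RtoC (- / 2 * ln 2))%C).
  { apply (cder_minus (fun u => (B (c + - d)%R u - B (c + d)%R u) - RtoC (2 * r) * (B (/ 2)%R u - B (/ 2 + w)%R u))%C
      (fun u => RtoC (2 * s) * (B (w / 2)%R u - B (1 + w / 2)%R u))%C).
    - apply (cder_minus (fun u => (B (c + - d)%R u - B (c + d)%R u))%C (fun u => RtoC (2 * r) * (B (/ 2)%R u - B (/ 2 + w)%R u))%C).
      + exact (cder_minus (B (c + - d)%R) (B (c + d)%R) 0 _ _ (barnes_zeta2_cder _ w cd2 hw) (barnes_zeta2_cder _ w cd1 hw)).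
      + exact (cder_scal (RtoC (2 * r)) (fun u => B (/ 2)%R u - B (/ 2 + w)%R u)%C 0 _ (half_t_cder w hw)).
    - exact (cder_scal (RtoC (2 * s)) (fun u => B (w / 2)%R u - B (1 + w / 2)%R u)%C 0 _ (half_1_cder w hw)). }
  assert (cQ : cder Q 0 ((C_derive (B (c + - d)%R) 0 - C_derive (B (c + d)%R) 0) - RtoC (2 * r) * RtoC (- / 2 * ln 2)
     - RtoC (2 * s) * RtoC (- / 2 * ln 2))%C).
  { apply (cder_ext_loc L _ _ _ rr rp); [| exact cL]. intros u hu. specialize (hr u hu). cbn beta in hr.
    replace (Q u) with (L u - (L u - Q u))%C by ring. rewrite hr. ring. }
  pose proof (cder_unique _ _ _ _ cQ h4) as e.
  assert (eD : D = RtoC (Series (fun i => Series (fun j => qterm (RtoC w) r s i j)))).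
  { unfold D, dsum. simpl.
    assert (z : Series (fun _ : nat => Series (fun _ : nat => 0)) = 0).
    { rewrite (Series_ext _ (fun _ => 0)); [apply is_series_unique, (proj1 csum_const_0) |].
      intros; apply is_series_unique, (proj1 csum_const_0). }
    rewrite z. unfold RtoC. f_equal.
    destruct (qterm_bound r s w w hw) as (K & M & hb).
    assert (hu : summable_pos (power_weight (3 / 2))) by (apply power_weight_summable; lra).
    destruct (dominate_all (fun i j => Rabs (qterm (RtoC w) r s i j)) M K (power_weight (3 / 2)) (power_weight (3 / 2))) as (C' & pC & hC).
    - apply hu.
    - apply hu.
    - intros i j hij. apply hb; [simpl; lra | rewrite Cmod_R, Rabs_pos_eq; lra | exact hij].
    - symmetry. apply (double_Series_exchange _ (fun i => C' * power_weight (3 / 2) i) (power_weight (3 / 2))).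
      + split; [intros n; apply Rmult_lt_0_compat; [exact pC | apply hu] |].
        apply (ex_series_scal C' (power_weight (3 / 2))), hu.
      + exact hu.
      + intros i j. rewrite Rmult_assoc. apply hC. }
  rewrite eD in e. unfold log_double_sine. fold r s.
  set (SS := Series (fun i => Series (fun j => qterm (RtoC w) r s i j))) in *.
  change (barnes_zeta2 (c + - d) w) with (B (c + - d)%R). change (barnes_zeta2 (c + d) w) with (B (c + d)%R).
  transitivity (RtoC SS + RtoC (2 * r) * RtoC (- / 2 * ln 2) + RtoC (2 * s) * RtoC (- / 2 * ln 2))%C.
  - rewrite <- e. ring.
  - rewrite <- !RtoC_mult, <- !RtoC_plus. f_equal. field.
Qed.

From Stdlib Require Import QArith Qreals Znumtheory.
Open Scope R_scope.

(** * Arithmetic of the totally positive units *)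

(** In lowest terms the denominator divides a square prime to it, hence is a unit. So [d] is a
    square, and being squarefree it would be [1]. *)
Lemma squarefree_sqrt_irrational (d : nat) (p q : Z) : (1 < d)%nat -> squarefree d ->
  (p * p = Z.of_nat d * (q * q))%Z -> q = 0%Z.
Proof.
  intros hd hsf e. destruct (Z.eq_dec q 0) as [| hq]; [assumption | exfalso].
  set (g := Z.gcd p q).
  assert (gp : (g <> 0)%Z) by (intros h; apply Z.gcd_eq_0_r in h; contradiction).
  destruct (Z.gcd_divide_l p q) as [p' hp']. destruct (Z.gcd_divide_r p q) as [q' hq']. fold g in hp', hq'.
  assert (cop : Z.gcd p' q' = 1%Z).
  { assert (h : Z.gcd (p' * g) (q' * g) = g) by (rewrite <- hp', <- hq'; reflexivity).
    rewrite Z.gcd_mul_mono_r in h. pose proof (Z.gcd_nonneg p q). fold g in H. rewrite Z.abs_eq in h by lia. nia. }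
  assert (e' : (p' * p' = Z.of_nat d * (q' * q'))%Z).
  { rewrite hp', hq' in e. nia. }
  assert (rp : rel_prime q' p') by (apply Zgcd_1_rel_prime; rewrite Z.gcd_comm; exact cop).
  assert (dv : (q' | p' * p')%Z) by (exists (Z.of_nat d * q')%Z; rewrite e'; ring).
  pose proof (Gauss _ _ _ dv rp) as dv2.
  assert (u1 : (q' | 1)%Z).
  { rewrite <- cop. apply Z.gcd_greatest; [exact dv2 | apply Z.divide_refl]. }
  apply Z.divide_1_r in u1.
  assert (e2 : (p' * p' = Z.of_nat d)%Z) by (destruct u1; subst q'; lia).
  assert (e3 : (Z.abs_nat p' * Z.abs_nat p')%nat = d).
  { apply Nat2Z.inj. rewrite Nat2Z.inj_mul, !Zabs2Nat.id_abs. lia. }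
  assert (m1 : Z.abs_nat p' = 1%nat) by (apply hsf; exists 1%nat; lia).
  rewrite m1 in e3. lia.
Qed.

Lemma Q2R_frac (r : Q) : Q2R r = IZR (Qnum r) / IZR (QDen r).
Proof. reflexivity. Qed.

Lemma sqrt_indep (d : nat) (r s : Q) : (1 < d)%nat -> squarefree d ->
  Q2R r + Q2R s * sqrt (INR d) = 0 -> Q2R r = 0 /\ Q2R s = 0.
Proof.
  intros hd hsf e.
  assert (r0 : IZR (QDen r) <> 0) by (apply not_0_IZR; discriminate).
  assert (s0 : IZR (QDen s) <> 0) by (apply not_0_IZR; discriminate).
  assert (dp : 0 <= INR d) by apply pos_INR.
  set (P := (Qnum r * QDen s)%Z). set (T := (Qnum s * QDen r)%Z).
  assert (e1 : IZR P + IZR T * sqrt (INR d) = 0).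
  { unfold P, T. rewrite !mult_IZR. rewrite !Q2R_frac in e.
    transitivity ((IZR (Qnum r) / IZR (QDen r) + IZR (Qnum s) / IZR (QDen s) * sqrt (INR d)) * (IZR (QDen r) * IZR (QDen s))).
    - field. split; assumption.
    - rewrite e; ring. }
  assert (e2 : (P * P = Z.of_nat d * (T * T))%Z).
  { apply eq_IZR. rewrite !mult_IZR, <- INR_IZR_INZ.
    rewrite <- (sqrt_sqrt (INR d)) by exact dp.
    replace (IZR P) with (- (IZR T * sqrt (INR d))) by lra. ring. }
  assert (T0 : T = 0%Z) by (apply (squarefree_sqrt_irrational d P T); assumption).
  assert (sz : Q2R s = 0).
  { unfold T in T0. apply Z.mul_eq_0 in T0. rewrite Q2R_frac. destruct T0 as [-> | h]; [unfold Rdiv; ring | discriminate]. }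
  split; [| exact sz]. rewrite sz in e. lra.
Qed.

Lemma rational_IZR (z : Z) : rational (IZR z).
Proof. exists (inject_Z z). unfold Q2R; simpl. field. Qed.

Lemma rational_plus x y : rational x -> rational y -> rational (x + y).
Proof. intros [p ->] [q ->]. exists (p + q)%Q. now rewrite Q2R_plus. Qed.

Lemma rational_mult x y : rational x -> rational y -> rational (x * y).
Proof. intros [p ->] [q ->]. exists (p * q)%Q. now rewrite Q2R_mult. Qed.

Lemma rational_opp x : rational x -> rational (- x).
Proof. intros [p ->]. exists (- p)%Q. now rewrite Q2R_opp. Qed.

Lemma rational_minus x y : rational x -> rational y -> rational (x - y).
Proof. intros hx hy. apply rational_plus; [exact hx | apply rational_opp, hy]. Qed.

Lemma rational_INR (n : nat) : rational (INR n).
Proof. rewrite INR_IZR_INZ. apply rational_IZR. Qed.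

Lemma rational_inv_INR (n : nat) : (0 < n)%nat -> rational (/ INR n).
Proof.
  intros hn. exists (1 # Pos.of_nat n)%Q. unfold Q2R; simpl.
  rewrite INR_IZR_INZ, Rmult_1_l. do 2 f_equal. rewrite <- positive_nat_Z, Nat2Pos.id by lia. reflexivity.
Qed.

Lemma rational_half : rational (/ 2).
Proof. exact (rational_inv_INR 2 ltac:(lia)). Qed.

(** What is used of the arithmetic of [K]: [a] is the trace of the unit [eps]
    of norm [1], and [(1, eps)] is linearly independent over the rationals. *)
Record unit_data (d a b : nat) (eps : R) : Prop := {
  ud_gt1 : 1 < eps;
  ud_sq : eps * eps = INR a * eps - 1;
  ud_diff : INR b * sqrt (INR d) = eps - / eps;
  ud_indep : forall x y, rational x -> rational y -> x * eps + y = 0 -> x = 0 /\ y = 0 }.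

(** The norm [N] of [eps] is positive because [eps] is totally positive. Once it is known to be [1],
    the conjugate is [/ eps], and [eps - / eps = b sqrt d > 0] gives [eps > 1]. *)
Lemma unit_data_intro (d a b : nat) :
  (1 < d)%nat -> squarefree d ->
  let eps := (INR a + INR b * sqrt (INR d)) / 2 in
  generated_by (totally_positive_unit d) eps ->
  (forall x : R, ring_of_integers d x <-> exists m n : Z, x = IZR m + IZR n * eps) ->
  unit_data d a b eps.
Proof.
  intros hd hsf eps hgen hO.
  assert (ind : forall x y, rational x -> rational y -> x + y * sqrt (INR d) = 0 -> x = 0 /\ y = 0).
  { intros x y [p ->] [q ->]. apply sqrt_indep; assumption. }
  assert (dp : 1 < INR d) by (change 1 with (INR 1); apply lt_INR; exact hd).
  assert (sp : 0 < sqrt (INR d)) by (apply sqrt_lt_R0; lra).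
  assert (ss : sqrt (INR d) * sqrt (INR d) = INR d) by (apply sqrt_sqrt; lra).
  (* Otherwise [eps] would be rational and the integer [sqrt d] could not lie in [Z + Z eps]. *)
  assert (bpos : 0 < INR b).
  { destruct (pos_INR b) as [h | h]; [exact h | exfalso].
    assert (hs : ring_of_integers d (sqrt (INR d))).
    { split.
      - exists (- sqrt (INR d)), 0%Q, 1%Q. unfold Q2R; simpl. split; field.
      - exists 1%nat, (fun k => match k with O => (- Z.of_nat d)%Z | _ => 0%Z end).
        simpl. rewrite opp_IZR, <- INR_IZR_INZ. nra. }
    apply hO in hs. destruct hs as (m & n & e).
    destruct (ind (IZR m + IZR n * (INR a * / 2)) (-1)) as [_ h1].
    - apply rational_plus; [apply rational_IZR | apply rational_mult; [apply rational_IZR |]].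
      apply rational_mult; [apply rational_INR | apply rational_half].
    - apply rational_IZR.
    - unfold eps in e. rewrite <- h in e. lra.
    - lra. }
  assert (indep : forall x y, rational x -> rational y -> x * eps + y = 0 -> x = 0 /\ y = 0).
  { intros x y hx hy e.
    destruct (ind (x * (INR a * / 2) + y) (x * (INR b * / 2))) as [h1 h2].
    - apply rational_plus; [| exact hy]. apply rational_mult; [exact hx |].
      apply rational_mult; [apply rational_INR | apply rational_half].
    - apply rational_mult; [exact hx |]. apply rational_mult; [apply rational_INR | apply rational_half].
    - unfold eps in e. lra.
    - assert (x0 : x = 0).
      { apply Rmult_integral in h2. destruct h2 as [h2 | h2]; [exact h2 | lra]. }
      split; [exact x0 |]. rewrite x0 in e. lra. }
  assert (tp : forall n : Z, totally_positive_unit d (powerRZ eps n)) by (intros n; apply hgen; exists n; reflexivity).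
  pose proof (tp 1%Z) as t1. simpl in t1. rewrite Rmult_1_r in t1.
  destruct t1 as (_ & _ & (x' & (r & s & e1 & e2) & ep & xp)).
  set (N := (INR a * INR a - INR b * INR b * INR d) / 4).
  assert (Nrat : rational N).
  { unfold N, Rdiv. replace (/ 4) with (/ 2 * / 2) by field.
    apply rational_mult; [apply rational_minus; repeat apply rational_mult; apply rational_INR | apply rational_mult; apply rational_half]. }
  assert (x'e : x' = (INR a - INR b * sqrt (INR d)) / 2).
  { destruct (ind (Q2R r - INR a * / 2) (Q2R s - INR b * / 2)) as [h1 h2].
    - apply rational_minus; [exists r; reflexivity | apply rational_mult; [apply rational_INR | apply rational_half]].
    - apply rational_minus; [exists s; reflexivity | apply rational_mult; [apply rational_INR | apply rational_half]].
    - unfold eps in e1. lra.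
    - rewrite e2. replace (Q2R r) with (INR a * / 2) by lra. replace (Q2R s) with (INR b * / 2) by lra. field. }
  assert (Ne : eps * x' = N).
  { rewrite x'e. unfold eps, N.
    transitivity ((INR a * INR a - INR b * INR b * (sqrt (INR d) * sqrt (INR d))) / 4); [field | rewrite ss; reflexivity]. }
  assert (Npos : 0 < N) by (rewrite <- Ne; apply Rmult_lt_0_compat; assumption).
  assert (sq : eps * eps = INR a * eps - N).
  { rewrite <- Ne, x'e. unfold eps. field. }
  (* Comparing [eps^2 = a eps - N] with its coordinates in [Z + Z eps]. *)
  assert (Nint : exists n : Z, N = IZR n).
  { destruct (tp 2%Z) as ((q1 & q2) & _).
    destruct (proj1 (hO (powerRZ eps 2)) (conj q1 q2)) as (m & n & e).
    simpl in e. rewrite Rmult_1_r, sq in e.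
    destruct (indep (INR a - IZR n) (- N - IZR m)) as [_ h].
    - apply rational_minus; [apply rational_INR | apply rational_IZR].
    - apply rational_minus; [apply rational_opp, Nrat | apply rational_IZR].
    - lra.
    - exists (- m)%Z. rewrite opp_IZR. lra. }
  (* Writing [/ eps = m + n eps] and multiplying by [eps], independence yields [n N = -1]. *)
  assert (N1 : N = 1).
  { destruct Nint as [k hk].
    destruct (tp (-1)%Z) as ((q1 & q2) & _).
    destruct (proj1 (hO (powerRZ eps (-1))) (conj q1 q2)) as (m & n & e).
    simpl in e. rewrite Rmult_1_r in e.
    assert (e' : 1 = eps * (IZR m + IZR n * eps)) by (rewrite <- e; field; lra).
    destruct (indep (IZR m + IZR n * INR a) (- (IZR n * N) - 1)) as [_ h].
    - apply rational_plus; [apply rational_IZR | apply rational_mult; [apply rational_IZR | apply rational_INR]].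
    - apply rational_minus; [apply rational_opp, rational_mult; [apply rational_IZR | exact Nrat] | apply rational_IZR].
    - assert (e3 : 1 = IZR m * eps + IZR n * (eps * eps)) by lra. rewrite sq in e3. lra.
    - rewrite hk in h, Npos |- *. rewrite <- mult_IZR in h.
      assert (h' : (n * k = -1)%Z) by (apply eq_IZR; lra).
      apply lt_IZR in Npos. f_equal. apply Z.divide_1_r_nonneg; [lia | exists (- n)%Z; lia]. }
  rewrite N1 in sq, Ne.
  assert (xinv : x' = / eps) by (apply (Rmult_eq_reg_l eps); [rewrite Rinv_r; lra | lra]).
  assert (df : INR b * sqrt (INR d) = eps - / eps).
  { rewrite <- xinv, x'e. unfold eps. field. }
  assert (bs : 0 < INR b * sqrt (INR d)) by (apply Rmult_lt_0_compat; lra).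
  constructor; auto.
  destruct (Rlt_dec 1 eps) as [h | h]; [exact h | exfalso].
  assert (1 <= / eps) by (rewrite <- Rinv_1; apply Rinv_le_contravar; lra). lra.
Qed.

(** * Powers of the unit modulo [u] and the Shintani pairs *)

Section Units.
Variables (d a b u : nat) (eps : R).
Hypothesis ud : unit_data d a b eps.
Hypothesis hu : (2 <= u)%nat.

Definition lat (x : R) : Prop := exists m n : Z, x = IZR m + IZR n * eps.

Let e1 : 1 < eps := ud_gt1 _ _ _ _ ud.
Let ez : eps <> 0.
Proof. pose proof e1; lra. Qed.
Let esq : eps * eps = INR a * eps - 1 := ud_sq _ _ _ _ ud.
Let einv : / eps = INR a - eps.
Proof. apply (Rmult_eq_reg_l eps); [| exact ez]. rewrite Rinv_r by exact ez. lra. Qed.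
Let up : 0 < INR u.
Proof. apply lt_0_INR; lia. Qed.

Lemma trace_eq : INR a = eps + / eps.
Proof. rewrite einv; ring. Qed.

Lemma lat_plus x y : lat x -> lat y -> lat (x + y).
Proof. intros (m & n & ->) (m' & n' & ->). exists (m + m')%Z, (n + n')%Z. rewrite !plus_IZR. ring. Qed.

Lemma lat_opp x : lat x -> lat (- x).
Proof. intros (m & n & ->). exists (- m)%Z, (- n)%Z. rewrite !opp_IZR. ring. Qed.

Lemma lat_eps x : lat x -> lat (x * eps).
Proof.
  intros (m & n & ->). exists (- n)%Z, (m + Z.of_nat a * n)%Z.
  rewrite opp_IZR, plus_IZR, mult_IZR, <- INR_IZR_INZ.
  transitivity (IZR m * eps + IZR n * (eps * eps)); [ring | rewrite esq; ring].
Qed.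

Lemma lat_inv_eps x : lat x -> lat (x * / eps).
Proof.
  intros h. rewrite einv. replace (x * (INR a - eps)) with (INR a * x + - (x * eps)) by ring.
  apply lat_plus; [| apply lat_opp, lat_eps, h].
  destruct h as (m & n & ->). exists (Z.of_nat a * m)%Z, (Z.of_nat a * n)%Z.
  rewrite !mult_IZR, <- INR_IZR_INZ. ring.
Qed.

Lemma lat_power x (n : Z) : lat x -> lat (x * powerRZ eps n).
Proof.
  intros h. destruct n as [| p | p]; simpl.
  - rewrite Rmult_1_r; exact h.
  - induction (Pos.to_nat p) as [| k IH]; simpl; [rewrite Rmult_1_r; exact h |].
    replace (x * (eps * eps ^ k)) with (x * eps ^ k * eps) by ring. apply lat_eps, IH.
  - induction (Pos.to_nat p) as [| k IH]; simpl; [rewrite Rinv_1, Rmult_1_r; exact h |].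
    rewrite Rinv_mult. replace (x * (/ eps * / eps ^ k)) with (x * / eps ^ k * / eps) by ring. apply lat_inv_eps, IH.
Qed.

(** [eps^n = 1] modulo [u]. *)
Definition cong1 (n : Z) : Prop := lat ((powerRZ eps n - 1) / INR u).

Lemma cong1_plus n m : cong1 n -> cong1 m -> cong1 (n + m).
Proof.
  unfold cong1. intros h1 h2. rewrite powerRZ_add by exact ez.
  replace ((powerRZ eps n * powerRZ eps m - 1) / INR u) with
    ((powerRZ eps m - 1) / INR u * powerRZ eps n + (powerRZ eps n - 1) / INR u) by (field; lra).
  apply lat_plus; [apply lat_power, h2 | exact h1].
Qed.

Lemma cong1_opp n : cong1 n -> cong1 (- n).
Proof.
  unfold cong1. intros h.
  replace ((powerRZ eps (- n) - 1) / INR u) with (- ((powerRZ eps n - 1) / INR u * powerRZ eps (- n))).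
  - apply lat_opp, lat_power, h.
  - assert (q : powerRZ eps n * powerRZ eps (- n) = 1).
    { rewrite <- powerRZ_add by exact ez. replace (n + - n)%Z with 0%Z by ring. reflexivity. }
    transitivity (- ((powerRZ eps n * powerRZ eps (- n) - powerRZ eps (- n)) / INR u)); [field; lra | rewrite q; field; lra].
Qed.

Lemma cong1_0 : cong1 0.
Proof. exists 0%Z, 0%Z. simpl. field. lra. Qed.

Lemma cong1_mul n (k : Z) : cong1 n -> cong1 (n * k).
Proof.
  intros h.
  assert (p : forall j : nat, cong1 (n * Z.of_nat j)).
  { induction j as [| j IH]; [rewrite Z.mul_0_r; apply cong1_0 |].
    replace (n * Z.of_nat (S j))%Z with (n * Z.of_nat j + n)%Z by lia. apply cong1_plus; assumption. }
  destruct (Z_le_gt_dec 0 k) as [hk | hk].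
  - rewrite <- (Z2Nat.id k hk). apply p.
  - replace (n * k)%Z with (- (n * Z.of_nat (Z.to_nat (- k))))%Z by (rewrite Z2Nat.id; lia). apply cong1_opp, p.
Qed.

Fixpoint coord (k : nat) : Z * Z :=
  match k with
  | O => (0, 1)%Z
  | S j => let c := coord j in (Z.of_nat a * fst c + snd c, - fst c)%Z
  end.

Lemma coord_spec k : eps ^ k = IZR (fst (coord k)) * eps + IZR (snd (coord k)).
Proof.
  induction k as [| k IH]; [simpl; ring |].
  cbn [coord fst snd]. rewrite plus_IZR, mult_IZR, opp_IZR, <- INR_IZR_INZ.
  change (eps ^ S k) with (eps * eps ^ k). rewrite IH.
  transitivity (IZR (fst (coord k)) * (eps * eps) + IZR (snd (coord k)) * eps); [ring | rewrite esq; ring].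
Qed.

(** The recursion is invertible over the integers, so a common divisor of the two coordinates would
    descend to the starting pair [(0, 1)]. *)
Lemma coord_primitive k : ~ ((Z.of_nat u | fst (coord k))%Z /\ (Z.of_nat u | snd (coord k))%Z).
Proof.
  induction k as [| k IH].
  - simpl. intros [_ h]. apply Z.divide_1_r in h. lia.
  - intros [h1 h2]. apply IH. cbn [coord fst snd] in h1, h2.
    apply Z.divide_opp_r in h2. rewrite Z.opp_involutive in h2. split; [exact h2 |].
    replace (snd (coord k)) with (Z.of_nat a * fst (coord k) + snd (coord k) - Z.of_nat a * fst (coord k))%Z by ring.
    apply Z.divide_sub_r; [exact h1 | apply Z.divide_mul_r, h2].
Qed.

(** Pigeonhole: among [u^2 + 1] powers two have the same coordinates modulo [u], and their quotient
    is the required power because [eps] is invertible in the lattice. *)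
Lemma cong1_exists : exists m : nat, (0 < m)%nat /\ cong1 (Z.of_nat m).
Proof.
  set (U := Z.of_nat u).
  set (f := fun k => (Z.to_nat (fst (coord k) mod U), Z.to_nat (snd (coord k) mod U))).
  set (l := map f (seq 0 (u * u + 1))).
  set (tgt := list_prod (seq 0 u) (seq 0 u)).
  assert (inc : incl l tgt).
  { intros p hp. apply in_map_iff in hp. destruct hp as (k & <- & _). unfold f, tgt.
    apply in_prod; apply in_seq; split; try lia.
    - pose proof (Z.mod_pos_bound (fst (coord k)) U ltac:(lia)). lia.
    - pose proof (Z.mod_pos_bound (snd (coord k)) U ltac:(lia)). lia. }
  assert (nd : ~ NoDup l).
  { intros h. pose proof (NoDup_incl_length h inc) as hl. unfold l, tgt in hl.
    rewrite length_map, length_prod, !length_seq in hl. lia. }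
  assert (ex : exists i j, (i < j)%nat /\ f i = f j).
  { destruct (Classical_Prop.classic (exists i j, (i < j)%nat /\ f i = f j)) as [h | h]; [exact h | exfalso].
    apply nd. unfold l. apply NoDup_map_NoDup_ForallPairs; [| apply seq_NoDup].
    intros i j _ _ e. destruct (lt_eq_lt_dec i j) as [[h1 | h1] | h1]; [| exact h1 |]; exfalso; apply h.
    - exists i, j; auto.
    - exists j, i; auto. }
  destruct ex as (i & j & hij & e).
  exists (j - i)%nat. split; [lia |].
  injection e as ea eb.
  assert (mz : forall x y, Z.to_nat (x mod U) = Z.to_nat (y mod U) -> exists q, (y - x = q * U)%Z).
  { intros x y h. pose proof (Z.mod_pos_bound x U ltac:(lia)). pose proof (Z.mod_pos_bound y U ltac:(lia)).
    apply Z2Nat.inj in h; try lia. exists (y / U - x / U)%Z.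
    rewrite (Z.div_mod y U), (Z.div_mod x U) at 1 by lia. rewrite h. ring. }
  destruct (mz _ _ ea) as [q1 h1]. destruct (mz _ _ eb) as [q2 h2].
  unfold cong1.
  replace ((powerRZ eps (Z.of_nat (j - i)) - 1) / INR u) with ((eps ^ j - eps ^ i) / INR u * powerRZ eps (- Z.of_nat i)).
  - apply lat_power. exists q2, q1. rewrite !coord_spec.
    apply (f_equal IZR) in h1, h2. rewrite minus_IZR, mult_IZR in h1, h2. unfold U in *. rewrite <- INR_IZR_INZ in h1, h2.
    transitivity (((IZR (fst (coord j)) - IZR (fst (coord i))) * eps + (IZR (snd (coord j)) - IZR (snd (coord i)))) / INR u); [field; lra |].
    rewrite h1, h2. field. lra.
  - rewrite !pow_powerRZ. unfold Rdiv. rewrite Rmult_assoc, (Rmult_comm (/ INR u)), <- Rmult_assoc.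
    f_equal. rewrite Rmult_minus_distr_r, <- !powerRZ_add by exact ez.
    replace (Z.of_nat j + - Z.of_nat i)%Z with (Z.of_nat (j - i)) by lia.
    replace (Z.of_nat i + - Z.of_nat i)%Z with 0%Z by ring. reflexivity.
Qed.

Hypothesis hgen : generated_by (totally_positive_unit d) eps.
Hypothesis hO : forall x : R, ring_of_integers d x <-> lat x.

Lemma ray_unit_iff x : ray_unit d u x <-> exists n : Z, x = powerRZ eps n /\ cong1 n.
Proof.
  unfold ray_unit, ideal_gen, cong1. split.
  - intros (h1 & y & h2 & h3). apply hgen in h1. destruct h1 as [n ->]. exists n. split; [reflexivity |].
    rewrite h3. replace (INR u * y / INR u) with y by (field; lra). apply hO, h2.
  - intros (n & -> & h). split; [apply hgen; exists n; reflexivity |].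
    exists ((powerRZ eps n - 1) / INR u). split; [apply hO, h | field; lra].
Qed.

Lemma powerRZ_pow_mult (m : nat) (n : Z) : powerRZ (eps ^ m) n = powerRZ eps (Z.of_nat m * n).
Proof.
  assert (mz : eps ^ m <> 0) by (apply pow_nonzero, ez).
  assert (p : forall j : nat, powerRZ (eps ^ m) (Z.of_nat j) = powerRZ eps (Z.of_nat m * Z.of_nat j)).
  { intros j. rewrite <- pow_powerRZ, <- pow_mult, pow_powerRZ, Nat2Z.inj_mul. reflexivity. }
  destruct (Z_le_gt_dec 0 n) as [h | h].
  - rewrite <- (Z2Nat.id n h). apply p.
  - assert (q : powerRZ (eps ^ m) (- n) = powerRZ eps (Z.of_nat m * - n)).
    { rewrite <- (Z2Nat.id (- n)) by lia. apply p. }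
    assert (q0 : powerRZ (eps ^ m) (- n) <> 0) by (apply powerRZ_NOR, mz).
    apply (Rmult_eq_reg_r (powerRZ (eps ^ m) (- n))); [| exact q0].
    rewrite <- powerRZ_add by exact mz. rewrite q, <- powerRZ_add by exact ez.
    replace (n + - n)%Z with 0%Z by ring. replace (Z.of_nat m * n + Z.of_nat m * - n)%Z with 0%Z by ring. reflexivity.
Qed.

Lemma least_nat (Q : nat -> Prop) : (exists n, Q n) -> exists n, Q n /\ forall m, Q m -> (n <= m)%nat.
Proof.
  intros [n hn]. revert hn. induction n as [n IH] using lt_wf_ind. intros hn.
  destruct (Classical_Prop.classic (exists m, (m < n)%nat /\ Q m)) as [(m & h1 & h2) | h].
  - exact (IH m h1 h2).
  - exists n. split; [exact hn |]. intros m hm. destruct (le_lt_dec n m); [assumption |].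
    exfalso; apply h; exists m; auto.
Qed.

(** [ray_index] is a choice, so an index has to be exhibited before anything is known about it. *)
Lemma ray_index_spec : (0 < ray_index d eps u)%nat /\ cong1 (Z.of_nat (ray_index d eps u)).
Proof.
  assert (ex : exists g, is_ray_index d eps u g).
  { unfold is_ray_index.
    (* The least positive exponent of a congruent power generates, by division with remainder. The
       outer use of [least_nat] supplies the minimality among generators that the definition
       demands. *)
    destruct (least_nat (fun m => (0 < m)%nat /\ generated_by (ray_unit d u) (eps ^ m))) as (g & hg & hmin).
    - destruct (least_nat (fun m => (0 < m)%nat /\ cong1 (Z.of_nat m)) cong1_exists) as (m & [m0 hm] & hmin).
      exists m. split; [exact m0 |]. intros x. rewrite ray_unit_iff. split.
      + intros (n & -> & hn).
        assert (hr : cong1 (n mod Z.of_nat m)).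
        { rewrite Zmod_eq_full by lia. unfold Z.sub. apply cong1_plus; [exact hn |].
          apply cong1_opp. rewrite Z.mul_comm. apply cong1_mul, hm. }
        pose proof (Z.mod_pos_bound n (Z.of_nat m) ltac:(lia)) as bd.
        exists (n / Z.of_nat m)%Z. rewrite powerRZ_pow_mult. f_equal.
        destruct (Z.eq_dec (n mod Z.of_nat m) 0) as [z | nz].
        * pose proof (Z.div_mod n (Z.of_nat m) ltac:(lia)). lia.
        * exfalso. specialize (hmin (Z.to_nat (n mod Z.of_nat m))).
          rewrite Z2Nat.id in hmin by lia. specialize (hmin ltac:(split; [lia | exact hr])). lia.
      + intros (n & ->). exists (Z.of_nat m * n)%Z. split; [apply powerRZ_pow_mult | apply cong1_mul, hm].
    - exists g. split; [exact hg |]. intros m h1 h2. apply hmin; auto. }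
  pose proof (ClassicalEpsilon.epsilon_spec (inhabits 0%nat) (is_ray_index d eps u) ex) as [[h1 h2] _].
  fold (ray_index d eps u) in h1, h2. split; [exact h1 |].
  assert (hr : ray_unit d u (eps ^ ray_index d eps u)) by (apply h2; exists 1%Z; simpl; ring).
  apply ray_unit_iff in hr. destruct hr as (n & e & hn). unfold cong1 in *. rewrite <- pow_powerRZ, e. exact hn.
Qed.

(** The coordinates of [eps^k] in the basis [(eps, 1)], divided by [u] and
    reduced modulo [1] into [(0, 1]] and [[0, 1)]. *)
Definition xk (k : nat) : R := INR (S (Z.to_nat ((fst (coord k) - 1) mod Z.of_nat u))) / INR u.
Definition yk (k : nat) : R := INR (Z.to_nat (snd (coord k) mod Z.of_nat u)) / INR u.

Lemma xk_spec k : 0 < xk k <= 1 /\ exists m : Z, xk k = IZR (fst (coord k)) / INR u - IZR m.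
Proof.
  set (U := Z.of_nat u). pose proof (Z.mod_pos_bound (fst (coord k) - 1) U ltac:(lia)) as bd.
  assert (e : INR (S (Z.to_nat ((fst (coord k) - 1) mod U))) = IZR ((fst (coord k) - 1) mod U) + 1).
  { rewrite S_INR, INR_IZR_INZ, Z2Nat.id by lia. reflexivity. }
  assert (uU : INR u = IZR U) by apply INR_IZR_INZ.
  unfold xk. fold U. rewrite e. split.
  - assert (b1 : 0 <= IZR ((fst (coord k) - 1) mod U)) by (apply IZR_le; lia).
    assert (b2 : IZR ((fst (coord k) - 1) mod U) + 1 <= INR u).
    { rewrite uU, <- plus_IZR. apply IZR_le; lia. }
    split; [apply Rdiv_lt_0_compat; lra |]. apply Rmult_le_reg_r with (INR u); [exact up |].
    unfold Rdiv. rewrite Rmult_assoc, Rinv_l; lra.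
  - exists ((fst (coord k) - 1) / U)%Z. rewrite Zmod_eq_full by lia.
    rewrite minus_IZR, minus_IZR, mult_IZR, <- uU. field. lra.
Qed.

Lemma yk_spec k : 0 <= yk k < 1 /\ exists m : Z, yk k = IZR (snd (coord k)) / INR u - IZR m.
Proof.
  set (U := Z.of_nat u). pose proof (Z.mod_pos_bound (snd (coord k)) U ltac:(lia)) as bd.
  assert (e : INR (Z.to_nat (snd (coord k) mod U)) = IZR (snd (coord k) mod U)).
  { rewrite INR_IZR_INZ, Z2Nat.id by lia. reflexivity. }
  assert (uU : INR u = IZR U) by apply INR_IZR_INZ.
  unfold yk. fold U. rewrite e. split.
  - assert (b1 : 0 <= IZR (snd (coord k) mod U)) by (apply IZR_le; lia).
    assert (b2 : IZR (snd (coord k) mod U) < INR u) by (rewrite uU; apply IZR_lt; lia).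
    split; [apply Rdiv_le_0_compat; lra |]. apply Rmult_lt_reg_r with (INR u); [exact up |].
    unfold Rdiv. rewrite Rmult_assoc, Rinv_l; lra.
  - exists (snd (coord k) / U)%Z. rewrite Zmod_eq_full by lia.
    rewrite minus_IZR, mult_IZR, <- uU. field. lra.
Qed.

Lemma int_unit_interval (x : R) (m : Z) : -1 < x < 1 -> x = IZR m -> x = 0.
Proof.
  intros h e. rewrite e in h |- *. destruct h as [h1 h2]. apply lt_IZR in h1, h2. f_equal; lia.
Qed.

(** Multiplication by [eps^k] turns the membership condition into one on [x eps + y - eps^k / u]. By
    independence, two solutions differ by integers coordinatewise, and the half-open ranges force
    these to be [0]. *)
Lemma shintani_pair_eq k : shintani_pair d eps u (Z.of_nat k) = (xk k, yk k).
Proof.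
  destruct (xk_spec k) as (bx & mx & ex). destruct (yk_spec k) as (by_ & my & ey).
  assert (shift : forall x y, lat (x * powerRZ eps (1 - Z.of_nat k) + y * powerRZ eps (- Z.of_nat k) - / INR u) <->
     lat (x * eps + y - eps ^ k / INR u)).
  { intros x y.
    assert (q : powerRZ eps (Z.of_nat k) * powerRZ eps (- Z.of_nat k) = 1).
    { rewrite <- powerRZ_add by exact ez. replace (Z.of_nat k + - Z.of_nat k)%Z with 0%Z by ring. reflexivity. }
    assert (e : x * powerRZ eps (1 - Z.of_nat k) + y * powerRZ eps (- Z.of_nat k) - / INR u =
       (x * eps + y - eps ^ k / INR u) * powerRZ eps (- Z.of_nat k)).
    { unfold Z.sub. rewrite powerRZ_add, powerRZ_1, pow_powerRZ by exact ez.
      transitivity (x * (eps * powerRZ eps (- Z.of_nat k)) + y * powerRZ eps (- Z.of_nat k) - / INR u * (powerRZ eps (Z.of_nat k) * powerRZ eps (- Z.of_nat k)));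
        [rewrite q; ring | field; lra]. }
    rewrite e. split; intros h.
    - apply (lat_power _ (Z.of_nat k)) in h. rewrite Rmult_assoc, (Rmult_comm (powerRZ eps (- _))), q, Rmult_1_r in h. exact h.
    - apply lat_power, h. }
  assert (rx : rational (xk k) /\ rational (yk k)).
  { split; apply rational_mult; try apply rational_INR; apply rational_inv_INR; lia. }
  assert (good : is_shintani_pair d eps u (Z.of_nat k) (xk k, yk k)).
  { unfold is_shintani_pair; simpl. refine (conj (proj1 rx) (conj (proj2 rx) (conj bx (conj by_ _)))).
    apply hO, shift. exists (- my)%Z, (- mx)%Z. rewrite coord_spec, !opp_IZR, ex, ey. field. lra. }
  pose proof (ClassicalEpsilon.epsilon_spec (inhabits (0, 0)) (is_shintani_pair d eps u (Z.of_nat k)) (ex_intro _ _ good)) as h.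
  fold (shintani_pair d eps u (Z.of_nat k)) in h. destruct (shintani_pair d eps u (Z.of_nat k)) as [x y].
  destruct h as (r1 & r2 & b1 & b2 & hl). simpl in *. apply hO, shift in hl. destruct hl as (m & n & e).
  rewrite coord_spec in e.
  destruct (ud_indep _ _ _ _ ud (x - IZR (fst (coord k)) * / INR u - IZR n) (y - IZR (snd (coord k)) * / INR u - IZR m)) as [h1 h2].
  - apply rational_minus; [apply rational_minus; [exact r1 | apply rational_mult; [apply rational_IZR | apply rational_inv_INR; lia]] | apply rational_IZR].
  - apply rational_minus; [apply rational_minus; [exact r2 | apply rational_mult; [apply rational_IZR | apply rational_inv_INR; lia]] | apply rational_IZR].
  - transitivity (x * eps + y - (IZR (fst (coord k)) * eps + IZR (snd (coord k))) / INR u - (IZR m + IZR n * eps)); [field; lra | rewrite e; ring].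
  - f_equal.
    + assert (x - xk k = 0); [| lra]. apply (int_unit_interval _ (n + mx)); [lra |]. rewrite plus_IZR. unfold Rdiv in *. lra.
    + assert (y - yk k = 0); [| lra]. apply (int_unit_interval _ (m + my)); [lra |]. rewrite plus_IZR. unfold Rdiv in *. lra.
Qed.

(** An exact equality: [x -> 1 - x] maps [(0, 1]] onto [[0, 1)], so no integer is left over. For
    [xk] an integer remains, harmless because [logphi] has period [1]. *)
Lemma yk_succ k : yk (S k) = 1 - xk k.
Proof.
  destruct (xk_spec k) as (bx & mx & ex). destruct (yk_spec (S k)) as (by_ & my & ey).
  cbn [coord snd] in ey. rewrite opp_IZR in ey.
  assert (yk (S k) + xk k - 1 = 0); [| lra]. apply (int_unit_interval _ (- my - mx - 1)); [lra |].
  rewrite !minus_IZR, opp_IZR. unfold Rdiv in *. lra.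
Qed.

Lemma xk_succ k : exists m : Z, xk (S k) - INR a * xk k = yk k + IZR m.
Proof.
  destruct (xk_spec k) as (_ & mx & ex). destruct (yk_spec k) as (_ & my & ey). destruct (xk_spec (S k)) as (_ & mx' & ex').
  cbn [coord fst] in ex'. rewrite plus_IZR, mult_IZR, <- INR_IZR_INZ in ex'.
  exists (Z.of_nat a * mx + my - mx')%Z. rewrite minus_IZR, plus_IZR, mult_IZR, <- INR_IZR_INZ.
  rewrite ex, ey, ex'. field. lra.
Qed.

(** Primitive coordinates keep [x_k t + y_k] off the lattice, as the limit of [Rq] requires. *)
Lemma xyk_nonint k : forall p q : Z, xk k <> IZR p \/ yk k <> IZR q.
Proof.
  intros p q. destruct (Classical_Prop.classic (xk k = IZR p /\ yk k = IZR q)) as [[h1 h2] | h].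
  2:{ destruct (Req_dec (xk k) (IZR p)); [right; intros h'; apply h; auto | left; assumption]. }
  exfalso. destruct (xk_spec k) as (_ & mx & ex). destruct (yk_spec k) as (_ & my & ey).
  assert (gen : forall (c m p : Z), IZR c / INR u - IZR m = IZR p -> (Z.of_nat u | c)%Z).
  { intros c m p' h. exists (p' + m)%Z. apply eq_IZR. rewrite mult_IZR, plus_IZR, <- INR_IZR_INZ, <- h. field. lra. }
  apply (coord_primitive k). split; eapply gen; [rewrite <- ex; exact h1 | rewrite <- ey; exact h2].
Qed.

(** The coordinates are congruent to [(0, 1)], and [0] is represented by [1] in [(0, 1]]. This holds
    at both ends [k = 0] and [k = g] of the telescope. *)
Lemma xyk_cong1 k : cong1 (Z.of_nat k) -> xk k = 1 /\ yk k = / INR u.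
Proof.
  intros (m & n & e). destruct (xk_spec k) as (bx & mx & ex). destruct (yk_spec k) as (by_ & my & ey).
  rewrite <- pow_powerRZ, coord_spec in e.
  destruct (ud_indep _ _ _ _ ud (IZR (fst (coord k)) * / INR u - IZR n) ((IZR (snd (coord k)) - 1) * / INR u - IZR m)) as [h1 h2].
  - apply rational_minus; [apply rational_mult; [apply rational_IZR | apply rational_inv_INR; lia] | apply rational_IZR].
  - apply rational_minus; [apply rational_mult; [apply rational_minus; apply rational_IZR | apply rational_inv_INR; lia] | apply rational_IZR].
  - transitivity ((IZR (fst (coord k)) * eps + IZR (snd (coord k)) - 1) / INR u - (IZR m + IZR n * eps)); [field; lra | rewrite e; ring].
  - assert (iu : 0 < / INR u < 1).
    { split; [apply Rinv_0_lt_compat; exact up |]. rewrite <- Rinv_1. apply Rinv_lt_contravar; [lra |].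
      change 1 with (INR 1). apply lt_INR. lia. }
    split.
    + assert (xk k - 1 = 0); [| lra]. apply (int_unit_interval _ (n - mx - 1)); [lra |]. rewrite !minus_IZR. unfold Rdiv in *. lra.
    + assert (yk k - / INR u = 0); [| lra]. apply (int_unit_interval _ (m - my)); [lra |]. rewrite minus_IZR. unfold Rdiv in *. lra.
Qed.

End Units.

(** * The q-products at [tau_n] *)

(** The operator [lim] is only specified on Cauchy filters by completeness; two points that are both
    approached by the filter have equal coordinates. *)
Lemma C_lim_unique (f : nat -> C) (l : C) :
  is_lim_seq (fun n => fst (f n)) (fst l) -> is_lim_seq (fun n => snd (f n)) (snd l) ->
  @lim C_CompleteNormedModule (filtermap f eventually) = l.
Proof.
  intros h1 h2.
  set (F := filtermap f eventually).
  assert (hl : forall e : posreal, F (ball (M := C_UniformSpace) l e)).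
  { intros e. generalize (proj1 (filterlim_locally _ _) h1 e) (proj1 (filterlim_locally _ _) h2 e).
    intros u v; generalize (filter_and _ _ u v); unfold F, filtermap; apply filter_imp.
    intros n [b1 b2]. split; [exact b1 | exact b2]. }
  assert (PF : ProperFilter F) by (apply filtermap_proper_filter, eventually_filter).
  assert (cF : @cauchy C_CompleteNormedModule F) by (intros e; exists l; apply hl).
  pose proof (@complete_cauchy C_CompleteNormedModule F PF cF) as hc.
  set (m := @lim C_CompleteNormedModule F) in *.
  assert (eqc : forall x y : R, (forall e : posreal, Rabs (x - y) < e + e) -> x = y).
  { intros x y h. destruct (Req_dec x y) as [e | ne]; [exact e | exfalso].
    assert (p : 0 < Rabs (x - y) / 2) by (pose proof (Rabs_pos_lt (x - y) ltac:(lra)); lra).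
    specialize (h (mkposreal _ p)). simpl in h. lra. }
  assert (both : forall e : posreal, Rabs (fst m - fst l) < e + e /\ Rabs (snd m - snd l) < e + e).
  { intros e. destruct (filter_ex _ (filter_and _ _ (hc e) (hl e))) as (z & [a1 a2] & [b1 b2]).
    unfold ball in *; simpl in *. unfold AbsRing_ball, abs, minus, plus, opp in *; simpl in *.
    apply Rabs_def2 in a1, a2, b1, b2. split; apply Rabs_def1; lra. }
  apply injective_projections; apply eqc; intros e; apply both.
Qed.

Lemma nonint_real_shift (t w : C) : 0 < Im t -> nonint w -> Im w = 0 -> forall i, (1 - ce (w + RtoC (INR i) * t))%C <> 0.
Proof.
  intros ht hw iw i. destruct i as [| i].
  - replace (w + RtoC (INR 0) * t)%C with w by (simpl; ring). apply ce_neq_1, hw.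
  - apply one_minus_ce_pos_im. pose proof (pos_INR i). rewrite S_INR. destruct w, t; simpl in *. nra.
Qed.

(** Convergence of the moduli follows from that of [logphi], but [lim] asks for convergence of the
    complex products. Their increments are at most [B r^n], where [B] bounds the moduli already
    known to converge. *)
Lemma qpochhammer_mod (t w : C) : 0 < Im t -> nonint w -> Im w = 0 ->
  Cmod (qpochhammer (ce w) (ce t)) = exp (logphi t w).
Proof.
  intros ht hw iw.
  pose proof (nonint_real_shift t w ht hw iw) as nz.
  set (f := fun k => (1 - ce (w + RtoC (INR k) * t))%C).
  assert (ef : forall n, Cprod (fun k => (1 - ce w * ce t ^ k)%C) n = Cprod f n).
  { intros n. induction n as [| n IH]; simpl; [reflexivity |]. rewrite IH. f_equal. unfold f. do 2 f_equal. clear.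
    rewrite ce_add. f_equal. induction n as [| n IH].
    - simpl. replace (RtoC 0 * t)%C with (RtoC (IZR 0)) by ring. symmetry. apply ce_Z.
    - rewrite S_INR, RtoC_plus. simpl Cpow. rewrite IH, <- ce_add. f_equal. ring. }
  set (P := Cprod f).
  assert (mP : forall n, Cmod (P n) = exp (sumR (fun i => lnm (f i)) n)).
  { intros n. induction n as [| n IH].
    { change (P 0%nat) with (RtoC 1). cbn [sumR]. rewrite Cmod_1, exp_0. reflexivity. }
    change (P (S n)) with (P n * f n)%C. cbn [sumR].
    rewrite Cmod_mult, IH, exp_plus. f_equal. unfold lnm. rewrite exp_ln; [reflexivity |]. apply Cmod_gt_0, nz. }
  pose proof (logphi_ex t w ht) as ex.
  assert (ls : is_lim_seq (sumR (fun i => lnm (f i))) (logphi t w)).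
  { apply is_lim_seq_incr_1. apply (is_lim_seq_ext (sum_n (fun i => lnm (f i)))); [intros; symmetry; apply sumR_sum_n |].
    exact (Series_correct _ ex). }
  assert (lP : is_lim_seq (fun n => Cmod (P n)) (exp (logphi t w))).
  { apply (is_lim_seq_ext (fun n => exp (sumR (fun i => lnm (f i)) n))); [intros; symmetry; apply mP |].
    apply (is_lim_seq_continuous exp); [| exact ls]. apply derivable_continuous_pt, derivable_pt_exp. }
  destruct (lim_bounded _ _ lP) as [B hB].
  pose proof PI_RGT_0.
  set (r := exp (- (2 * PI * Im t))).
  assert (r1 : 0 < r < 1).
  { split; [apply exp_pos |]. unfold r. rewrite <- exp_0. apply exp_increasing.
    assert (0 < 2 * PI * Im t) by (apply Rmult_lt_0_compat; lra). lra. }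
  assert (er : forall i, Cmod (ce (w + RtoC (INR i) * t)) = r ^ i).
  { intros i. rewrite Cmod_ce. unfold r. induction i as [| i IH].
    - simpl. rewrite <- exp_0. f_equal. destruct w, t; simpl in *. rewrite iw. ring.
    - simpl pow. rewrite <- IH, <- exp_plus. f_equal. rewrite S_INR. destruct w, t; simpl; ring. }
  assert (cs : csum (fun n => (P (S n) - P n)%C) (Series (fun n => fst (P (S n) - P n)%C), Series (fun n => snd (P (S n) - P n)%C))).
  { apply (csum_exists (fun n => (P (S n) - P n)%C) (fun n => B * r ^ n)).
    - apply (ex_series_scal B (fun n => r ^ n)). apply ex_series_geom. rewrite Rabs_pos_eq; lra.
    - intros n. unfold P. simpl. fold P. unfold f at 1.
      replace (P n * (1 - ce (w + RtoC (INR n) * t)) - P n)%C with (- (P n * ce (w + RtoC (INR n) * t)))%C by ring.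
      rewrite Cmod_opp, Cmod_mult, er. apply Rmult_le_compat_r; [apply pow_le; lra |].
      specialize (hB n). rewrite Rabs_pos_eq in hB by apply Cmod_ge_0. exact hB. }
  match type of cs with csum _ ?v => set (l0 := v : C) in * end.
  set (l := (1 + l0)%C).
  assert (lim1 : forall pr : C -> R, (forall x y, pr (x - y)%C = pr x - pr y) -> (forall x y, pr (x + y)%C = pr x + pr y) ->
     is_series (fun n => pr (P (S n) - P n)%C) (pr l0) -> is_lim_seq (fun n => pr (P n)) (pr l)).
  { intros pr m1 m2 hs. apply is_lim_seq_incr_1.
    apply (is_lim_seq_ext (fun n => pr 1 + sum_n (fun n => pr (P (S n) - P n)%C) n)).
    - intros n. induction n as [| n IH]; [rewrite sum_O, m1; change (P 0%nat) with (RtoC 1); ring |].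
      rewrite sum_Sn. unfold plus; simpl (AbelianMonoid.plus _ _). 
      transitivity ((pr 1 + sum_n (fun n0 => pr (P (S n0) - P n0)%C) n) + pr (P (S (S n)) - P (S n))%C); [simpl; ring |].
      rewrite IH, m1. ring.
    - unfold l. rewrite m2. apply is_lim_seq_plus'; [apply is_lim_seq_const | exact hs]. }
  assert (L1 : is_lim_seq (fun n => fst (P n)) (fst l)) by (apply (lim1 fst); [reflexivity | reflexivity | apply cs]).
  assert (L2 : is_lim_seq (fun n => snd (P n)) (snd l)) by (apply (lim1 snd); [reflexivity | reflexivity | apply cs]).
  unfold qpochhammer. rewrite (C_lim_unique _ l).
  - assert (L3 : is_lim_seq (fun n => Cmod (P n)) (Cmod l)).
    { unfold Cmod. apply (is_lim_seq_continuous sqrt (fun n => fst (P n) ^ 2 + snd (P n) ^ 2)).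
      - apply continuity_pt_sqrt. nra.
      - apply (is_lim_seq_ext (fun n => fst (P n) * fst (P n) + snd (P n) * snd (P n))); [intros; ring |].
        replace (fst l ^ 2 + snd l ^ 2) with (fst l * fst l + snd l * snd l) by ring.
        apply is_lim_seq_plus'; apply is_lim_seq_mult'; assumption. }
    apply is_lim_seq_unique in L3, lP. rewrite L3 in lP. injection lP; auto.
  - apply (is_lim_seq_ext (fun n => fst (P n))); [intros; rewrite ef; reflexivity | exact L1].
  - apply (is_lim_seq_ext (fun n => snd (P n))); [intros; rewrite ef; reflexivity | exact L2].
Qed.

Lemma logphi_tau_period (t w : C) (n : Z) : logphi (t + RtoC (IZR n)) w = logphi t w.
Proof.
  apply Series_ext. intros i. do 2 f_equal.
  replace (w + RtoC (INR i) * (t + RtoC (IZR n)))%C with (w + RtoC (INR i) * t + RtoC (IZR (Z.of_nat i * n)))%C.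
  - now rewrite ce_add_Z.
  - rewrite mult_IZR, RtoC_mult, <- INR_IZR_INZ. ring.
Qed.

Lemma root_of_unity_ce (u : nat) : (0 < u)%nat -> root_of_unity u = ce (RtoC (/ INR u)).
Proof.
  intros hu. unfold root_of_unity, ce. f_equal. rewrite RtoC_inv.
  - reflexivity.
  - apply not_0_INR. lia.
Qed.

(** * The sequence [tau_n], the telescope and the limits *)

Section Assembly.
Variables (d a b u : nat) (eps : R).
Hypothesis ud : unit_data d a b eps.
Hypothesis hu : (2 <= u)%nat.
Hypothesis hgen : generated_by (totally_positive_unit d) eps.
Hypothesis hO : forall x : R, ring_of_integers d x <-> lat eps x.

Let e1 : 1 < eps := ud_gt1 _ _ _ _ ud.
Let ez : eps <> 0.
Proof. pose proof e1; lra. Qed.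

(** The value [T_n(a)]; correspondingly [unit_gap] is [b sqrt d]. *)
Definition unit_trace (n : Z) : R := powerRZ eps n + powerRZ eps (- n).
Definition unit_gap : R := eps - / eps.

Lemma unit_trace_pos n : 0 < unit_trace n.
Proof. unfold unit_trace. pose proof e1. pose proof (powerRZ_lt eps n ltac:(lra)). pose proof (powerRZ_lt eps (- n) ltac:(lra)). lra. Qed.

Lemma unit_gap_pos : 0 < unit_gap.
Proof. pose proof e1. unfold unit_gap. assert (/ eps < 1) by (rewrite <- Rinv_1; apply Rinv_lt_contravar; lra). lra. Qed.

Lemma cheb_unit_trace n : cheb n (INR a) = unit_trace n.
Proof. rewrite (trace_eq d a b eps ud). apply cheb_spec, ez. Qed.

Lemma tau_eq n : tau d a b n = (unit_trace (n + 1) / unit_trace n, unit_gap / unit_trace n).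
Proof.
  unfold tau. rewrite !cheb_unit_trace, (ud_diff _ _ _ _ ud). fold unit_gap. pose proof (unit_trace_pos n).
  assert (nz : RtoC (unit_trace n) <> 0) by (intros q; apply RtoC_inj in q; lra).
  transitivity ((RtoC (unit_trace (n + 1)) + Ci * RtoC unit_gap) * / RtoC (unit_trace n))%C; [reflexivity |].
  rewrite <- RtoC_inv by lra. apply injective_projections; simpl; unfold Rdiv; ring.
Qed.

Lemma tau_im n : 0 < Im (tau d a b n).
Proof. rewrite tau_eq; simpl. apply Rdiv_lt_0_compat; [apply unit_gap_pos | apply unit_trace_pos]. Qed.

(** Two identities: the Chebyshev recursion [k1], and [k2], which says
    [|tau_n|^2 = T_(n+2)(a) / T_n(a)] and rests on [eps^n eps^(-n) = 1]. *)
Lemma tau_step n : (- / tau d a b n)%C = (tau d a b (n + 2) - RtoC (INR a))%C.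
Proof.
  pose proof (unit_trace_pos n) as p0. pose proof (unit_trace_pos (n + 2)) as p2.
  assert (tz : tau d a b n <> 0).
  { intros e. pose proof (tau_im n) as h. rewrite e in h. simpl in h. lra. }
  set (X := powerRZ eps n). set (Y := powerRZ eps (- n)).
  assert (XY : X * Y = 1).
  { unfold X, Y. rewrite <- powerRZ_add by exact ez. replace (n + - n)%Z with 0%Z by ring. reflexivity. }
  assert (tr : INR a = eps + / eps) by apply (trace_eq d a b eps ud).
  assert (ei : eps * / eps = 1) by (apply Rinv_r, ez).
  assert (E : forall j : nat, unit_trace (n + Z.of_nat j) = X * eps ^ j + Y * (/ eps) ^ j).
  { intros j. unfold unit_trace, X, Y. rewrite powerRZ_add by exact ez.
    replace (- (n + Z.of_nat j))%Z with (- n + - Z.of_nat j)%Z by ring. rewrite powerRZ_add by exact ez.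
    rewrite <- pow_powerRZ. f_equal. f_equal. rewrite pow_inv, pow_powerRZ.
    apply (Rmult_eq_reg_l (powerRZ eps (Z.of_nat j))); [| apply powerRZ_NOR, ez].
    rewrite Rinv_r by apply powerRZ_NOR, ez. rewrite <- powerRZ_add by exact ez.
    replace (Z.of_nat j + - Z.of_nat j)%Z with 0%Z by ring. reflexivity. }
  pose proof (E 0%nat) as E0. pose proof (E 1%nat) as E1. pose proof (E 2%nat) as E2. pose proof (E 3%nat) as E3.
  simpl in E0, E1, E2, E3. rewrite Z.add_0_r in E0.
  rewrite !Rmult_1_r in *.
  assert (key : ((tau d a b (n + 2) - RtoC (INR a)) * tau d a b n)%C = (- (1))%C).
  { rewrite !tau_eq. replace (n + 2 + 1)%Z with (n + 3)%Z by ring.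
    assert (k1 : unit_trace (n + 3) - INR a * unit_trace (n + 2) = - unit_trace (n + 1)).
    { rewrite E3, E2, E1, tr. set (v := / eps) in *.
      transitivity (X * (eps * (eps * eps)) + Y * (v * (v * v)) - (X * (eps * eps) * eps + (eps * v) * (X * eps) + (eps * v) * (Y * v) + Y * (v * v) * v)); [ring |].
      rewrite ei. ring. }
    assert (k2 : unit_trace (n + 1) * unit_trace (n + 1) + unit_gap * unit_gap = unit_trace n * unit_trace (n + 2)).
    { rewrite E0, E1, E2. unfold unit_gap. set (v := / eps) in *.
      transitivity (X * X * (eps * eps) + Y * Y * (v * v) + 2 * (X * Y) * (eps * v) + eps * eps + v * v - 2 * (eps * v)); [ring |].
      transitivity (X * X * (eps * eps) + Y * Y * (v * v) + (X * Y) * (eps * eps) + (X * Y) * (v * v)); [rewrite XY, ei; ring | ring]. }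
    apply injective_projections; simpl.
    - transitivity (((unit_trace (n + 3) - INR a * unit_trace (n + 2)) * unit_trace (n + 1) - unit_gap * unit_gap) / (unit_trace n * unit_trace (n + 2))); [field; lra |].
      rewrite k1. replace (- unit_trace (n + 1) * unit_trace (n + 1) - unit_gap * unit_gap) with (- (unit_trace (n + 1) * unit_trace (n + 1) + unit_gap * unit_gap)) by ring.
      rewrite k2. field. lra.
    - transitivity (unit_gap * ((unit_trace (n + 3) - INR a * unit_trace (n + 2)) + unit_trace (n + 1)) / (unit_trace n * unit_trace (n + 2))); [field; lra |].
      rewrite k1. field. lra. }
  transitivity ((tau d a b (n + 2) - RtoC (INR a)) * tau d a b n * / tau d a b n)%C.
  - rewrite key. ring.
  - field. exact tz.
Qed.

(** With [y = eps^(-n)] the point is [(eps + y^2 / eps + i (eps - / eps) y) / (1 + y^2)], and [y]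
    tends to [0]. In the other direction [y = eps^n], and [eps] and [/ eps] change places. *)
Lemma tau_lim_pos (n : nat -> Z) : is_lim_seq (fun N => powerRZ eps (- n N)) 0 ->
  is_lim_seq (fun N => Re (tau d a b (n N))) eps /\ is_lim_seq (fun N => Im (tau d a b (n N))) 0.
Proof.
  intros h. set (y := fun N => powerRZ eps (- n N)) in *.
  assert (E : forall N, powerRZ eps (n N) * y N = 1).
  { intros N. unfold y. rewrite <- powerRZ_add by exact ez. replace (n N + - n N)%Z with 0%Z by ring. reflexivity. }
  assert (yp : forall N, 0 < y N) by (intros N; apply powerRZ_lt; pose proof e1; lra).
  assert (e' : forall N, powerRZ eps (n N) = / y N) by (intros N; specialize (E N); specialize (yp N); apply (Rmult_eq_reg_r (y N)); [rewrite Rinv_l; lra | lra]).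
  assert (i1 : powerRZ eps (-1) = / eps) by (simpl; rewrite Rmult_1_r; reflexivity).
  split.
  - apply (is_lim_seq_ext (fun N => (eps + / eps * (y N * y N)) / (1 + y N * y N))).
    + intros N. rewrite tau_eq. simpl. unfold unit_trace. replace (- (n N + 1))%Z with (- n N + -1)%Z by ring.
      rewrite !powerRZ_add, powerRZ_1, i1 by exact ez. fold (y N). rewrite e'. specialize (yp N). field. repeat split; try lra; nra.
    + replace (Finite eps) with (Finite ((eps + / eps * (0 * 0)) / (1 + 0 * 0))) by (f_equal; field; exact ez).
      apply is_lim_seq_div'; [| | lra].
      * apply is_lim_seq_plus'; [apply is_lim_seq_const |].
        apply (is_lim_seq_scal_l _ (/ eps) (0 * 0)). apply is_lim_seq_mult'; assumption.
      * apply is_lim_seq_plus'; [apply is_lim_seq_const |]. apply is_lim_seq_mult'; assumption.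
  - apply (is_lim_seq_ext (fun N => (unit_gap * y N) / (1 + y N * y N))).
    + intros N. rewrite tau_eq. simpl. unfold unit_trace. fold (y N). rewrite e'. specialize (yp N). field. repeat split; try lra; nra.
    + replace (Finite 0) with (Finite ((unit_gap * 0) / (1 + 0 * 0))) by (f_equal; field).
      apply is_lim_seq_div'; [| | lra].
      * apply (is_lim_seq_scal_l _ unit_gap 0). exact h.
      * apply is_lim_seq_plus'; [apply is_lim_seq_const |]. apply is_lim_seq_mult'; assumption.
Qed.

Lemma tau_lim_neg (n : nat -> Z) : is_lim_seq (fun N => powerRZ eps (n N)) 0 ->
  is_lim_seq (fun N => Re (tau d a b (n N))) (/ eps) /\ is_lim_seq (fun N => Im (tau d a b (n N))) 0.
Proof.
  intros h. set (y := fun N => powerRZ eps (n N)) in *.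
  assert (E : forall N, powerRZ eps (- n N) * y N = 1).
  { intros N. unfold y. rewrite <- powerRZ_add by exact ez. replace (- n N + n N)%Z with 0%Z by ring. reflexivity. }
  assert (yp : forall N, 0 < y N) by (intros N; apply powerRZ_lt; pose proof e1; lra).
  assert (e' : forall N, powerRZ eps (- n N) = / y N) by (intros N; specialize (E N); specialize (yp N); apply (Rmult_eq_reg_r (y N)); [rewrite Rinv_l; lra | lra]).
  assert (i1 : powerRZ eps (-1) = / eps) by (simpl; rewrite Rmult_1_r; reflexivity).
  split.
  - apply (is_lim_seq_ext (fun N => (/ eps + eps * (y N * y N)) / (1 + y N * y N))).
    + intros N. rewrite tau_eq. simpl. unfold unit_trace. replace (- (n N + 1))%Z with (- n N + -1)%Z by ring.
      rewrite !powerRZ_add, powerRZ_1, i1 by exact ez. fold (y N). rewrite e'. specialize (yp N). field. repeat split; try lra; nra.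
    + replace (Finite (/ eps)) with (Finite ((/ eps + eps * (0 * 0)) / (1 + 0 * 0))) by (f_equal; field; exact ez).
      apply is_lim_seq_div'; [| | lra].
      * apply is_lim_seq_plus'; [apply is_lim_seq_const |].
        apply (is_lim_seq_scal_l _ eps (0 * 0)). apply is_lim_seq_mult'; assumption.
      * apply is_lim_seq_plus'; [apply is_lim_seq_const |]. apply is_lim_seq_mult'; assumption.
  - apply (is_lim_seq_ext (fun N => (unit_gap * y N) / (1 + y N * y N))).
    + intros N. rewrite tau_eq. simpl. unfold unit_trace. fold (y N). rewrite e'. specialize (yp N). field. repeat split; try lra; nra.
    + replace (Finite 0) with (Finite ((unit_gap * 0) / (1 + 0 * 0))) by (f_equal; field).
      apply is_lim_seq_div'; [| | lra].
      * apply (is_lim_seq_scal_l _ unit_gap 0). exact h.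
      * apply is_lim_seq_plus'; [apply is_lim_seq_const |]. apply is_lim_seq_mult'; assumption.
Qed.

Let g : nat := ray_index d eps u.
Let x := xk a u.
Let y := yk a u.

Definition logP (n : Z) : R := logphi (tau d a b n) (RtoC (/ INR u)).

Lemma nonint_inv_u : nonint (RtoC (/ INR u)).
Proof.
  intros n e. apply RtoC_inj in e.
  assert (up : 1 < INR u) by (change 1 with (INR 1); apply lt_INR; lia).
  assert (0 < / INR u < 1) by (split; [apply Rinv_0_lt_compat; lra | rewrite <- Rinv_1; apply Rinv_lt_contravar; lra]).
  rewrite e in H. destruct H as [h1 h2]. apply lt_IZR in h1, h2. lia.
Qed.

Lemma qpoch_logP n : Cmod (qpochhammer (root_of_unity u) (nome d a b n)) = exp (logP n).
Proof.
  rewrite root_of_unity_ce by lia. change (nome d a b n) with (ce (tau d a b n)).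
  apply qpochhammer_mod; [apply tau_im | apply nonint_inv_u | reflexivity].
Qed.

Definition zk (k : nat) (n : Z) : C := (RtoC (x k) * tau d a b n + RtoC (y k))%C.

(** The second product in [Rq] has nome parameter [- 1 / tau_n = tau_(n+2) - a], and its argument is
    [x_(k+1) - x_k / tau_n], which equals [x_k tau_(n+2) + y_k] up to an integer. Both integers
    disappear by periodicity. *)
Lemma Rq_tau (k : nat) (n : Z) :
  Rq (tau d a b n) (zk (S k) n) = logphi (tau d a b n) (zk (S k) n) - logphi (tau d a b (n + 2)) (zk k (n + 2)).
Proof.
  assert (tz : tau d a b n <> 0).
  { intros e. pose proof (tau_im n) as h. rewrite e in h. simpl in h. lra. }
  unfold Rq. f_equal.
  destruct (xk_succ d a b u eps ud hu k) as [m hm].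
  assert (hy : y (S k) = 1 - x k) by apply (yk_succ d a b u eps ud hu).
  replace ((zk (S k) n - 1) / tau d a b n)%C with (zk k (n + 2) + RtoC (IZR m))%C.
  - rewrite tau_step, logphi_period.
    replace (tau d a b (n + 2) - RtoC (INR a))%C with (tau d a b (n + 2) + RtoC (IZR (- Z.of_nat a)))%C.
    + apply logphi_tau_period.
    + rewrite opp_IZR, <- INR_IZR_INZ, RtoC_opp. ring.
  - unfold zk. rewrite hy, RtoC_minus. 
    replace ((RtoC (x (S k)) * tau d a b n + (1 - RtoC (x k)) - 1) / tau d a b n)%C
      with (RtoC (x (S k)) + RtoC (x k) * - / tau d a b n)%C by (field; exact tz).
    rewrite tau_step. fold (x k) (x (S k)) (y k) in hm.
    replace (RtoC (x (S k))) with (RtoC (INR a * x k + (y k + IZR m))) by (f_equal; lra).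
    rewrite !RtoC_plus, RtoC_mult. ring.
Qed.

Lemma Rq_telescope (n : Z) (G : nat) :
  sumR (fun i => Rq (tau d a b (n + 2 * Z.of_nat (G - S i))) (zk (S i) (n + 2 * Z.of_nat (G - S i)))) G =
  logphi (tau d a b n) (zk G n) - logphi (tau d a b (n + 2 * Z.of_nat G)) (zk 0 (n + 2 * Z.of_nat G)).
Proof.
  assert (g' : forall i, (i <= G)%nat ->
    sumR (fun i => Rq (tau d a b (n + 2 * Z.of_nat (G - S i))) (zk (S i) (n + 2 * Z.of_nat (G - S i)))) i =
    logphi (tau d a b (n + 2 * Z.of_nat (G - i))) (zk i (n + 2 * Z.of_nat (G - i)))
    - logphi (tau d a b (n + 2 * Z.of_nat G)) (zk 0 (n + 2 * Z.of_nat G))).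
  { induction i as [| i IH]; intros hi.
    - simpl sumR. rewrite Nat.sub_0_r. ring.
    - cbn [sumR]. rewrite IH by lia. rewrite Rq_tau.
      replace (n + 2 * Z.of_nat (G - S i) + 2)%Z with (n + 2 * Z.of_nat (G - i))%Z by lia. ring. }
  rewrite g' by lia. rewrite Nat.sub_diag. change (2 * Z.of_nat 0)%Z with 0%Z. rewrite Z.add_0_r. reflexivity.
Qed.

(** At both ends the argument is [tau + 1 / u], so the products start one factor later than [P_n].
    The missing factor [1 - zeta_u] is the same on both sides and cancels. *)
Lemma logP_diff (n : Z) :
  logP n - logP (n + 2 * Z.of_nat g) =
  sumR (fun i => Rq (tau d a b (n + 2 * Z.of_nat (g - S i))) (zk (S i) (n + 2 * Z.of_nat (g - S i)))) g.
Proof.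
  rewrite Rq_telescope.
  destruct (ray_index_spec d a b u eps ud hu hgen hO) as [_ hg]. fold g in hg.
  destruct (xyk_cong1 d a b u eps ud hu g hg) as [xg yg].
  destruct (xyk_cong1 d a b u eps ud hu 0 (cong1_0 d a b u eps ud hu)) as [x0 y0].
  assert (z : forall k m, x k = 1 -> y k = / INR u -> logphi (tau d a b m) (zk k m) = logP m - lnm (1 - ce (RtoC (/ INR u)))).
  { intros k m h1 h2. unfold zk, logP. rewrite h1, h2, (logphi_shift _ (RtoC (/ INR u))) by apply tau_im.
    replace (RtoC 1 * tau d a b m + RtoC (/ INR u))%C with (RtoC (/ INR u) + tau d a b m)%C by ring. ring. }
  rewrite (z g n xg yg), (z 0%nat _ x0 y0). ring.
Qed.

Definition logX (w : R) : R := sumR (fun i => log_double_sine w (x (S i) - / 2) (y (S i) - / 2)) g.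

Lemma shintani_factor_exp (w : R) : 0 < w -> shintani_factor d eps u w = RtoC (exp (logX w)).
Proof.
  intros hw. unfold shintani_factor, logX. fold g. induction g as [| n IH].
  - simpl. rewrite exp_0. reflexivity.
  - cbn [Cprod sumR]. rewrite IH, exp_plus, RtoC_mult. f_equal.
    rewrite (shintani_pair_eq d a b u eps ud hu hO (S n)). simpl fst. simpl snd.
    apply double_sine_value; [exact hw | |].
    + apply (xk_spec d a b u eps ud hu).
    + apply (yk_spec d a b u eps ud hu).
Qed.

Lemma sumR_lim (f : nat -> nat -> R) (F : nat -> R) (n : nat) :
  (forall k, is_lim_seq (fun N => f N k) (F k)) -> is_lim_seq (fun N => sumR (f N) n) (sumR F n).
Proof.
  intros h. induction n as [| n IH]; simpl; [apply is_lim_seq_const |].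
  apply is_lim_seq_plus'; [exact IH | apply h].
Qed.

Lemma logP_lim (w : R) (n : nat -> Z) : 0 < w ->
  (forall c : Z, is_lim_seq (fun N => Re (tau d a b (n N + c))) w /\ is_lim_seq (fun N => Im (tau d a b (n N + c))) 0) ->
  is_lim_seq (fun N => logP (n N) - logP (n N + 2 * Z.of_nat g)) (logX w).
Proof.
  intros hw h.
  apply (is_lim_seq_ext (fun N => sumR (fun i => Rq (tau d a b (n N + 2 * Z.of_nat (g - S i))) (zk (S i) (n N + 2 * Z.of_nat (g - S i)))) g)).
  - intros N. symmetry. apply logP_diff.
  - unfold logX. apply (sumR_lim (fun N i => Rq (tau d a b (n N + 2 * Z.of_nat (g - S i))) (zk (S i) (n N + 2 * Z.of_nat (g - S i))))
      (fun i => log_double_sine w (x (S i) - / 2) (y (S i) - / 2))).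
    intros k. destruct (h (2 * Z.of_nat (g - S k))%Z) as [h1 h2].
    apply (Rq_lim (fun N => tau d a b (n N + 2 * Z.of_nat (g - S k))) w (x (S k)) (y (S k)) hw).
    + intros N. apply tau_im.
    + exact h1.
    + exact h2.
    + apply (xk_spec d a b u eps ud hu).
    + apply (yk_spec d a b u eps ud hu).
    + apply (xyk_nonint d a b u eps ud hu).
Qed.

Lemma power_lim (c : Z) : is_lim_seq (fun N => powerRZ eps (- (Z.of_nat N + c))) 0.
Proof.
  pose proof e1.
  apply (is_lim_seq_ext (fun N => powerRZ eps (- c) * (/ eps) ^ N)).
  - intros N. replace (- (Z.of_nat N + c))%Z with (- c + - Z.of_nat N)%Z by ring.
    rewrite powerRZ_add by exact ez. f_equal. rewrite pow_inv, pow_powerRZ.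
    apply (Rmult_eq_reg_l (powerRZ eps (Z.of_nat N))); [| apply powerRZ_NOR, ez].
    rewrite Rinv_r by apply powerRZ_NOR, ez. rewrite <- powerRZ_add by exact ez.
    replace (Z.of_nat N + - Z.of_nat N)%Z with 0%Z by ring. reflexivity.
  - replace (Finite 0) with (Rbar_mult (powerRZ eps (- c)) 0) by (simpl; f_equal; ring).
    apply is_lim_seq_scal_l, is_lim_seq_geom.
    assert (0 < / eps) by (apply Rinv_0_lt_compat; lra).
    rewrite Rabs_pos_eq by lra. rewrite <- Rinv_1. apply Rinv_lt_contravar; lra.
Qed.

Lemma RtoC_lim (f : nat -> R) (l : R) : is_lim_seq f l -> filterlim (fun N => RtoC (f N)) eventually (locally (RtoC l)).
Proof.
  intros h. apply (filterlim_locally (U := C_UniformSpace)). intros e.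
  generalize (proj1 (filterlim_locally _ _) h e). apply filter_imp. intros N b'.
  split; [exact b' | apply ball_center].
Qed.

(** The values [c = 0] and [c = - g] give the two limits. The indices going to plus infinity
    contribute the factor at [eps], those going to minus infinity the factor at [/ eps]. *)
Lemma limit_shift (c : Z) :
  let P := fun n : Z => qpochhammer (root_of_unity u) (nome d a b n) in
  filterlim (fun N : nat => RtoC (Cmod ((P (Z.of_nat N + c)%Z * P (- Z.of_nat N + c)%Z)
      / (P (Z.of_nat N + c + 2 * Z.of_nat g)%Z * P (- Z.of_nat N + c + 2 * Z.of_nat g)%Z))%C))
    eventually (locally (shintani_X d eps u)).
Proof.
  intros P. pose proof e1 as e1'.
  assert (ie : 0 < / eps) by (apply Rinv_0_lt_compat; lra).
  unfold shintani_X. rewrite !shintani_factor_exp by lra. rewrite <- RtoC_mult, <- exp_plus.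
  apply RtoC_lim.
  assert (Pz : forall n, P n <> 0).
  { intros n. apply Cmod_gt_0. unfold P. rewrite qpoch_logP. apply exp_pos. }
  apply (is_lim_seq_ext (fun N => exp ((logP (Z.of_nat N + c) - logP (Z.of_nat N + c + 2 * Z.of_nat g)) +
      (logP (- Z.of_nat N + c) - logP (- Z.of_nat N + c + 2 * Z.of_nat g))))).
  - intros N. rewrite Cmod_div, !Cmod_mult by (apply Cmult_neq_0; apply Pz). unfold P. rewrite !qpoch_logP.
    rewrite <- !exp_plus. unfold Rdiv. rewrite <- exp_Ropp, <- exp_plus. f_equal. ring.
  - apply (is_lim_seq_continuous exp); [apply derivable_continuous_pt, derivable_pt_exp |].
    apply is_lim_seq_plus'.
    + apply (logP_lim eps (fun N => Z.of_nat N + c)%Z); [lra |]. intros c'.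
      apply (tau_lim_pos (fun N => Z.of_nat N + c + c')%Z).
      eapply is_lim_seq_ext; [| apply (power_lim (c + c'))]. intros N; cbn beta. f_equal. lia.
    + apply (logP_lim (/ eps) (fun N => - Z.of_nat N + c)%Z); [lra |]. intros c'.
      apply (tau_lim_neg (fun N => - Z.of_nat N + c + c')%Z).
      eapply is_lim_seq_ext; [| apply (power_lim (- c - c'))]. intros N; cbn beta. f_equal. lia.
Qed.

End Assembly.

Theorem corollary3p2 (d a b u : nat) :
  (1 < d)%nat -> squarefree d ->
  let eps := (INR a + INR b * sqrt (INR d)) / 2 in
  generated_by (totally_positive_unit d) eps ->
  (forall x : R, ring_of_integers d x <->
     exists m n : Z, x = IZR m + IZR n * eps) ->
  (2 <= u)%nat ->
  let g := Z.of_nat (ray_index d eps u) in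
  let P := fun n : Z => qpochhammer (root_of_unity u) (nome d a b n) in
  filterlim
    (fun N : nat => let n := Z.of_nat N in
       RtoC (Cmod ((P n * P (- n)%Z)
                   / (P (n + 2 * g)%Z * P (- n + 2 * g)%Z))%C))
    eventually (locally (shintani_X d eps u)) /\
  filterlim
    (fun N : nat => let n := Z.of_nat N in
       RtoC (Cmod ((P (n - g)%Z * P (- n - g)%Z)
                   / (P (n + g)%Z * P (- n + g)%Z))%C))
    eventually (locally (shintani_X d eps u)).
Proof.
  intros hd hsf eps hgen hO hu g P.
  pose proof (unit_data_intro d a b hd hsf hgen hO) as ud. fold eps in ud.
  split.
  - pose proof (limit_shift d a b u eps ud hu hgen hO 0) as h. cbn zeta in h.
    eapply filterlim_ext; [| exact h]. intros N. cbn zeta beta. rewrite !Z.add_0_r. reflexivity.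
  - pose proof (limit_shift d a b u eps ud hu hgen hO (- g)) as h. cbn zeta in h.
    eapply filterlim_ext; [| exact h]. intros N. cbn zeta beta. fold g.
    replace (Z.of_nat N + - g + 2 * g)%Z with (Z.of_nat N + g)%Z by ring.
    replace (- Z.of_nat N + - g + 2 * g)%Z with (- Z.of_nat N + g)%Z by ring. reflexivity.
Qed.
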